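(* In the generalized functional linear model setting of the context, let $w\in L^2(\mathbb I)$ and $c\in\mathbb R$ be given, $w_\nu=\int_0^1w(t)\varphi_\nu(t)dt$, $M_1=\sum_{\nu=1}^\infty\frac{w_\nu^2}{1+\lambda\rho_\nu}$, $M_2=\sum_{\nu=1}^\infty\frac{w_\nu^2}{(1+\lambda\rho_\nu)^2}$, and $$CT_{n,\lambda}=\frac{\sqrt n\big(\int_0^1w(t)\widehat\beta_{n,\lambda}(t)dt-c\big)}{\sqrt{\sum_{\nu=1}^\infty\frac{w_\nu^2}{(1+\lambda\rho_\nu)^2}}}.$$ Suppose Assumptions A1–A5 (listed in the context) hold, $\beta_0=\sum_\nu b_\nu\varphi_\nu$ with $\sum_\nu b_\nu^2\rho_\nu^2<\infty$, $E\{\exp(s|\epsilon|)\}<\infty$ for some $s>0$, and as $n\to\infty$: $h=o(1)$, $\log(h^{-1})=O(\log n)$, $nh^{2a+1}(\log(1/h))^{-4}\to\infty$, $M_1\asymp M_2$, $na_n^2=o(1)$, $nh^{4k}=o(1)$. Then under the null hypothesis $H_0^{CT}:\int_0^1w(t)\beta_0(t)dt=c$, we have $CT_{n,\lambda}\xrightarrow{d}N(0,1)$ as $n\to\infty$.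
   Context: Setting. $\mathbb I=[0,1]$; $m\ge 1$ is an integer; $H^m(\mathbb I)=\{\beta:\mathbb I\to\mathbb R \mid \beta^{(j)},\ j=0,\dots,m-1,$ absolutely continuous, $\beta^{(m)}\in L^2(\mathbb I)\}$; $\mathcal H=\mathbb R\times H^m(\mathbb I)$. $(Y_i,X_i)$, $i=1,\dots,n$, are i.i.d. copies of $(Y,X)$, with $Y\in\mathcal Y\subset\mathbb R$ and $X=X(t)$ a real-valued random process on $\mathbb I$ with paths in $L^2(\mathbb I)$. The true parameter is $\theta_0=(\alpha_0,\beta_0)\in\mathcal H$, with $E\{Y|X\}=F(\alpha_0+\int_0^1X(t)\beta_0(t)dt)$ for a known link function $F$. $\ell(y;a)$, $y\in\mathcal Y$, $a\in\mathbb R$, is a criterion function with first, second, third derivatives in $a$ denoted $\dot\ell_a,\ddot\ell_a,\ell'''_a$. $\lambda=\lambda_n>0$ is deterministic, $J(\beta,\tilde\beta)=\int_0^1\beta^{(m)}\tilde\beta^{(m)}dt$, $\ell_{n,\lambda}(\theta)=\frac1n\sum_{i=1}^n\ell(Y_i;\alpha+\int_0^1X_i\beta\,dt)-\frac\lambda2J(\beta,\beta)$ for $\theta=(\alpha,\beta)$, and $\widehat\theta_{n,\lambda}=(\widehat\alpha_{n,\lambda},\widehat\beta_{n,\lambda})$ maximizes $\ell_{n,\lambda}$ over $\mathcal H$. Notation. $B(X)=-E\{\ddot\ell_a(Y;\alpha_0+\int_0^1X\beta_0)\mid X\}$, $C(s,t)=E\{B(X)X(s)X(t)\}$, $V(\beta,\tilde\beta)=\int_0^1\int_0^1C(s,t)\beta(t)\tilde\beta(s)dsdt$,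 $(C\beta)(t)=\int_0^1C(s,t)\beta(s)ds$. On $H^m(\mathbb I)$: $\langle\beta,\tilde\beta\rangle_1=V(\beta,\tilde\beta)+\lambda J(\beta,\tilde\beta)$. On $\mathcal H$: $\langle\theta,\tilde\theta\rangle=E\{B(X)(\alpha+\int_0^1X\beta)(\tilde\alpha+\int_0^1X\tilde\beta)\}+\lambda J(\beta,\tilde\beta)$, with norm $\|\cdot\|$. With $k,a$ from A3: $h=\lambda^{1/(2k)}$, $r_n=(nh)^{-1/2}+h^k$, and $a_n=n^{-1/2}h^{-\frac{4ma+6m-1}{4m}}r_n(\log n)^2(\log\log n)^{1/2}+C_\ell h^{-1/2}r_n^2$, $C_\ell=\sup_{x\in L^2(\mathbb I)}E\{\sup_{u\in\mathbb R}|\ell'''_a(Y;u)|\,|X=x\}$. Assumptions. A1: (a) $\ell(y;\cdot)$ is three times continuously differentiable and strictly concave; there are constants $C_0,C_1>0$ with $E\{\exp(\sup_{a\in\mathbb R}|\ddot\ell_a(Y;a)|/C_0)|X\}\le C_1$ and $E\{\exp(\sup_{a\in\mathbb R}|\ell'''_a(Y;a)|/C_0)|X\}\le C_1$ a.s. (b) There is $C_2>0$ with $C_2^{-1}\le B(X)\le C_2$ a.s., and $E\{B(X)X(t)\}=0$ for all $t\in\mathbb I$. (c) $\epsilon=\dot\ell_a(Y;\alpha_0+\int_0^1X\beta_0)$ satisfies $E\{\epsilon|X\}=0$, $E\{\epsilon^2|X\}=B(X)$ a.s. A2: $C(s,t)$ is continuous on $\mathbb I\times\mathbb I$, and $\beta\in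 L^2(\mathbb I)$, $C\beta=0$ imply $\beta=0$. A3: There are $\varphi_\nu\in H^m(\mathbb I)$, $\nu\ge1$, with $\|\varphi_\nu\|_{L^2}\le C_\varphi\nu^a$ for constants $a\ge0$, $C_\varphi>0$, and $V(\varphi_\nu,\varphi_\mu)=\delta_{\nu\mu}$, $J(\varphi_\nu,\varphi_\mu)=\rho_\nu\delta_{\nu\mu}$ for all $\nu,\mu\ge1$, where $\rho_\nu\ge0$ is nondecreasing with $\rho_\nu\asymp\nu^{2k}$ for a constant $k>a+1/2$; every $\beta\in H^m(\mathbb I)$ has the expansion $\beta=\sum_{\nu}V(\beta,\varphi_\nu)\varphi_\nu$ converging in $\langle\cdot,\cdot\rangle_1$. A4: There is $s\in(0,1)$ with $E\{\exp(s\|X\|_{L^2})\}<\infty$, and $M_0>0$ with $E\{|\int_0^1X\beta|^4\}\le M_0[E\{|\int_0^1X\beta|^2\}]^2$ for all $\beta\in H^m(\mathbb I)$. A5: $\|\widehat\theta_{n,\lambda}-\theta_0\|=O_P(r_n)$. *)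

(* Defs.v *)
From HB Require Import structures.
From mathcomp Require Import all_boot all_order all_algebra.
From mathcomp Require Import all_classical all_reals all_analysis.
From mathcomp Require Import measurable_realfun.

Set Implicit Arguments.
Unset Strict Implicit.
Unset Printing Implicit Defensive.

Import Order.TTheory GRing.Theory Num.Theory.
Import numFieldNormedType.Exports.

Local Open Scope classical_set_scope.
Local Open Scope ring_scope.

(** A function on [0, 1] is represented by a function [R -> R]; only its values
    on [unit_itv] matter. *)

Section unit_interval.
Context {R : realType}.
Local Notation mu := (@lebesgue_measure R).

Definition unit_itv : set R := `[0, 1].

Definition L2 : set (R -> R) := [set f | f \_ unit_itv \in Lfun mu 2%:E].

Definition ip (f g : R -> R) : R := \int[mu]_(t in unit_itv) (f t * g t).

Definition L2norm (f : R -> R) : R := Num.sqrt (ip f f).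

(* Derivatives are taken relative to [0, 1], hence one-sided at 0 and 1. *)
Definition diffquot (f : R -> R) (t u : R) : R := (f u - f t) / (u - t).

Definition derivable_on01 (f : R -> R) (t : R) : Prop :=
  cvg (diffquot f t @ within unit_itv t^').

Definition deriv01 (f : R -> R) (t : R) : R :=
  lim (diffquot f t @ within unit_itv t^').

Definition deriv01n (j : nat) (f : R -> R) : R -> R := iter j deriv01 f.

Definition absolutely_continuous01 (f : R -> R) : Prop :=
  forall e : R, 0 < e -> exists2 del : R, 0 < del &
    forall (n : nat) (u v : 'I_n -> R),
      (forall i, 0 <= u i /\ u i <= v i /\ v i <= 1) ->
      (forall i j, i != j -> v i <= u j \/ v j <= u i) ->
      \sum_(i < n) (v i - u i) < del ->
      \sum_(i < n) `|f (v i) - f (u i)| < e.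

(* The last derivative, of order [m], need only exist almost everywhere. Where
   it does not, [deriv01] has a default value, on a null set. *)
Definition Sobolev (m : nat) : set (R -> R) := [set f |
  [/\ forall j : nat, (j.+1 < m)%N ->
        forall t, unit_itv t -> derivable_on01 (deriv01n j f) t,
      forall j : nat, (j < m)%N -> absolutely_continuous01 (deriv01n j f) &
      L2 (deriv01n m f)]].

Definition J (m : nat) (f g : R -> R) : R := ip (deriv01n m f) (deriv01n m g).

(** The sigma-algebra on paths generated by the functionals [x |-> ip x b], for
    [b] in L^2: on L^2, it is the Borel one. *)
Definition cylinder : set (set (R -> R)) := [set A |
  exists2 b : R -> R, L2 b &
  exists2 D : set R, measurable D & A = [set x | D (ip x b)]].

Definition Hspace (m : nat) : set (R * (R -> R)) := [set th | Sobolev m th.2].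

Definition predictor (th : R * (R -> R)) (x : R -> R) : R := th.1 + ip x th.2.

(** [u] and [v] are of the same order: the ratio is eventually well defined and
    bounded away from 0 and from infinity. *)
Definition same_order (u v : nat -> R) : Prop :=
  exists c C : R, [/\ 0 < c, 0 < C &
    \forall n \near \oo, 0 < v n /\ c * v n <= u n <= C * v n].

Definition sum_from1 (u : nat -> R) : R :=
  limn (fun N : nat => \sum_(1 <= nu < N.+1) u nu).

Definition summable_from1 (u : nat -> R) : Prop :=
  cvgn (fun N : nat => \sum_(1 <= nu < N.+1) u nu).

Definition strictly_concave (f : R -> R) : Prop :=
  forall x y t : R, x != y -> 0 < t < 1 ->
    t * f x + (1 - t) * f y < f (t * x + (1 - t) * y).

End unit_interval.

Notation pathType R := (g_sigma_algebraType (@cylinder R)).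

Section probability.
Context d {T : measurableType d} {R : realType} (P : probability T R).

Definition random_process (X : T -> R -> R) : Prop :=
  measurable_fun ([set: T] `*` @unit_itv R) (fun p : T * R => X p.1 p.2) /\
  forall w, L2 (X w).

(** [g x] is a version of [E{Z | X = x}]. It is meant for [Z] that is
    nonnegative or integrable. *)
Definition is_condexp (X : T -> R -> R) (Z : T -> \bar R)
    (g : pathType R -> \bar R) : Prop :=
  measurable_fun [set: pathType R] g /\
  forall A : set (pathType R), measurable A ->
    (\int[P]_(w in [set w | A (X w)]) Z w
     = \int[P]_(w in [set w | A (X w)]) g (X w))%E.

Definition condexp_le (X : T -> R -> R) (Z : T -> \bar R) (C : R) : Prop :=
  exists2 g : pathType R -> \bar R, is_condexp X Z g &
    {ae P, forall w, (g (X w) <= C%:E)%E}.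

Definition mutually_independent d' (S : measurableType d')
    (Z : nat -> T -> S) : Prop :=
  forall (n : nat) (A : nat -> set S), (forall i, measurable (A i)) ->
    P (\bigcap_(i in [set i | (i < n)%N]) (Z i @^-1` A i))
    = (\prod_(i < n) P (Z i @^-1` A i))%E.

Definition same_law d' (S : measurableType d') (Z Z' : T -> S) : Prop :=
  forall A : set S, measurable A -> P (Z @^-1` A) = P (Z' @^-1` A).

Definition obs (Y : T -> R) (X : T -> R -> R) (w : T) :
  (measurableTypeR R * pathType R)%type := (Y w, X w).

Definition iid_copies (Y : T -> R) (X : T -> R -> R)
    (Ys : nat -> T -> R) (Xs : nat -> T -> R -> R) : Prop :=
  mutually_independent (fun i => obs (Ys i) (Xs i)) /\
  forall i, same_law (obs (Ys i) (Xs i)) (obs Y X).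

(** [U n = O_P(r n)]. The exceptional event is covered by a measurable one, so
    that [P] is evaluated on measurable sets only. *)
Definition bounded_in_prob (U : nat -> T -> R) (r : nat -> R) : Prop :=
  forall e : R, 0 < e -> exists M : R, \forall n \near \oo,
    exists A : set T, [/\ measurable A, (P A <= e%:E)%E &
      [set w | M * r n < `|U n w|] `<=` A].

(** Convergence in distribution to N(0,1), by distribution functions. *)
Definition cvg_std_normal (U : nat -> T -> R) : Prop :=
  forall x : R, P [set w | U n w <= x] @[n --> \oo]
    --> normal_prob (0 : R) 1 `]-oo, x].

End probability.

Section model.
Context d {T : measurableType d} {R : realType} (P : probability T R).
Variables (m : nat) (ell : R -> R -> R) (Y : T -> R) (X : T -> R -> R).
Variables (th0 : R * (R -> R)) (B : pathType R -> R).

Definition sup_deriv_ell (j : nat) (y : R) : \bar R :=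
  ereal_sup (range (fun a : R => `|derive1n j (ell y) a|%:E)).

Definition residual (w : T) : R := derive1n 1 (ell (Y w)) (predictor th0 (X w)).

(* Fixes [B] to be a version of the conditional expectation that defines it. *)
Definition is_information : Prop :=
  is_condexp P X (fun w => (derive1n 2 (ell (Y w)) (predictor th0 (X w)))%:E)
    (fun x => (- B x)%:E).

Definition Cov (s t : R) : R := fine 'E_P[fun w => (B (X w) * X w s * X w t)%R].

Definition V (b b' : R -> R) : R :=
  \int[lebesgue_measure]_(t in unit_itv)
    \int[lebesgue_measure]_(s in unit_itv) (Cov s t * b t * b' s).

Definition Cov_op (b : R -> R) (t : R) : R :=
  \int[lebesgue_measure]_(s in unit_itv) (Cov s t * b s).

Definition ip1 (lam : R) (b b' : R -> R) : R := V b b' + lam * J m b b'.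

Definition ipH (lam : R) (th th' : R * (R -> R)) : R :=
  fine 'E_P[fun w => (B (X w) * predictor th (X w) * predictor th' (X w))%R]
  + lam * J m th.2 th'.2.

Definition normH (lam : R) (th : R * (R -> R)) : R := Num.sqrt (ipH lam th th).

Definition assumption_A1 (Yset : set R) : Prop :=
  [/\ (forall y, Yset y ->
         [/\ forall j : nat, (j < 3)%N ->
               forall a : R, derivable (derive1n j (ell y)) a 1,
             continuous (derive1n 3 (ell y)) & strictly_concave (ell y)]) /\
      (exists C0 C1 : R, [/\ 0 < C0, 0 < C1,
         condexp_le P X
           (fun w => expeR (sup_deriv_ell 2 (Y w) * (C0^-1)%:E)%E) C1 &
         condexp_le P X
           (fun w => expeR (sup_deriv_ell 3 (Y w) * (C0^-1)%:E)%E) C1]),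
      (exists2 C2 : R, 0 < C2 & {ae P, forall w, C2^-1 <= B (X w) <= C2}) /\
      (forall t, unit_itv t -> ('E_P[fun w => (B (X w) * X w t)%R] = 0)%E) &
      is_condexp P X (fun w => (residual w)%:E) (fun=> 0%E) /\
      is_condexp P X (fun w => (residual w ^+ 2)%:E) (fun x => (B x)%:E)].

(* The integrability makes [Cov] an actual expectation. *)
Definition assumption_A2 : Prop :=
  [/\ forall s t, unit_itv s -> unit_itv t ->
        P.-integrable [set: T] (EFin \o (fun w => B (X w) * X w s * X w t)),
      {within unit_itv `*` unit_itv, continuous (fun p : R * R => Cov p.1 p.2)} &
      forall b : R -> R, L2 b ->
        ae_eq lebesgue_measure unit_itv (Cov_op b) (cst 0) ->
        ae_eq lebesgue_measure unit_itv b (cst 0)].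

(** The series of the [c nu * phi nu], over [nu >= 1], converges to [b] in the
    norm of [ip1 lam]. *)
Definition expansion (lam : R) (phi : nat -> R -> R) (c : nat -> R)
    (b : R -> R) : Prop :=
  let rest N t := b t - \sum_(1 <= nu < N.+1) c nu * phi nu t in
  Num.sqrt (ip1 lam (rest N) (rest N)) @[N --> \oo] --> (0 : R).

(* [phi 0] and [rho 0] are not used. *)
Definition assumption_A3 (lam : nat -> R) (phi : nat -> R -> R)
    (rho : nat -> R) (a k : R) : Prop :=
  [/\ 0 <= a, a + 2^-1 < k,
      (forall nu, (0 < nu)%N -> Sobolev m (phi nu)) /\
      (exists2 Cphi : R, 0 < Cphi &
         forall nu, (0 < nu)%N -> L2norm (phi nu) <= Cphi * nu%:R `^ a),
      (forall nu nu', (0 < nu)%N -> (0 < nu')%N ->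
         V (phi nu) (phi nu') = (nu == nu')%:R /\
         J m (phi nu) (phi nu') = rho nu * (nu == nu')%:R) &
      [/\ forall nu, (0 < nu)%N -> 0 <= rho nu,
          forall nu nu', (0 < nu <= nu')%N -> rho nu <= rho nu',
          same_order rho (fun nu => nu%:R `^ (2 * k)) &
          forall (n : nat) (b : R -> R), (0 < n)%N -> Sobolev m b ->
            expansion (lam n) phi (fun nu => V b (phi nu)) b]].

Definition assumption_A4 : Prop :=
  (exists s : R, 0 < s < 1 /\
     ('E_P[fun w => expR (s * L2norm (X w))] < +oo)%E) /\
  (exists2 M0 : R, 0 < M0 & forall b : R -> R, Sobolev m b ->
     ('E_P[fun w => (`|ip (X w) b| ^+ 4)%R]
      <= M0%:E * 'E_P[fun w => (`|ip (X w) b| ^+ 2)%R] ^+ 2)%E).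

(** The sample of size [n] is indexed from 0 to [n - 1]. *)
Definition penalized_criterion (Ys : nat -> T -> R) (Xs : nat -> T -> R -> R)
    (lam : nat -> R) (n : nat) (w : T) (th : R * (R -> R)) : R :=
  n%:R^-1 * \sum_(i < n) ell (Ys i w) (predictor th (Xs i w))
  - lam n / 2 * J m th.2 th.2.

Definition is_estimator (Ys : nat -> T -> R) (Xs : nat -> T -> R -> R)
    (lam : nat -> R) (thhat : nat -> T -> R * (R -> R)) : Prop :=
  forall n : nat, (0 < n)%N ->
    [/\ forall w, Hspace m (thhat n w),
        measurable_fun [set: T] (fun w => (thhat n w).1),
        forall t, unit_itv t -> measurable_fun [set: T] (fun w => (thhat n w).2 t) &
        {ae P, forall w, forall th, Hspace m th ->
           penalized_criterion Ys Xs lam n w th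
           <= penalized_criterion Ys Xs lam n w (thhat n w)}].

End model.

Section rates.
Context {R : realType}.
Variables (m : nat) (a k : R) (lam : nat -> R).

Definition bandwidth (n : nat) : R := lam n `^ (2 * k)^-1.
Local Notation h := bandwidth.

Definition rate_r (n : nat) : R := (n%:R * h n) `^ (- 2^-1) + h n `^ k.

(* Extended real, as the supremum [Cell] may be infinite. *)
Definition rate_a (Cell : \bar R) (n : nat) : \bar R :=
  ((n%:R `^ (- 2^-1)
    * h n `^ (- ((4 * m%:R * a + 6 * m%:R - 1) / (4 * m%:R)))
    * rate_r n * ln n%:R ^+ 2 * Num.sqrt (ln (ln n%:R)))%:E
   + Cell * (h n `^ (- 2^-1) * rate_r n ^+ 2)%:E)%E.

End rates.

Section contrast.
Context d {T : measurableType d} {R : realType}.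
Variables (wt : R -> R) (phi : nat -> R -> R) (rho : nat -> R) (lam : nat -> R).

Definition M_sum (j n : nat) : R :=
  sum_from1 (fun nu => ip wt (phi nu) ^+ 2 / (1 + lam n * rho nu) ^+ j).

Definition CT (thhat : nat -> T -> R * (R -> R)) (c : R) (n : nat) (w : T) : R :=
  Num.sqrt n%:R * (ip wt (thhat n w).2 - c) / Num.sqrt (M_sum 2 n).

End contrast.

(* Main.v *)
Require Import Defs.
From HB Require Import structures.
From mathcomp Require Import all_boot all_order all_algebra.
From mathcomp Require Import all_classical all_reals all_analysis.
From mathcomp Require Import measurable_realfun.
From mathcomp Require Import zify ring lra.

Set Implicit Arguments.
Unset Strict Implicit.
Unset Printing Implicit Defensive.

Import Order.TTheory GRing.Theory Num.Theory.
Import numFieldNormedType.Exports.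

Local Open Scope classical_set_scope.
Local Open Scope ring_scope.

(** Test the first-order condition of the penalized criterion in the direction
    [tau = sum_(nu <= N) w_nu / (1 + lambda rho_nu) phi_nu], where [N] is so large
    that the rest of the series is negligible, and expand the score to second order
    at the true parameter. With [d] the coordinates of the estimation error,
    [kappa_nu = 1 + lambda rho_nu] and [T_i] the integral of [X_i tau], this gives
    [sum_(nu <= N) w_nu d_nu = n^-1 sum_i eps_i T_i + L + Q - lambda J(beta_0, tau)].
    In the linear remainder [L] and the quadratic remainder [Q], the error is
    expanded pointwise along the eigenfunctions, so that Cauchy-Schwarz bounds them
    by the norm of the error times the Hilbert-Schmidt norm of centered sample
    averages that do not depend on the estimator; Markov's inequality controls those
    averages, so no empirical-process bound is needed. The weights satisfy
    [sum_nu nu^(2a) / kappa_nu = O(h^-(2a + 5/2))], and [n a_n^2 -> 0] makes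
    [r_n h^-(a + 5/4)] vanish because [C_ell >= 0]; the bias is [O(lambda)] with
    [lambda sqrt n -> 0]. The main term is a sum of independent variables, whose
    central limit theorem follows from Lindeberg's replacement of the summands by
    Gaussian ones. *)

(** * Real-valued integrals *)

(** The test direction must lie in H^m, which the full series is not known to do: hence the
    truncation, at an order depending on [n]. The series of the error converges in <.,.>_1 only, a
    norm that does not control the integral against a given path. Bessel's inequality and the
    summability of |phi_nu|^2 / kappa_nu make it converge almost everywhere and in L^2, and the
    injectivity of the covariance operator identifies its sum. Markov's inequality is applied to
    nondecreasing partial sums of squared coefficients, so that one exceptional event serves all
    orders of expansion and all values of the error. As derivatives of order m exist almost
    everywhere only, even the bilinearity of J rests on the differentiability of absolutely
    continuous functions, obtained from the total variation, the Stieltjes measure, Radon-Nikodym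
    and Lebesgue differentiation. The 5/4 is the least value of (4ma + 6m - 1) / (4m) - a over m >=
    1. The third moments of the normalized summands are uniformly of order n^(-3/2), by the
    fourth-moment condition on X and the moments of the residual. *)

Section real_integral.
Context d (T : measurableType d) (R : realType) (mu : {measure set T -> \bar R}).
Implicit Types f g : T -> R.

(** Expectations and integrals over [0, 1] are both treated as integrals over the whole space, in
    the second case after extension by zero. *)
Definition intg f := mu.-integrable [set: T] (EFin \o f).
Definition itg f : R := \int[mu]_x f x.

Lemma intg_meas f : intg f -> measurable_fun setT f.
Proof. by move/integrableP => [/measurable_EFinP]. Qed.

Lemma intg_le g f : measurable_fun setT f -> (forall x, `|f x| <= g x) ->
  intg g -> intg f.
Proof.
move=> mf fg; apply: le_integrable => //; first exact/measurable_EFinP.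
by move=> x _ /=; rewrite lee_fin (le_trans (fg x))// ler_norm.
Qed.

Lemma intgD f g : intg f -> intg g -> intg (fun x => f x + g x).
Proof.
move=> hf hg; have := @integrableD _ _ _ mu setT measurableT _ _ hf hg.
by apply: eq_integrable => // x _ /=; rewrite EFinD.
Qed.

Lemma intgN f : intg f -> intg (fun x => - f x).
Proof.
move=> hf; have := @integrableN _ _ _ mu setT _ hf.
by apply: eq_integrable => // x _ /=; rewrite EFinN.
Qed.

Lemma intgB f g : intg f -> intg g -> intg (fun x => f x - g x).
Proof. by move=> hf hg; apply: intgD => //; exact: intgN. Qed.

Lemma intgZ k f : intg f -> intg (fun x => k * f x).
Proof.
move=> hf; have := @integrableZl _ _ _ mu setT measurableT k _ hf.
by apply: eq_integrable => // x _ /=; rewrite EFinM.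
Qed.

Lemma intgZr k f : intg f -> intg (fun x => f x * k).
Proof. by move=> hf; under eq_fun do rewrite mulrC; exact: intgZ. Qed.

Lemma intg_norm f : intg f -> intg (fun x => `|f x|).
Proof.
move=> hf; apply: (@le_integrable _ _ _ mu setT measurableT _ (EFin \o f)) => //.
- by apply/measurable_EFinP/measurableT_comp => //; exact: intg_meas.
- by move=> x _ /=; rewrite normr_id.
Qed.

Lemma intg0 : intg (fun=> 0).
Proof. exact: integrable0. Qed.

Lemma intg_sum (I : Type) (s : seq I) (F : I -> T -> R) :
  (forall i, intg (F i)) -> intg (fun x => \sum_(i <- s) F i x).
Proof.
move=> h; elim: s => [|i s ih].
  by under eq_fun do rewrite big_nil; exact: intg0.
by under eq_fun do rewrite big_cons; exact: intgD.
Qed.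

Lemma itgD f g : intg f -> intg g ->
  itg (fun x => f x + g x) = itg f + itg g.
Proof. exact: RintegralD. Qed.

Lemma itgB f g : intg f -> intg g ->
  itg (fun x => f x - g x) = itg f - itg g.
Proof. exact: RintegralB. Qed.

Lemma itgZ k f : intg f -> itg (fun x => k * f x) = k * itg f.
Proof. by move=> h; rewrite /itg RintegralZl. Qed.

Lemma itgZr k f : intg f -> itg (fun x => f x * k) = itg f * k.
Proof. by move=> h; rewrite /itg RintegralZr. Qed.

Lemma itgN f : intg f -> itg (fun x => - f x) = - itg f.
Proof.
by move=> h; rewrite -mulN1r -itgZ//; congr itg; apply/funext => x; rewrite mulN1r.
Qed.

Lemma itg0 : itg (fun=> 0) = 0.
Proof. by rewrite /itg /Rintegral integral0. Qed.

Lemma itg_sum (I : Type) (s : seq I) (F : I -> T -> R) :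
  (forall i, intg (F i)) -> itg (fun x => \sum_(i <- s) F i x) = \sum_(i <- s) itg (F i).
Proof.
move=> h; elim: s => [|i s ih].
  by rewrite big_nil; under eq_fun do rewrite big_nil; exact: itg0.
rewrite big_cons -ih -itgD//; last exact: intg_sum.
by congr itg; apply/funext => x; rewrite big_cons.
Qed.

Lemma itg_ge0 f : (forall x, 0 <= f x) -> 0 <= itg f.
Proof. by move=> h; apply: Rintegral_ge0. Qed.

Lemma le_itg f g : intg f -> intg g -> (forall x, f x <= g x) -> itg f <= itg g.
Proof. by move=> hf hg fg; apply: le_Rintegral. Qed.

Lemma itg_norm f : intg f -> `|itg f| <= itg (fun x => `|f x|).
Proof. exact: le_normr_Rintegral. Qed.

Lemma EFin_itg f : intg f -> (itg f)%:E = (\int[mu]_x (f x)%:E)%E.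
Proof. by move=> h; rewrite /itg /Rintegral fineK//; exact: integrable_fin_num. Qed.

Lemma intgP_ge0 f : measurable_fun setT f -> (forall x, 0 <= f x) ->
  (\int[mu]_x (f x)%:E < +oo)%E -> intg f.
Proof.
move=> mf f0 fi; apply/integrableP; split; first exact/measurable_EFinP.
by under eq_integral do rewrite /= ger0_norm//.
Qed.

Lemma intg_ltyP f : intg f -> (forall x, 0 <= f x) -> (\int[mu]_x (f x)%:E < +oo)%E.
Proof. by move=> hf f0; rewrite -EFin_itg// ltry. Qed.

Lemma intg_mul f g : measurable_fun setT f -> measurable_fun setT g ->
  intg (fun x => f x ^+ 2) -> intg (fun x => g x ^+ 2) ->
  intg (fun x => f x * g x).
Proof.
move=> mf mg f2 g2; apply: (@intg_le (fun x => f x ^+ 2 + g x ^+ 2)).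
- exact: measurable_funM.
- move=> x; rewrite normrM -(real_normK (num_real (f x))) -(real_normK (num_real (g x))).
  have := sqr_ge0 (`|f x| - `|g x|); have := normr_ge0 (f x); have := normr_ge0 (g x).
  nra.
- exact: intgD.
Qed.

Lemma intg_sqD f g : measurable_fun setT f -> measurable_fun setT g ->
  intg (fun x => f x ^+ 2) -> intg (fun x => g x ^+ 2) ->
  intg (fun x => (f x + g x) ^+ 2).
Proof.
move=> mf mg f2 g2.
under eq_fun do rewrite sqrrD.
apply: intgD => //; apply: intgD => //.
under eq_fun do rewrite -mulr_natl.
by apply: intgZ; exact: intg_mul.
Qed.

(* The quadratic polynomial [s |-> itg (f + s g)^2] is nonnegative. *)
Lemma cauchy_schwarz f g : measurable_fun setT f -> measurable_fun setT g ->
  intg (fun x => f x ^+ 2) -> intg (fun x => g x ^+ 2) ->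
  itg (fun x => f x * g x) ^+ 2 <=
  itg (fun x => f x ^+ 2) * itg (fun x => g x ^+ 2).
Proof.
move=> mf mg f2 g2; have fg := intg_mul mf mg f2 g2.
set A := itg (fun x => f x ^+ 2); set B := itg (fun x => g x ^+ 2).
set C := itg _.
have key s : 0 <= A + s * (2 * C) + s ^+ 2 * B.
  have -> : A + s * (2 * C) + s ^+ 2 * B = itg (fun x => (f x + s * g x) ^+ 2).
    rewrite /A /C /B -itgZ// -itgZ; last exact: intgZ.
    rewrite -itgZ// -itgD//; last by apply: intgZ; exact: intgZ.
    rewrite -itgD//; [|apply: intgD => //; apply: intgZ; exact: intgZ|exact: intgZ].
    by congr itg; apply/funext => x; ring.
  by apply: itg_ge0 => x; exact: sqr_ge0.
have B0 : 0 <= B by apply: itg_ge0 => x; exact: sqr_ge0.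
have [B0'|Bn0] := eqVneq B 0.
  rewrite B0' mulr0; have [->|Cn0] := eqVneq C 0; first by rewrite expr0n.
  (* Here the polynomial is affine and takes the value -1 at this point. *)
  have := key (- (A + 1) / (2 * C)); rewrite B0' mulr0 addr0.
  by rewrite divfK ?mulf_neq0// => ?; exfalso; lra.
have Bp : 0 < B by rewrite lt_neqAle eq_sym Bn0.
(* The minimizer of the polynomial. *)
have := key (- C / B).
have -> : A + - C / B * (2 * C) + (- C / B) ^+ 2 * B = (A * B - C ^+ 2) / B by field.
by rewrite pmulr_lge0 ?invr_gt0// subr_ge0.
Qed.

Lemma ae_eq_itg f g : measurable_fun setT f -> measurable_fun setT g ->
  {ae mu, forall x, f x = g x} -> itg f = itg g.
Proof.
move=> mf mg fg; congr fine; apply: ae_eq_integral => //; try exact/measurable_EFinP.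
by apply: filterS fg => x + _ => /= ->.
Qed.

Lemma ae_intg f g : measurable_fun setT f -> measurable_fun setT g ->
  {ae mu, forall x, f x = g x} -> intg f -> intg g.
Proof.
move=> mf mg fg /integrableP[_ fi]; apply/integrableP; split; first exact/measurable_EFinP.
apply: le_lt_trans fi; rewrite le_eqVlt; apply/orP; left; apply/eqP.
apply: ge0_ae_eq_integral => //.
- by apply: measurableT_comp => //; exact/measurable_EFinP.
- by apply: measurableT_comp => //; exact/measurable_EFinP.
- by apply: filterS fg => x + _ => /= ->.
Qed.

Lemma itg_eq0 f : intg f -> (forall x, 0 <= f x) -> itg f = 0 ->
  {ae mu, forall x, f x = 0}.
Proof.
move=> hf f0 If.
have mf : measurable_fun setT (EFin \o f) by apply/measurable_EFinP; exact: intg_meas.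
have I0 : (\int[mu]_x `|(EFin \o f) x| = 0)%E.
  by under eq_integral do rewrite /= ger0_norm//; rewrite -EFin_itg// If.
have /filterS := (ae_eq_integral_abs mu measurableT mf).1 I0; apply.
by move=> x /(_ I) [].
Qed.

End real_integral.
Arguments intg {d T R} mu f.
Arguments itg {d T R} mu f.

(** * Fubini's theorem for real-valued functions *)

Section real_fubini.
Context d1 d2 (T1 : measurableType d1) (T2 : measurableType d2) (R : realType).
Variable m1 : {sigma_finite_measure set T1 -> \bar R}.
Variable m2 : {sigma_finite_measure set T2 -> \bar R}.
Implicit Types f : T1 -> T2 -> R.

Let unc f : T1 * T2 -> R := fun z => f z.1 z.2.

Lemma intg_prod12 f (g : T1 -> R) : measurable_fun setT (unc f) ->
  (forall x, intg m2 (f x)) -> (forall x, itg m2 (fun y => `|f x y|) <= g x) ->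
  intg m1 g -> intg (m1 \x m2)%E (unc f).
Proof.
move=> mf fx fg hg; apply/integrable12ltyP; first exact/measurable_EFinP.
have g0 x : 0 <= g x by apply: le_trans (fg x); apply: itg_ge0.
have := intg_ltyP hg g0; apply: le_lt_trans; apply: ge0_le_integral => //.
- by move=> x _; exact: integral_ge0.
- apply: (measurable_fun_fubini_tonelli_F (abse \o (EFin \o unc f))) => //=.
  by apply: measurableT_comp => //; exact/measurable_EFinP.
- by apply/measurable_EFinP; exact: intg_meas hg.
- by move=> x _; rewrite -(EFin_itg (intg_norm (fx x))) lee_fin.
Qed.

Lemma itg_fubini f : intg (m1 \x m2)%E (unc f) ->
  (forall x, intg m2 (f x)) -> (forall y, intg m1 (f^~ y)) ->
  itg m1 (fun x => itg m2 (f x)) = itg m2 (fun y => itg m1 (f^~ y)).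
Proof.
move=> hf h1 h2; congr fine.
transitivity (\int[m1]_x \int[m2]_y (unc f (x, y))%:E)%E.
  by apply: eq_integral => x _; rewrite EFin_itg.
by rewrite (Fubini hf); apply: eq_integral => y _; rewrite EFin_itg.
Qed.

(** Tonelli applies to the positive and negative parts separately; where their difference is
    infinite, [fine] returns a default value, still measurably. *)
Lemma measurable_itg_l f : measurable_fun setT (unc f) ->
  measurable_fun setT (fun x => itg m2 (f x)).
Proof.
move=> mf; apply: measurableT_comp => //.
under eq_fun do rewrite integralE.
apply: emeasurable_funB.
- have mp : measurable_fun setT ((EFin \o unc f)^\+%E).
    by apply: measurable_funepos; exact/measurable_EFinP.
  have mF := measurable_fun_fubini_tonelli_F (m2 := m2) _ mp (funepos_ge0 _).
  by apply: eq_measurable_fun mF => x _; apply: eq_integral => y _; rewrite !funeposE.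
- have mp : measurable_fun setT ((EFin \o unc f)^\-%E).
    by apply: measurable_funeneg; exact/measurable_EFinP.
  have mF := measurable_fun_fubini_tonelli_F (m2 := m2) _ mp (funeneg_ge0 _).
  by apply: eq_measurable_fun mF => x _; apply: eq_integral => y _; rewrite !funenegE.
Qed.

Lemma intg_prod_itg f : intg (m1 \x m2)%E (unc f) -> (forall x, intg m2 (f x)) ->
  intg m1 (fun x => itg m2 (f x)).
Proof.
move=> hf h1; have := integrable_fubini_F hf; apply: eq_integrable => // x _.
by rewrite /fubini_F /= EFin_itg.
Qed.

End real_fubini.

(** * Gaussian averages *)

Section gaussian.
Context (R : realType).
Local Notation mu := (@lebesgue_measure R).

Definition gpdf : R -> R := normal_pdf 0 1.

Lemma gpdfE y : gpdf y = normal_peak 1 * expR (- (y ^+ 2 / 2)).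
Proof.
rewrite /gpdf normal_pdfE ?oner_eq0// /normal_fun; congr (_ * expR _).
by rewrite subr0 expr1n mulNr.
Qed.

Lemma gpdf_ge0 y : 0 <= gpdf y. Proof. exact: normal_pdf_ge0. Qed.

Lemma measurable_gpdf : measurable_fun setT gpdf.
Proof. exact: measurable_normal_pdf. Qed.

Lemma continuous_gpdf : continuous gpdf.
Proof. by apply: continuous_normal_pdf; rewrite oner_eq0. Qed.

Lemma intg_gpdf : intg mu gpdf. Proof. exact: integrable_normal_pdf. Qed.

Lemma itg_gpdf : itg mu gpdf = 1.
Proof. by rewrite /itg /Rintegral integral_normal_pdf. Qed.

Lemma integral_affine (G : R -> R) (c e : R) : 0 < c ->
  continuous G -> (forall x, 0 <= G x) ->
  (\int[mu]_x (G x)%:E = \int[mu]_x (c * G (c * x + e))%:E)%E.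
Proof.
move=> c0 cG G0.
pose F x : R := c * x + e.
have dF x : is_derive x (1 : R) F c.
  rewrite /F; apply: is_derive_eq.
  by rewrite addr0 /GRing.scale/= mulr1.
have F'E : F^`()%classic = cst c by apply/funext => x; rewrite derive1E derive_val.
rewrite (@increasing_ge0_integration_by_substitutionT _ F)//.
- by apply: eq_integral => x _; rewrite F'E /= mulrC.
- by move=> x y xy; rewrite /F ltrD2r ltr_pM2l.
- by rewrite F'E => x; exact: cvg_cst.
- by rewrite F'E; exact: is_cvg_cst.
- by rewrite F'E; exact: is_cvg_cst.
- apply/cvgrNyPle => A; near=> x; rewrite /F -lerBrDr mulrC -ler_pdivlMr//.
- apply/cvgryPge => A; near=> x; rewrite /F -lerBlDr mulrC -ler_pdivrMr//.
Unshelve. all: by end_near. Qed.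

(** Rotation invariance of the planar Gaussian density: for the [y] with [al * y + be * z = ga * u],
    the coordinates of [(y, z)] in the frame rotated to the direction [(al, be)] are [u] and
    [(ga * z - be * u) / al]. *)
Lemma gpdf_rotate (al be ga u z : R) : al != 0 -> al ^+ 2 + be ^+ 2 = ga ^+ 2 ->
  gpdf (ga / al * u - be / al * z) * gpdf z = gpdf u * gpdf (ga / al * z - be / al * u).
Proof.
move=> a0 abc; rewrite !gpdfE mulrACA [RHS]mulrACA -!expRD; congr (_ * expR _).
have -> : ga / al * u - be / al * z = (ga * u - be * z) / al by field.
have -> : ga / al * z - be / al * u = (ga * z - be * u) / al by field.
rewrite !expr_div_n.
apply/eqP; rewrite -subr_eq0; apply/eqP.
rewrite [LHS](_ : _ = (ga ^+ 2 - (al ^+ 2 + be ^+ 2)) * (z ^+ 2 - u ^+ 2) / (2 * al ^+ 2)).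
  by rewrite abc subrr !mul0r.
by field.
Qed.

(** In the inner integral, [y] is traded for the [u] with [al * y + be * z = ga * u]. By rotation
    the density splits into one at [u] and one at an affine function of [z]; Tonelli's theorem then
    integrates [z] out. *)
Lemma gauss_convolution (f : R -> R) (x al be ga : R) : 0 < al -> 0 < ga ->
  al ^+ 2 + be ^+ 2 = ga ^+ 2 ->
  continuous f -> (forall x, 0 <= f x) ->
  (\int[mu]_z \int[mu]_y (f (x + al * y + be * z) * gpdf y * gpdf z)%:E =
   \int[mu]_u (f (x + ga * u) * gpdf u)%:E)%E.
Proof.
move=> a0 g0 abc cf f0.
have a0' : al != 0 by rewrite gt_eqF.
pose H (z u : R) := ga / al * (f (x + ga * u) * (gpdf u * gpdf (ga / al * z - be / al * u))).
have mf : measurable_fun setT f by exact: continuous_measurable_fun.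
transitivity (\int[mu]_z \int[mu]_u (H z u)%:E)%E.
  apply: eq_integral => z _.
  rewrite (@integral_affine _ (ga / al) (- (be / al * z))).
  - apply: eq_integral => u _; congr EFin; rewrite /H; congr (_ * _).
    rewrite -mulrA gpdf_rotate//; congr (f _ * _).
    by field.
  - by rewrite divr_gt0.
  - move=> y; apply: cvgM; last exact: cvg_cst.
    apply: cvgM; last exact: continuous_gpdf.
    apply: (cvg_comp (fun y => x + al * y + be * z) f); last exact: cf.
    apply: (@cvgD _ R^o); last exact: cvg_cst.
    apply: (@cvgD _ R^o); first exact: cvg_cst.
    by apply: cvgM; [exact: cvg_cst|exact: cvg_id].
  - by move=> y; rewrite !mulr_ge0// ?gpdf_ge0.
have mH : measurable_fun setT (fun p : R * R => H p.1 p.2).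
  apply: measurable_funM => //; apply: measurable_funM.
    by apply: measurableT_comp => //; apply: measurable_funD => //; apply: measurable_funM.
  apply: measurable_funM.
    by apply: measurableT_comp => //; exact: measurable_gpdf.
  apply: measurableT_comp; first exact: measurable_gpdf.
  by apply: measurable_funB; apply: measurable_funM.
have H0 z u : 0 <= H z u.
  by rewrite !mulr_ge0 ?gpdf_ge0// ?invr_ge0 ltW.
have mHE : measurable_fun setT (fun p : R * R => (H p.1 p.2)%:E).
  exact/measurable_EFinP.
rewrite (fubini_tonelli (m1 := mu) (m2 := mu) (fun p : R * R => (H p.1 p.2)%:E) mHE); last first.
  by move=> p; rewrite lee_fin.
apply: eq_integral => u _.
transitivity (\int[mu]_z ((f (x + ga * u) * gpdf u)%:E *
     (ga / al * gpdf (ga / al * z + (- (be / al * u))))%:E))%E.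
  by apply: eq_integral => z _; rewrite -EFinM /H; congr EFin; ring.
rewrite ge0_integralZl//.
- rewrite -(@integral_affine gpdf); first by rewrite integral_normal_pdf mule1.
  + by rewrite divr_gt0.
  + exact: continuous_gpdf.
  + exact: gpdf_ge0.
- apply/measurable_EFinP; apply: measurable_funM => //.
  by apply: measurableT_comp; [exact: measurable_gpdf|apply: measurable_funD => //; apply: measurable_funM].
- by move=> z _; rewrite lee_fin mulr_ge0 ?gpdf_ge0// divr_ge0// ltW.
- by rewrite lee_fin mulr_ge0 ?gpdf_ge0.
Qed.

Lemma expR_ge_sqr (w : R) : 0 <= w -> w ^+ 2 / 4 <= expR w.
Proof.
move=> w0; have -> : w = w / 2 + w / 2 by field.
rewrite expRD; have := expR_ge1Dx (w / 2); nra.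
Qed.

(** Half of the Gaussian exponent absorbs the polynomial; the other half is, up to a constant, the
    density of variance 2. With [w = y ^+ 2 / 4], [1 + y ^+ 4 = 1 + 16 * w ^+ 2] is at most
    [65 * expR w], since [w ^+ 2 / 4 <= expR w]. *)
Lemma intg_gpdf_poly (q : R -> R) (K : R) : measurable_fun setT q ->
  (forall y, `|q y| <= K * (1 + y ^+ 4)) -> intg mu (fun y => q y * gpdf y).
Proof.
move=> mq qK.
have s2 : Num.sqrt 2 != 0 :> R by rewrite gt_eqF// sqrtr_gt0.
have K0 : 0 <= K.
  have := qK 0; rewrite expr0n/= addr0 mulr1; exact: le_trans.
pose C := K * 65 * normal_peak (1 : R) / normal_peak (Num.sqrt 2 : R).
refine (@intg_le _ _ _ mu (fun y => C * normal_pdf 0 (Num.sqrt 2) y) _ _ _ _).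
- by apply: measurable_funM => //; exact: measurable_gpdf.
- move=> y; rewrite normrM [X in _ * X]ger0_norm ?gpdf_ge0//.
  rewrite gpdfE normal_pdfE// /normal_fun subr0 sqr_sqrtr// /C.
  set w := y ^+ 2 / 4.
  have w0 : 0 <= w by rewrite divr_ge0// sqr_ge0.
  have -> : y ^+ 2 / 2 = w + w by rewrite /w; field.
  have -> : - y ^+ 2 / (2 *+ 2) = - w by rewrite /w; field.
  rewrite opprD expRD.
  have e0 : 0 < expR (- w) by exact: expR_gt0.
  have e1 : 1 + y ^+ 4 <= 65 * expR w.
    have -> : y ^+ 4 = 16 * w ^+ 2 by rewrite /w; field.
    by have := expR_ge_sqr w0; have := expR_ge1Dx w; lra.
  have e2 : (1 + y ^+ 4) * expR (- w) <= 65.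
    by rewrite expRN -ler_pdivlMr ?invrK ?invr_gt0 ?expR_gt0.
  have p1 := normal_peak_ge0 (1 : R).
  have p2 : normal_peak (Num.sqrt 2 : R) != 0 by rewrite gt_eqF// normal_peak_gt0.
  apply: (@le_trans _ _ (K * (1 + y ^+ 4) * (normal_peak 1 * (expR (- w) * expR (- w))))).
    by apply: ler_wpM2r => //; rewrite mulr_ge0// mulr_ge0// ltW.
  have -> : K * 65 * normal_peak 1 / normal_peak (Num.sqrt 2) *
    (normal_peak (Num.sqrt 2) * expR (- w)) = K * normal_peak 1 * expR (- w) * 65 :> R by field.
  have -> : K * (1 + y ^+ 4) * (normal_peak 1 * (expR (- w) * expR (- w))) =
    K * normal_peak 1 * expR (- w) * ((1 + y ^+ 4) * expR (- w)) :> R by ring.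
  by apply: ler_wpM2l => //; rewrite !mulr_ge0// ltW.
- by apply: intgZ; exact: integrable_normal_pdf.
Qed.

Lemma gpdfN y : gpdf (- y) = gpdf y.
Proof. by rewrite !gpdfE sqrrN. Qed.

Lemma is_derive_gpdf y : is_derive y (1 : R) gpdf (- y * gpdf y).
Proof.
have -> : gpdf = (fun x => normal_peak 1 * expR (- (x ^+ 2 / 2))).
  by apply/funext => x; rewrite gpdfE.
apply: is_derive_eq.
by rewrite /GRing.scale/=; field.
Qed.

(** On [[-n, n]] the fundamental theorem leaves the boundary terms of [F], which vanish in the
    limit; dominated convergence passes to the whole line. This computes the first two moments. *)
Lemma itg_gpdf_parts (q F : R -> R) (K : R) : continuous q ->
  (forall y, `|q y| <= K * (1 + y ^+ 4)) ->
  (forall y, is_derive y (1 : R) F (q y * gpdf y)) ->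
  (F n%:R - F (- n%:R)) @[n --> \oo] --> (0 : R) ->
  itg mu (fun y => q y * gpdf y) = 0.
Proof.
move=> cq qK dF F0.
have mq : measurable_fun setT q by exact: continuous_measurable_fun.
have hq := intg_gpdf_poly mq qK.
have mqg : measurable_fun setT (EFin \o (fun y => q y * gpdf y)).
  by apply/measurable_EFinP; apply: measurable_funM => //; exact: measurable_gpdf.
have cqg : continuous (fun y => q y * gpdf y).
  by move=> y; apply: cvgM; [exact: cq|exact: continuous_gpdf].
pose f_ n := (EFin \o (fun y => q y * gpdf y)) \_ `[- n%:R, n%:R : R].
have [] := @dominated_convergence _ _ _ mu setT measurableT f_ (EFin \o (fun y => q y * gpdf y))
  (EFin \o (fun y => `|q y * gpdf y|)).
- move=> n; apply/(measurable_restrictT _ _).1 => //.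
  exact: measurable_funTS.
- exact: mqg.
- apply: aeW => y _; apply: cvg_near_cst; near=> n.
  rewrite /f_ patchE mem_set//= in_itv/= -ler_norml.
  by near: n; exact: nbhs_infty_ger.
- exact: intg_norm.
- apply: aeW => y n _; rewrite /f_ patchE; case: ifPn => _ /=; first by [].
  by rewrite normr0 lee_fin.
move=> _ _ cv.
have cv0 : [sequence (\int[mu]_x f_ n x)%E]_n @ \oo --> (0 : \bar R)%E.
  apply: (@cvg_trans _ (EFin \o (fun n : nat => F n%:R - F (- n%:R)) @ \oo)); last first.
    by apply: cvg_EFin; [exact: nearW|exact: F0].
  apply: near_eq_cvg; near=> n.
  have n0 : (0 : R) < n%:R by rewrite ltr0n; near: n; exact: nbhs_infty_gt.
  rewrite /= -integral_mkcond (@continuous_FTC2 _ _ F)//.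
  - by rewrite (lt_trans _ n0)// oppr_lt0.
  - exact: continuous_subspaceT.
  - split.
    + by move=> y _; exact: ex_derive.
    + apply: cvg_at_right_filter.
      exact/differentiable_continuous/derivable1_diffP/ex_derive.
    + apply: cvg_at_left_filter.
      exact/differentiable_continuous/derivable1_diffP/ex_derive.
  - by move=> y _; rewrite derive1E derive_val.
have E := cvg_unique _ cv cv0.
rewrite /itg /Rintegral; have := E; rewrite /=; move=> ->//.
Unshelve. all: by end_near. Qed.

Lemma itg_gpdf1 : itg mu (fun y => y * gpdf y) = 0.
Proof.
apply: (@itg_gpdf_parts id (fun y => - gpdf y) 1).
- by move=> y; exact: cvg_id.
- move=> y; have := sqr_ge0 (y ^+ 2 - 2^-1); have := sqr_ge0 (y - 2^-1); have := sqr_ge0 (y + 2^-1).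
  by move=> ? ? ?; rewrite mul1r ler_norml; apply/andP; split; nra.
- move=> y; have := is_derive_gpdf y => h; apply: is_derive_eq.
  by rewrite mulNr opprK.
- under eq_fun do rewrite gpdfN subrr; exact: cvg_cst.
Qed.

(** As [y * gpdf y] has the derivative [(1 - y ^+ 2) * gpdf y], the second moment equals the total
    mass. *)
Lemma itg_gpdf2 : itg mu (fun y => y ^+ 2 * gpdf y) = 1.
Proof.
have h2 : intg mu (fun y : R => y ^+ 2 * gpdf y).
  apply: (@intg_gpdf_poly _ 1).
    by apply: measurable_funX.
  by move=> y; rewrite mul1r ger0_norm ?sqr_ge0//; nra.
suff : itg mu (fun y : R => (1 - y ^+ 2) * gpdf y) = 0.
  under eq_fun do rewrite mulrBl mul1r.
  by rewrite itgB//; [rewrite itg_gpdf => ?; lra|exact: intg_gpdf].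
apply: (@itg_gpdf_parts (fun y => 1 - y ^+ 2) (fun y => y * gpdf y) 2).
- move=> y; apply: (@cvgB _ R^o); first exact: cvg_cst.
  exact: sqr_continuous.
- by move=> y; rewrite ler_norml; apply/andP; split; nra.
- move=> y; have := is_derive_gpdf y => h; apply: is_derive_eq.
  by rewrite /GRing.scale/=; ring.
- apply: (@squeeze_cvgr _ _ _ _ (fun=> 0) (fun n => 4 * normal_peak 1 * n%:R^-1)).
  + near=> n.
    have n0 : (0 : R) < n%:R by rewrite ltr0n; near: n; exact: nbhs_infty_gt.
    rewrite gpdfN mulNr opprK.
    have g0 := gpdf_ge0 n%:R.
    have -> /= : 0 <= n%:R * gpdf n%:R + n%:R * gpdf n%:R by rewrite addr_ge0// mulr_ge0// ltW.
    rewrite gpdfE.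
    have e1 : expR (- (n%:R ^+ 2 / 2)) <= 2 * n%:R^-1 ^+ 2 :> R.
      rewrite expRN -[X in _ <= X]invrK lef_pV2 ?posrE ?expR_gt0//; last first.
        by rewrite invr_gt0 mulr_gt0// exprn_gt0// invr_gt0.
      rewrite invfM exprVn invrK mulrC.
      by have := expR_ge1Dx (n%:R ^+ 2 / 2 : R); lra.
    have p0 := normal_peak_ge0 (1 : R).
    have -> : n%:R * (normal_peak 1 * expR (- (n%:R ^+ 2 / 2))) + n%:R * (normal_peak 1 * expR (- (n%:R ^+ 2 / 2))) = 2 * n%:R * normal_peak 1 * expR (- (n%:R ^+ 2 / 2)) :> R by ring.
    have -> : 4 * normal_peak 1 / n%:R = 2 * n%:R * normal_peak 1 * (2 * n%:R^-1 ^+ 2) :> R.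
      by field; rewrite gt_eqF.
    by apply: ler_wpM2l => //; rewrite !mulr_ge0// ltW.
  + exact: cvg_cst.
  + rewrite -(mulr0 (4 * normal_peak 1)); apply: cvgM; first exact: cvg_cst.
    by apply/gtr0_cvgV0; [near=> n; rewrite ltr0n; near: n; exact: nbhs_infty_gt|exact: cvgr_idn].
Unshelve. all: by end_near. Qed.

End gaussian.

(** * Independence *)

Section independence.
Context (R : realType).

(** Attaches the measure structure to the pushforward from the proof [mf], so that uniqueness and
    integration lemmas for measures apply to it directly. *)
Definition pushm d1 d2 (T1 : measurableType d1) (T2 : measurableType d2)
  (mu : {measure set T1 -> \bar R}) (f : T1 -> T2) (mf : measurable_fun setT f)
  : {measure set T2 -> \bar R} :=
  measure_function_pushforward__canonical__measure_function_Measure mu mf.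

(** Rectangles are closed under intersection and generate the product sigma-algebra. *)
Lemma prod_measure_ext d1 d2 (T1 : measurableType d1) (T2 : measurableType d2)
  (m1 m2 : {measure set (T1 * T2) -> \bar R}) : (m1 setT < +oo)%E ->
  (forall A B, measurable A -> measurable B -> m1 (A `*` B) = m2 (A `*` B)) ->
  forall X, measurable X -> m1 X = m2 X.
Proof.
move=> fin h.
pose C : set (set (T1 * T2)) :=
  [set C | exists A, measurable A /\ exists B, measurable B /\ C = A `*` B].
apply: (measure_unique C (fun=> setT)).
- rewrite measurable_prod_measurableType //; congr (<<s _ >>).
  rewrite predeqE; split => [[A mA [B mB <-]]|[A [mA [B [mB ->]]]]].
    by exists A; split => //; exists B.
  by exists A => //; exists B.
- move=> _ _ [X1 [mX1 [X2 [mX2 ->]]]] [Y1 [mY1 [Y2 [mY2 ->]]]].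
  rewrite -setXI; exists (X1 `&` Y1); split; first exact: measurableI.
  by exists (X2 `&` Y2); split => //; exact: measurableI.
- move=> i; exists setT; split => //; exists setT; split => //.
  by rewrite setXTT.
- by rewrite bigcup_const.
- by move=> _ [A [mA [B [mB ->]]]]; exact: h.
- by [].
Qed.

Lemma itg_prod d1 d2 (T1 : measurableType d1) (T2 : measurableType d2)
  (m1 : {sigma_finite_measure set T1 -> \bar R})
  (m2 : {sigma_finite_measure set T2 -> \bar R}) (f : T1 -> T2 -> R) :
  intg (m1 \x m2)%E (fun z => f z.1 z.2) -> (forall x, intg m2 (f x)) ->
  itg (m1 \x m2)%E (fun z => f z.1 z.2) = itg m1 (fun x => itg m2 (f x)).
Proof.
move=> hf h1; congr fine; rewrite -(integral12_prod_meas1 hf).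
by apply: eq_integral => x _; rewrite /fubini_F /= EFin_itg.
Qed.

Context d (T : measurableType d) (P : probability T R).

Lemma intg_cst (c : R) : intg P (fun=> c).
Proof. exact: finite_measure_integrable_cst. Qed.

Lemma itg_cst (c : R) : itg P (fun=> c) = c.
Proof.
rewrite /itg Rintegral_cst//; have -> : fine (P setT) = 1 by rewrite probability_setT.
by rewrite mulr1.
Qed.

Lemma itg_le_bound (f : T -> R) (c : R) : intg P f -> (forall x, `|f x| <= c) ->
  `|itg P f| <= c.
Proof.
move=> hf fc; apply: (le_trans (itg_norm hf)); rewrite -[leRHS]itg_cst.
by apply: le_itg => //; [exact: intg_norm|exact: intg_cst].
Qed.

Lemma intg_bounded (f : T -> R) (c : R) : measurable_fun setT f ->
  (forall x, `|f x| <= c) -> intg P f.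
Proof. by move=> mf fc; apply: (intg_le mf fc); exact: intg_cst. Qed.

(** The law of [(U, V)] under [P] and that of [(U z.1, V z.2)] under [P \x P] agree on rectangles,
    hence everywhere. Independence is thus used through an integral over two independent sample
    points. *)
Lemma indep_integrable d1 d2 (S1 : measurableType d1) (S2 : measurableType d2)
  (U : T -> S1) (V : T -> S2) (F : S1 -> S2 -> R) :
  measurable_fun setT U -> measurable_fun setT V ->
  (forall A B, measurable A -> measurable B ->
     P (U @^-1` A `&` V @^-1` B) = (P (U @^-1` A) * P (V @^-1` B))%E) ->
  measurable_fun setT (fun z : S1 * S2 => F z.1 z.2) ->
  intg (P \x P)%E (fun z => F (U z.1) (V z.2)) ->
  intg P (fun w => F (U w) (V w)) /\
  itg P (fun w => F (U w) (V w)) = itg (P \x P)%E (fun z => F (U z.1) (V z.2)).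
Proof.
move=> mU mV UV mF iF.
pose uv w := (U w, V w).
have muv : measurable_fun setT uv by exact: measurable_fun_pair.
pose uv2 (z : T * T) := (U z.1, V z.2).
have muv2 : measurable_fun setT uv2.
  by apply: measurable_fun_pair; exact: measurableT_comp.
have mE A : measurable A -> measurable (U @^-1` A).
  by move=> mA; rewrite -[X in measurable X]setTI; exact: mU.
have mE' A : measurable A -> measurable (V @^-1` A).
  by move=> mA; rewrite -[X in measurable X]setTI; exact: mV.
have E X : measurable X -> pushm P muv X = pushm (P \x P)%E muv2 X.
  apply: prod_measure_ext.
    by rewrite /= /pushforward preimage_setT probability_setT ltry.
  move=> A B mA mB; rewrite /= /pushforward.
  have -> : uv @^-1` (A `*` B) = U @^-1` A `&` V @^-1` B by [].
  have -> : uv2 @^-1` (A `*` B) = (U @^-1` A) `*` (V @^-1` B) by [].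
  by rewrite UV// product_measure1E//; [exact: mE|exact: mE'].
pose F2 (z : S1 * S2) := (F z.1 z.2)%:E.
have mF2 : measurable_fun setT F2 by exact/measurable_EFinP.
have i1 : P.-integrable setT (F2 \o uv).
  apply/integrableP; split; first exact: measurableT_comp.
  move/integrableP : iF => [_]; apply: le_lt_trans; rewrite le_eqVlt; apply/orP; left.
  apply/eqP; transitivity (\int[pushm P muv]_z `|F2 z|)%E.
    by rewrite ge0_integral_pushforward//; exact: measurableT_comp.
  rewrite (eq_measure_integral (pushm (P \x P)%E muv2)); last by move=> A mA _; exact: E.
  by rewrite ge0_integral_pushforward//; exact: measurableT_comp.
split; first exact: i1.
congr fine; transitivity (\int[pushm P muv]_z F2 z)%E.
  by rewrite (integral_pushforward muv).
rewrite (eq_measure_integral (pushm (P \x P)%E muv2)); last by move=> A mA _; exact: E.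
by rewrite (integral_pushforward muv2).
Qed.

Lemma indep_itgM d1 d2 (S1 : measurableType d1) (S2 : measurableType d2)
  (U : T -> S1) (V : T -> S2) (f : S1 -> R) (g : S2 -> R) :
  measurable_fun setT U -> measurable_fun setT V ->
  (forall A B, measurable A -> measurable B ->
     P (U @^-1` A `&` V @^-1` B) = (P (U @^-1` A) * P (V @^-1` B))%E) ->
  measurable_fun setT f -> measurable_fun setT g ->
  intg P (f \o U) -> intg P (g \o V) ->
  intg P (fun w => f (U w) * g (V w)) /\
  itg P (fun w => f (U w) * g (V w)) = itg P (f \o U) * itg P (g \o V).
Proof.
move=> mU mV UV mf mg fi gi.
have iF : intg (P \x P)%E (fun z => f (U z.1) * g (V z.2)).
  apply: (@intg_prod12 _ _ _ _ _ _ _ (fun x y => f (U x) * g (V y))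
    (fun x => `|f (U x)| * itg P (fun y => `|g (V y)|))).
  - apply: measurable_funM; apply: measurableT_comp => //; exact: measurableT_comp.
  - by move=> x; exact: intgZ.
  - move=> x; rewrite -itgZ; last exact: intg_norm.
    by rewrite le_eqVlt; apply/orP; left; apply/eqP; congr itg; apply/funext => y; rewrite normrM.
  - by apply: intgZr; exact: intg_norm.
have [||h1 ->] := @indep_integrable _ _ _ _ U V (fun x y => f x * g y) mU mV UV.
- by apply: measurable_funM; exact: measurableT_comp.
- exact: iF.
split => //; rewrite (itg_prod (f := fun x y => f (U x) * g (V y)) iF).
- rewrite -itgZr//; congr itg; apply/funext => x.
  exact: (itgZ (f (U x)) gi).
- by move=> x; exact: intgZ.
Qed.

End independence.

(** * Independence of a partial sum from the next summand *)

Section partial_sums.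
Context d (T : measurableType d) (R : realType) (P : probability T R).

Definition row_independent (n : nat) (Z : nat -> T -> R) : Prop :=
  forall A : nat -> set R, (forall i, measurable (A i)) ->
  P (\bigcap_(i in [set i | (i < n)%N]) (Z i @^-1` A i)) =
  (\prod_(i < n) P (Z i @^-1` A i))%E.

Definition psum (Z : nat -> T -> R) (k : nat) (w : T) : R := \sum_(i < k) Z i w.

Lemma measurable_psum Z k : (forall i, measurable_fun setT (Z i)) ->
  measurable_fun setT (psum Z k).
Proof. by move=> mZ; apply: measurable_sum => i. Qed.

Let future (Z : nat -> T -> R) (A : nat -> set R) n k :=
  \bigcap_(j in [set j | (k <= j < n)%N]) (Z j @^-1` A j).

(** Induction on [k], with the event on the later variables carried along. Restricted to that event,
    the joint law of [psum Z k] and [Z k] is a multiple of a product law: the induction hypothesis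
    gives this on rectangles. Evaluation on the pairs with sum in [C] gives the step to [k.+1]. *)
Lemma psum_future_indep n Z k : (forall i, measurable_fun setT (Z i)) ->
  row_independent n Z -> (k <= n)%N ->
  forall (C : set R) A, measurable C -> (forall i, measurable (A i)) ->
  P (psum Z k @^-1` C `&` future Z A n k) =
  (P (psum Z k @^-1` C) * \prod_(k <= j < n) P (Z j @^-1` A j))%E.
Proof.
move=> mZ indZ; elim: k => [_|k ih kn] C A mC mA.
  have pE : psum Z 0 = fun=> 0 by apply/funext => w; rewrite /psum big_ord0.
  have fE : future Z A n 0 = \bigcap_(i in [set i | (i < n)%N]) (Z i @^-1` A i) by [].
  rewrite pE fE preimage_cst; case: ifPn => _.
    by rewrite setTI probability_setT mul1e indZ// big_mkord.
  by rewrite set0I measure0 mul0e.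
have mpre B i : measurable B -> measurable (Z i @^-1` B).
  by move=> mB; rewrite -[X in measurable X]setTI; exact: mZ.
have mS B : measurable B -> measurable (psum Z k @^-1` B).
  move=> mB; rewrite -[X in measurable X]setTI.
  by apply: (measurable_psum k mZ).
have mF : measurable (future Z A n k.+1).
  by apply: bigcap_measurableType => i _; exact: mpre.
pose uv w := (psum Z k w, Z k w).
have muv : measurable_fun setT uv.
  by apply: measurable_fun_pair; [exact: measurable_psum|exact: mZ].
pose p := (\prod_(k.+1 <= j < n) P (Z j @^-1` A j))%E.
have p0 : (0 <= p)%E by apply: prode_ge0 => j _; exact: measure_ge0.
have pfin : p \is a fin_num.
  apply: prode_fin_num => j _; exact: fin_num_measure (mpre _ _ (mA j)).
have fp0 : (0 <= fine p)%R by exact: fine_ge0.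
pose uv2 (z : T * T) := (psum Z k z.1, Z k z.2).
have muv2 : measurable_fun setT uv2.
  apply: measurable_fun_pair; apply: measurableT_comp => //; exact: measurable_psum.
have msE Y : mscale (NngNum fp0) (pushm (P \x P)%E muv2) Y =
    ((fine p)%:E * (P \x P)%E (uv2 @^-1` Y))%E by [].
have E X : measurable X -> pushm (mrestr P mF) muv X =
    mscale (NngNum fp0) (pushm (P \x P)%E muv2) X.
  apply: prod_measure_ext.
    rewrite /= /pushforward preimage_setT /mrestr setTI.
    by rewrite (le_lt_trans (probability_le1 P mF))// ltry.
  move=> B1 B2 mB1 mB2; transitivity ((fine p)%:E * (P \x P)%E (uv2 @^-1` (B1 `*` B2)))%E; last by [].
  rewrite /= /pushforward /mrestr.
  have -> : uv @^-1` (B1 `*` B2) = psum Z k @^-1` B1 `&` Z k @^-1` B2 by [].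
  have -> : uv2 @^-1` (B1 `*` B2) = (psum Z k @^-1` B1) `*` (Z k @^-1` B2) by [].
  rewrite product_measure1E; [|exact: mS|exact: mpre].
  rewrite fineK//.
  (* The constraint on [Z k] joins the event on the later variables, to which the induction
     hypothesis applies. *)
  pose A' j := if j == k then B2 else A j.
  have mA' j : measurable (A' j) by rewrite /A'; case: ifP.
  have -> : psum Z k @^-1` B1 `&` Z k @^-1` B2 `&` future Z A n k.+1 =
    psum Z k @^-1` B1 `&` future Z A' n k.
    rewrite -setIA; congr (_ `&` _); apply/seteqP; split => w.
      move=> [wk wf] j /= kj; rewrite /A'; case: eqP => [->//|/eqP jk].
      by apply: wf; rewrite /= ltn_neqAle eq_sym jk.
    move=> wf; split.
      by have := wf k; rewrite /A' /= eqxx; apply; rewrite leqnn.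
    move=> j /= /andP[kj jn]; have := wf j; rewrite /A' /= gtn_eqF//.
    by apply; rewrite (ltnW kj).
  rewrite ih//; last exact: ltnW.
  have A'k : A' k = B2 by rewrite /A' eqxx.
  rewrite big_ltn// A'k.
  rewrite (eq_big_nat _ _ (F2 := fun j => P (Z j @^-1` A j))); last first.
    by move=> j /andP[kj _]; rewrite /A' gtn_eqF.
  by rewrite -/p muleA muleC.
pose X := [set z : R * R | C (z.1 + z.2)].
have mX : measurable X.
  rewrite -[X in measurable X]setTI.
  by apply: (@measurable_funD _ _ _ setT fst snd) => //; exact: measurable_fst.
have sE : psum Z k.+1 @^-1` C = uv @^-1` X.
  by apply/seteqP; split => w; rewrite /X /= /psum big_ord_recr.
have := E X mX; move=> /(@eq_trans _ _ _ _)/(_ (msE X)); rewrite /= /pushforward /mrestr -sE => ->.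
(* The unrestricted comparison turns the product law back into the law of [psum Z k.+1] under
   [P]. *)
have E1 : P (uv @^-1` X) = (P \x P)%E (uv2 @^-1` X).
  have : pushm P muv X = pushm (P \x P)%E muv2 X.
    apply: prod_measure_ext => //.
      by rewrite /= /pushforward preimage_setT probability_setT ltry.
    move=> B1 B2 mB1 mB2; rewrite /= /pushforward.
    have -> : uv2 @^-1` (B1 `*` B2) = (psum Z k @^-1` B1) `*` (Z k @^-1` B2) by [].
    rewrite product_measure1E; [|exact: mS|exact: mpre].
    pose A' j : set R := if j == k then B2 else setT.
    have mA' j : measurable (A' j) by rewrite /A'; case: ifP.
    have -> : uv @^-1` (B1 `*` B2) = psum Z k @^-1` B1 `&` future Z A' n k.
      apply/seteqP; split => w.
        move=> [/= w1 w2]; split => // j /= kj; rewrite /A'; case: eqP => [->//|_].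
        by [].
      move=> [/= w1 wf]; split => //=.
      by have := wf k; rewrite /A' /= eqxx; apply; rewrite leqnn.
    rewrite ih//; last exact: ltnW.
    have A'k : A' k = B2 by rewrite /A' eqxx.
    rewrite big_ltn// A'k.
    rewrite big_nat big1 ?mule1// => j /andP[kj _].
    by rewrite /A' gtn_eqF// preimage_setT probability_setT.
  by [].
by rewrite sE E1 fineK// muleC.
Qed.

Lemma psum_indep n Z k : (forall i, measurable_fun setT (Z i)) ->
  row_independent n Z -> (k < n)%N ->
  forall A B : set R, measurable A -> measurable B ->
  P (psum Z k @^-1` A `&` Z k @^-1` B) = (P (psum Z k @^-1` A) * P (Z k @^-1` B))%E.
Proof.
move=> mZ indZ kn A B mA mB.
pose A' j : set R := if j == k then B else setT.
have mA' j : measurable (A' j) by rewrite /A'; case: ifP.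
have := psum_future_indep mZ indZ (ltnW kn) mA mA'.
have A'k : A' k = B by rewrite /A' eqxx.
rewrite big_ltn// A'k.
rewrite big_nat big1 ?mule1; last first.
  by move=> j /andP[kj _]; rewrite /A' gtn_eqF// preimage_setT probability_setT.
move=> <-; congr (P (_ `&` _)); apply/seteqP; split => w.
  by move=> wB j _; rewrite /A'; case: eqP => [->|].
by move=> wf; have := wf k; rewrite /A' /= eqxx; apply; rewrite leqnn.
Qed.

End partial_sums.

(** * The Lindeberg replacement argument *)

Section smoothing.
Context (R : realType).
Local Notation mu := (@lebesgue_measure R).

(* [f], [f1], [f2] play the roles of a function and of its first two derivatives;
   no differentiability is required, so the class is stable under averaging. *)
Definition taylor3 (K : R) (f f1 f2 : R -> R) : Prop :=
  [/\ measurable_fun setT f, measurable_fun setT f1, measurable_fun setT f2,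
      (forall x, [/\ `|f x| <= K, `|f1 x| <= K & `|f2 x| <= K]) &
      forall x h, `|f (x + h) - f x - f1 x * h - f2 x * (h ^+ 2 / 2)| <= K * `|h| ^+ 3].

(** Convolution with the centered normal law of standard deviation [s]. Its iterates stand for the
    sums of Gaussian replacements, which are never built as random variables. *)
Definition gsmooth (s : R) (f : R -> R) (x : R) : R :=
  itg mu (fun y => f (x + s * y) * gpdf y).

Definition gpdf_m3 : R := itg mu (fun y : R => `|y| ^+ 3 * gpdf y).

Lemma intg_gpdf_m3 : intg mu (fun y : R => `|y| ^+ 3 * gpdf y).
Proof.
apply: (@intg_gpdf_poly _ _ 1).
  by apply: measurable_funX => //; exact: measurable_normr.
move=> y; rewrite mul1r ger0_norm ?exprn_ge0//.
have -> : y ^+ 4 = `|y| ^+ 4 by rewrite -[4%N]/(2 * 2)%N !exprM real_normK ?num_real.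
have := normr_ge0 y; set t := `|y|; move=> t0.
have [t1|/ltW t1] := leP t 1.
  have : t ^+ 3 <= 1 by rewrite exprn_ile1.
  by have := exprn_ge0 4 t0; lra.
have : t ^+ 3 <= t ^+ 4 by rewrite [leRHS]exprSr ler_peMr// exprn_ge0.
by lra.
Qed.

Lemma intg_gsmooth (s : R) (f : R -> R) (K x : R) : measurable_fun setT f -> (forall y, `|f y| <= K) ->
  intg mu (fun y => f (x + s * y) * gpdf y).
Proof.
move=> mf fK; apply: (@intg_gpdf_poly _ _ K).
  apply: measurableT_comp => //; apply: measurable_funD => //; exact: measurable_funM.
move=> y; apply: (le_trans (fK _)); rewrite ler_peMr//.
  exact: le_trans (fK 0).
by rewrite lerDl exprn_even_ge0.
Qed.

Lemma gsmooth_norm_le (s : R) (f : R -> R) (K : R) : measurable_fun setT f -> (forall y, `|f y| <= K) ->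
  forall x, `|gsmooth s f x| <= K.
Proof.
move=> mf fK x; have h := intg_gsmooth s x mf fK.
apply: (le_trans (itg_norm h)); rewrite -[leRHS]mulr1 -[X in _ <= _ * X](itg_gpdf R) -itgZ; last exact: intg_gpdf.
apply: le_itg; [exact: intg_norm|apply: intgZ; exact: intg_gpdf|].
by move=> y; rewrite normrM [X in _ * X]ger0_norm ?gpdf_ge0// ler_wpM2r ?gpdf_ge0.
Qed.

Lemma measurable_gsmooth (s : R) (f : R -> R) : measurable_fun setT f ->
  measurable_fun setT (gsmooth s f).
Proof.
move=> mf; apply: (@measurable_itg_l _ _ R _ R mu (fun x y => f (x + s * y) * gpdf y)).
apply: measurable_funM.
  apply: measurableT_comp => //; apply: measurable_funD => //.
  by apply: measurable_funM.
by apply: measurableT_comp => //; exact: measurable_gpdf.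
Qed.

(** The remainder bound holds at every base point with the same [K], hence survives averaging over
    Gaussian shifts. *)
Lemma taylor3_gsmooth K s f f1 f2 : taylor3 K f f1 f2 ->
  taylor3 K (gsmooth s f) (gsmooth s f1) (gsmooth s f2).
Proof.
move=> [mf mf1 mf2 b tay].
have b0 y : `|f y| <= K by have [] := b y.
have b1 y : `|f1 y| <= K by have [] := b y.
have b2 y : `|f2 y| <= K by have [] := b y.
split; [exact: measurable_gsmooth..| |].
  by move=> x; split; exact: gsmooth_norm_le.
move=> x h; rewrite /gsmooth.
have i0 := intg_gsmooth s (x + h) mf b0.
have i1 := intg_gsmooth s x mf b0.
have i2 := intgZr h (intg_gsmooth s x mf1 b1).
have i3 := intgZr (h ^+ 2 / 2) (intg_gsmooth s x mf2 b2).
rewrite -(itgZr _ (intg_gsmooth s x mf1 b1)) -(itgZr _ (intg_gsmooth s x mf2 b2)).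
rewrite -!itgB//; [|by do 2? apply: intgB..].
have i4 := intgB (intgB (intgB i0 i1) i2) i3.
apply: (le_trans (itg_norm i4)).
rewrite -[leRHS]mulr1 -[X in _ <= _ * X](itg_gpdf R) -itgZ; last exact: intg_gpdf.
apply: le_itg; [exact: intg_norm|apply: intgZ; exact: intg_gpdf|].
move=> y.
have -> : f (x + h + s * y) * gpdf y - f (x + s * y) * gpdf y - f1 (x + s * y) * gpdf y * h -
   f2 (x + s * y) * gpdf y * (h ^+ 2 / 2) = (f (x + s * y + h) - f (x + s * y) - f1 (x + s * y) * h - f2 (x + s * y) * (h ^+ 2 / 2)) * gpdf y.
  by rewrite (addrAC x h); ring.
by rewrite normrM [X in _ * X]ger0_norm ?gpdf_ge0// ler_wpM2r ?gpdf_ge0.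
Qed.

(** The zero mean removes the first-order term, and the unit variance leaves [s ^+ 2 / 2] in the
    second-order one. *)
Lemma gsmooth_taylor K s f f1 f2 x : 0 <= s -> taylor3 K f f1 f2 ->
  `|gsmooth s f x - f x - f2 x * (s ^+ 2 / 2)| <= K * (s ^+ 3 * gpdf_m3).
Proof.
move=> s0 [mf mf1 mf2 b tay].
have b0 y : `|f y| <= K by have [] := b y.
have i0 := intg_gsmooth s x mf b0.
have i1 := intgZ (f x) (intg_gpdf R).
have j1 : intg mu (fun y : R => y * gpdf y).
  apply: (@intg_gpdf_poly _ id 1) => // y; rewrite mul1r.
  have := sqr_ge0 (y ^+ 2 - 2^-1); have := sqr_ge0 (y - 2^-1); have := sqr_ge0 (y + 2^-1).
  by move=> ? ? ?; rewrite ler_norml; apply/andP; split; nra.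
have j2 : intg mu (fun y : R => y ^+ 2 * gpdf y).
  apply: (@intg_gpdf_poly _ _ 1); first exact: measurable_funX.
  by move=> y; rewrite mul1r ger0_norm ?sqr_ge0//; nra.
have i2 := intgZ (f1 x * s) j1.
have i3 := intgZ (f2 x * (s ^+ 2 / 2)) j2.
have -> : gsmooth s f x - f x - f2 x * (s ^+ 2 / 2) = itg mu (fun y =>
    f (x + s * y) * gpdf y - f x * gpdf y - f1 x * s * (y * gpdf y) - f2 x * (s ^+ 2 / 2) * (y ^+ 2 * gpdf y)).
  rewrite itgB//; [|by do 2? apply: intgB].
  rewrite itgB//; [|exact: intgB].
  rewrite itgB// (itgZ _ (intg_gpdf R)) (itgZ _ j1) (itgZ _ j2).
  by rewrite itg_gpdf itg_gpdf1 itg_gpdf2 mulr0 subr0 !mulr1.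
have i4 := intgB (intgB (intgB i0 i1) i2) i3.
apply: (le_trans (itg_norm i4)).
rewrite [leRHS]mulrA -itgZ; last exact: intg_gpdf_m3.
apply: le_itg; [exact: intg_norm|apply: intgZ; exact: intg_gpdf_m3|].
move=> y.
have -> : f (x + s * y) * gpdf y - f x * gpdf y - f1 x * s * (y * gpdf y) - f2 x * (s ^+ 2 / 2) * (y ^+ 2 * gpdf y) =
  (f (x + s * y) - f x - f1 x * (s * y) - f2 x * ((s * y) ^+ 2 / 2)) * gpdf y by ring.
rewrite normrM [X in _ * X]ger0_norm ?gpdf_ge0// [leRHS]mulrA ler_wpM2r ?gpdf_ge0//.
by apply: (le_trans (tay _ _)); rewrite normrM (ger0_norm s0) exprMn mulrA.
Qed.

(** Variances add under convolution of normal laws. The sign condition on [f] is for Tonelli's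
    theorem. *)
Lemma gsmooth_gsmooth (f : R -> R) (K al be ga : R) : 0 < al -> 0 < ga -> al ^+ 2 + be ^+ 2 = ga ^+ 2 ->
  continuous f -> (forall x, 0 <= f x <= K) ->
  gsmooth be (gsmooth al f) = gsmooth ga f.
Proof.
move=> a0 g0 abc cf fK; apply/funext => x.
have f0 y : 0 <= f y by have /andP[] := fK y.
have fK' y : `|f y| <= K by rewrite ger0_norm//; have /andP[] := fK y.
have mf : measurable_fun setT f by exact: continuous_measurable_fun.
have mg := measurable_gsmooth al mf.
have gK := gsmooth_norm_le al mf fK'.
congr fine; rewrite -(gauss_convolution x a0 g0 abc cf f0).
apply: eq_integral => z _; rewrite /gsmooth.
have h := intg_gsmooth al (x + be * z) mf fK'.
rewrite -(itgZr _ h) EFin_itg; last exact: intgZr.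
by apply: eq_integral => y _; rewrite (addrAC x).
Qed.

End smoothing.

Section lindeberg.
Context d (T : measurableType d) (R : realType) (P : probability T R).

(** The counterpart of [gsmooth_taylor] for a summand: with mean 0 and the same variance, the two
    expansions agree through second order and differ by third moments only. *)
Lemma itg_taylor (Z : T -> R) (K M v : R) f f1 f2 x : taylor3 K f f1 f2 ->
  measurable_fun setT Z -> intg P (fun w => `|Z w| ^+ 3) -> intg P (fun w => Z w ^+ 2) ->
  intg P Z -> itg P Z = 0 -> itg P (fun w => Z w ^+ 2) = v ->
  itg P (fun w => `|Z w| ^+ 3) <= M ->
  `|itg P (fun w => f (x + Z w)) - f x - f2 x * (v / 2)| <= K * M.
Proof.
move=> [mf mf1 mf2 b tay] mZ j3 j2 j1 Z0 Zv ZM.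
have K0 : 0 <= K by have [h _ _] := b 0; exact: le_trans h.
have i0 : intg P (fun w => f (x + Z w)).
  apply: (@intg_bounded _ _ _ _ _ K); last by move=> w; have [] := b (x + Z w).
  by apply: measurableT_comp => //; exact: measurable_funD.
have i1 : intg P (fun=> f x) by exact: intg_cst.
have i2 := intgZ (f1 x) j1.
have i3 := intgZ (f2 x / 2) j2.
have -> : itg P (fun w => f (x + Z w)) - f x - f2 x * (v / 2) = itg P (fun w =>
    f (x + Z w) - f x - f1 x * Z w - f2 x / 2 * Z w ^+ 2).
  rewrite itgB//; [|by do 2? apply: intgB].
  rewrite itgB//; [|exact: intgB].
  rewrite itgB// itg_cst (itgZ _ j1) (itgZ _ j2) Z0 Zv mulr0 subr0.
  by congr (_ - _); rewrite mulrA mulrAC.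
have i4 := intgB (intgB (intgB i0 i1) i2) i3.
apply: (le_trans (itg_norm i4)).
apply: (@le_trans _ _ (K * itg P (fun w => `|Z w| ^+ 3))); last exact: ler_wpM2l.
rewrite -itgZ//; apply: le_itg; [exact: intg_norm|exact: intgZ|].
move=> w; have := tay x (Z w); congr (`| _ - _ | <= _); by ring.
Qed.

(** The intermediate quantity keeps the first [k] summands and has the other [n - k] replaced by
    Gaussian ones, integrated out by iterating [gsmooth]. Raising [k] by one restores one summand,
    at the cost of two third-order remainders. *)
Lemma lindeberg_swap n (Z : nat -> T -> R) (K M s : R) f f1 f2 :
  0 <= s -> taylor3 K f f1 f2 -> (forall i, measurable_fun setT (Z i)) ->
  row_independent P n Z ->
  (forall i, (i < n)%N -> [/\ intg P (fun w => `|Z i w| ^+ 3), intg P (fun w => Z i w ^+ 2),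
      intg P (Z i) & [/\ itg P (Z i) = 0, itg P (fun w => Z i w ^+ 2) = s ^+ 2 &
      itg P (fun w => `|Z i w| ^+ 3) <= M]]) ->
  `|itg P (fun w => f (psum Z n w)) - iter n (gsmooth s) f 0| <=
  n%:R * (K * (M + s ^+ 3 * gpdf_m3 R)).
Proof.
move=> s0 tf mZ indZ hZ.
have tit k : exists f1' f2', taylor3 K (iter k (gsmooth s) f) f1' f2'.
  elim: k => [|k [g1 [g2 tg]]]; first by exists f1, f2.
  by exists (gsmooth s g1), (gsmooth s g2) => /=; exact: taylor3_gsmooth.
have bnd k : (measurable_fun setT (iter k (gsmooth s) f)) /\
   forall x, `|iter k (gsmooth s) f x| <= K.
  by have [g1 [g2 [? ? ? b _]]] := tit k; split => // x; have [] := b x.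
suff H k : (k <= n)%N -> `|itg P (fun w => iter (n - k) (gsmooth s) f (psum Z k w)) -
    iter n (gsmooth s) f 0| <= k%:R * (K * (M + s ^+ 3 * gpdf_m3 R)).
  by have := H n (leqnn n); rewrite subnn.
elim: k => [_|k ih kn].
  rewrite subn0 mul0r; have -> : (fun w => iter n (gsmooth s) f (psum Z 0 w)) = fun=> iter n (gsmooth s) f 0.
    by apply/funext => w; rewrite /psum big_ord0.
  by rewrite itg_cst subrr normr0.
have := ih (ltnW kn); set E1 := itg P _ => ihk.
set E2 := itg P _; set I := iter n _ _ _ in ihk *.
set u := iter (n - k.+1) (gsmooth s) f in E2 *.
have uE : iter (n - k) (gsmooth s) f = gsmooth s u.
  by rewrite /u -iterS -subSn// subSS.
have [u1 [u2 tu]] := tit (n - k.+1)%N.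
have [mu_ uK] := bnd (n - k.+1)%N.
have [mgu guK] := bnd (n - k)%N.
have mS := measurable_psum k mZ.
have [z3 z2 z1 [ez1 ez2 ez3]] := hZ k kn.
have iu s' : intg P (fun w => u (s' + Z k w)).
  apply: (@intg_bounded _ _ _ _ _ K) => //.
  by apply: measurableT_comp => //; exact: measurable_funD.
have key s' : `|itg P (fun w => u (s' + Z k w)) - gsmooth s u s'| <= K * (M + s ^+ 3 * gpdf_m3 R).
  have a1 := itg_taylor s' tu (mZ k) z3 z2 z1 ez1 ez2 ez3.
  have a2 := gsmooth_taylor s' s0 tu.
  rewrite mulrDr.
  move: a1 a2; rewrite -/u !ler_norml => /andP[? ?] /andP[? ?]; apply/andP; split; lra.
have mF : measurable_fun setT (fun z : R * R => u (z.1 + z.2)).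
  by apply: measurableT_comp => //; exact: measurable_funD.
(* By independence [Z k] is integrated first, with [psum Z k] frozen; the pointwise comparison [key]
   then applies inside. *)
have iF : intg (P \x P)%E (fun z => u (psum Z k z.1 + Z k z.2)).
  apply: (@intg_prod12 _ _ _ _ _ _ _ (fun x y => u (psum Z k x + Z k y)) (fun=> K)).
  - by apply: measurableT_comp => //; apply: measurable_funD; exact: measurableT_comp.
  - by move=> x; exact: iu.
  - move=> x; apply: le_trans (ler_norm _) _; apply: itg_le_bound; first exact: intg_norm.
    by move=> y; rewrite normr_id.
  - exact: intg_cst.
have [iE EE] := @indep_integrable _ _ _ P _ _ _ _ (psum Z k) (Z k) (fun x y => u (x + y))
  mS (mZ k) (psum_indep mZ indZ kn) mF iF.
have E2E : E2 = itg P (fun w => itg P (fun w' => u (psum Z k w + Z k w'))).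
  rewrite -(itg_prod (f := fun x y => u (psum Z k x + Z k y)) iF) -?EE.
    by congr itg; apply/funext => w; rewrite /psum big_ord_recr.
  by move=> x; exact: iu.
have E12 : `|E2 - E1| <= K * (M + s ^+ 3 * gpdf_m3 R).
  have i1 : intg P (fun w => itg P (fun w' => u (psum Z k w + Z k w'))).
    by apply: (intg_prod_itg (f := fun x y => u (psum Z k x + Z k y)) iF) => x; exact: iu.
  have i2 : intg P (fun w => gsmooth s u (psum Z k w)).
    rewrite -uE; apply: (@intg_bounded _ _ _ _ _ K) => //.
    exact: measurableT_comp.
  rewrite E2E /E1 uE -itgB//; apply: itg_le_bound; first exact: intgB.
  by move=> w; exact: key.
rewrite -natr1 mulrDl mul1r.
have -> : E2 - I = (E1 - I) + (E2 - E1) by ring.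
by apply: (le_trans (ler_normD _ _)); exact: lerD.
Qed.

(** The variances [1 / n] of the [n] smoothings add up to 1. *)
Lemma iter_gsmooth n (f : R -> R) K : (0 < n)%N -> continuous f -> (forall x, 0 <= f x <= K) ->
  iter n (gsmooth (Num.sqrt n%:R^-1)) f = gsmooth 1 f.
Proof.
move=> n0 cf fK; set s := Num.sqrt n%:R^-1.
have nR : (0 : R) < n%:R by rewrite ltr0n.
have s0 : 0 < s by rewrite sqrtr_gt0 invr_gt0.
suff H k : iter k.+1 (gsmooth s) f = gsmooth (Num.sqrt (k.+1%:R / n%:R)) f.
  by case: n n0 nR @s s0 H => // n _ nR s s0 H; rewrite H divff ?gt_eqF// sqrtr1.
elim: k => [|k ih]; first by rewrite /= mul1r.
rewrite iterS ih; apply: (gsmooth_gsmooth (K := K)) => //.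
- by rewrite sqrtr_gt0 divr_gt0// ltr0n.
- by rewrite sqrtr_gt0 divr_gt0// ltr0n.
- rewrite !sqr_sqrtr ?divr_ge0 ?invr_ge0 ?ler0n//.
  by rewrite -[in RHS]natr1 mulrDl mul1r.
Qed.

End lindeberg.

(** * A central limit theorem for triangular arrays *)

Section spline.
Context (R : realType).
Local Notation mu := (@lebesgue_measure R).

Let p (x : R) : R := Num.max x 0.

(** The positive-part cube is a polynomial on each side of 0, with matching derivatives up to order
    two. Without a sign change the remainder is 0 or [h ^+ 3]; with one it lies between these two
    values. *)
Lemma pos_cube_taylor (x h : R) :
  `|p (x + h) ^+ 3 - p x ^+ 3 - 3 * p x ^+ 2 * h - 3 * p x * h ^+ 2| <= `|h| ^+ 3.
Proof.
rewrite /p; have [x0|x0] := leP x 0; have [y0|y0] := leP (x + h) 0.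
- by rewrite !expr0n/= !(mulr0, mul0r, subr0) normr0 exprn_ge0.
- rewrite !expr0n/= !(mulr0, mul0r, subr0) ger0_norm; last by rewrite exprn_ge0// ltW.
  have h0 : 0 <= h by lra.
  by rewrite ger0_norm//; apply: lerXn2r; rewrite ?nnegrE; lra.
- have h0 : h < 0 by lra.
  rewrite (ltr0_norm h0) expr0n/= ler_norml; apply/andP; split.
    have -> : - (- h) ^+ 3 = h ^+ 3 by ring.
    have : 0 <= (- (x + h)) ^+ 3 by rewrite exprn_ge0//; lra.
    have -> : 0 - x ^+ 3 - 3 * x ^+ 2 * h - 3 * x * h ^+ 2 = h ^+ 3 + (- (x + h)) ^+ 3 by ring.
    by lra.
  have : (- (x + h)) ^+ 3 <= (- h) ^+ 3 by rewrite lerXn2r ?nnegrE//; lra.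
  have : 0 <= (- h) ^+ 3 by rewrite exprn_ge0//; lra.
  have -> : 0 - x ^+ 3 - 3 * x ^+ 2 * h - 3 * x * h ^+ 2 = (- (x + h)) ^+ 3 - (- h) ^+ 3 by ring.
  by lra.
- have -> : (x + h) ^+ 3 - x ^+ 3 - 3 * x ^+ 2 * h - 3 * x * h ^+ 2 = h ^+ 3 by ring.
  by rewrite normrX.
Qed.

(* One minus the integrated cubic B-spline: a twice differentiable decreasing step
   from 1 on the nonpositive reals to 0 beyond 3. *)
Definition spl (x : R) : R :=
  1 - (p x ^+ 3 - 3 * p (x - 1) ^+ 3 + 3 * p (x - 2) ^+ 3 - p (x - 3) ^+ 3) / 6.
Definition spl1 (x : R) : R :=
  - (p x ^+ 2 - 3 * p (x - 1) ^+ 2 + 3 * p (x - 2) ^+ 2 - p (x - 3) ^+ 2) / 2.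
Definition spl2 (x : R) : R :=
  - (p x - 3 * p (x - 1) + 3 * p (x - 2) - p (x - 3)).

Lemma spl_le0 x : x <= 0 -> spl x = 1.
Proof.
move=> x0; rewrite /spl /p !max_r; [|lra..].
by rewrite expr0n/=; field.
Qed.

Lemma spl_ge3 x : 3 <= x -> spl x = 0.
Proof. by move=> x0; rewrite /spl /p !max_l; [field|lra..]. Qed.

(** The cells between the knots 0, 1, 2, 3: on each of them the four positive parts are 0 or affine,
    so [spl] is a polynomial. *)
Let p_bounds (x : R) :
  [\/ x <= 0 /\ [/\ p x = 0, p (x - 1) = 0, p (x - 2) = 0 & p (x - 3) = 0],
      0 <= x <= 1 /\ [/\ p x = x, p (x - 1) = 0, p (x - 2) = 0 & p (x - 3) = 0],
      1 <= x <= 2 /\ [/\ p x = x, p (x - 1) = x - 1, p (x - 2) = 0 & p (x - 3) = 0] |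
      2 <= x <= 3 /\ [/\ p x = x, p (x - 1) = x - 1, p (x - 2) = x - 2 & p (x - 3) = 0]] \/
      (3 <= x /\ [/\ p x = x, p (x - 1) = x - 1, p (x - 2) = x - 2 & p (x - 3) = x - 3]).
Proof.
have mr (u : R) : u <= 0 -> Num.max u 0 = 0 by exact: max_r.
have ml (u : R) : 0 <= u -> Num.max u 0 = u by exact: max_l.
rewrite /p; have /orP[x0|x0] := le_total x 0.
  by left; constructor 1; split; [lra|split; first [apply: mr; lra|apply: ml; lra]].
have /orP[x1|x1] := le_total x 1.
  by left; constructor 2; split; [lra|split; first [apply: mr; lra|apply: ml; lra]].
have /orP[x2|x2] := le_total x 2.
  by left; constructor 3; split; [lra|split; first [apply: mr; lra|apply: ml; lra]].
have /orP[x3|x3] := le_total x 3.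
  by left; constructor 4; split; [lra|split; first [apply: mr; lra|apply: ml; lra]].
by right; split; [lra|split; apply: ml; lra].
Qed.

Lemma spl01 x : 0 <= spl x <= 1.
Proof.
have [x0|/ltW x0] := leP x 0; first by rewrite spl_le0// ler01 lexx.
have [x3|/ltW x3] := leP 3 x; first by rewrite spl_ge3// ler01 lexx.
have := p_bounds x; rewrite /spl => -[[[xx [-> -> -> ->]]|[xx [-> -> -> ->]]|[xx [-> -> -> ->]]|[xx [-> -> -> ->]]]|[xx [-> -> -> ->]]].
- by apply/andP; split; nra.
- have : 0 <= x ^+ 3 <= 1 by rewrite exprn_ge0 ?exprn_ile1; lra.
  by move=> /andP[? ?]; apply/andP; split; lra.
(* Nonnegative products of [u] and [1 - u], with [u] in [0, 1], certify both bounds. *)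
- set u := x - 1; have -> : x = u + 1 by rewrite /u; ring.
  have u0 : 0 <= u by rewrite /u; lra.
  have u1 : 0 <= 1 - u by rewrite /u; lra.
  have u2 := mulr_ge0 u0 u1.
  have u3 := mulr_ge0 u2 u0; have u4 := mulr_ge0 u3 u0; have u5 := mulr_ge0 u2 u1.
  by apply/andP; split; nra.
- have -> : 1 - (x ^+ 3 - 3 * (x - 1) ^+ 3 + 3 * (x - 2) ^+ 3 - 0 ^+ 3) / 6 = (3 - x) ^+ 3 / 6.
    by field.
  have : 0 <= (3 - x) ^+ 3 <= 1 by rewrite exprn_ge0 ?exprn_ile1; lra.
  by move=> /andP[? ?]; apply/andP; split; lra.
- by apply/andP; split; nra.
Qed.

Lemma spl_bounds x : [/\ `|spl x| <= 6, `|spl1 x| <= 6 & `|spl2 x| <= 6].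
Proof.
split.
- by rewrite ger0_norm; have /andP[] := spl01 x => ? ?; lra.
- have := p_bounds x; rewrite /spl1 => -[[[xx [-> -> -> ->]]|[xx [-> -> -> ->]]|[xx [-> -> -> ->]]|[xx [-> -> -> ->]]]|[xx [-> -> -> ->]]];
    rewrite ler_norml; apply/andP; split; nra.
- have := p_bounds x; rewrite /spl2 => -[[[xx [-> -> -> ->]]|[xx [-> -> -> ->]]|[xx [-> -> -> ->]]|[xx [-> -> -> ->]]]|[xx [-> -> -> ->]]];
    rewrite ler_norml; apply/andP; split; lra.
Qed.

Let continuous_p : continuous p.
Proof.
move=> x; apply: (@continuous_max _ _ id (fun=> 0)); [exact: cvg_id|exact: cvg_cst].
Qed.

Let continuous_pX k c : continuous (fun x => p (x - c) ^+ k).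
Proof.
move=> x; apply: (@cvg_comp _ _ _ (fun x => p (x - c)) (fun y => y ^+ k) _ (nbhs (p (x - c)))).
  apply: (@cvg_comp _ _ _ (fun x => x - c) p _ (nbhs (x - c))); last exact: continuous_p.
  by apply: (@cvgB _ R^o); [exact: cvg_id|exact: cvg_cst].
exact: exprn_continuous.
Qed.

Let continuous_comb k : continuous (fun x =>
  p x ^+ k - 3 * p (x - 1) ^+ k + 3 * p (x - 2) ^+ k - p (x - 3) ^+ k).
Proof.
have c0 : continuous (fun x => p x ^+ k).
  by have := @continuous_pX k 0; under eq_fun do rewrite subr0.
move=> x; apply: (@cvgB _ R^o); last exact: continuous_pX.
apply: (@cvgD _ R^o); last by apply: cvgM; [exact: cvg_cst|exact: continuous_pX].
apply: (@cvgB _ R^o); first exact: c0.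
by apply: cvgM; [exact: cvg_cst|exact: continuous_pX].
Qed.

Lemma continuous_spl : continuous spl.
Proof.
move=> x; apply: (@cvgB _ R^o); first exact: cvg_cst.
by apply: cvgM; [exact: continuous_comb|exact: cvg_cst].
Qed.

Lemma spl_taylor3 : taylor3 6 spl spl1 spl2.
Proof.
split.
- by apply: continuous_measurable_fun; exact: continuous_spl.
- apply: continuous_measurable_fun => x.
  apply: cvgM; last exact: cvg_cst.
  by apply: (@cvgN _ R^o); exact: continuous_comb.
- apply: continuous_measurable_fun => x.
  apply: (@cvgN _ R^o).
  exact: (continuous_comb (k := 1)).
- exact: spl_bounds.
- move=> x h; rewrite /spl /spl1 /spl2.
  have t0 := pos_cube_taylor x h; have t1 := pos_cube_taylor (x - 1) h.
  have t2 := pos_cube_taylor (x - 2) h; have t3 := pos_cube_taylor (x - 3) h.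
  have h3 : 0 <= `|h| ^+ 3 by rewrite exprn_ge0.
  rewrite !(addrAC x h); move: t0 t1 t2 t3; rewrite !ler_norml.
  by move=> /andP[? ?] /andP[? ?] /andP[? ?] /andP[? ?]; apply/andP; split; nra.
Qed.

(** Equal to 1 up to [x] and to 0 beyond [x + 3 * del], hence between the indicators of two
    half-lines. *)
Definition step (x del y : R) : R := spl ((y - x) / del).

Lemma step_taylor3 x del : 0 < del ->
  exists K f1 f2, taylor3 K (step x del) f1 f2.
Proof.
move=> d0; have [m0 m1 m2 b tay] := spl_taylor3.
set e := del^-1; have e0 : 0 <= e by rewrite invr_ge0 ltW.
have mc : measurable_fun setT (fun y : R => (y - x) / del).
  by apply: measurable_funM => //; apply: measurable_funB.
exists (6 * (1 + e) ^+ 3), (fun y => spl1 ((y - x) / del) * e), (fun y => spl2 ((y - x) / del) * e ^+ 2).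
have E1 : 1 <= (1 + e) ^+ 3 by rewrite exprn_ege1// lerDl.
have E2 : e <= (1 + e) ^+ 3.
  by apply: (@le_trans _ _ (1 + e)); [rewrite lerDr|rewrite exprS ler_peMr ?addr_ge0// exprn_ege1// lerDl].
have E3 : e ^+ 2 <= (1 + e) ^+ 3.
  apply: (@le_trans _ _ ((1 + e) ^+ 2)); first by rewrite lerXn2r ?nnegrE ?addr_ge0// lerDr.
  by rewrite [leRHS]exprSr ler_peMr ?exprn_ge0 ?addr_ge0// lerDl.
have E4 : e ^+ 3 <= (1 + e) ^+ 3 by rewrite lerXn2r ?nnegrE ?addr_ge0// lerDr.
split.
- exact: measurableT_comp.
- by apply: measurable_funM => //; exact: measurableT_comp.
- by apply: measurable_funM => //; exact: measurableT_comp.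
- move=> y; have [b0 b1 b2] := b ((y - x) / del); split.
  + by apply: (le_trans b0); rewrite ler_peMr.
  + by rewrite normrM (ger0_norm e0); apply: ler_pM.
  + by rewrite normrM (ger0_norm (exprn_ge0 2 e0)); apply: ler_pM => //; exact: exprn_ge0.
- move=> y h; rewrite /step.
  have -> : (y + h - x) / del = (y - x) / del + h * e by rewrite -/e; ring.
  have := tay ((y - x) / del) (h * e).
  have -> : spl1 ((y - x) / del) * (h * e) = spl1 ((y - x) / del) * e * h by ring.
  have -> : spl2 ((y - x) / del) * ((h * e) ^+ 2 / 2) = spl2 ((y - x) / del) * e ^+ 2 * (h ^+ 2 / 2) by field.
  move=> H; apply: (le_trans H); rewrite normrM (ger0_norm e0) exprMn.
  have -> : 6 * (1 + e) ^+ 3 * `|h| ^+ 3 = 6 * (`|h| ^+ 3 * (1 + e) ^+ 3) by ring.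
  by rewrite ler_wpM2l// ler_wpM2l ?exprn_ge0.
Qed.

Lemma continuous_step x del : continuous (step x del).
Proof.
move=> y; apply: (@cvg_comp _ _ _ (fun y => (y - x) / del) spl _ (nbhs ((y - x) / del))).
  apply: cvgM; last exact: cvg_cst.
  by apply: (@cvgB _ R^o); [exact: cvg_id|exact: cvg_cst].
exact: continuous_spl.
Qed.

Lemma step_ge x del y : 0 < del -> \1_(`]-oo, x]) y <= step x del y.
Proof.
move=> d0; rewrite indicE /step; have /andP[s0 _] := spl01 ((y - x) / del).
case: (boolP (y \in _)) => // /[!inE] /=; rewrite in_itv/= => yx.
by rewrite spl_le0// pmulr_lle0 ?invr_gt0// subr_le0.
Qed.

Lemma step_le x del y : 0 < del -> step x del y <= \1_(`]-oo, x + 3 * del]) y.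
Proof.
move=> d0; rewrite indicE /step; have /andP[_ s1] := spl01 ((y - x) / del).
case: (boolP (y \in _)) => // /negP; rewrite inE /= in_itv/= => /negP; rewrite -ltNge => h.
by rewrite spl_ge3// ler_pdivlMr//; lra.
Qed.

Definition Phi (x : R) : R := itg mu (fun y => \1_(`]-oo, x]) y * gpdf y).

Lemma intg_Phi x : intg mu (fun y => \1_(`]-oo, x]) y * gpdf y).
Proof.
apply: (@intg_gpdf_poly _ _ 1); first exact: measurable_indic.
move=> y; rewrite mul1r ger0_norm//; apply: (@le_trans _ _ 1).
  by rewrite indicE; case: (_ \in _).
by rewrite lerDl exprn_even_ge0.
Qed.

Lemma PhiE x : normal_prob (0 : R) 1 `]-oo, x] = (Phi x)%:E.
Proof.
rewrite /Phi (EFin_itg (intg_Phi x)) /normal_prob [LHS]integral_mkcond.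
apply: eq_integral => y _; rewrite patchE /gpdf indicE.
by case: (y \in _); rewrite ?mul1r ?mul0r.
Qed.

(** The density is bounded by its peak. *)
Lemma Phi_lipschitz x y : x <= y -> Phi y <= Phi x + normal_peak 1 * (y - x).
Proof.
move=> xy; rewrite -lerBlDl /Phi -itgB; [|exact: intg_Phi..].
have ii : intg mu (\1_(`]x, y] : set R)) by exact: integrable_indic_itv.
have -> : y - x = itg mu (\1_(`]x, y] : set R)).
  transitivity (fine (mu (`]x, y] : set R))).
    by rewrite lebesgue_measure_itv/= lte_fin; case: ltgtP xy => // -> _; rewrite subrr.
  by congr fine; rewrite integral_indic// setIT.
rewrite -itgZ//; apply: le_itg; [apply: intgB; exact: intg_Phi|exact: intgZ|].
move=> t; rewrite -mulrBl [leRHS]mulrC.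
have -> : \1_(`]-oo, y]) t - \1_(`]-oo, x]) t = \1_(`]x, y]) t :> R.
  rewrite !indicE !mem_setE !in_itv/=; case: (ltP x t) => xt /=; first by rewrite subr0.
  by rewrite (le_trans xt xy) subrr.
by rewrite ler_wpM2l//; apply: normal_pdf_ub; rewrite oner_eq0.
Qed.

Lemma gsmooth_step x del : 0 < del ->
  Phi x <= gsmooth 1 (step x del) 0 <= Phi (x + 3 * del).
Proof.
move=> d0; have [K [f1 [f2 [mf _ _ b _]]]] := step_taylor3 x d0.
have i := intg_gsmooth 1 0 mf (fun y => let: And3 h _ _ := b y in h).
rewrite /gsmooth; apply/andP; split; apply: le_itg => //; try exact: intg_Phi;
  move=> y; rewrite add0r mul1r ler_wpM2r ?gpdf_ge0//; [exact: step_ge|exact: step_le].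
Qed.

End spline.

(** * The limit theorem and its stability under negligible errors *)

Section clt.
Context d (T : measurableType d) (R : realType) (P : probability T R).

Definition small_in_prob (U : nat -> T -> R) : Prop :=
  forall e eta : R, 0 < e -> 0 < eta -> \forall n \near \oo,
    exists A, [/\ measurable A, (P A <= eta%:E)%E & [set w | e < `|U n w|] `<=` A].

Lemma measurable_le (S : T -> R) x : measurable_fun setT S -> measurable [set w | S w <= x].
Proof.
move=> mS; rewrite -[X in measurable X]setTI.
have -> : [set w | S w <= x] = S @^-1` `]-oo, x] by apply/seteqP; split => w /=; rewrite in_itv.
exact: mS.
Qed.

Lemma fine_le_itg (S : T -> R) (x : R) (f : R -> R) (K : R) : measurable_fun setT S ->
  measurable_fun setT f -> (forall y, `|f y| <= K) -> (forall y, \1_(`]-oo, x]) y <= f y) ->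
  fine (P [set w | S w <= x]) <= itg P (f \o S).
Proof.
move=> mS mf fK h.
have -> : fine (P [set w | S w <= x]) = itg P (\1_[set w | S w <= x]).
  by rewrite /itg /Rintegral integral_indic// ?setIT//; exact: measurable_le.
apply: le_itg.
- by apply: integrable_indic; exact: measurable_le.
- apply: (@intg_bounded _ _ _ _ _ K); first exact: measurableT_comp mf mS.
  by move=> w; exact: fK.
- move=> w; apply: le_trans (h (S w)); rewrite !indicE.
  by rewrite le_eqVlt; apply/orP; left; apply/eqP; congr (nat_of_bool _)%:R;
    apply/idP/idP; rewrite !inE/= in_itv.
Qed.

Lemma itg_le_fine (S : T -> R) (x : R) (f : R -> R) (K : R) : measurable_fun setT S ->
  measurable_fun setT f -> (forall y, `|f y| <= K) -> (forall y, f y <= \1_(`]-oo, x]) y) ->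
  itg P (f \o S) <= fine (P [set w | S w <= x]).
Proof.
move=> mS mf fK h.
have -> : fine (P [set w | S w <= x]) = itg P (\1_[set w | S w <= x]).
  by rewrite /itg /Rintegral integral_indic// ?setIT//; exact: measurable_le.
apply: le_itg.
- apply: (@intg_bounded _ _ _ _ _ K); first exact: measurableT_comp mf mS.
  by move=> w; exact: fK.
- by apply: integrable_indic; exact: measurable_le.
- move=> w; apply: le_trans (h (S w)) _; rewrite !indicE.
  by rewrite le_eqVlt; apply/orP; left; apply/eqP; congr (nat_of_bool _)%:R;
    apply/idP/idP; rewrite !inE/= in_itv.
Qed.

Lemma cvg_sqrt_invn : Num.sqrt (n%:R^-1 : R) @[n --> \oo] --> (0 : R).
Proof.
rewrite -sqrtr0; apply: (@cvg_comp _ _ _ (fun n => n%:R^-1 : R) Num.sqrt _ (nbhs (0 : R))).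
  by apply/gtr0_cvgV0; [near=> n; rewrite ltr0n; near: n; exact: nbhs_infty_gt|exact: cvgr_idn].
exact: sqrt_continuous.
Unshelve. all: by end_near. Qed.

Variables (Z : nat -> nat -> T -> R) (C : R).
Hypothesis mZ : forall n i, measurable_fun setT (Z n i).
Hypothesis rowZ : \forall n \near \oo, row_independent P n (Z n).
Hypothesis momZ : \forall n \near \oo, forall i, (i < n)%N ->
  [/\ intg P (fun w => `|Z n i w| ^+ 3), intg P (fun w => Z n i w ^+ 2),
      intg P (Z n i) & [/\ itg P (Z n i) = 0, itg P (fun w => Z n i w ^+ 2) = n%:R^-1 &
      itg P (fun w => `|Z n i w| ^+ 3) <= C * Num.sqrt n%:R^-1 ^+ 3]].

(** Each of the [n] replacements costs a multiple of n^(-3/2), in total a multiple of n^(-1/2); the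
    [n] Gaussian smoothings amount to one of variance 1. *)
Lemma clt_step (x del : R) : 0 < del ->
  itg P (step x del \o psum (Z n) n) @[n --> \oo] --> gsmooth 1 (step x del) 0.
Proof.
move=> d0; have [K [f1 [f2 tf]]] := step_taylor3 x d0.
apply/cvgrPdist_le => e e0.
have cs : Num.sqrt (n%:R^-1 : R) * (K * (C + gpdf_m3 R)) @[n --> \oo] --> (0 : R).
  rewrite -(mul0r (K * (C + gpdf_m3 R))); apply: cvgM; [exact: cvg_sqrt_invn|exact: cvg_cst].
move/cvgrPdist_le : cs => /(_ e e0) cs.
near=> n.
have n0 : (0 < n)%N by near: n; exact: nbhs_infty_gt.
have nR : (0 : R) < n%:R by rewrite ltr0n.
set s := Num.sqrt (n%:R^-1 : R).
have s0 : 0 <= s by exact: sqrtr_ge0.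
have s2 : s ^+ 2 = n%:R^-1 by rewrite sqr_sqrtr// invr_ge0 ltW.
have H1 : row_independent P n (Z n) by near: n.
have H2 : forall i, (i < n)%N ->
  [/\ intg P (fun w => `|Z n i w| ^+ 3), intg P (fun w => Z n i w ^+ 2),
      intg P (Z n i) & [/\ itg P (Z n i) = 0, itg P (fun w => Z n i w ^+ 2) = s ^+ 2 &
      itg P (fun w => `|Z n i w| ^+ 3) <= C * s ^+ 3]].
  by rewrite s2 /s; near: n.
have := lindeberg_swap s0 tf (mZ n) H1 H2.
rewrite (@iter_gsmooth _ n _ 1 n0 (@continuous_step R x del)); last by move=> y; exact: spl01.
rewrite distrC => /le_trans; apply.
have -> : n%:R * (K * (C * s ^+ 3 + s ^+ 3 * gpdf_m3 R)) = n%:R * s ^+ 2 * (s * (K * (C + gpdf_m3 R))) by ring.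
rewrite s2 divff ?gt_eqF// mul1r.
have : `|0 - s * (K * (C + gpdf_m3 R))| <= e by rewrite /s; near: n.
by rewrite sub0r normrN; apply: le_trans; exact: ler_norm.
Unshelve. all: by end_near. Qed.

Lemma step_norm_le (x del y : R) : `|step x del y| <= 1.
Proof. by have /andP[? ?] := spl01 ((y - x) / del); rewrite ger0_norm. Qed.

(** The distribution function of [U n] at [x] is enclosed between those of the partial sum at
    [x - del] and [x + del], up to [P A], and these between expectations of smooth steps. Each side
    loses at most [e / 4] three times: from [P A], from the convergence for the step, and from the
    variation of [Phi] over a length [4 * del]. *)
Lemma clt_slutsky (U : nat -> T -> R) :
  (forall n, measurable_fun setT (U n)) ->
  small_in_prob (fun n w => U n w - psum (Z n) n w) -> cvg_std_normal P U.
Proof.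
move=> mU sU x; rewrite PhiE.
have mS n : measurable_fun setT (psum (Z n) n) by exact: measurable_psum.
pose p n y := fine (P [set w | psum (Z n) n w <= y]).
suff cu : fine (P [set w | U n w <= x]) @[n --> \oo] --> Phi x.
  rewrite (_ : (fun n => _) = EFin \o (fun n => fine (P [set w | U n w <= x]))).
    by apply: cvg_EFin; [exact: nearW|exact: cu].
  apply/funext => n /=; rewrite fineK//; apply: fin_num_measure; exact: measurable_le.
apply/cvgrPdist_le => e e0.
set K := normal_peak (1 : R).
have K0 : 0 < K by rewrite normal_peak_gt0// oner_eq0.
(* Makes the bound [K * (4 * del)] on the variation of [Phi] equal to [e / 4]. *)
pose del := e / (16 * K).
have d0 : 0 < del by rewrite divr_gt0// mulr_gt0.
have dK : K * del = e / 16 by rewrite /del; field; rewrite gt_eqF.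
have e4 : 0 < e / 4 by rewrite divr_gt0.
have step_m y : measurable_fun setT (step y del).
  by apply: continuous_measurable_fun; exact: continuous_step.
have c1 := @clt_step (x + del) del d0.
have c2 := @clt_step (x - del - 3 * del) del d0.
move/cvgrPdist_le : c1 => /(_ _ e4) c1.
move/cvgrPdist_le : c2 => /(_ _ e4) c2.
near=> n.
have [A [mA PA hA]] : exists A, [/\ measurable A, (P A <= (e / 4)%:E)%E &
   [set w | del < `|U n w - psum (Z n) n w|] `<=` A].
  by near: n; exact: sU.
have PfinE B : measurable B -> (fine (P B))%:E = P B.
  by move=> mB; rewrite fineK//; exact: fin_num_measure.
have PAr : fine (P A) <= e / 4 by rewrite -lee_fin PfinE.
have upU : fine (P [set w | U n w <= x]) <= p n (x + del) + e / 4.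
  apply: (@le_trans _ _ (p n (x + del) + fine (P A))); last by rewrite lerD2l.
  rewrite -lee_fin EFinD /p !PfinE//; [|exact: measurable_le..].
  apply: (@le_trans _ _ (P ([set w | psum (Z n) n w <= x + del] `|` A))); last first.
    by apply: measureU2 => //; exact: measurable_le.
  apply: le_measure; rewrite ?inE; [exact: measurable_le|by apply: measurableU => //; exact: measurable_le|].
  move=> w /= Uw; have [h|h] := leP (psum (Z n) n w) (x + del); first by left.
  right; apply: hA => /=; rewrite distrC ger0_norm; lra.
have loU : p n (x - del) - e / 4 <= fine (P [set w | U n w <= x]).
  rewrite lerBlDr; apply: (@le_trans _ _ (fine (P [set w | U n w <= x]) + fine (P A))); last by rewrite lerD2l.
  rewrite -lee_fin EFinD /p !PfinE//; [|exact: measurable_le..].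
  apply: (@le_trans _ _ (P ([set w | U n w <= x] `|` A))); last first.
    by apply: measureU2 => //; exact: measurable_le.
  apply: le_measure; rewrite ?inE; [exact: measurable_le|by apply: measurableU => //; exact: measurable_le|].
  move=> w /= Sw; have [h|h] := leP (U n w) x; first by left.
  right; apply: hA => /=; rewrite ger0_norm; lra.
have upS : p n (x + del) <= itg P (step (x + del) del \o psum (Z n) n).
  apply: (fine_le_itg (K := 1)) => //; first exact: step_norm_le.
  by move=> y; exact: step_ge.
have loS : itg P (step (x - del - 3 * del) del \o psum (Z n) n) <= p n (x - del).
  apply: (itg_le_fine (K := 1)) => //; first exact: step_norm_le.
  move=> y; have := step_le (x - del - 3 * del) y d0.
  by rewrite subrK.
have C1 : `|gsmooth 1 (step (x + del) del) 0 - itg P (step (x + del) del \o psum (Z n) n)| <= e / 4.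
  by near: n; exact: c1.
have C2 : `|gsmooth 1 (step (x - del - 3 * del) del) 0 - itg P (step (x - del - 3 * del) del \o psum (Z n) n)| <= e / 4.
  by near: n; exact: c2.
have /andP[_ G1] := gsmooth_step (x + del) d0.
have /andP[G2 _] := gsmooth_step (x - del - 3 * del) d0.
have L1 : Phi (x + del + 3 * del) <= Phi x + K * (x + del + 3 * del - x).
  by apply: Phi_lipschitz; lra.
have L2 : Phi x <= Phi (x - del - 3 * del) + K * (x - (x - del - 3 * del)).
  by apply: Phi_lipschitz; lra.
have E0 : 4 * (K * del) = e / 4 by rewrite dK; field.
have E1 : K * (x + del + 3 * del - x) = e / 4 by rewrite -E0; ring.
have E2 : K * (x - (x - del - 3 * del)) = e / 4 by rewrite -E0; ring.
move: C1 C2; rewrite !ler_norml => /andP[? ?] /andP[? ?].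
by apply/andP; split; lra.
Unshelve. all: by end_near. Qed.

End clt.

(** * Absolutely continuous functions *)

Section absolutely_continuous.
Context (R : realType).
Implicit Types (f F : R -> R) (s r : seq (R * R)).

Definition unit_pair (p : R * R) : bool := [&& 0 <= p.1, p.1 <= p.2 & p.2 <= 1].
Definition apart (p q : R * R) : bool := (p.2 <= q.1) || (q.2 <= p.1).

(** Families of intervals as lists of endpoint pairs are easier to concatenate and refine than
    families indexed by ordinals. *)
Definition nonoverlapping s : bool := all unit_pair s && pairwise apart s.
Definition total_length s : R := \sum_(p <- s) (p.2 - p.1).

Lemma absolutely_continuous_seq f : absolutely_continuous01 f ->
  forall e : R, 0 < e -> exists2 del : R, 0 < del &
    forall s, nonoverlapping s -> total_length s < del ->
      \sum_(p <- s) `|f p.2 - f p.1| <= e.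
Proof.
move=> acf e e0; have [del d0 h] := acf e e0; exists del => // s /andP[us ps] ls.
have := h (size s) (fun i => (nth (0, 0) s i).1) (fun i => (nth (0, 0) s i).2).
have sE (g : R * R -> R) : \sum_(i < size s) g (nth (0, 0) s i) = \sum_(p <- s) g p.
  by rewrite (big_nth (0, 0)) big_mkord.
rewrite (sE (fun p => p.2 - p.1)) (sE (fun p => `|f p.2 - f p.1|)) => H.
apply/ltW/H => //.
- by move=> i; have /(_ i (ltn_ord i))/and3P[? ? ?] := all_nthP (0, 0) us.
- move=> i j ij; have /pairwiseP pw := ps.
  have [lij|lji|/val_inj/eqP] := ltngtP i j; last by rewrite (negbTE ij).
    have /orP[] := pw (0, 0) i j (ltn_ord i) (ltn_ord j) lij; by [left|right].
  have /orP[] := pw (0, 0) j i (ltn_ord j) (ltn_ord i) lji; by [right|left].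
Qed.

Let pairs (a : R) (t : seq R) : seq (R * R) := zip (a :: t) t.

Let pairs_cons a x t : pairs a (x :: t) = (a, x) :: pairs x t. Proof. by []. Qed.

Let pairs_in a b t : itv_partition a b t ->
  all (fun p : R * R => [&& a <= p.1, p.1 <= p.2 & p.2 <= b]) (pairs a t).
Proof.
elim: t a => [//|x t ih a] H.
have ax : a <= x by case: H => /= /andP[/ltW].
have xt := itv_partition_cons H.
have xb := itv_partition_le xt.
rewrite pairs_cons /= lexx ax xb /=; apply: sub_all (ih _ xt).
by move=> p /and3P[xp -> ->]; rewrite (le_trans ax xp).
Qed.

Let pairs_apart a b t : itv_partition a b t -> pairwise apart (pairs a t).
Proof.
elim: t a => [//|x t ih a] H.
have xt := itv_partition_cons H.
rewrite pairs_cons /= (ih _ xt) andbT; apply: sub_all (pairs_in xt).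
by move=> p /and3P[xp _ _]; rewrite /apart /= xp.
Qed.

Let pairs_length a b t : itv_partition a b t -> total_length (pairs a t) = b - a.
Proof.
elim: t a => [a H|x t ih a H].
  by rewrite (itv_partition_nil H) /total_length /pairs /= big_nil subrr.
by rewrite /total_length pairs_cons big_cons /= -/(total_length _) (ih _ (itv_partition_cons H)); ring.
Qed.

Let variation_pairs f a b t : itv_partition a b t ->
  variation a b f t = \sum_(p <- pairs a t) `|f p.2 - f p.1|.
Proof.
move=> H; rewrite variation_zip// /pairs.
elim: t a {H} => [|x t ih] a; first by rewrite /= !big_nil.
by rewrite /= !big_cons /= ih.
Qed.

(** Replacing an interval by the cells of a partition keeps the total length, so the [del] of
    absolute continuity bounds the variation along all partitions at once, and then the suprema. *)
Lemma ac_total_variation f : absolutely_continuous01 f ->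
  forall e : R, 0 < e -> exists2 del : R, 0 < del &
    forall s, nonoverlapping s -> total_length s < del ->
      (\sum_(p <- s) total_variation p.1 p.2 f <= e%:E)%E.
Proof.
move=> acf e e0; have [del d0 h] := absolutely_continuous_seq acf e0.
exists del => // r.
(* The intervals of [r] still carry total variations, those of [s] are already refined; the
   induction moves one interval at a time from [r] to [s]. *)
suff H s : nonoverlapping (r ++ s) -> total_length (r ++ s) < del ->
    (\sum_(p <- r) total_variation p.1 p.2 f + (\sum_(p <- s) `|f p.2 - f p.1|)%:E <= e%:E)%E.
  move=> nr lr; have := H [::]; rewrite cats0 => /(_ nr lr).
  by rewrite big_nil adde0.
elim: r s => [|[a b] r ih] s; first by rewrite big_nil add0e lee_fin; exact: h.
rewrite cat_cons => nr lr; rewrite big_cons/=.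
have tl s1 s2 : total_length (s1 ++ s2) = total_length s1 + total_length s2.
  by rewrite /total_length big_cat.
move: (nr); rewrite /nonoverlapping /= => /andP[/andP[/and3P[/= a0 ab b1] al] /andP[pl pw]].
have key t : itv_partition a b t ->
    ((variation a b f t)%:E + (\sum_(p <- r) total_variation p.1 p.2 f +
      (\sum_(p <- s) `|f p.2 - f p.1|)%:E) <= e%:E)%E.
  move=> H; have := ih (pairs a t ++ s).
  rewrite big_cat /= EFinD -(variation_pairs f H) addeCA; apply.
    have pin := pairs_in H.
    rewrite /nonoverlapping !all_cat !pairwise_cat (pairs_apart H).
    move: al pl pw; rewrite all_cat all_cat pairwise_cat => /andP[-> ->] /andP[ar as_] /and3P[rs -> ->].
    rewrite allrel_catr rs !andbT /=; apply/and3P; split.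
    - apply: sub_all pin => p /and3P[ap pp pb].
      by rewrite /unit_pair (le_trans a0 ap) pp (le_trans pb b1).
    - apply/allrelP => q p qr pt; have := allP ar q qr; have := allP pin p pt.
      rewrite /apart /= => /and3P[ap pp pb] /orP[h1|h1].
        by rewrite (le_trans pb h1) orbT.
      by rewrite (le_trans h1 ap).
    - apply/allrelP => p q pt qs; have := allP as_ q qs; have := allP pin p pt.
      rewrite /apart /= => /and3P[ap pp pb] /orP[h1|h1].
        by rewrite (le_trans pb h1).
      by rewrite (le_trans h1 ap) orbT.
  have := lr; rewrite !tl (pairs_length H).
  have -> : total_length ((a, b) :: r ++ s) = (b - a) + (total_length r + total_length s).
    by rewrite /total_length big_cons big_cat.
  by rewrite addrCA.
have rest0 : (0 <= \sum_(p <- r) total_variation p.1 p.2 f)%E.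
  rewrite big_seq sume_ge0// => p pr; apply: total_variation_ge0.
  by move: al; rewrite all_cat => /andP[/allP/(_ p pr)/and3P[]].
set A := (\sum_(p <- r) _)%E in key rest0 *; set B := \sum_(p <- s) _ in key *.
have B0 : 0 <= B by apply: sumr_ge0.
have [t0 Ht0] : exists t, itv_partition a b t.
  move: ab; rewrite le_eqVlt => /predU1P[->|ab]; last by exists [:: b]; exact: itv_partition1.
  by exists [::]; split => //=; rewrite eqxx.
have AB : (A + B%:E)%E \is a fin_num.
  rewrite ge0_fin_numE ?adde_ge0//; apply: le_lt_trans (ltry e).
  by apply: le_trans (key _ Ht0); rewrite lee_paddl// lee_fin variation_ge0.
rewrite -addeA -leeBrDr//; apply: ge_ereal_sup => _ [_ [t Ht <-] <-].
by rewrite leeBrDr//; exact: key.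
Qed.

Lemma nonoverlapping1 (a b : R) : 0 <= a -> a <= b -> b <= 1 -> nonoverlapping [:: (a, b)].
Proof. by move=> a0 ab b1; rewrite /nonoverlapping /= /unit_pair /= a0 ab b1. Qed.

Lemma total_length1 (a b : R) : total_length [:: (a, b)] = b - a.
Proof. by rewrite /total_length big_seq1. Qed.

(** [[0, 1]] is a finite union of cells shorter than the [del] that belongs to the bound 1, each of
    variation at most 1. *)
Lemma ac_finite_variation f : absolutely_continuous01 f ->
  forall x y : R, 0 <= x -> x <= y -> y <= 1 -> total_variation x y f \is a fin_num.
Proof.
move=> acf; have [del d0 h] := ac_total_variation acf ltr01.
pose N := (Num.bound del^-1).
have N0 : (0 : R) < N%:R by apply: le_lt_trans (archi_boundP _); rewrite invr_ge0 ltW.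
have Nd : N%:R^-1 < del.
  rewrite -[ltRHS]invrK ltf_pV2 ?posrE ?invr_gt0//.
  by apply: archi_boundP; rewrite invr_ge0 ltW.
have H (k : nat) : (k <= N)%N -> (total_variation 0 (k%:R / N%:R) f <= k%:R%:E)%E.
  elim: k => [_|k ih kN]; first by rewrite mul0r total_variationxx.
  have kN1 : k%:R / N%:R <= k.+1%:R / N%:R :> R by rewrite ler_pM2r ?invr_gt0// ler_nat.
  have k0 : 0 <= k%:R / N%:R :> R by rewrite divr_ge0// ltW.
  have k1 : k.+1%:R / N%:R <= 1 :> R by rewrite ler_pdivrMr// mul1r ler_nat.
  rewrite (total_variationD f k0 kN1) -[in leRHS]natr1 EFinD; apply: leeD; first exact/ih/ltnW.
  have := h [:: (k%:R / N%:R, k.+1%:R / N%:R)]; rewrite big_seq1 total_length1; apply.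
    exact: nonoverlapping1.
  by rewrite -mulrBl -natrB// subSnn mul1r.
have B : total_variation 0 1 f \is a fin_num.
  rewrite ge0_fin_numE ?total_variation_ge0//; apply: le_lt_trans (ltry N%:R).
  by have := H N (leqnn N); rewrite divff// gt_eqF.
move=> x y x0 xy y1.
have y0 := le_trans x0 xy; have x1 := le_trans xy y1.
rewrite ge0_fin_numE ?total_variation_ge0//; move: B.
rewrite ge0_fin_numE ?total_variation_ge0//; apply: le_lt_trans.
rewrite (total_variationD f x0 x1) (total_variationD f xy y1).
rewrite lee_paddl ?total_variation_ge0// lee_paddr ?total_variation_ge0//.
Qed.

(** The retraction of the line onto [0, 1]; composing with it extends a function from [0, 1] by
    constants, which preserves continuity and monotonicity. *)
Definition clamp01 (x : R) : R := Num.max 0 (Num.min x 1).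

Lemma clamp01_itv x : 0 <= clamp01 x <= 1.
Proof. by rewrite /clamp01 le_max lexx /= ge_max ler01 ge_min lexx orbT. Qed.

Lemma clamp01_id x : 0 <= x <= 1 -> clamp01 x = x.
Proof. by move=> /andP[x0 x1]; rewrite /clamp01 min_l// max_r. Qed.

Lemma clamp01_le x y : x <= y -> clamp01 x <= clamp01 y.
Proof.
move=> xy; have : Num.min x 1 <= Num.min y 1 by case: (leP x 1); case: (leP y 1); lra.
by rewrite /clamp01; case: (leP 0 (Num.min x 1)); case: (leP 0 (Num.min y 1)); lra.
Qed.

Lemma clamp01_dist x y : x <= y -> clamp01 y - clamp01 x <= y - x.
Proof.
move=> xy; rewrite /clamp01.
case: (leP y 1) => ?; case: (leP x 1) => ?.
- by case: (leP 0 x); case: (leP 0 y); lra.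
- by lra.
- by case: (leP 0 x); case: (leP 0 (1 : R)); lra.
- by lra.
Qed.

Definition tvf f (x : R) : R := fine (total_variation 0 (clamp01 x) f).

Lemma tvf_diff f x y : absolutely_continuous01 f -> 0 <= x -> x <= y -> y <= 1 ->
  (tvf f y - tvf f x)%:E = total_variation x y f.
Proof.
move=> acf x0 xy y1; have fin := ac_finite_variation acf.
have y0 := le_trans x0 xy; have x1 := le_trans xy y1.
rewrite /tvf !clamp01_id ?x0 ?y0// EFinB !fineK ?fin//.
rewrite (total_variationD f x0 xy) addeAC subee ?fin// add0e//.
Qed.

End absolutely_continuous.

(** * Almost everywhere differentiability of monotone absolutely continuous functions *)

Section monotone_differentiable.
Context (R : realType).
Local Notation mu := (@lebesgue_measure R).

(** An alias of [F] that records the two proofs, so that the Stieltjes measure of [F] can be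
    formed. *)
Definition monotone_cumulative (F : R -> R) (nd : nondecreasing F)
  (rc : forall x, F @ at_right x --> F x) : R -> R := F.

HB.instance Definition _ F nd rc := isCumulative.Build R _ R (@monotone_cumulative F nd rc) nd rc.

Variable F : R -> R.
Hypothesis ndF : nondecreasing F.
Hypothesis clF : forall x, F x = F (clamp01 x).
Hypothesis acF : forall e : R, 0 < e -> exists2 del : R, 0 < del &
    forall s, nonoverlapping s -> total_length s < del ->
      \sum_(p <- s) (F p.2 - F p.1) <= e.

Lemma ac_continuous : continuous F.
Proof.
move=> x; apply/cvgrPdist_le => e e0; have [del d0 h] := acF e0.
have key u v : u <= v -> v - u < del -> F v - F u <= e.
  move=> uv uvd; have /andP[u0 u1] := clamp01_itv u; have /andP[v0 v1] := clamp01_itv v.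
  have := h [:: (clamp01 u, clamp01 v)]; rewrite big_seq1 total_length1 /= -!clF; apply.
    by apply: nonoverlapping1 => //; exact: clamp01_le.
  by apply: le_lt_trans uvd; exact: clamp01_dist.
near=> y.
have : `|x - y| < del by near: y; exact: cvgr_dist_lt.
have [xy|/ltW yx] := leP x y.
  have Fxy := ndF xy.
  rewrite distrC ger0_norm ?subr_ge0// distrC ger0_norm ?subr_ge0//; exact: key.
have Fyx := ndF yx.
by rewrite ger0_norm ?subr_ge0// ger0_norm ?subr_ge0//; exact: key.
Unshelve. all: by end_near. Qed.

Let rcF : forall x, F @ at_right x --> F x.
Proof. exact/right_continuousW/ac_continuous. Qed.

Let cF : cumulative R R := monotone_cumulative ndF rcF.
Let muF := lebesgue_stieltjes_measure cF.

Lemma muF_itv (a b : R) : a <= b -> muF `]a, b] = (F b - F a)%:E.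
Proof.
move=> ab; rewrite /muF /lebesgue_stieltjes_measure /measure_extension/=.
by rewrite measurable_mu_extE/= ?wlength_itv_bnd//; exact: is_ocitv.
Qed.

Let I n (j : nat) : set R := `]j%:R / 2 ^+ n, j.+1%:R / 2 ^+ n].

Let pow2 n : (0 : R) < 2 ^+ n. Proof. by rewrite exprn_gt0. Qed.

Let mI n j : measurable (I n j). Proof. exact: measurable_itv. Qed.

Let sub n (U : set R) (j : nat) : bool := `[< I n j `<=` U >].

Let C n (U : set R) (j : nat) : set R := if sub n U j then I n j else set0.

(** The dyadic cells of level [n] contained in [U]. Absolute continuity speaks of finite families
    only; these finite disjoint unions increase with [n] and exhaust the part of an open [U] in []0,
    1]]. *)
Let D (U : set R) n := \big[setU/set0]_(j < 2 ^ n) C n U j.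

Let DP (U : set R) n x : D U n x <-> exists j : nat, [/\ (j < 2 ^ n)%N, I n j `<=` U & I n j x].
Proof.
rewrite /D -bigcup_mkord; split.
  by move=> [j /= jn]; rewrite /C; case: ifP => // /asboolP sj Ij; exists j.
by move=> [j [jn /asboolP sj Ij]]; exists j => //=; rewrite /C /sub sj.
Qed.

Let D_nd U : {homo (D U) : n m / (n <= m)%N >-> n `<=` m}.
Proof.
apply: homo_leq => [A //|B A E|n]; first exact: subset_trans.
move=> x /DP[j [jn sj]]; rewrite /I /= in_itv/= => /andP[jx xj]; apply/DP.
have e0 : (j.*2)%:R / 2 ^+ n.+1 = j%:R / 2 ^+ n :> R.
  by rewrite -mul2n natrM exprS -mulf_div divff// mul1r.
have e2 : (j.*2.+2)%:R / 2 ^+ n.+1 = j.+1%:R / 2 ^+ n :> R.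
  by rewrite -doubleS -mul2n natrM exprS -mulf_div divff// mul1r.
have p2 : (0 : R) < (2 ^+ n.+1)^-1 by rewrite invr_gt0.
have [h|h] := leP x ((j.*2.+1)%:R / 2 ^+ n.+1).
  exists j.*2; split; first by rewrite expnS mul2n ltn_double.
    move=> y; rewrite /I /= in_itv/= e0 => /andP[h1 h2]; apply: sj; rewrite /I /= in_itv/= h1/=.
    by apply: (le_trans h2); rewrite -e2 ler_pM2r// ler_nat.
  by rewrite /I /= in_itv/= e0 jx h.
exists j.*2.+1; split; first by rewrite expnS mul2n ltn_Sdouble.
  move=> y; rewrite /I /= in_itv/= e2 => /andP[h1 h2]; apply: sj; rewrite /I /= in_itv/= h2 andbT.
  by apply: le_lt_trans h1; rewrite -e0 ler_pM2r// ler_nat.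
by rewrite /I /= in_itv/= e2 xj h.
Qed.

Let dyadic_cell n (x : R) : 0 < x -> x <= 1 -> exists j, (j < 2 ^ n)%N /\ I n j x.
Proof.
move=> x0 x1.
have ex : exists k : nat, x <= k%:R / 2 ^+ n.
  by exists (2 ^ n)%N; rewrite natrX divff// gt_eqF.
have [[|j] xj min] := ex_minnP ex.
  by move: xj; rewrite mul0r leNgt x0.
exists j; split.
  rewrite -ltnS; have := min (2 ^ n)%N; rewrite natrX divff ?gt_eqF//; exact.
rewrite /I /= in_itv/= xj andbT ltNge; apply/negP => /min; by rewrite ltnn.
Qed.

Let D_cover (U : set R) : open U -> U `&` `]0, 1] `<=` \bigcup_n D U n.
Proof.
move=> oU x [Ux]; rewrite /= in_itv/= => /andP[x0 x1].
have [r r0 rU] := (@nbhs_ballP _ R^o _ _).1 (open_nbhs_nbhs (conj oU Ux)).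
pose n := Num.bound r^-1.
have nr : (2 ^+ n)^-1 < r :> R.
  rewrite -[ltRHS]invrK ltf_pV2 ?posrE ?invr_gt0//.
  apply: (lt_trans (archi_boundP _)); first by rewrite invr_ge0 ltW.
  by rewrite -natrX ltr_nat ltn_expl.
have [j [jn Ij]] := dyadic_cell n x0 x1.
exists n => //; apply/DP; exists j; split => // y.
move: Ij; rewrite /I /= !in_itv/= => /andP[a1 a2] /andP[b1 b2]; apply: rU => /=.
rewrite /ball /= ltr_norml.
have e : j.+1%:R / 2 ^+ n = j%:R / 2 ^+ n + (2 ^+ n)^-1 :> R by rewrite -natr1 mulrDl mul1r.
by rewrite e in a2 b2; apply/andP; split; lra.
Qed.

(** The cells in [D U n] have total length at most [mu U], hence below [del]. *)
Let D_measure (U : set R) (e del : R) : open U -> (mu U < del%:E)%E ->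
  (forall s, nonoverlapping s -> total_length s < del -> \sum_(p <- s) (F p.2 - F p.1) <= e) ->
  forall n, (muF (D U n) <= e%:E)%E.
Proof.
move=> oU mUd h n.
pose s := [seq (j%:R / 2 ^+ n, j.+1%:R / 2 ^+ n) : R * R | j <- iota 0 (2 ^ n) & sub n U j].
have jj (j : nat) : j%:R / 2 ^+ n <= j.+1%:R / 2 ^+ n :> R by rewrite ler_pM2r ?invr_gt0// ler_nat.
have ns : nonoverlapping s.
  apply/andP; split.
    rewrite all_map; apply/allP => j; rewrite mem_filter mem_iota /= add0n => /andP[_ jn].
    by rewrite /unit_pair /= jj divr_ge0 ?(ltW (pow2 n))//= ler_pdivrMr// mul1r -natrX ler_nat.
  rewrite pairwise_map; apply: (@sub_pairwise _ (fun a b : nat => (a < b)%N)).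
    by move=> a b ab; rewrite /apart /= ler_pM2r ?invr_gt0// ler_nat ab.
  have : pairwise ltn (iota 0 (2 ^ n)) by rewrite -sorted_pairwise ?iota_ltn_sorted//; exact: ltn_trans.
  exact: pairwise_filter.
have sE (g : R * R -> R) : \sum_(p <- s) g p = \sum_(j < 2 ^ n | sub n U j) g (j%:R / 2 ^+ n, j.+1%:R / 2 ^+ n).
  by rewrite /s big_map big_filter -{1}(subn0 (2 ^ n)%N) -/(index_iota 0 (2 ^ n)%N) big_mkord.
have mC j : measurable (C n U j) by rewrite /C; case: ifP.
have tC : trivIset setT (fun j : 'I_(2 ^ n) => C n U j).
  move=> i j _ _ [y []]; rewrite /C; case: ifP => // _; case: ifP => // _.
  rewrite /I /= !in_itv/= => /andP[a1 a2] /andP[b1 b2].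
  have : i%:R / 2 ^+ n < j.+1%:R / 2 ^+ n :> R by exact: lt_le_trans a1 b2.
  have : j%:R / 2 ^+ n < i.+1%:R / 2 ^+ n :> R by exact: lt_le_trans b1 a2.
  rewrite !ltr_pM2r ?invr_gt0// !ltr_nat !ltnS => ji ij.
  by apply/val_inj/eqP; rewrite eqn_leq ij.
have DE (nu : {measure set (measurableTypeR R) -> \bar R}) : nu (D U n) = (\sum_(j < 2 ^ n | sub n U j) nu (I n j))%E.
  have E0 := @measure_bigsetU_ord _ _ _ nu (2 ^ n) xpredT (fun j => C n U j) (fun j => mC j) tC.
  apply: (etrans E0).
  rewrite [in RHS]big_mkcond.
  by apply: eq_bigr => j _; rewrite /C; case: ifP => //; rewrite measure0.
have mD : measurable (D U n) by apply: bigsetU_measurable => j _.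
have ls : total_length s < del.
  rewrite -lte_fin; apply: le_lt_trans mUd; rewrite /total_length sE.
  have <- : mu (D U n) = (\sum_(j < 2 ^ n | sub n U j) ((j.+1%:R / 2 ^+ n) - (j%:R / 2 ^+ n)))%:E.
    rewrite DE -sumEFin; apply: eq_bigr => j _.
    have eI : mu (I n j) = (j.+1%:R / 2 ^+ n - j%:R / 2 ^+ n)%:E.
      by rewrite /I lebesgue_measure_itv/= lte_fin ltr_pM2r ?invr_gt0// ltr_nat ltnSn EFinB.
    exact: eI.
  apply: le_measure; rewrite ?inE//; first exact: open_measurable.
  by move=> y /DP[j [_ sj /sj]].
apply: (@le_trans _ _ (\sum_(j < 2 ^ n | sub n U j) muF (I n j))%E).
  by rewrite le_eqVlt; apply/orP; left; apply/eqP; exact: (DE muF).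
rewrite (eq_bigr (fun j : 'I_(2 ^ n) => (F (j.+1%:R / 2 ^+ n) - F (j%:R / 2 ^+ n))%:E)); last first.
  by move=> j _; rewrite muF_itv.
rewrite sumEFin lee_fin -(sE (fun p => F p.2 - F p.1)); exact: h.
Qed.

Let mO : measurable (`]0, 1]%classic : set (measurableTypeR R)). Proof. exact: measurable_itv. Qed.

(** An open set around [A] of Lebesgue measure below [del] is exhausted by its dyadic unions, each
    of Stieltjes measure at most [e]; continuity from below passes to the limit. *)
Let muF_null (A : set R) : measurable A -> mu A = 0 -> muF (A `&` `]0, 1]) = 0%E.
Proof.
move=> mA A0; apply/eqP; rewrite eq_le measure_ge0 andbT.
apply/lee_addgt0Pr => e e0; rewrite add0e.
have [del d0 h] := acF e0.
have Afin : (mu A < +oo)%E by rewrite A0 ltry.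
have [U [oU AU UA]] := lebesgue_regularity_outer mA Afin d0.
have mU : measurable U by exact: open_measurable.
have mUd : (mu U < del%:E)%E.
  have -> : U = A `|` (U `\` A) by rewrite setDUK.
  apply: le_lt_trans UA; apply: (le_trans (measureU2 _ _ _)) => //; first exact: measurableD.
  by rewrite [X in (X + _)%E]A0 add0e.
have mD n : measurable (D U n).
  by apply: bigsetU_measurable => j _; rewrite /C; case: ifP.
have H := D_measure oU mUd h.
apply: (@le_trans _ _ (muF (\bigcup_n D U n))).
  apply: le_measure; rewrite ?inE; [exact: (measurableI _ _ mA mO)|by apply: bigcup_measurable => k _; exact: mD|].
  by move=> x [Ax x01]; apply: (D_cover oU); split => //; exact: AU.
have cv : muF (D U n) @[n --> \oo] --> muF (\bigcup_n D U n).
  apply: nondecreasing_cvg_mu; [exact: mD|by apply: bigcup_measurable => k _; exact: mD|].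
  by move=> n m nm; apply/subsetPset; exact: D_nd.
rewrite -(cvg_lim _ cv)//; apply: lime_le; last exact: nearW.
by apply/cvg_ex; exists (muF (\bigcup_n D U n)).
Qed.

(** The Stieltjes measure is dominated by Lebesgue measure, so [F] is an indefinite integral of the
    Radon-Nikodym density on []0, 1[] and has a derivative at every Lebesgue point of that
    density. *)
Lemma monotone_ac_derivable :
  {ae mu, forall x : R, 0 < x < 1 -> derivable F x 1}.
Proof.
have fin : (muF (`]0, 1]%classic : set R)%R < +oo)%E by rewrite muF_itv// ltry.
pose nu : {finite_measure set (measurableTypeR R) -> \bar R} := mfrestr mO fin.
have nuE A : nu A = muF (A `&` `]0, 1]) by [].
have dom : nu `<< mu.
  by apply/null_content_dominatesP => A mA A0; rewrite nuE muF_null.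
have [g [g0 gfin ig gE]] := radon_nikodym_sigma_finite dom.
pose fg := fine \o g.
have gfg : g = EFin \o fg by apply/funext => x; rewrite /fg /= fineK.
have lg : locally_integrable setT fg.
  by apply: open_integrable_locally; [exact: openT|rewrite -gfg].
have := lebesgue_differentiation lg.
apply: filterS; first exact: (ae_filter_ringOfSetsType mu).
move=> x lx /andP[x0 x1].
pose G y := (\int[mu]_(t in [set` Interval (BRight 0) (BRight y)]) fg t)%R.
have ig2 : mu.-integrable [set` Interval (BRight 0) (BRight (2 : R))] (EFin \o fg).
  by rewrite -gfg; exact: integrableS ig.
have [||dG _] := @FTC1_lebesgue_pt R fg (BRight 0) x 2 _ ig2 _ lx; [lra|by rewrite ?bnd_simp ?lte_fin|].
have GE y : 0 < y < 1 -> F y = G y + F 0.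
  move=> /andP[y0 y1]; rewrite -[LHS](subrK (F 0)); congr (_ + _).
  apply: EFin_inj; rewrite -muF_itv ?ltW// /G /Rintegral.
  have := gE `]0, y]%classic (measurable_itv _); rewrite nuE.
  have -> : `]0, y] `&` `]0, 1] = `]0, y]%classic :> set R.
    apply/seteqP; split => [z []//|z]; rewrite /= !in_itv/= => /andP[-> zy].
    by rewrite zy (le_trans zy (ltW y1)).
  move=> e; rewrite -[LHS]fineK; last by rewrite muF_itv ?ltW.
  by congr (fine _)%:E; rewrite [LHS]e; apply: eq_integral => z _; rewrite {1}gfg.
have : derivable (fun y => G y + F 0) x 1.
  exact: (derivableD dG (derivable_cst _ _ _)).
apply: near_eq_derivable.
near=> y; apply/esym/GE.
have : y \in `]0, 1[ by near: y; apply: near_in_itvoo; rewrite in_itv/= x0 x1.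
by rewrite in_itv.
Unshelve. all: by end_near. Qed.

End monotone_differentiable.

Section ac_derivable.
Context (R : realType).
Local Notation mu := (@lebesgue_measure R).

Lemma clamp01K (x : R) : clamp01 (clamp01 x) = clamp01 x.
Proof. by rewrite clamp01_id// clamp01_itv. Qed.

(** Jordan decomposition: the total variation function and its difference with [f] are both
    nondecreasing and absolutely continuous. *)
Lemma ac_derivable (f : R -> R) : absolutely_continuous01 f ->
  {ae mu, forall x : R, 0 < x < 1 -> derivable f x 1}.
Proof.
move=> acf.
pose F1 := tvf f; pose F2 x := tvf f x - f (clamp01 x).
have tvfc x : tvf f x = tvf f (clamp01 x) by rewrite /tvf clamp01K.
have dif x y : x <= y -> `|f (clamp01 y) - f (clamp01 x)| <= tvf f y - tvf f x.
  move=> xy; have /andP[x0 x1] := clamp01_itv x; have /andP[y0 y1] := clamp01_itv y.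
  have cxy := clamp01_le xy.
  rewrite tvfc (tvfc x) -lee_fin (tvf_diff acf x0 cxy y1).
  exact: total_variation_ge.
have nd1 : nondecreasing F1.
  by move=> x y xy; rewrite -subr_ge0; apply: le_trans (dif _ _ xy).
have nd2 : nondecreasing F2.
  by move=> x y xy; have := dif _ _ xy; rewrite /F2 ler_norml => /andP[? ?]; lra.
have cl2 x : F2 x = F2 (clamp01 x) by rewrite /F2 clamp01K -tvfc.
have tvE s : nonoverlapping s -> (\sum_(p <- s) (F1 p.2 - F1 p.1))%:E =
    (\sum_(p <- s) total_variation p.1 p.2 f)%E.
  move=> /andP[/allP us _]; rewrite -sumEFin big_seq [RHS]big_seq; apply: eq_bigr => p ps.
  by have /and3P[? ? ?] := us p ps; rewrite /F1 tvf_diff.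
have ac1 : forall e : R, 0 < e -> exists2 del : R, 0 < del &
    forall s, nonoverlapping s -> total_length s < del -> \sum_(p <- s) (F1 p.2 - F1 p.1) <= e.
  move=> e e0; have [del d0 h] := ac_total_variation acf e0; exists del => // s ns ls.
  by rewrite -lee_fin tvE//; exact: h.
have ac2 : forall e : R, 0 < e -> exists2 del : R, 0 < del &
    forall s, nonoverlapping s -> total_length s < del -> \sum_(p <- s) (F2 p.2 - F2 p.1) <= e.
  move=> e e0; have e2 : 0 < e / 2 by rewrite divr_gt0.
  have [d1 d10 h1] := ac1 _ e2; have [d2 d20 h2] := absolutely_continuous_seq acf e2.
  exists (Num.min d1 d2); first by rewrite lt_min d10.
  move=> s ns; rewrite lt_min => /andP[l1 l2].
  have := h1 s ns l1; have := h2 s ns l2 => H2 H1.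
  apply: (@le_trans _ _ (\sum_(p <- s) (F1 p.2 - F1 p.1) + \sum_(p <- s) `|f p.2 - f p.1|)); last by lra.
  rewrite -big_split /= big_seq [leRHS]big_seq; apply: ler_sum => p ps.
  have /andP[/allP us _] := ns; have /and3P[p0 pp p1] := us p ps.
  have c2 : clamp01 p.2 = p.2 by rewrite clamp01_id// p1 (le_trans p0).
  have c1 : clamp01 p.1 = p.1 by rewrite clamp01_id// p0 (le_trans pp).
  rewrite /F2 /F1 c1 c2; have := ler_norm (- (f p.2 - f p.1)); rewrite normrN; lra.
have := monotone_ac_derivable nd1 tvfc ac1; have := monotone_ac_derivable nd2 cl2 ac2.
apply: filterS2; first exact: (ae_filter_ringOfSetsType mu).
move=> x h2 h1 x01; have d1 := h1 x01; have d2 := h2 x01.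
have : derivable (F1 \- F2) x 1 by exact: derivableB.
apply: near_eq_derivable; near=> y.
have : y \in `]0, 1[ by near: y; apply: near_in_itvoo; rewrite in_itv.
rewrite in_itv/= => /andP[/ltW y0 /ltW y1].
by rewrite /F1 /F2 /= opprB addrC subrK clamp01_id// y0.
Unshelve. all: by end_near. Qed.

End ac_derivable.

(** * The derivative relative to the unit interval *)

Section derivative01.
Context (R : realType).
Implicit Types (f g : R -> R).

Definition has_deriv01 f (t l : R) : Prop :=
  diffquot f t @ within unit_itv t^' --> l.

Lemma has_deriv01P f t l : has_deriv01 f t l <-> forall e : R, 0 < e ->
  exists2 del : R, 0 < del & forall u, 0 <= u <= 1 -> u != t -> `|u - t| < del ->
    `|l - diffquot f t u| <= e.
Proof.
split.
  move=> /cvgrPdist_le h e e0; have := h e e0.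
  rewrite /within /= => /nbhs_ballP[del d0 H]; exists del => // u u01 ut utd.
  by apply: H => //; rewrite /ball/= distrC.
move=> h; apply/cvgrPdist_le => e e0; have [del d0 H] := h e e0.
rewrite /within /=; apply/nbhs_ballP; exists del => // u ut neq u01.
by apply: H => //; move: ut; rewrite /ball/= distrC.
Qed.

Lemma within_unit_proper (t : R) : 0 <= t <= 1 -> ProperFilter (within unit_itv t^').
Proof.
move=> /andP[t0 t1].
apply: Build_ProperFilter_ex => A.
rewrite /within /= => /nbhs_ballP[del d0 H].
pose e := Num.min (del / 2) (1 / 2).
have e0 : 0 < e by rewrite lt_min !divr_gt0.
have ed : e < del by rewrite /e gt_min; apply/orP; left; rewrite ltr_pdivrMr// ltr_pMr// ltr1n.
have e1 : e <= 1 / 2 by rewrite /e ge_min lexx orbT.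
have [th|th] := leP t (1 / 2).
  exists (t + e); apply: H; first by rewrite /ball /= opprD addNKr normrN gtr0_norm.
    by rewrite -subr_eq0 addrC addKr gt_eqF.
  by rewrite /unit_itv /= in_itv/=; apply/andP; split; lra.
exists (t - e); apply: H; first by rewrite /ball /= opprB addrC subrK gtr0_norm.
  by rewrite -subr_eq0 addrC addKr oppr_eq0 gt_eqF.
by rewrite /unit_itv /= in_itv/=; apply/andP; split; lra.
Qed.

Lemma has_deriv01_deriv f t l : 0 <= t <= 1 -> has_deriv01 f t l -> deriv01 f t = l.
Proof. by move=> t01 h; have pf := within_unit_proper t01; exact: (cvg_lim _ h). Qed.

Lemma derivable_on01P f t : 0 <= t <= 1 -> derivable_on01 f t <-> exists l, has_deriv01 f t l.
Proof.
move=> t01; have pf := within_unit_proper t01; split.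
  by move=> /cvg_ex[l h]; exists l.
by move=> [l h]; apply/cvg_ex; exists l.
Qed.

Lemma derivable_on01_has f t : 0 <= t <= 1 -> derivable_on01 f t -> has_deriv01 f t (deriv01 f t).
Proof.
move=> t01 /(derivable_on01P _ t01)[l h]; by rewrite (has_deriv01_deriv t01 h).
Qed.

Lemma has_deriv01_lin f g (c t l l' : R) : has_deriv01 f t l -> has_deriv01 g t l' ->
  has_deriv01 (fun x => f x + c * g x) t (l + c * l').
Proof.
move=> hf hg; rewrite /has_deriv01.
have -> : diffquot (fun x => f x + c * g x) t = (fun u => diffquot f t u + c * diffquot g t u).
  by apply/funext => u; rewrite /diffquot; ring.
apply: (@cvgD _ R^o); first exact: hf.
by apply: cvgM; [exact: cvg_cst|exact: hg].
Qed.

Lemma has_deriv01_ext f g t l : (forall u, 0 <= u <= 1 -> f u = g u) -> 0 <= t <= 1 ->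
  has_deriv01 f t l -> has_deriv01 g t l.
Proof.
move=> fg t01 /has_deriv01P h; apply/has_deriv01P => e e0; have [del d0 H] := h e e0.
exists del => // u u01 ut utd; rewrite /diffquot -!fg//; exact: H.
Qed.

(** The image filters coincide, so that the two derivatives agree also where [lim] returns its
    default value. *)
Lemma deriv01_ext f g t : (forall u, 0 <= u <= 1 -> f u = g u) -> 0 <= t <= 1 ->
  deriv01 f t = deriv01 g t.
Proof.
move=> fg t01; rewrite /deriv01; congr (lim _); apply/seteqP; split => A h.
  have h' : \forall u \near t^', unit_itv u -> A (diffquot f t u) := h.
  change (\forall u \near t^', unit_itv u -> A (diffquot g t u)).
  by apply: filterS h' => u hu u01; rewrite /diffquot -!fg//; exact: hu.
have h' : \forall u \near t^', unit_itv u -> A (diffquot g t u) := h.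
change (\forall u \near t^', unit_itv u -> A (diffquot f t u)).
by apply: filterS h' => u hu u01; rewrite /diffquot !fg//; exact: hu.
Qed.

Lemma derivable_has_deriv01 f t : 0 < t < 1 -> derivable f t 1 -> derivable_on01 f t.
Proof.
move=> /andP[t0 t1] /cvg_ex[l h]; apply/derivable_on01P; first by rewrite !ltW.
exists l; apply/has_deriv01P => e e0.
move/cvgrPdist_le : h => /(_ e e0) /nbhs_ballP[del d0 H]; exists del => // u u01 ut utd.
have := H (u - t); rewrite /ball /= sub0r normrN => /(_ utd).
rewrite subr_eq0 => /(_ ut); congr (`|_ - _| <= _).
by rewrite /diffquot /GRing.scale /= mulr1 subrK mulrC.
Qed.

End derivative01.

(** * Square-integrable functions on the unit interval *)

Section square_integrable.
Context (R : realType).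
Local Notation mu := (@lebesgue_measure R).
Implicit Types (f g x y : R -> R) (c : R).

(** Turns measurability and integrals on [0, 1] into statements on the line, independent of the
    arbitrary values outside [0, 1]. *)
Definition res f : R -> R := f \_ unit_itv.

Lemma unit_itvE (t : R) : unit_itv t = (0 <= t <= 1 : Prop).
Proof. by rewrite /unit_itv /= in_itv. Qed.

Lemma res_in f t : 0 <= t <= 1 -> res f t = f t.
Proof. by move=> h; rewrite /res patchE mem_set// unit_itvE. Qed.

Lemma res_out f t : ~~ (0 <= t <= 1) -> res f t = 0.
Proof. by move=> h; rewrite /res patchE memNset// unit_itvE; exact/negP. Qed.

Lemma measurable_unit : measurable (unit_itv : set R).
Proof. exact: measurable_itv. Qed.

Lemma L2P f : L2 f <-> measurable_fun setT (res f) /\ intg mu (fun t => res f t ^+ 2).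
Proof.
split.
  move=> h; split; last exact: Lfun2_integrable_sqr.
  by have := sub_Lfun_mfun h; rewrite inE.
move=> [mf sf]; rewrite /L2 /= inE /=; apply/andP; split; first by rewrite inE.
rewrite inE /=; rewrite /finite_norm unlock /=.
apply: poweR_lty; have := intg_ltyP sf (fun t => sqr_ge0 _); apply: le_lt_trans.
rewrite le_eqVlt; apply/orP; left; apply/eqP; apply: eq_integral => t _.
by rewrite /= powR_mulrn// real_normK// num_real.
Qed.

Lemma L2_meas f : L2 f -> measurable_fun setT (res f). Proof. by move=> /L2P[]. Qed.
Lemma L2_sq f : L2 f -> intg mu (fun t => res f t ^+ 2). Proof. by move=> /L2P[]. Qed.

Lemma res_mul f g t : res (fun t => f t * g t) t = res f t * res g t.
Proof. by case: (boolP (0 <= t <= 1)) => h; [rewrite !res_in|rewrite !res_out// mul0r]. Qed.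

Lemma ipE f g : ip f g = itg mu (fun t => res f t * res g t).
Proof.
rewrite /ip Rintegral_mkcond; congr (Rintegral _ _ _); apply/funext => t.
exact: (res_mul f g t).
Qed.

Lemma L2_intg_mul f g : L2 f -> L2 g -> intg mu (fun t => res f t * res g t).
Proof. by move=> /L2P[? ?] /L2P[? ?]; exact: intg_mul. Qed.

Lemma res_lin f g c t : res (fun t => f t + c * g t) t = res f t + c * res g t.
Proof. by case: (boolP (0 <= t <= 1)) => h; [rewrite !res_in|rewrite !res_out// mulr0 addr0]. Qed.

Lemma L2_lin f g c : L2 f -> L2 g -> L2 (fun t => f t + c * g t).
Proof.
move=> /L2P[mf sf] /L2P[mg sg]; apply/L2P.
have E : res (fun t => f t + c * g t) = (fun t => res f t + c * res g t).
  by apply/funext => t; rewrite res_lin.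
have mcg : measurable_fun setT (fun t => c * res g t) by exact: measurable_funM.
rewrite E; split; first exact: measurable_funD.
apply: intg_sqD => //; under eq_fun do rewrite exprMn; exact: intgZ.
Qed.

Lemma res0 : res (fun=> 0) = (fun=> 0).
Proof. by apply/funext => t; case: (boolP (0 <= t <= 1)) => h; [rewrite res_in|rewrite res_out]. Qed.

Lemma L2_0 : L2 (fun=> 0 : R).
Proof.
apply/L2P; rewrite res0; split => //.
by under eq_fun do rewrite expr0n /=; exact: intg0.
Qed.

Lemma ipC f g : ip f g = ip g f.
Proof. by rewrite !ipE; congr itg; apply/funext => t; rewrite mulrC. Qed.

Lemma ip_linl f g x c : L2 f -> L2 g -> L2 x ->
  ip (fun t => f t + c * g t) x = ip f x + c * ip g x.
Proof.
move=> hf hg hx; rewrite !ipE -itgZ; last exact: L2_intg_mul.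
rewrite -itgD; [|exact: L2_intg_mul|by apply: intgZ; exact: L2_intg_mul].
by congr itg; apply/funext => t; rewrite res_lin mulrDl mulrA.
Qed.

Lemma ip_linr f g x c : L2 f -> L2 g -> L2 x ->
  ip x (fun t => f t + c * g t) = ip x f + c * ip x g.
Proof. by move=> hf hg hx; rewrite ipC ip_linl// (ipC f) (ipC g). Qed.

Lemma ip0r x : ip x (fun=> 0) = 0.
Proof. by rewrite ipE res0; under eq_fun do rewrite mulr0; exact: itg0. Qed.

Lemma ip_ge0 f : 0 <= ip f f.
Proof. by rewrite ipE; apply: itg_ge0 => t; rewrite -expr2 sqr_ge0. Qed.

Lemma ip_cauchy_schwarz f g : L2 f -> L2 g -> ip f g ^+ 2 <= ip f f * ip g g.
Proof. by move=> /L2P[? ?] /L2P[? ?]; rewrite !ipE; exact: cauchy_schwarz. Qed.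

Lemma ip_ae f g x : L2 f -> L2 g -> L2 x -> {ae mu, forall t, res f t = res g t} ->
  ip x f = ip x g.
Proof.
move=> /L2_meas mf /L2_meas mg /L2_meas mx fg; rewrite !ipE.
apply: ae_eq_itg; [exact: measurable_funM..|].
apply: filterS fg; first exact: (ae_filter_ringOfSetsType mu).
by move=> t ->.
Qed.

Lemma ip_ext f g x y : (forall t, 0 <= t <= 1 -> f t = g t) -> (forall t, 0 <= t <= 1 -> x t = y t) ->
  ip f x = ip g y.
Proof.
move=> fg xy; rewrite !ipE; congr itg; apply/funext => t.
by case: (boolP (0 <= t <= 1)) => h; [rewrite !res_in// fg// xy|rewrite !res_out].
Qed.

Lemma L2_ae f g : L2 f -> measurable_fun setT (res g) ->
  {ae mu, forall t, res f t = res g t} -> L2 g.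
Proof.
move=> /L2P[mf sf] mg fg; apply/L2P; split => //.
refine (@ae_intg _ _ _ mu (fun t => res f t ^+ 2) _ _ _ _ _) => //; [exact: measurable_funX|exact: measurable_funX|].
apply: filterS fg; first exact: (ae_filter_ringOfSetsType mu).
by move=> t ->.
Qed.

Lemma ae_open_unit (Q : R -> Prop) : {ae mu, forall t : R, 0 < t < 1 -> Q t} ->
  {ae mu, forall t : R, 0 <= t <= 1 -> Q t}.
Proof.
have n0 (a : R) : {ae mu, forall t : R, t != a}.
  exists [set a]; split => //; first by rewrite lebesgue_measure_set1.
  by move=> t /= /negP; rewrite negbK => /eqP.
have := n0 0; have := n0 1.
apply: filterS3; first exact: (ae_filter_ringOfSetsType mu).
move=> t t1 t0 h /andP[a b]; apply: h; by rewrite !lt_neqAle eq_sym t0 a t1 b.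
Qed.

Lemma continuous_clampL2 f : continuous (f \o @clamp01 R) -> L2 f.
Proof.
move=> cf; have mfc : measurable_fun setT (f \o @clamp01 R) by exact: continuous_measurable_fun.
have rE : res f = (fun t => (f \o @clamp01 R) t * \1_(unit_itv : set R) t).
  apply/funext => t; rewrite indicE; case: (boolP (0 <= t <= 1)) => h.
    by rewrite res_in// mem_set ?unit_itvE// mulr1 /= clamp01_id.
  by rewrite res_out// memNset ?mulr0// unit_itvE; exact/negP.
have [M HM] : exists M : R, forall t : R, 0 <= t <= 1 -> `|f t| <= M.
  have cw : {within `[0 : R, 1], continuous (f \o @clamp01 R)} by exact: continuous_subspaceT.
  have [a _ ha] := EVT_max ler01 cw; have [b _ hb] := EVT_min ler01 cw.
  exists (Num.max `|f (clamp01 a)| `|f (clamp01 b)|) => t t01.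
  have := ha t; have := hb t; rewrite !in_itv /= t01 [clamp01 t]clamp01_id// => /(_ erefl) h1 /(_ erefl) h2.
  rewrite le_max; case: (leP 0 (f t)) => ft.
    by rewrite (ger0_norm ft) (le_trans h2)// ler_norm.
  by apply/orP; right; rewrite (ltr0_norm ft) lerNl (le_trans _ h1)// lerNl -normrN ler_norm.
have mf : measurable_fun setT (res f).
  by rewrite rE; apply: measurable_funM => //; apply: measurable_indic; exact: measurable_unit.
apply/L2P; split => //.
apply: (@intg_le _ _ _ mu (fun t => M ^+ 2 * \1_(unit_itv : set R) t)).
- exact: measurable_funX.
- move=> t; rewrite ger0_norm ?sqr_ge0// indicE; case: (boolP (0 <= t <= 1)) => h.
    rewrite res_in// mem_set ?unit_itvE// mulr1 -(real_normK (num_real (f t))).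
    by apply: lerXn2r; rewrite ?nnegrE ?HM// (le_trans _ (HM t h)).
  by rewrite res_out// memNset ?unit_itvE ?mulr0 ?expr0n//; exact/negP.
- by apply: intgZ; exact: integrable_indic_itv.
Qed.

Lemma ac_clamp_continuous f : absolutely_continuous01 f -> continuous (f \o @clamp01 R).
Proof.
move=> acf x; apply/cvgrPdist_le => e e0.
have [del d0 h] := absolutely_continuous_seq acf e0.
have key u v : u <= v -> v - u < del -> `|f (clamp01 v) - f (clamp01 u)| <= e.
  move=> uv uvd; have /andP[u0 u1] := clamp01_itv u; have /andP[v0 v1] := clamp01_itv v.
  have := h [:: (clamp01 u, clamp01 v)]; rewrite big_seq1 total_length1 /=; apply.
    by apply: nonoverlapping1 => //; exact: clamp01_le.
  by apply: le_lt_trans uvd; exact: clamp01_dist.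
near=> y.
have : `|x - y| < del by near: y; exact: cvgr_dist_lt.
have [xy|/ltW yx] := leP x y.
  by rewrite distrC ger0_norm ?subr_ge0// => H; rewrite /= distrC; exact: key.
by rewrite ger0_norm ?subr_ge0// => H; exact: key.
Unshelve. all: by end_near. Qed.

Lemma ac_L2 f : absolutely_continuous01 f -> L2 f.
Proof. by move=> h; apply: continuous_clampL2; exact: ac_clamp_continuous. Qed.

Lemma ac_lin f g c : absolutely_continuous01 f -> absolutely_continuous01 g ->
  absolutely_continuous01 (fun t => f t + c * g t).
Proof.
move=> acf acg e e0.
have e2 : 0 < e / 2 by rewrite divr_gt0.
have c1 : 0 < `|c| + 1 by rewrite ltr_wpDl.
have ec : 0 < e / 2 / (`|c| + 1) by rewrite divr_gt0.
have [d1 d10 h1] := acf _ e2; have [d2 d20 h2] := acg _ ec.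
exists (Num.min d1 d2); first by rewrite lt_min d10.
move=> n u v uv ap; rewrite lt_min => /andP[l1 l2].
have H1 := h1 n u v uv ap l1; have H2 := h2 n u v uv ap l2.
apply: (@le_lt_trans _ _ (\sum_(i < n) `|f (v i) - f (u i)| + `|c| * \sum_(i < n) `|g (v i) - g (u i)|)).
  rewrite mulr_sumr -big_split /=; apply: ler_sum => i _.
  have -> : f (v i) + c * g (v i) - (f (u i) + c * g (u i)) = (f (v i) - f (u i)) + c * (g (v i) - g (u i)) by ring.
  by rewrite -normrM; exact: ler_normD.
have : `|c| * \sum_(i < n) `|g (v i) - g (u i)| <= e / 2.
  apply: (@le_trans _ _ ((`|c| + 1) * (e / 2 / (`|c| + 1)))).
    by apply: ler_pM; rewrite ?sumr_ge0// ?lerDl// ltW.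
  by rewrite mulrC divfK// gt_eqF.
by lra.
Qed.

End square_integrable.

(** * Measurability of derivatives *)

Section derivative_measurable.
Context (R : realType).
Local Notation mu := (@lebesgue_measure R).

Lemma continuous_diffquot (f : R -> R) (u t : R) : continuous f -> t != u ->
  {for t, continuous (fun t => diffquot f t u)}.
Proof.
move=> cf tu; rewrite /prop_for /continuous_at /diffquot.
apply: cvgM.
  by apply: (@cvgB _ R^o); [exact: cvg_cst|exact: cf].
apply: cvgV; first by rewrite subr_eq0 eq_sym.
by apply: (@cvgB _ R^o); [exact: cvg_cst|exact: cvg_id].
Qed.

(* The points at which the difference quotients oscillate by more than [e] at scale
   [del] form an open set. *)
Let osc (f : R -> R) (e del : R) : set R :=
  \bigcup_(p in [set p : R * R | 0 <= p.1 <= 1 /\ 0 <= p.2 <= 1])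
    [set t | [/\ t != p.1, t != p.2, `|p.1 - t| < del, `|p.2 - t| < del &
       e < `|diffquot f t p.1 - diffquot f t p.2|]].

(** For a fixed pair of points the conditions are open in [t], and openness survives the uncountable
    union over pairs. *)
Let osc_open f e del : continuous f -> open (osc f e del).
Proof.
move=> cf; apply: bigcup_open => -[u v] _ /=; rewrite openE => t /= [tu tv ut vt eq].
rewrite /interior; near=> s; split.
- by near: s; apply: open_nbhs_nbhs; split => //; exact: open_neq.
- by near: s; apply: open_nbhs_nbhs; split => //; exact: open_neq.
- near: s; apply: (@cvgr_lt _ R _ _ (fun s => `|u - s|)) => //; last exact: ut.
  by apply: cvg_norm; apply: (@cvgB _ R^o); [exact: cvg_cst|exact: cvg_id].
- near: s; apply: (@cvgr_lt _ R _ _ (fun s => `|v - s|)) => //; last exact: vt.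
  by apply: cvg_norm; apply: (@cvgB _ R^o); [exact: cvg_cst|exact: cvg_id].
- near: s; apply: (@cvgr_gt _ R _ _ (fun s => `|diffquot f s u - diffquot f s v|)) => //; last exact: eq.
  by apply: cvg_norm; apply: (@cvgB _ R^o); exact: continuous_diffquot.
Unshelve. all: by end_near. Qed.

(** Cauchy's criterion for the difference quotients, with countably many scales. *)
Let derivable_osc f t : 0 <= t <= 1 -> derivable_on01 f t <->
  forall k : nat, exists j : nat, ~ osc f k.+1%:R^-1 j.+1%:R^-1 t.
Proof.
move=> t01; split.
  move=> /(derivable_on01P _ t01)[l /has_deriv01P h] k.
  have k0 : 0 < k.+1%:R^-1 / 2 :> R by rewrite divr_gt0// invr_gt0.
  have [del d0 H] := h _ k0.
  have [j jd] : exists j : nat, j.+1%:R^-1 < del.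
    exists (Num.bound del^-1); rewrite -[ltRHS]invrK ltf_pV2 ?posrE ?invr_gt0//.
    apply: (lt_trans (archi_boundP _)); first by rewrite invr_ge0 ltW.
    by rewrite ltr_nat.
  exists j => -[[u v] /= [u01 v01] [tu tv ut vt]]; apply/negP; rewrite -leNgt.
  have Hu := H u u01; have Hv := H v v01.
  have -> : diffquot f t u - diffquot f t v = (l - diffquot f t v) - (l - diffquot f t u) by ring.
  apply: (le_trans (ler_normB _ _)); rewrite [leRHS]splitr; apply: lerD.
    by apply: Hv; [rewrite eq_sym|exact: lt_trans vt jd].
  by apply: Hu; [rewrite eq_sym|exact: lt_trans ut jd].
move=> h; rewrite /derivable_on01; have pf := within_unit_proper t01.
apply: cauchy_cvg; apply/cauchy_ballP => e e0.
have [k ke] : exists k : nat, k.+1%:R^-1 < e.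
  exists (Num.bound e^-1); rewrite -[ltRHS]invrK ltf_pV2 ?posrE ?invr_gt0//.
  apply: (lt_trans (archi_boundP _)); first by rewrite invr_ge0 ltW.
  by rewrite ltr_nat.
have [j hj] := h k.
have nj : \forall u \near within unit_itv t^', [/\ 0 <= u <= 1, u != t & `|u - t| < j.+1%:R^-1].
  rewrite /within /=; apply/nbhs_ballP; exists j.+1%:R^-1; first by rewrite /= invr_gt0.
  by move=> u; rewrite /ball /= distrC => ut neq; rewrite unit_itvE.
exists (diffquot f t @` [set u | [/\ 0 <= u <= 1, u != t & `|u - t| < j.+1%:R^-1]],
        diffquot f t @` [set u | [/\ 0 <= u <= 1, u != t & `|u - t| < j.+1%:R^-1]]).
  by split; apply: filterS nj => u hu; exists u.
move=> [a b] /= [[u [u01 ut utd] <-] [v [v01 vt vtd] <-]].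
rewrite /ball /=; apply: le_lt_trans ke; rewrite leNgt; apply/negP => H; apply: hj.
by exists (u, v) => //=; split => //; rewrite eq_sym.
Qed.

(** On the set [E] of differentiability, Borel by the Cauchy criterion over countably many scales,
    the derivative is a limit of difference quotients along a fixed sequence of increments;
    elsewhere in [0, 1] it is the default [point]. *)
Lemma measurable_deriv01 f : continuous (f \o @clamp01 R) ->
  measurable_fun setT (res (deriv01 f)).
Proof.
move=> cf; pose g := f \o @clamp01 R.
have fg t : 0 <= t <= 1 -> deriv01 f t = deriv01 g t.
  by move=> t01; apply: deriv01_ext => // u u01; rewrite /g /= clamp01_id.
have -> : res (deriv01 f) = res (deriv01 g).
  apply/funext => t; case: (boolP (0 <= t <= 1)) => h; last by rewrite !res_out.
  by rewrite !res_in// fg.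
pose E : set R := unit_itv `&` \bigcap_k \bigcup_j ~` osc g k.+1%:R^-1 j.+1%:R^-1.
have mE : measurable E.
  apply: measurableI; first exact: measurable_unit.
  apply: bigcapT_measurable => k; apply: bigcupT_measurable => j.
  by apply: measurableC; apply: open_measurable; exact: osc_open.
have EP t : 0 <= t <= 1 -> E t <-> derivable_on01 g t.
  move=> t01; rewrite derivable_osc//; split.
    by move=> [_ h] k; have [j _ hj] := h k I; exists j.
  move=> h; split; first by rewrite unit_itvE.
  by move=> k _; have [j hj] := h k; exists j.
(* The increment points inwards, and [n.+2] keeps it at most 1/2, so that [s n t] stays in
   [0, 1]. *)
pose s (n : nat) (t : R) := t + (if t <= 2^-1 then n.+2%:R^-1 else - n.+2%:R^-1).
pose d n t := diffquot g t (s n t).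
have st n t : s n t - t = if t <= 2^-1 then n.+2%:R^-1 else - n.+2%:R^-1.
  by rewrite /s addrC addKr.
have mg : measurable_fun setT g by exact: continuous_measurable_fun.
have mle : measurable_fun setT (fun t : R => t <= 2^-1) by exact: measurable_fun_ler.
have ms n : measurable_fun setT (s n).
  apply: measurable_funD => //.
  by apply: (measurable_fun_ifT mle).
have md n : measurable_fun setT (d n).
  have -> : d n = (fun t => (g (s n t) - g t) * (if t <= 2^-1 then n.+2%:R else - n.+2%:R)).
    apply/funext => t; rewrite /d /diffquot st.
    by case: ifP => _; rewrite ?invrN invrK.
  apply: measurable_funM; last exact: (measurable_fun_ifT mle).
  by apply: measurable_funB => //; exact: measurableT_comp.
pose h n t := \1_E t * d n t + \1_(unit_itv `\` E) t * (point : R).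
have mh n : measurable_fun setT (h n).
  apply: measurable_funD; apply: measurable_funM => //; apply: measurable_indic => //.
  by apply: measurableD => //; exact: measurable_unit.
apply: (measurable_fun_cvg mh) => t _.
case: (boolP (0 <= t <= 1)) => t01; last first.
  rewrite res_out//; apply: cvg_near_cst; apply: nearW => n; rewrite /h !indicE.
  rewrite !memNset ?mul0r ?addr0//.
    by move=> -[]; rewrite unit_itvE (negbTE t01).
  by move=> -[]; rewrite unit_itvE (negbTE t01).
rewrite res_in//; have [Et|nEt] := pselect (E t); last first.
  have -> : deriv01 g t = point by apply: dvgP => /(EP t t01).
  apply: cvg_near_cst; apply: nearW => n; rewrite /h !indicE.
  by rewrite memNset// mul0r add0r mem_set ?mul1r//; split => //; rewrite unit_itvE.
have /(derivable_on01_has t01)/has_deriv01P hd := (EP t t01).1 Et.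
apply/cvgrPdist_le => e e0; have [del d0 H] := hd e e0.
near=> n.
rewrite /h !indicE mem_set// memNset ?mul0r ?addr0 ?mul1r; last by move=> [].
have n0 : 0 < n.+2%:R^-1 :> R by rewrite invr_gt0.
have n2 : n.+2%:R^-1 <= 2^-1 :> R by rewrite lef_pV2 ?posrE// ler_nat.
have nd : n.+2%:R^-1 < del.
  rewrite -[ltRHS]invrK ltf_pV2 ?posrE ?invr_gt0//.
  apply: (@lt_trans _ _ n%:R); last by rewrite ltr_nat.
  by near: n; exact: nbhs_infty_gtr.
have aux (x q : R) : 0 <= x -> x <= 2^-1 -> 0 <= q -> q <= 2^-1 -> 0 <= x + q <= 1.
  by move=> *; apply/andP; split; lra.
have aux' (x q : R) : x <= 1 -> 2^-1 < x -> 0 <= q -> q <= 2^-1 -> 0 <= x - q <= 1.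
  by move=> *; apply/andP; split; lra.
apply: H.
- move/andP: t01 => [t0 t1]; rewrite /s; case: ifP => [t2|/negbT]; last rewrite -ltNge => t2.
    by apply: aux => //; exact: ltW.
  by apply: aux' => //; exact: ltW.
- rewrite -subr_eq0 st; case: ifP => _; first by rewrite gt_eqF.
  by rewrite oppr_eq0 gt_eqF.
- rewrite st; case: ifP => _; first by rewrite gtr0_norm.
  by rewrite normrN gtr0_norm.
Unshelve. all: by end_near. Qed.

End derivative_measurable.

(** * Sobolev spaces *)

Section sobolev.
Context (R : realType) (m : nat).
Hypothesis m0 : (0 < m)%N.
Local Notation mu := (@lebesgue_measure R).
Implicit Types (f g x : R -> R) (c t : R).

Lemma ac_ext f g : (forall t, 0 <= t <= 1 -> f t = g t) ->
  absolutely_continuous01 f -> absolutely_continuous01 g.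
Proof.
move=> fg acf e e0; have [del d0 H] := acf e e0; exists del => // n u v uv ap l.
rewrite (le_lt_trans _ (H n u v uv ap l))// le_eqVlt; apply/orP; left; apply/eqP.
apply: eq_bigr => i _; have [u0 [uvi v1]] := uv i.
by rewrite !fg// ?u0 ?v1 ?(le_trans uvi)// (le_trans u0).
Qed.

Lemma deriv01n_lin f g c j t : Sobolev m f -> Sobolev m g -> (j < m)%N -> 0 <= t <= 1 ->
  deriv01n j (fun t => f t + c * g t) t = deriv01n j f t + c * deriv01n j g t.
Proof.
move=> [df _ _] [dg _ _]; elim: j t => [//|j ih] t jm t01.
have h : forall u : R, 0 <= u <= 1 -> deriv01n j (fun t => f t + c * g t) u = deriv01n j f u + c * deriv01n j g u.
  by move=> u u01; apply: ih => //; exact: ltnW.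
rewrite /deriv01n !iterS -!/(deriv01n _ _) (deriv01_ext h t01).
apply: has_deriv01_deriv => //; apply: has_deriv01_lin; apply: derivable_on01_has => //.
  by apply: df => //; rewrite unit_itvE.
by apply: dg => //; rewrite unit_itvE.
Qed.

(** Where a derivative of order [m] is missing, the default value of [deriv01] may break linearity.
    Such points are negligible, since the derivatives of order [m.-1] are absolutely continuous. *)
Lemma deriv01n_lin_ae f g c : Sobolev m f -> Sobolev m g ->
  {ae mu, forall t, res (deriv01n m (fun t => f t + c * g t)) t =
     res (fun t => deriv01n m f t + c * deriv01n m g t) t}.
Proof.
move=> sf sg; have [df acf _] := sf; have [dg acg _] := sg.
have mE : m = m.-1.+1 by rewrite prednK.
have m1 : (m.-1 < m)%N by rewrite prednK.
have aef := ae_open_unit (ac_derivable (acf _ m1)).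
have aeg := ae_open_unit (ac_derivable (acg _ m1)).
have n0 (a : R) : {ae mu, forall t : R, t != a}.
  exists [set a]; split => //; first by rewrite lebesgue_measure_set1.
  by move=> t /= /negP; rewrite negbK => /eqP.
have ends : {ae mu, forall t : R, t != 0 /\ t != 1}.
  have := n0 0; have := n0 1.
  by apply: filterS2; first exact: (ae_filter_ringOfSetsType mu).
move: aef aeg ends; apply: filterS3; first exact: (ae_filter_ringOfSetsType mu).
move=> t hf hg [t0 t1]; case: (boolP (0 <= t <= 1)) => t01; last by rewrite !res_out.
rewrite !res_in//.
have t01' : 0 < t < 1.
  by move/andP: t01 => [? ?]; rewrite !lt_neqAle eq_sym t0 t1 /=; apply/andP.
have h (u : R) : 0 <= u <= 1 -> deriv01n m.-1 (fun t => f t + c * g t) u = deriv01n m.-1 f u + c * deriv01n m.-1 g u.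
  by move=> u01; exact: deriv01n_lin.
rewrite mE /deriv01n !iterS -!/(deriv01n _ _) (deriv01_ext h t01).
apply: has_deriv01_deriv => //; apply: has_deriv01_lin; apply: derivable_on01_has => //.
  by apply: derivable_has_deriv01 => //; exact: hf.
by apply: derivable_has_deriv01 => //; exact: hg.
Qed.

(** The derivative of order [m] equals the combination of derivatives almost everywhere only, so its
    measurability is established separately, from the continuity of the derivative of order
    [m.-1]. *)
Lemma sobolev_lin f g c : Sobolev m f -> Sobolev m g -> Sobolev m (fun t => f t + c * g t).
Proof.
move=> sf sg; have [df acf lf] := sf; have [dg acg lg] := sg.
have acl j : (j < m)%N -> absolutely_continuous01 (deriv01n j (fun t => f t + c * g t)).
  move=> jm; apply: (@ac_ext (fun t => deriv01n j f t + c * deriv01n j g t)).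
    by move=> t t01; rewrite deriv01n_lin.
  by apply: ac_lin; [exact: acf|exact: acg].
split => //.
- move=> j jm t; rewrite unit_itvE => t01; apply/derivable_on01P => //.
  exists (deriv01 (deriv01n j f) t + c * deriv01 (deriv01n j g) t).
  apply: (@has_deriv01_ext _ (fun t => deriv01n j f t + c * deriv01n j g t)) => //.
    by move=> u u01; rewrite deriv01n_lin// ltnW.
  apply: has_deriv01_lin; apply: derivable_on01_has => //.
    by apply: df => //; rewrite unit_itvE.
  by apply: dg => //; rewrite unit_itvE.
- apply: (@L2_ae _ (fun t => deriv01n m f t + c * deriv01n m g t)).
  + exact: L2_lin.
  + have -> : m = m.-1.+1 by rewrite prednK.
    rewrite /deriv01n iterS; apply: measurable_deriv01.
    by apply: ac_clamp_continuous; apply: acl; rewrite prednK.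
  + have := deriv01n_lin_ae c sf sg; apply: filterS; first exact: (ae_filter_ringOfSetsType mu).
    by move=> t ->.
Qed.

Lemma sobolev_L2 f : Sobolev m f -> L2 f.
Proof. by move=> [_ h _]; exact: (ac_L2 (h 0 m0)). Qed.

Lemma sobolevL2 f : Sobolev m f -> L2 (deriv01n m f).
Proof. by case. Qed.

Lemma sobolev_continuous f : Sobolev m f -> continuous (f \o @clamp01 R).
Proof. by move=> [_ h _]; exact: (ac_clamp_continuous (h 0 m0)). Qed.

(** Written as [f - f], zero inherits membership by linearity, without a computation of its iterated
    derivatives. *)
Lemma sobolev0 f : Sobolev m f -> Sobolev m (fun=> 0 : R).
Proof.
move=> sf; have := sobolev_lin (-1) sf sf; congr (Sobolev m _).
by apply/funext => t; rewrite mulN1r subrr.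
Qed.

Lemma sobolevB f g : Sobolev m f -> Sobolev m g -> Sobolev m (f \- g).
Proof.
move=> sf sg; have := sobolev_lin (-1) sf sg; congr (Sobolev m _).
by apply/funext => t /=; rewrite mulN1r.
Qed.

Lemma JC f g : J m f g = J m g f. Proof. exact: ipC. Qed.

Lemma J_linl f g x c : Sobolev m f -> Sobolev m g -> Sobolev m x ->
  J m (fun t => f t + c * g t) x = J m f x + c * J m g x.
Proof.
move=> sf sg sx; rewrite /J -ip_linl; try exact: sobolevL2.
rewrite ipC [RHS]ipC; apply: ip_ae; try exact: sobolevL2.
- by apply: sobolevL2; exact: sobolev_lin.
- by apply: L2_lin; exact: sobolevL2.
- exact: deriv01n_lin_ae.
Qed.

Lemma J_linr f g x c : Sobolev m f -> Sobolev m g -> Sobolev m x ->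
  J m x (fun t => f t + c * g t) = J m x f + c * J m x g.
Proof. by move=> *; rewrite JC J_linl// (JC f) (JC g). Qed.

Lemma J_ge0 f : 0 <= J m f f. Proof. exact: ip_ge0. Qed.

Lemma J_cauchy_schwarz f g : Sobolev m f -> Sobolev m g ->
  J m f g ^+ 2 <= J m f f * J m g g.
Proof. by move=> sf sg; apply: ip_cauchy_schwarz; exact: sobolevL2. Qed.

Lemma J0r f : Sobolev m f -> J m f (fun=> 0) = 0.
Proof.
move=> sf; have := J_linr (-1) sf sf sf; rewrite mulN1r subrr => {2}<-.
by congr (J m f _); apply/funext => t; rewrite mulN1r subrr.
Qed.

Lemma sobolev_sum (N : nat) (c : nat -> R) (f : nat -> R -> R) :
  (forall i, (0 < i)%N -> Sobolev m (f i)) ->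
  Sobolev m (fun t => \sum_(1 <= i < N.+1) c i * f i t).
Proof.
move=> h; elim: N => [|N ih].
  under eq_fun do rewrite big_nil; exact: (sobolev0 (h 1 isT)).
by under eq_fun do rewrite big_nat_recr//=; apply: sobolev_lin => //; exact: h.
Qed.

Lemma J_sumr (N : nat) (c : nat -> R) (f : nat -> R -> R) x :
  (forall i, (0 < i)%N -> Sobolev m (f i)) -> Sobolev m x ->
  J m x (fun t => \sum_(1 <= i < N.+1) c i * f i t) = \sum_(1 <= i < N.+1) c i * J m x (f i).
Proof.
move=> h sx; elim: N => [|N ih].
  by rewrite big_nil; under eq_fun do rewrite big_nil; exact: J0r.
under eq_fun do rewrite big_nat_recr//=.
rewrite (J_linr (f := fun t => \sum_(1 <= i < N.+1) c i * f i t))//.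
- by rewrite ih [RHS]big_nat_recr.
- exact: sobolev_sum.
- exact: h.
Qed.

End sobolev.

(** * Identically distributed samples and conditional centering *)

Section markov.
Context d (T : measurableType d) (R : realType) (P : probability T R).

Lemma markov_itg (f : T -> R) (c e : R) : intg P f -> (forall w, 0 <= f w) -> 0 < c -> 0 < e ->
  itg P f <= c -> measurable [set w | c / e < f w] /\ (P [set w | (c / e < f w)%R] <= e%:E)%E.
Proof.
move=> hf f0 c0 e0 fc.
have mA : measurable [set w | c / e < f w].
  rewrite -[X in measurable X]setTI.
  have -> : [set w | c / e < f w] = f @^-1` `]c / e, +oo[%classic.
    by apply/seteqP; split => w /=; rewrite in_itv /= andbT.
  exact: (intg_meas hf).
split => //.
have iA : itg P (\1_[set w | c / e < f w]) = fine (P [set w | c / e < f w]).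
  by rewrite /itg /Rintegral integral_indic// ?setIT.
have PE : P [set w | c / e < f w] = (fine (P [set w | c / e < f w]))%:E.
  by rewrite fineK// fin_num_measure.
rewrite PE lee_fin -iA.
have ce : 0 < c / e by rewrite divr_gt0.
rewrite -(ler_pM2l ce) -itgZ; last exact: integrable_indic.
rewrite divfK ?gt_eqF//; apply: le_trans fc; apply: le_itg => //.
  by apply: intgZ; exact: integrable_indic.
move=> w; rewrite indicE; case: (boolP (w \in _)) => [|_]; last by rewrite mulr0.
by rewrite inE /= mulr1 => /ltW.
Qed.

(** The events [A N] increase with [N], so the bound on their probabilities passes to the union. One
    exceptional event thus serves all orders of truncation. *)
Lemma markov_nondecreasing (f : nat -> T -> R) (c e : R) :
  (forall N, intg P (f N)) -> (forall N w, 0 <= f N w) ->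
  (forall N w, f N w <= f N.+1 w) -> 0 < c -> 0 < e -> (forall N, itg P (f N) <= c) ->
  exists A, [/\ measurable A, (P A <= e%:E)%E & forall w, ~ A w -> forall N, f N w <= c / e].
Proof.
move=> hf f0 fS c0 e0 fc.
pose A N := [set w | c / e < f N w].
have mA N : measurable (A N) by have [] := markov_itg (hf N) (f0 N) c0 e0 (fc N).
exists (\bigcup_N A N); split.
- exact: bigcupT_measurable.
- have ndA : nondecreasing_seq A.
    apply/nondecreasing_seqP => N; apply/subsetPset => w /= h; exact: lt_le_trans (fS N w).
  have := nondecreasing_cvg_mu mA (bigcupT_measurable A mA) ndA => /(_ R P).
  move=> /cvg_lim <- //; apply: lime_le.
    by apply: ereal_nondecreasing_is_cvgn => x y xy; apply: le_measure; rewrite ?inE//; apply/subsetPset; exact: ndA.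
  by apply: nearW => N; have [] := markov_itg (hf N) (f0 N) c0 e0 (fc N).
- by move=> w h N; rewrite leNgt; apply/negP => H; apply: h; exists N.
Qed.

End markov.

(** * Transfer of expectations between equally distributed variables, and conditional centering *)

Section law.
Context d (T : measurableType d) (R : realType) (P : probability T R).

Lemma law_itg dO (O : measurableType dO) (Z Z' : T -> O) (h : O -> R) :
  measurable_fun setT Z -> measurable_fun setT Z' -> same_law P Z Z' ->
  measurable_fun setT h -> intg P (h \o Z') ->
  intg P (h \o Z) /\ itg P (h \o Z) = itg P (h \o Z').
Proof.
move=> mZ mZ' l mh ih.
have E A : measurable A -> pushm P mZ A = pushm P mZ' A by move=> mA; exact: l.
have mh' : measurable_fun setT (EFin \o h) by exact/measurable_EFinP.
have i1 : P.-integrable setT ((EFin \o h) \o Z).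
  apply/integrableP; split; first exact: measurableT_comp.
  move/integrableP : ih => [_]; apply: le_lt_trans; rewrite le_eqVlt; apply/orP; left.
  apply/eqP; transitivity (\int[pushm P mZ]_z `|(EFin \o h) z|)%E.
    by rewrite ge0_integral_pushforward//; exact: measurableT_comp.
  rewrite (eq_measure_integral (pushm P mZ')); last by move=> A mA _; exact: E.
  by rewrite ge0_integral_pushforward//; exact: measurableT_comp.
split; first exact: i1.
congr fine; transitivity (\int[pushm P mZ]_z (EFin \o h) z)%E.
  by rewrite (integral_pushforward mZ).
rewrite (eq_measure_integral (pushm P mZ')); last by move=> A mA _; exact: E.
by rewrite (integral_pushforward mZ').
Qed.

Lemma itg_indicator_itv (c : R) : 0 <= c ->
  intg (@lebesgue_measure R) (\1_(`[0, c[%classic : set R)) /\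
  itg (@lebesgue_measure R) (\1_(`[0, c[%classic : set R)) = c.
Proof.
move=> c0; split; first exact: integrable_indic_itv.
rewrite /itg /Rintegral integral_indic//= setIT lebesgue_measure_itv /= lte_fin.
by case: ltP => h /=; [rewrite oppr0 addr0|apply/eqP; rewrite eq_le c0].
Qed.

(* Layer-cake: [psi (X w)] is the integral over [s >= 0] of the indicators of
   [s < psi (X w)], and Fubini reduces the claim to those. *)
Lemma condexp0_mul_ge0 dS (S : measurableType dS) (X : T -> S) (U : T -> R) (psi : S -> R) :
  measurable_fun setT X -> intg P U ->
  (forall A, measurable A -> itg P (fun w => U w * \1_A (X w)) = 0) ->
  measurable_fun setT psi -> (forall x, 0 <= psi x) ->
  intg P (fun w => U w * psi (X w)) -> itg P (fun w => U w * psi (X w)) = 0.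
Proof.
move=> mX iU hU mpsi p0 iUp.
have mU := intg_meas iU.
pose q (p : measurableTypeR R) (w : T) : R := \1_(`[0, psi (X w)[%classic : set R) p.
have qE s w : q s w = if (0 <= s) && (s < psi (X w)) then 1 else 0.
  rewrite /q indicE; case: ifP => h; first by rewrite mem_set//= in_itv.
  by rewrite memNset//= in_itv /= h.
have mq : measurable_fun setT (fun z : T * measurableTypeR R => q z.2 z.1).
  have -> : (fun z : T * measurableTypeR R => q z.2 z.1) =
    (fun z => if (0 <= z.2) && (z.2 < psi (X z.1)) then 1 else 0).
    by apply/funext => z; rewrite qE.
  apply: measurable_fun_ifT => //; apply: measurable_and.
    exact: measurable_fun_ler.
  apply: measurable_fun_ltr => //.
  by apply: (measurableT_comp mpsi); exact: measurableT_comp.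
have q0 s w : 0 <= q s w by rewrite qE; case: ifP.
pose f (w : T) (s : measurableTypeR R) := U w * q s w.
have [iq eq] : (forall w, intg (@lebesgue_measure R) (fun s => q s w)) /\
    (forall w, itg (@lebesgue_measure R) (fun s => q s w) = psi (X w)).
  by split => w; have [] := itg_indicator_itv (p0 (X w)).
have ifw w : intg (@lebesgue_measure R) (f w) by exact: intgZ.
have ifs s : intg P (f^~ s).
  apply: (@intg_le _ _ _ P (fun w => `|U w|)).
  - apply: measurable_funM => //.
    exact: (measurableT_comp mq (measurable_pair2 s)).
  - move=> w; rewrite /f normrM (ger0_norm (q0 _ _)) ler_piMr// qE; by case: ifP.
  - exact: intg_norm.
have if2 : intg (P \x (@lebesgue_measure R))%E (fun z => f z.1 z.2).
  apply: (@intg_prod12 _ _ _ _ _ _ _ f (fun w => `|U w * psi (X w)|)).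
  - by apply: measurable_funM => //; exact: measurableT_comp.
  - exact: ifw.
  - move=> w; under eq_fun do rewrite /f normrM (ger0_norm (q0 _ _)).
    by rewrite itgZ// eq normrM (ger0_norm (p0 _)).
  - exact: intg_norm.
transitivity (itg P (fun w => itg (@lebesgue_measure R) (f w))).
  by congr itg; apply/funext => w; rewrite /f itgZ// eq.
rewrite (itg_fubini if2)//.
rewrite -[RHS](itg0 (@lebesgue_measure R)); congr itg; apply/funext => s.
case: (leP 0 s) => s0; last first.
  rewrite -[RHS](itg0 P); congr itg; apply/funext => w.
  by rewrite /f qE leNgt s0 /= mulr0.
rewrite -(hU [set x | s < psi x]).
  congr itg; apply/funext => w; rewrite /f qE s0 indicE /=.
  by case: ifP => h; [rewrite mem_set|rewrite memNset//= h].
rewrite -[X in measurable X]setTI.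
have -> : [set x | s < psi x] = psi @^-1` `]s, +oo[%classic.
  by apply/seteqP; split => w /=; rewrite in_itv /= andbT.
exact: mpsi.
Qed.

Lemma condexp0_mul dS (S : measurableType dS) (X : T -> S) (U : T -> R) (psi : S -> R) :
  measurable_fun setT X -> intg P U ->
  (forall A, measurable A -> itg P (fun w => U w * \1_A (X w)) = 0) ->
  measurable_fun setT psi ->
  intg P (fun w => U w * psi (X w)) -> itg P (fun w => U w * psi (X w)) = 0.
Proof.
move=> mX iU hU mpsi iUp.
pose p1 x := Num.max (psi x) 0; pose p2 x := Num.max (- psi x) 0.
have m1 : measurable_fun setT p1 by exact: measurable_maxr.
have m2 : measurable_fun setT p2 by apply: measurable_maxr => //; exact: measurableT_comp.
have p1n x : `|p1 x| <= `|psi x| by rewrite /p1; case: (leP (psi x) 0) => h; rewrite ?normr0.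
have p2n x : `|p2 x| <= `|psi x|.
  by rewrite /p2; case: (leP (- psi x) 0) => h; rewrite ?normr0// normrN.
have i12 (p : S -> R) : measurable_fun setT p -> (forall x, `|p x| <= `|psi x|) -> intg P (fun w => U w * p (X w)).
  move=> mp pn; apply: (@intg_le _ _ _ P (fun w => `|U w * psi (X w)|)).
  - apply: measurable_funM; first exact: intg_meas iU.
    exact: measurableT_comp mp mX.
  - by move=> w; rewrite !normrM ler_wpM2l.
  - exact: intg_norm.
have pE x : psi x = p1 x - p2 x.
  by rewrite /p1 /p2; case: (leP (psi x) 0) => h; case: (leP (- psi x) 0) => h'; lra.
under eq_fun do rewrite pE mulrBr.
rewrite itgB; [|exact: i12..].
rewrite !condexp0_mul_ge0 ?subr0//; try exact: i12.
  by move=> x; rewrite /p2 le_max lexx orbT.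
by move=> x; rewrite /p1 le_max lexx orbT.
Qed.

End law.

(** * Averages over an independent sample *)

Section iid.
Context d (T : measurableType d) (R : realType) (P : probability T R).
Context dO (O : measurableType dO) (o : T -> O) (os : nat -> T -> O).
Hypothesis mo : measurable_fun setT o.
Hypothesis mos : forall i, measurable_fun setT (os i).
Hypothesis ind : mutually_independent P os.
Hypothesis law : forall i, same_law P (os i) o.

Definition avg (h : O -> R) (n : nat) (w : T) : R := n%:R^-1 * \sum_(i < n) h (os i w).

Let pre (A : set O) i : measurable A -> measurable (os i @^-1` A).
Proof. by move=> mA; rewrite -[X in measurable X]setTI; exact: mos. Qed.

Lemma pairwise_indep i j (A B : set O) : i != j -> measurable A -> measurable B ->
  P (os i @^-1` A `&` os j @^-1` B) = (P (os i @^-1` A) * P (os j @^-1` B))%E.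
Proof.
move=> ij mA mB.
pose n := (maxn i j).+1; pose C k : set O := if k == i then A else if k == j then B else setT.
have ni : (i < n)%N by rewrite ltnS leq_maxl.
have nj : (j < n)%N by rewrite ltnS leq_maxr.
have mC k : measurable (C k) by rewrite /C; case: ifP => // _; case: ifP.
have := ind n mC; rewrite (_ : \bigcap_(k in _) _ = os i @^-1` A `&` os j @^-1` B).
  move=> ->; rewrite (bigD1 (Ordinal ni))//= (bigD1 (Ordinal nj))//=; last first.
    by rewrite -val_eqE /= eq_sym.
  rewrite big1 ?mule1; first by rewrite /C eqxx eq_sym (negbTE ij) eqxx.
  move=> k /andP[ki kj]; rewrite /C; rewrite -val_eqE /= in ki; rewrite -val_eqE /= in kj.
  by rewrite (negbTE ki) (negbTE kj) preimage_setT probability_setT.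
apply/seteqP; split => w /=.
  move=> h; have := h i ni; have := h j nj; rewrite /C eqxx eq_sym (negbTE ij) => hj.
  by rewrite eqxx.
move=> [hA hB] k _; rewrite /C; case: eqP => [->//|_]; by case: eqP => [->|].
Qed.

Lemma row_independent_iid n (psi : O -> R) : measurable_fun setT psi ->
  row_independent P n (fun i => psi \o os i).
Proof.
move=> mpsi A mA; apply: (ind n (A := fun i => psi @^-1` A i)) => i.
by rewrite -[X in measurable X]setTI; exact: mpsi.
Qed.

Lemma iid_itg i (h : O -> R) : measurable_fun setT h -> intg P (h \o o) ->
  intg P (h \o os i) /\ itg P (h \o os i) = itg P (h \o o).
Proof. by move=> mh ih; exact: law_itg. Qed.

(** Pairwise independence and centering remove the off-diagonal terms of the double sum. *)
Lemma avg_sqr h n : measurable_fun setT h -> intg P (h \o o) -> itg P (h \o o) = 0 ->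
  intg P (fun w => h (o w) ^+ 2) -> (0 < n)%N ->
  intg P (fun w => avg h n w ^+ 2) /\
  itg P (fun w => avg h n w ^+ 2) = n%:R^-1 * itg P (fun w => h (o w) ^+ 2).
Proof.
move=> mh ih h0 ih2 n0.
have mh2 : measurable_fun setT (fun x => h x ^+ 2) by exact: measurable_funX.
have hij i j : intg P (fun w => h (os i w) * h (os j w)) /\
    itg P (fun w => h (os i w) * h (os j w)) = (i == j)%:R * itg P (fun w => h (o w) ^+ 2).
  case: (eqVneq i j) => [<-|ij].
    by under eq_fun do rewrite -expr2; rewrite mul1r; exact: (iid_itg i mh2 ih2).
  have [i1 e1] := iid_itg i mh ih; have [i2 e2] := iid_itg j mh ih.
  have [iij eij] := indep_itgM (mos i) (mos j) (fun A B mA mB => pairwise_indep ij mA mB) mh mh i1 i2.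
  by split => //; rewrite eij e1 h0 !mul0r.
have E w : avg h n w ^+ 2 = n%:R^-1 ^+ 2 * \sum_(i < n) \sum_(j < n) h (os i w) * h (os j w).
  by rewrite /avg exprMn [X in _ * X]expr2 mulr_suml; congr (_ * _); apply: eq_bigr => i _; rewrite mulr_sumr.
have iS : intg P (fun w => \sum_(i < n) \sum_(j < n) h (os i w) * h (os j w)).
  by apply: intg_sum => i; apply: intg_sum => j; have [] := hij i j.
split; first by under eq_fun do rewrite E; exact: intgZ.
under eq_fun do rewrite E.
rewrite itgZ// itg_sum; last by move=> i; apply: intg_sum => j; have [] := hij i j.
rewrite (eq_bigr (fun=> itg P (fun w => h (o w) ^+ 2))); last first.
  move=> i _; rewrite itg_sum; last by move=> j; have [] := hij i j.
  rewrite (bigD1 i)//= big1 ?addr0; first by have [_ ->] := hij i i; rewrite eqxx mul1r.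
  by move=> j ji; have [_ ->] := hij i j; rewrite -val_eqE /= eq_sym in ji; rewrite (negbTE ji) mul0r.
rewrite sumr_const card_ord -[X in _ * X]mulr_natl mulrA expr2 -(mulrA n%:R^-1).
by rewrite mulVf ?mulr1// pnatr_eq0 -lt0n.
Qed.

End iid.

(** * The criterion function *)

Section caratheodory.
Context d (T : measurableType d) (R : realType).

(** Rounding the second argument down to multiples of [1 / k.+1] leaves countably many values, for
    each of which measurability in the first argument suffices; continuity gives the limit in
    [k]. *)
Lemma caratheodory_measurable (g : T -> R -> R) : (forall a, measurable_fun setT (g^~ a)) ->
  (forall y, continuous (g y)) -> measurable_fun setT (fun p : T * measurableTypeR R => g p.1 p.2).
Proof.
move=> mg cg.
pose q (k : nat) (a : R) : R := (Num.floor (k.+1%:R * a))%:~R / k.+1%:R.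
apply: (@measurable_fun_cvg _ _ _ setT (fun k p => g p.1 (q k p.2))); last first.
  move=> p _; apply: (@cvg_comp _ _ _ (fun k => q k p.2) (g p.1) _ (nbhs p.2)); last exact: cg.
  apply/cvgrPdist_le => e e0; near=> k.
  have k0 : 0 < k.+1%:R :> R by [].
  have /andP[f1 f2] := floor_itv (k.+1%:R * p.2).
  rewrite intrD in f2.
  have -> : p.2 - q k p.2 = (k.+1%:R * p.2 - (Num.floor (k.+1%:R * p.2))%:~R) / k.+1%:R.
    by rewrite /q mulrBl mulrAC divff ?mul1r// gt_eqF.
  rewrite normrM normfV (gtr0_norm k0) ger0_norm ?subr_ge0// ler_pdivrMr//.
  apply: (@le_trans _ _ 1); first by rewrite lerBlDl ltW.
  rewrite mulrC -ler_pdivrMr// div1r.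
  apply: (@le_trans _ _ k%:R); last by rewrite ler_nat.
  by near: k; exact: nbhs_infty_ger.
move=> k _ B mB; rewrite setTI.
(* The integers are enumerated by [unpickle]; numbers that code none contribute the empty set. *)
pose A (n : nat) : set (T * measurableTypeR R) := if unpickle n is Some z then
  [set p | Num.floor (k.+1%:R * p.2) = z /\ B (g p.1 (z%:~R / k.+1%:R))] else set0.
have -> : (fun p : T * measurableTypeR R => g p.1 (q k p.2)) @^-1` B = \bigcup_n A n.
  apply/seteqP; split => p /=.
    move=> Bp; set z := Num.floor (k.+1%:R * p.2).
    have [n nE] : exists n, unpickle n = Some z by exists (pickle z); rewrite pickleK.
    by exists n; first exact: I; rewrite /A nE.
  by move=> [n _]; rewrite /A; case: unpickle => // z [<-].
apply: bigcupT_measurable => n; rewrite /A; case: unpickle => [z|]; last exact: measurable0.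
have -> : [set p : T * measurableTypeR R | Num.floor (k.+1%:R * p.2) = z /\ B (g p.1 (z%:~R / k.+1%:R))]
  = (fun p => (z%:~R <= k.+1%:R * p.2) && (k.+1%:R * p.2 < (z + 1)%:~R)) @^-1` [set true]
    `&` (fun p => g p.1 (z%:~R / k.+1%:R)) @^-1` B.
  apply/seteqP; split => p /=.
    by move=> [<- Bp]; rewrite floor_itv.
  by move=> [h Bp]; split => //; apply: floor_def.
apply: measurableI.
  rewrite -[X in measurable X]setTI.
  have : measurable_fun setT (fun p : T * measurableTypeR R =>
      (z%:~R <= k.+1%:R * p.2) && (k.+1%:R * p.2 < (z + 1)%:~R)).
    apply: measurable_and.
      by apply: measurable_fun_ler => //; apply: measurable_funM.
    by apply: measurable_fun_ltr => //; apply: measurable_funM.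
  by apply.
rewrite -[X in measurable X]setTI.
have : measurable_fun setT (fun p : T * measurableTypeR R => g p.1 (z%:~R / k.+1%:R)).
  exact: (measurableT_comp (mg _)).
by apply.
Unshelve. all: by end_near. Qed.

End caratheodory.

(** * Measurability and Taylor expansion of the criterion *)

Section smooth_criterion.
Context (R : realType) (G : R -> R -> R).
Hypothesis mG : forall a, measurable_fun setT (fun y => G y a).
Hypothesis dG : forall y j, (j < 3)%N -> forall a : R, derivable (derive1n j (G y)) a 1.
Hypothesis cG3 : forall y, continuous (derive1n 3 (G y)).

Lemma criterion_continuous y j : (j <= 3)%N -> continuous (derive1n j (G y)).
Proof.
rewrite leq_eqVlt => /orP[/eqP ->|j3] => //.
by move=> x; apply: differentiable_continuous; apply/derivable1_diffP; exact: dG.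
Qed.

Lemma criterion_derive (y : R) j (a : R) : (j < 3)%N ->
  is_derive a (1 : R) (derive1n j (G y)) (derive1n j.+1 (G y) a).
Proof. by move=> j3; rewrite derive1nS derive1E; apply: DeriveDef; first exact: dG. Qed.

(** A derivative in [a] is the limit of difference quotients along the steps [1 / k.+1], each
    measurable in [y] by induction. *)
Lemma measurable_criterion_fixed j (a : R) : (j <= 3)%N ->
  measurable_fun setT (fun y => derive1n j (G y) a).
Proof.
elim: j a => [|j ih] a j3; first exact: mG.
pose u (k : nat) : R := k.+1%:R^-1.
have u0 k : u k != 0 by rewrite /u invr_eq0.
have uc : u @ \oo --> (0 : R)^'.
  move=> A /= /nbhs_ballP[e /= e0 he]; suff : \forall k \near \oo, A (u k) by [].
  near=> k; apply: he => //.
  rewrite /ball /= sub0r normrN gtr0_norm ?invr_gt0// /u -[ltRHS]invrK ltf_pV2 ?posrE ?invr_gt0//.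
  apply: (@lt_trans _ _ k%:R); last by rewrite ltr_nat.
  by near: k; exact: nbhs_infty_gtr.
apply: (@measurable_fun_cvg _ _ _ setT (fun k y => (u k)^-1 * (derive1n j (G y) (u k + a) - derive1n j (G y) a))).
  move=> k; apply: measurable_funM => //; by apply: measurable_funB; exact: (ih _ (ltnW j3)).
move=> y _.
rewrite derive1nS /derive1.
have : cvg ((fun h => h^-1 *: (derive1n j (G y) (h + a) - derive1n j (G y) a)) @ (0 : R)^').
  have := @dG y j j3 a; rewrite /derivable.
  by under [X in cvg (X @ _) -> _]eq_fun do rewrite /= [_%:A](mulr1).
exact: cvg_comp uc.
Unshelve. all: by end_near. Qed.

Lemma measurable_criterion j : (j <= 3)%N ->
  measurable_fun setT (fun p : measurableTypeR R * measurableTypeR R => derive1n j (G p.1) p.2).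
Proof.
move=> j3; apply: (@caratheodory_measurable _ (measurableTypeR R) _ (fun y => derive1n j (G y))).
  by move=> a; exact: measurable_criterion_fixed.
by move=> y; exact: criterion_continuous.
Qed.

(** By continuity in [a] the supremum may be taken over the rationals; as a countable one it is
    measurable in [y]. Numbers that code no rational are sent to 0. *)
Lemma sup_deriv_ell_rat (j : nat) y : (j <= 3)%N ->
  sup_deriv_ell G j y = esups (fun n => `|derive1n j (G y) (if unpickle n is Some q then ratr (q : rat) else 0)|%:E) 0.
Proof.
move=> j3; rewrite /sup_deriv_ell /esups /sdrop /=; apply/eqP; rewrite eq_le; apply/andP; split.
  apply: ge_ereal_sup => _ [a _ <-].
  rewrite leNgt; apply/negP => h.
  set s := ereal_sup _ in h.
  have [r sr] : exists r : R, s = r%:E.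
    have : (0 <= s)%E.
      apply: (@le_trans _ _ (`|derive1n j (G y) (if unpickle 0 is Some q then ratr (q : rat) else 0)|%:E)); first by rewrite lee_fin.
      by apply: ereal_sup_ubound; exists 0%N.
    by move: h; case: s => // r _ _; exists r.
  rewrite sr lte_fin in h.
  have : \forall x \near a, r < `|derive1n j (G y) x|.
    have cg : `|derive1n j (G y) x| @[x --> a] --> `|derive1n j (G y) a|.
      by apply: cvg_norm; exact: criterion_continuous.
    exact: (cvgr_gt _ cg _ h).
  move=> /nbhs_ballP[e /= e0 he].
  have [x [xb [q _ qx]]] := dense_rat (ex_intro _ a (ballxx a e0)) (ball_open a e).
  have := he x xb; rewrite ltNge => /negP; apply.
  have [n nE] : exists n, unpickle n = Some q by exists (pickle q); rewrite pickleK.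
  rewrite -lee_fin -sr; apply: ereal_sup_ubound; exists n; first exact: leq0n.
  by rewrite nE qx.
apply: ge_ereal_sup => _ [n _ <-]; apply: ereal_sup_ubound.
by exists (if unpickle n is Some q then ratr (q : rat) else 0).
Qed.

Lemma measurable_sup_deriv_ell j : (j <= 3)%N -> measurable_fun setT (fun y => sup_deriv_ell G j y).
Proof.
move=> j3; under eq_fun do rewrite sup_deriv_ell_rat//.
apply: (@measurable_fun_esups _ _ _ setT (fun n y => `|derive1n j (G y) (if unpickle n is Some q then ratr (q : rat) else 0)|%:E)).
move=> n; apply/measurable_EFinP; apply: measurableT_comp => //.
exact: measurable_criterion_fixed.
Qed.

Lemma lipschitz_derive (f df : R -> R) (K x y : R) : (forall z, is_derive z (1 : R) f (df z)) ->
  (forall z, `|z - x| <= `|y - x| -> `|df z| <= K) -> `|f y - f x| <= K * `|y - x|.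
Proof.
move=> hf hK.
have cf : continuous f.
  move=> z; apply: differentiable_continuous; apply/derivable1_diffP.
  exact: (@ex_derive _ _ _ _ _ _ _ (hf z)).
have [xy|/ltW yx] := leP x y.
  have [c] := MVT_segment xy (fun z _ => hf z) (continuous_subspaceT cf).
  rewrite in_itv /= => /andP[xc cy] ->; rewrite normrM ler_wpM2r//; apply: hK.
  by rewrite !ger0_norm ?subr_ge0// lerB.
have [c] := MVT_segment yx (fun z _ => hf z) (continuous_subspaceT cf).
rewrite in_itv /= => /andP[yc cx] E; rewrite distrC E normrM (distrC x y) ler_wpM2r//; apply: hK.
by rewrite !ler0_norm ?subr_le0// !opprB lerB.
Qed.

(** The mean value inequality is applied to the first derivative minus its linear part at [eta]; the
    derivative of this difference is at most [K * |g|] between [eta] and [eta + g]. Hence [K]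
    instead of the optimal [K / 2]. *)
Lemma criterion_taylor (y eta g K : R) : (forall a, `|derive1n 3 (G y) a| <= K) ->
  `|derive1n 1 (G y) (eta + g) - derive1n 1 (G y) eta - derive1n 2 (G y) eta * g| <= K * g ^+ 2.
Proof.
move=> hK; pose f x := derive1n 1 (G y) x - derive1n 2 (G y) eta * x.
have hf z : is_derive z (1 : R) f (derive1n 2 (G y) z - derive1n 2 (G y) eta).
  have h1 := criterion_derive y z (isT : (1 < 3)%N).
  have h2 : is_derive z (1 : R) (fun x : R => derive1n 2 (G y) eta * x) (derive1n 2 (G y) eta).
    have := @is_deriveZ _ _ _ id (derive1n 2 (G y) eta) z 1 1 (is_derive_id z 1).
    by rewrite [_ *: 1]mulr1.
  exact: is_deriveB.
have := @lipschitz_derive f _ (K * `|g|) eta (eta + g) hf.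
rewrite addrC addKr /f => h.
apply: (le_trans _ (le_trans (h _) _)).
- by rewrite le_eqVlt; apply/orP; left; apply/eqP; congr `|_|; ring.
- move=> z zg.
  have := @lipschitz_derive (derive1n 2 (G y)) (derive1n 3 (G y)) K eta z
    (fun z => criterion_derive y z (isT : (2 < 3)%N)) (fun z _ => hK z).
  move/le_trans; apply; apply: ler_wpM2l => //.
  exact: (le_trans (normr_ge0 _) (hK 0)).
- by rewrite -mulrA -normrM -expr2 ger0_norm// sqr_ge0.
Qed.

End smooth_criterion.

(** * Variables with finite moments of all orders *)

Section moments.
Context d (T : measurableType d) (R : realType) (P : probability T R).

Definition all_moments (f : T -> R) : Prop :=
  measurable_fun setT f /\ forall k : nat, intg P (fun w => `|f w| ^+ k).

Lemma all_moments_le (f g : T -> R) : measurable_fun setT f -> (forall w, `|f w| <= `|g w|) ->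
  all_moments g -> all_moments f.
Proof.
move=> mf fg [_ hg]; split => // k; apply: (@intg_le _ _ _ P (fun w => `|g w| ^+ k)) => //.
  by apply: measurable_funX; exact: measurableT_comp.
move=> w; rewrite ger0_norm ?exprn_ge0//.
by apply: lerXn2r; rewrite ?nnegrE ?fg.
Qed.

Lemma all_momentsD f g : all_moments f -> all_moments g -> all_moments (fun w => f w + g w).
Proof.
move=> [mf hf] [mg hg]; have mfg : measurable_fun setT (fun w => f w + g w) by exact: measurable_funD.
split => // k.
apply: (@intg_le _ _ _ P (fun w => 2 ^+ k * (`|f w| ^+ k + `|g w| ^+ k))).
- by apply: measurable_funX; exact: measurableT_comp.
- move=> w; rewrite ger0_norm ?exprn_ge0//.
  have h (x y : R) : 0 <= x -> x <= y -> (x + y) ^+ k <= 2 ^+ k * (x ^+ k + y ^+ k).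
    move=> x0 xy; have y0 := le_trans x0 xy.
    apply: (@le_trans _ _ ((2 * y) ^+ k)).
      by apply: lerXn2r; rewrite ?nnegrE ?addr_ge0 ?mulr_ge0//; lra.
    by rewrite exprMn ler_wpM2l ?exprn_ge0// lerDr exprn_ge0.
  apply: (@le_trans _ _ ((`|f w| + `|g w|) ^+ k)).
    by apply: lerXn2r; rewrite ?nnegrE ?addr_ge0// ler_normD.
  have [fg|/ltW gf] := leP `|f w| `|g w|; first exact: h.
  by rewrite addrC [X in _ * X]addrC; exact: h.
- by apply: intgZ; exact: intgD.
Qed.

Lemma all_moments_cst (c : R) : all_moments (fun=> c).
Proof. by split => // k; exact: intg_cst. Qed.

Lemma all_moments_norm f : all_moments f -> all_moments (fun w => `|f w|).
Proof.
move=> h; apply: (all_moments_le _ _ h).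
  by case: h => mf _; exact: measurableT_comp.
by move=> w; rewrite normr_id.
Qed.

(** From [x ^+ k / k! <= expR x] at [x = s * |f w|]. *)
Lemma exp_all_moments (f : T -> R) (s : R) : 0 < s -> measurable_fun setT f ->
  (\int[P]_w (expR (s * `|f w|))%:E < +oo)%E -> all_moments f.
Proof.
move=> s0 mf h; split => // k.
have ie : intg P (fun w => expR (s * `|f w|)).
  apply: intgP_ge0; [|by move=> w; exact: expR_ge0|exact: h].
  by apply: measurableT_comp => //; apply: measurable_funM => //; exact: measurableT_comp.
apply: (@intg_le _ _ _ P (fun w => (k`!%:R / s ^+ k) * expR (s * `|f w|))).
- by apply: measurable_funX; exact: measurableT_comp.
- move=> w; rewrite ger0_norm ?exprn_ge0// mulrAC ler_pdivlMr ?exprn_gt0// mulrC -exprMn.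
  have sf0 : 0 <= s * `|f w| by rewrite mulr_ge0// ltW.
  case: k => [|k]; first by rewrite expr0 fact0 mul1r -expR0 ler_expR.
  have := expR_ge1Dxn k sf0; rewrite -ler_pdivrMl ?ltr0n ?fact_gt0// mulrC.
  by move=> h'; apply: le_trans h'; rewrite lerDr.
- exact: intgZ.
Qed.

End moments.

(** * The covariate process and its covariance form *)

Section process.
Context d (T : measurableType d) (R : realType) (P : probability T R).
Local Notation mu := (@lebesgue_measure R).
Variable X : T -> R -> R.
Hypothesis rX : random_process X.

Lemma process_L2 w : L2 (X w). Proof. by case: rX. Qed.

Lemma measurable_process :
  measurable_fun setT (fun p : T * measurableTypeR R => res (X p.1) p.2).
Proof.
have mE : measurable ([set: T] `*` (@unit_itv R)).
  by apply: measurableX => //; exact: measurable_unit.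
have := rX.1; move/(measurable_restrictT _ mE).
congr (measurable_fun _ _); apply/funext => -[w t] /=.
rewrite patchE; case: (boolP (0 <= t <= 1)) => h.
  by rewrite mem_set ?res_in//; split => //; rewrite unit_itvE.
by rewrite memNset ?res_out//= => -[_]; rewrite unit_itvE (negbTE h).
Qed.

Lemma measurable_res_process t : measurable_fun setT (fun w => res (X w) t).
Proof. exact: (measurableT_comp measurable_process (measurable_pair2 t)). Qed.

Lemma measurable_ip_process b : L2 b -> measurable_fun setT (fun w => ip (X w) b).
Proof.
move=> lb; under eq_fun do rewrite ipE.
apply: (@measurable_itg_l _ _ T (measurableTypeR R) R mu (fun w t => res (X w) t * res b t)).
apply: measurable_funM; first exact: measurable_process.
by apply: measurableT_comp => //; exact: L2_meas.
Qed.

Lemma measurable_ipXX : measurable_fun setT (fun w => ip (X w) (X w)).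
Proof.
under eq_fun do rewrite ipE.
apply: (@measurable_itg_l _ _ T (measurableTypeR R) R mu (fun w t => res (X w) t * res (X w) t)).
by apply: measurable_funM; exact: measurable_process.
Qed.

Lemma measurable_path : measurable_fun setT (X : T -> pathType R).
Proof.
apply: (@measurability _ _ T (pathType R) setT X (@cylinder R)) => // _ [_ [b lb [D mD ->]] <-].
rewrite setTI; have -> : X @^-1` [set x | D (ip x b)] = (fun w => ip (X w) b) @^-1` D by [].
by rewrite -[X in measurable X]setTI; exact: (measurable_ip_process lb).
Qed.

Lemma measurable_obs (Y : T -> R) : measurable_fun setT Y -> measurable_fun setT (obs Y X).
Proof. by move=> mY; apply: measurable_fun_pair => //; exact: measurable_path. Qed.

End process.

Lemma measurable_ip_path (R : realType) (b : R -> R) : L2 b ->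
  measurable_fun setT (fun x : pathType R => ip x b).
Proof.
move=> lb _ D mD; rewrite setTI; apply: sub_sigma_algebra.
by exists b => //; exists D.
Qed.

Section covariance.
Context d (T : measurableType d) (R : realType) (P : probability T R).
Local Notation mu := (@lebesgue_measure R).
Variables (X : T -> R -> R) (B : pathType R -> R) (C2 : R).
Hypothesis rX : random_process X.
Hypothesis mB : measurable_fun setT B.
Hypothesis C20 : 0 < C2.
Hypothesis hB : {ae P, forall w, C2^-1 <= B (X w) <= C2}.
Hypothesis hBX : forall t, unit_itv t -> ('E_P[fun w => (B (X w) * X w t)%R] = 0)%E.
Hypothesis hXX : forall s t, unit_itv s -> unit_itv t ->
  intg P (fun w => B (X w) * X w s * X w t).
Hypothesis momX : intg P (fun w => ip (X w) (X w)).

(** The bounds on [B] hold almost surely along [X] only. Clipping makes them hold everywhere without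
    changing expectations along [X]. *)
Definition Bclip (x : pathType R) : R := Num.max C2^-1 (Num.min (B x) C2).

Lemma Bclip_itv x : C2^-1 <= C2 -> C2^-1 <= Bclip x <= C2.
Proof. by move=> h; rewrite /Bclip le_max lexx /= ge_max h ge_min lexx orbT. Qed.

(** Otherwise no value satisfies both bounds on [B], and the almost sure bound fails everywhere. *)
Lemma C2_ge : C2^-1 <= C2.
Proof.
have [N [mN N0 hN]] := hB; rewrite leNgt; apply/negP => h.
have : P setT = 0.
  apply: (subset_measure0 measurableT mN _ N0) => w _; apply: hN => /= /andP[h1 h2].
  by have := le_trans h1 h2; rewrite leNgt h.
by rewrite probability_setT => /eqP; rewrite onee_eq0.
Qed.

Local Notation Bc w := (Bclip (X w)).

Lemma Bclip_ge0 x : 0 <= Bclip x.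
Proof. by rewrite /Bclip le_max invr_ge0 ltW. Qed.

Lemma Bclip_le x : Bclip x <= C2.
Proof. by have /andP[] := Bclip_itv x C2_ge. Qed.

Lemma Bclip_ge x : C2^-1 <= Bclip x.
Proof. by have /andP[] := Bclip_itv x C2_ge. Qed.

Lemma measurable_Bclip : measurable_fun setT Bclip.
Proof. by apply: measurable_maxr => //; exact: measurable_minr. Qed.

Lemma measurable_BclipX : measurable_fun setT (fun w => Bc w).
Proof. exact: (measurableT_comp measurable_Bclip (measurable_path rX)). Qed.

Lemma ae_BclipX : {ae P, forall w, B (X w) = Bc w}.
Proof.
move: hB; apply: filterS => w /andP[h1 h2].
by rewrite /Bclip (min_idPl h2) (max_idPr h1).
Qed.

Lemma measurable_BX : measurable_fun setT (fun w => B (X w)).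
Proof. exact: (measurableT_comp mB (measurable_path rX)). Qed.

Local Notation x_ w t := (res (X w) t).

Lemma res_process w (t : R) : unit_itv t -> x_ w t = X w t.
Proof. by rewrite unit_itvE => h; rewrite res_in. Qed.

Lemma intg_Bc (H : T -> R) : intg P H -> intg P (fun w => Bc w * H w).
Proof.
move=> iH; apply: (@intg_le _ _ _ P (fun w => C2 * `|H w|)).
- by apply: measurable_funM; [exact: measurable_BclipX|exact: intg_meas iH].
- by move=> w; rewrite normrM ger0_norm ?Bclip_ge0// ler_wpM2r// Bclip_le.
- by apply: intgZ; exact: intg_norm.
Qed.

Lemma itg_Bc (H : T -> R) : measurable_fun setT H ->
  itg P (fun w => B (X w) * H w) = itg P (fun w => Bc w * H w).
Proof.
move=> mH; apply: ae_eq_itg.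
- by apply: measurable_funM => //; exact: measurable_BX.
- by apply: measurable_funM => //; exact: measurable_BclipX.
- by move: ae_BclipX; apply: filterS => w ->.
Qed.

Lemma intg_process_sq (t : R) : intg P (fun w => x_ w t ^+ 2).
Proof.
case: (boolP (0 <= t <= 1)) => h; last first.
  by under eq_fun do rewrite res_out// expr0n /=; exact: intg0.
have tI : unit_itv t by rewrite unit_itvE.
have i1 := hXX tI tI.
have i2 : intg P (fun w => Bc w * x_ w t * x_ w t).
  apply: (ae_intg _ _ _ i1).
  - exact: intg_meas i1.
  - by apply: measurable_funM; [apply: measurable_funM; [exact: measurable_BclipX|]|];
      exact: measurable_res_process.
  - by move: ae_BclipX; apply: filterS => w ->; rewrite res_process.
apply: (@intg_le _ _ _ P (fun w => C2 * (Bc w * x_ w t * x_ w t))).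
- by apply: measurable_funX; exact: measurable_res_process.
- move=> w; rewrite ger0_norm ?sqr_ge0// -mulrA -expr2 mulrA ler_peMl ?sqr_ge0//.
  by rewrite -(@mulfV _ C2) ?gt_eqF// ler_pM2l// Bclip_ge.
- exact: intgZ.
Qed.

Lemma intg_ip_sq b : L2 b -> intg P (fun w => ip (X w) b ^+ 2).
Proof.
move=> lb; apply: (@intg_le _ _ _ P (fun w => ip (X w) (X w) * ip b b)).
- by apply: measurable_funX; exact: measurable_ip_process.
- move=> w; rewrite ger0_norm ?sqr_ge0//; apply: ip_cauchy_schwarz => //; exact: process_L2.
- exact: intgZr.
Qed.

Lemma itg_ip_sq_le b : L2 b -> itg P (fun w => ip (X w) b ^+ 2) <= itg P (fun w => ip (X w) (X w)) * ip b b.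
Proof.
move=> lb; rewrite -itgZr//; apply: le_itg; [exact: intg_ip_sq lb|exact: intgZr momX|].
by move=> w; apply: ip_cauchy_schwarz => //; exact: process_L2.
Qed.

(** The inner integrals are dominated by [|H w| * q w], and Cauchy-Schwarz on each path makes [q]
    square integrable. *)
Lemma process_fubini (H : T -> R) b : measurable_fun setT H -> intg P (fun w => H w ^+ 2) -> L2 b ->
  itg mu (fun t => itg P (fun w => H w * x_ w t * res b t)) = itg P (fun w => H w * ip (X w) b).
Proof.
move=> mH iH lb.
pose q w := itg mu (fun t => `|x_ w t * res b t|).
have iw w : intg mu (fun t => x_ w t * res b t) by apply: L2_intg_mul => //; exact: process_L2.
have mq : measurable_fun setT q.
  apply: (@measurable_itg_l _ _ T (measurableTypeR R) R mu (fun w t => `|x_ w t * res b t|)).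
  apply: measurableT_comp => //; apply: measurable_funM; first exact: measurable_process.
  by apply: measurableT_comp => //; exact: L2_meas.
have iq : intg P (fun w => q w ^+ 2).
  apply: (@intg_le _ _ _ P (fun w => ip (X w) (X w) * ip b b)).
  - exact: measurable_funX.
  - move=> w; rewrite ger0_norm ?sqr_ge0// /q.
    under eq_fun do rewrite normrM.
    have [mx ix] := (L2P (X w)).1 (process_L2 rX w); have [mb ib] := (L2P b).1 lb.
    have := @cauchy_schwarz _ _ _ mu (fun t => `|x_ w t|) (fun t => `|res b t|).
    under [in X in _ -> _ -> X -> _ -> _]eq_fun do rewrite real_normK ?num_real//.
    under [in X in _ -> _ -> _ -> X -> _]eq_fun do rewrite real_normK ?num_real//.
    under [in X in _ -> _ -> _ -> _ -> (_ <= X * _)]eq_fun do rewrite real_normK ?num_real//.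
    under [in X in _ -> _ -> _ -> _ -> (_ <= _ * X)]eq_fun do rewrite real_normK ?num_real//.
    rewrite !ipE; apply => //; exact: measurableT_comp.
  - exact: intgZr.
pose F w (t : measurableTypeR R) := H w * x_ w t * res b t.
have mF : measurable_fun setT (fun z : T * measurableTypeR R => F z.1 z.2).
  apply: measurable_funM; last by apply: measurableT_comp => //; exact: L2_meas.
  by apply: measurable_funM; [exact: measurableT_comp|exact: measurable_process].
have iFw w : intg mu (F w) by rewrite /F; under eq_fun do rewrite -mulrA; exact: intgZ.
have iFt t : intg P (F^~ t).
  apply: intgZr; apply: intg_mul => //; first exact: measurable_res_process.
  exact: intg_process_sq.
have iF : intg (P \x mu)%E (fun z => F z.1 z.2).
  apply: (@intg_prod12 _ _ T (measurableTypeR R) R P mu F (fun w => `|H w| * q w)) => //.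
  - move=> w; rewrite /F; under eq_fun do rewrite -mulrA normrM.
    by rewrite itgZ//; exact: intg_norm.
  - apply: intg_mul => //; first exact: measurableT_comp.
    by under eq_fun do rewrite real_normK ?num_real//.
rewrite -(itg_fubini iF)//; congr itg; apply/funext => w.
by rewrite /F; under eq_fun do rewrite -mulrA; rewrite itgZ// ipE.
Qed.

Lemma CovE (s t : R) : unit_itv s -> unit_itv t -> Cov P X B s t = itg P (fun w => Bc w * x_ w s * x_ w t).
Proof.
move=> hs ht; rewrite /Cov unlock -/(itg P (fun w => B (X w) * X w s * X w t)).
transitivity (itg P (fun w => B (X w) * (x_ w s * x_ w t))).
  by congr itg; apply/funext => w; rewrite !res_process// mulrA.
rewrite itg_Bc; first by congr itg; apply/funext => w; rewrite mulrA.
by apply: measurable_funM; exact: measurable_res_process.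
Qed.

Lemma Cov_inner b (t c : R) : unit_itv t -> L2 b ->
  \int[mu]_(s in unit_itv) (Cov P X B s t * c * b s) = itg P (fun w => Bc w * ip (X w) b * x_ w t) * c.
Proof.
move=> ht lb.
have mBx : measurable_fun setT (fun w => Bc w * x_ w t).
  by apply: measurable_funM; [exact: measurable_BclipX|exact: measurable_res_process].
have ix := intg_process_sq t.
have ib := intg_ip_sq lb.
have mib := measurable_ip_process rX lb.
have mx := measurable_res_process rX.
transitivity (itg P (fun w => (Bc w * x_ w t * c) * ip (X w) b)); last first.
  rewrite -itgZr; first by congr itg; apply/funext => w; ring.
  by under eq_fun do rewrite -mulrA; apply: intg_Bc; exact: intg_mul.
rewrite -process_fubini//; first last.
- apply: (@intg_le _ _ _ P (fun w => (C2 ^+ 2 * c ^+ 2) * x_ w t ^+ 2)).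
  + by apply: measurable_funX; exact: measurable_funM.
  + move=> w; rewrite ger0_norm ?sqr_ge0// !exprMn mulrAC ler_wpM2r ?sqr_ge0// ler_wpM2r ?sqr_ge0//.
    by apply: lerXn2r; rewrite ?nnegrE ?Bclip_ge0 ?(ltW C20)// Bclip_le.
  + exact: intgZ.
- exact: measurable_funM.
rewrite Rintegral_mkcond; congr (Rintegral _ _ _); apply/funext => s.
rewrite patchE; case: ifPn => hs; last first.
  rewrite (_ : (fun w => _) = (fun=> 0)) ?itg0//; apply/funext => w.
  rewrite (@res_out _ b) ?mulr0//; apply/negP => h; move/negP: hs; apply.
  by rewrite inE unit_itvE.
rewrite inE in hs; rewrite CovE// itgZr; last first.
  under eq_fun do rewrite -!mulrA; apply: intg_Bc.
  under eq_fun do rewrite mulrCA; apply: intgZ.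
  by apply: intg_mul => //; exact: intg_process_sq.
rewrite unit_itvE in hs; rewrite (@res_in _ b)//; congr (_ * _); rewrite -itgZr.
  by congr itg; apply/funext => w; ring.
under eq_fun do rewrite -mulrA; apply: intg_Bc.
by apply: intg_mul => //; exact: intg_process_sq.
Qed.

Lemma Cov_opE b (t : R) : unit_itv t -> L2 b ->
  Cov_op P X B b t = itg P (fun w => Bc w * ip (X w) b * x_ w t).
Proof.
move=> ht lb; rewrite -[RHS]mulr1 -Cov_inner//; congr (Rintegral _ _ _).
by apply/funext => s; rewrite mulr1.
Qed.

(** Two exchanges of expectation and path integral. Bilinearity, symmetry, positivity and the
    Cauchy-Schwarz inequality for [V] are all read off this expectation. *)
Lemma V_E b b' : L2 b -> L2 b' -> V P X B b b' = itg P (fun w => Bc w * ip (X w) b' * ip (X w) b).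
Proof.
move=> lb lb'; rewrite /V -process_fubini//; first last.
- apply: (@intg_le _ _ _ P (fun w => C2 ^+ 2 * ip (X w) b' ^+ 2)).
  + by apply: measurable_funX; apply: measurable_funM; [exact: measurable_BclipX|exact: measurable_ip_process].
  + move=> w; rewrite ger0_norm ?sqr_ge0// exprMn ler_wpM2r ?sqr_ge0//.
    by apply: lerXn2r; rewrite ?nnegrE ?Bclip_ge0 ?(ltW C20)// Bclip_le.
  + by apply: intgZ; exact: intg_ip_sq lb'.
- by apply: measurable_funM; [exact: measurable_BclipX|exact: measurable_ip_process].
rewrite Rintegral_mkcond; congr (Rintegral _ _ _); apply/funext => t.
rewrite patchE; case: ifPn => ht; last first.
  rewrite (_ : (fun w => _) = (fun=> 0)) ?itg0//; apply/funext => w.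
  rewrite (@res_out _ b) ?mulr0//; apply/negP => h; move/negP: ht; apply.
  by rewrite inE unit_itvE.
rewrite inE in ht; rewrite Cov_inner// itgZr.
  by rewrite unit_itvE in ht; rewrite (@res_in _ b).
under eq_fun do rewrite -mulrA; apply: intg_Bc; apply: intg_mul.
- exact: measurable_ip_process.
- exact: measurable_res_process.
- exact: intg_ip_sq lb'.
- exact: intg_process_sq.
Qed.

(** The centering of [B * X] at each [t] is integrated against [b]; it makes intercept and slope
    orthogonal in [ipH]. *)
Lemma itg_Bip0 b : L2 b -> itg P (fun w => Bc w * ip (X w) b) = 0.
Proof.
move=> lb; rewrite -process_fubini//; first last.
- apply: (@intg_bounded _ _ _ _ _ (C2 ^+ 2)); first by apply: measurable_funX; exact: measurable_BclipX.
  move=> w; rewrite ger0_norm ?sqr_ge0//.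
  by apply: lerXn2r; rewrite ?nnegrE ?Bclip_ge0 ?(ltW C20)// Bclip_le.
- exact: measurable_BclipX.
rewrite -[RHS](itg0 mu); congr itg; apply/funext => t.
case: (boolP (0 <= t <= 1)) => h; last first.
  by rewrite -[RHS](itg0 P); congr itg; apply/funext => w; rewrite (@res_out _ b)// mulr0.
have ht : unit_itv t by rewrite unit_itvE.
have mx := measurable_res_process rX t.
rewrite itgZr; last first.
  apply: intg_Bc; apply: (@intg_le _ _ _ P (fun w => 1 + x_ w t ^+ 2)) => //.
  - by move=> w; rewrite -(real_normK (num_real (x_ w t))); have := sqr_ge0 (`|x_ w t| - 1); nra.
  - by apply: intgD; [exact: intg_cst|exact: intg_process_sq].
rewrite -itg_Bc//; have := hBX ht; rewrite unlock => h0.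
rewrite (_ : itg P _ = 0) ?mul0r// /itg /Rintegral.
rewrite -[RHS]/(fine 0%E) -h0; congr fine; apply: eq_integral => w _; by rewrite res_process.
Qed.

Lemma intg_Bip b b' : L2 b -> L2 b' -> intg P (fun w => Bc w * ip (X w) b' * ip (X w) b).
Proof.
move=> lb lb'; under eq_fun do rewrite -mulrA; apply: intg_Bc.
by apply: intg_mul; first [exact: measurable_ip_process|exact: intg_ip_sq].
Qed.

Lemma VC b b' : L2 b -> L2 b' -> V P X B b b' = V P X B b' b.
Proof. by move=> lb lb'; rewrite (V_E lb lb') (V_E lb' lb); congr itg; apply/funext => w; ring. Qed.

Lemma V_linl b b' f c : L2 b -> L2 b' -> L2 f ->
  V P X B (fun t => b t + c * b' t) f = V P X B b f + c * V P X B b' f.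
Proof.
move=> lb lb' lf; rewrite !V_E//; last exact: L2_lin.
rewrite -itgZ; last exact: intg_Bip.
rewrite -itgD; [|exact: intg_Bip|by apply: intgZ; exact: intg_Bip].
congr itg; apply/funext => w; rewrite ip_linr//; last exact: process_L2.
ring.
Qed.

Lemma V_linr b b' f c : L2 b -> L2 b' -> L2 f ->
  V P X B f (fun t => b t + c * b' t) = V P X B f b + c * V P X B f b'.
Proof. by move=> *; rewrite VC ?V_linl ?(VC (b' := f))//; exact: L2_lin. Qed.

Lemma V0r f : L2 f -> V P X B f (fun=> 0) = 0.
Proof.
move=> lf; rewrite V_E//; last exact: L2_0.
by rewrite -[RHS](itg0 P); congr itg; apply/funext => w; rewrite ip0r mulr0 mul0r.
Qed.

Lemma V_sumr (N : nat) (c : nat -> R) (f : nat -> R -> R) x :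
  (forall i, (0 < i)%N -> L2 (f i)) -> L2 x ->
  V P X B x (fun t => \sum_(1 <= i < N.+1) c i * f i t) = \sum_(1 <= i < N.+1) c i * V P X B x (f i).
Proof.
move=> h lx.
have hs n : L2 (fun t => \sum_(1 <= i < n.+1) c i * f i t).
  elim: n => [|n ih]; first by under eq_fun do rewrite big_nil; exact: L2_0.
  by under eq_fun do rewrite big_nat_recr//=; apply: L2_lin => //; exact: h.
elim: N => [|N ih]; first by rewrite big_nil; under eq_fun do rewrite big_nil; exact: V0r.
under eq_fun do rewrite big_nat_recr//=.
rewrite (V_linr (b := fun t => \sum_(1 <= i < N.+1) c i * f i t))//; last exact: h.
by rewrite ih [RHS]big_nat_recr.
Qed.

Lemma V_ge0 b : L2 b -> 0 <= V P X B b b.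
Proof.
move=> lb; rewrite V_E//; apply: itg_ge0 => w.
by rewrite -mulrA -expr2 mulr_ge0 ?Bclip_ge0 ?sqr_ge0.
Qed.

Lemma V_ge b : L2 b -> itg P (fun w => ip (X w) b ^+ 2) <= C2 * V P X B b b.
Proof.
move=> lb; rewrite V_E// -itgZ; last exact: intg_Bip.
apply: le_itg; [exact: intg_ip_sq lb|by apply: intgZ; exact: intg_Bip|].
move=> w; rewrite -mulrA -expr2 mulrA ler_peMl ?sqr_ge0//.
by rewrite -(@mulfV _ C2) ?gt_eqF// ler_pM2l// Bclip_ge.
Qed.

Lemma V_le b : L2 b -> V P X B b b <= C2 * itg P (fun w => ip (X w) (X w)) * ip b b.
Proof.
move=> lb; rewrite V_E// -mulrA.
apply: (@le_trans _ _ (C2 * itg P (fun w => ip (X w) b ^+ 2))).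
  rewrite -itgZ; last exact: intg_ip_sq lb.
  apply: le_itg; [exact: intg_Bip|by apply: intgZ; exact: intg_ip_sq lb|].
  by move=> w; rewrite -mulrA -expr2 ler_wpM2r ?sqr_ge0// Bclip_le.
by rewrite ler_pM2l//; exact: itg_ip_sq_le.
Qed.

Lemma V_cauchy_schwarz b b' : L2 b -> L2 b' -> V P X B b b' ^+ 2 <= V P X B b b * V P X B b' b'.
Proof.
move=> lb lb'; rewrite (V_E lb lb') (V_E lb lb) (V_E lb' lb').
have E f g : (fun w => Bc w * ip (X w) f * ip (X w) g) =
    (fun w => (Num.sqrt (Bc w) * ip (X w) g) * (Num.sqrt (Bc w) * ip (X w) f)).
  apply/funext => w; rewrite -[X in X * _ * _ = _](@sqr_sqrtr _ (Bc w)) ?Bclip_ge0//; ring.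
have E2 f : (fun w => Bc w * ip (X w) f * ip (X w) f) = (fun w => (Num.sqrt (Bc w) * ip (X w) f) ^+ 2).
  by rewrite E; apply/funext => w; rewrite expr2.
rewrite E !E2; have m f : L2 f -> measurable_fun setT (fun w => Num.sqrt (Bc w) * ip (X w) f).
  move=> lf; apply: measurable_funM; last exact: measurable_ip_process.
  exact: (measurableT_comp (continuous_measurable_fun (@sqrt_continuous R)) measurable_BclipX).
by apply: cauchy_schwarz; rewrite -?E2; first [exact: m|exact: intg_Bip].
Qed.

Lemma ipH_E m lam alpha b : Sobolev m b -> L2 b ->
  ipH P m X B lam (alpha, b) (alpha, b) =
  alpha ^+ 2 * itg P (fun w => Bc w) + V P X B b b + lam * J m b b.
Proof.
move=> sb lb; rewrite /ipH /=; congr (_ + _).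
rewrite unlock -/(itg P (fun w => B (X w) * predictor (alpha, b) (X w) * predictor (alpha, b) (X w))).
have mip := measurable_ip_process rX lb.
transitivity (itg P (fun w => B (X w) * (alpha + ip (X w) b) ^+ 2)).
  by congr itg; apply/funext => w; rewrite /predictor /=; ring.
rewrite itg_Bc; last by apply: measurable_funX; exact: measurable_funD.
have i1 : intg P (fun w => Bc w) by rewrite -[X in intg P X]/(fun w => Bc w);
  have := intg_Bc (intg_cst P 1); congr (intg P _); apply/funext => w; rewrite mulr1.
have iip : intg P (fun w => ip (X w) b).
  apply: (@intg_le _ _ _ P (fun w => 1 + ip (X w) b ^+ 2)) => //.
  - by move=> w; rewrite -(real_normK (num_real (ip (X w) b))); have := sqr_ge0 (`|ip (X w) b| - 1); nra.
  - by apply: intgD; [exact: intg_cst|exact: intg_ip_sq].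
have -> : (fun w => Bc w * (alpha + ip (X w) b) ^+ 2) =
  (fun w => alpha ^+ 2 * Bc w + (2 * alpha) * (Bc w * ip (X w) b) + Bc w * ip (X w) b * ip (X w) b).
  by apply/funext => w; ring.
have iBi := intg_Bc iip.
rewrite itgD; [|by apply: intgD; exact: intgZ|exact: intg_Bip].
rewrite itgD; [|exact: intgZ..].
by rewrite !itgZ// itg_Bip0// mulr0 addr0 V_E.
Qed.

Lemma itg_Bc_ge : C2^-1 <= itg P (fun w => Bc w).
Proof.
rewrite -[leLHS](itg_cst P); apply: le_itg; [exact: intg_cst| |by move=> w; exact: Bclip_ge].
by have := intg_Bc (intg_cst P 1); congr (intg P _); apply/funext => w; rewrite mulr1.
Qed.

(** As [B] is bounded below, a vanishing [V] forces [ip (X w) b = 0] almost surely, and the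
    covariance operator is an expectation containing that factor. *)
Lemma V_eq0 b : L2 b -> V P X B b b = 0 -> forall t : R, unit_itv t -> Cov_op P X B b t = 0.
Proof.
move=> lb V0 t ht; have mip := measurable_ip_process rX lb.
have := itg_eq0 (intg_ip_sq lb) (fun w => sqr_ge0 _).
have -> : itg P (fun w => ip (X w) b ^+ 2) = 0.
  apply/eqP; rewrite eq_le; apply/andP; split; first by have := V_ge lb; rewrite V0 mulr0.
  by apply: itg_ge0 => w; exact: sqr_ge0.
move=> /(_ erefl) h0; rewrite Cov_opE// -[RHS](itg0 P); apply: ae_eq_itg.
- apply: measurable_funM; last exact: measurable_res_process.
  by apply: measurable_funM => //; exact: measurable_BclipX.
- by [].
- by move: h0; apply: filterS => w /eqP; rewrite sqrf_eq0 => /eqP ->; rewrite mulr0 mul0r.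
Qed.

End covariance.

(** * Weighted eigenvalue sums *)

Section power_series.
Context (R : realType).

Lemma gt0_powRD (x r s : R) : 0 < x -> x `^ (r + s) = x `^ r * x `^ s.
Proof. by move=> x0; rewrite powRD//; apply/implyP => _; rewrite gt_eqF. Qed.

Lemma powR_le1 (x q : R) : 0 < x <= 1 -> 0 <= q -> x `^ q <= 1.
Proof.
move=> /andP[x0 x1] q0; apply: (@le_trans _ _ (1 `^ q)); last by rewrite powR1.
by apply: ge0_ler_powR; rewrite ?nnegrE ?ler01 ?(ltW x0).
Qed.

(* [nu^-(1+s) <= ((nu-1)^-s - nu^-s) / s], so the sum telescopes. *)
Lemma sum_powR_le (s : R) (N : nat) : 0 < s ->
  \sum_(1 <= nu < N.+1) nu%:R `^ (- (1 + s)) <= 1 + s^-1.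
Proof.
move=> s0.
suff h : forall N, \sum_(1 <= nu < N.+2) nu%:R `^ (- (1 + s)) <= 1 + s^-1 - N.+1%:R `^ (- s) / s.
  case: N => [|N]; first by rewrite big_nil addr_ge0// invr_ge0 ltW.
  by apply: (le_trans (h N)); rewrite gerBl divr_ge0 ?powR_ge0// ltW.
elim=> [|n ih]; first by rewrite big_nat1 !powR1 mul1r addrK.
rewrite big_nat_recr//=; have n0 : 0 < n.+1%:R :> R by [].
have n1 : 0 < n.+2%:R :> R by [].
have key : n.+2%:R `^ (- (1 + s)) <= (n.+1%:R `^ (- s) - n.+2%:R `^ (- s)) / s.
  have nq : n.+1%:R / n.+2%:R * n.+2%:R = n.+1%:R :> R by rewrite divfK// gt_eqF.
  rewrite ler_pdivlMr// lerBrDl -[X in _ <= X `^ _]nq.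
  have q0 : 0 < n.+1%:R / n.+2%:R :> R by rewrite divr_gt0.
  rewrite powRM ?(ltW q0) ?(ltW n1)// opprD gt0_powRD//.
  rewrite powR_inv1 ?(ltW n1)//.
  have lnq : ln (n.+1%:R / n.+2%:R) <= - n.+2%:R^-1 :> R.
    have -> : n.+1%:R / n.+2%:R = 1 + - n.+2%:R^-1 :> R.
      by apply: (@mulIf _ n.+2%:R); rewrite ?gt_eqF// nq mulrBl mul1r mulVf ?gt_eqF// -[n.+2%:R]natr1 addrK.
    by apply: le_ln1Dx; rewrite ltrN2 invf_lt1// ltr1n.
  have : 1 + s / n.+2%:R <= (n.+1%:R / n.+2%:R) `^ (- s).
    rewrite /powR gt_eqF//; apply: (le_trans (expR_ge1Dx _)); rewrite ler_expR mulNr -mulrN ler_pM2l//.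
    by rewrite lerNr.
  have p0 := powR_ge0 (n.+2%:R : R) (- s).
  move=> /(ler_wpM2r p0); rewrite mulrDl mul1r => h'; apply: le_trans h'; rewrite lerD2l.
  by rewrite le_eqVlt; apply/orP; left; apply/eqP; ring.
apply: (le_trans (lerD ih key)); rewrite le_eqVlt; apply/orP; left; apply/eqP; ring.
Qed.

Variables (rho : nat -> R) (a k : R).
Hypothesis a0 : 0 <= a.
Hypothesis ak : a + 2^-1 < k.
Hypothesis rho0 : forall nu, (0 < nu)%N -> 0 <= rho nu.
Hypothesis rhoE : same_order rho (fun nu => nu%:R `^ (2 * k)).

(** Three cases, one for each summand of the constant: [h * nu <= 1]; [nu >= N0], where [rho] is
    comparable with its power; and the finitely many [nu < N0]. *)
Lemma kappa_lower : exists2 C : R, 0 < C & forall (q h l : R) (nu : nat),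
  0 <= q <= 2 * k -> 0 < h <= 1 -> h `^ (2 * k) <= l -> (0 < nu)%N ->
  (h * nu%:R) `^ q <= C * (1 + l * rho nu).
Proof.
have [c [C [c0 C0 [N0 _ hN]]]] := rhoE.
exists (1 + c^-1 + N0%:R `^ (2 * k)).
  by rewrite ltr_pwDl ?powR_ge0// addr_gt0// invr_gt0.
move=> q h l nu /andP[q0 q2k] /andP[h0 h1] hl nu0.
have nuR : 0 < nu%:R :> R by rewrite ltr0n.
have l0 : 0 <= l by apply: le_trans hl; exact: powR_ge0.
have ci : 0 <= c^-1 by rewrite invr_ge0 ltW.
have rn := rho0 nu0.
have lr : 0 <= l * rho nu by rewrite mulr_ge0.
have np := powR_ge0 (N0%:R : R) (2 * k).
have k0 : 0 <= 2 * k by lra.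
have hn0 : 0 < h * nu%:R by rewrite mulr_gt0.
have [hn|/ltW hn] := leP (h * nu%:R) 1.
  have : (h * nu%:R) `^ q <= 1 by apply: powR_le1 => //; rewrite hn0.
  by nra.
have : (h * nu%:R) `^ q <= h `^ (2 * k) * nu%:R `^ (2 * k).
  by apply: (le_trans (ler_powR hn q2k)); rewrite powRM// ltW.
have [Nn|nN] := leqP N0 nu.
  have [_ /andP[h2 _]] := hN nu Nn.
  have : nu%:R `^ (2 * k) <= c^-1 * rho nu by rewrite ler_pdivlMl.
  have := powR_ge0 h (2 * k); have := powR_ge0 (nu%:R : R) (2 * k).
  move=> x0 y0 h3 /le_trans; apply.
  apply: (@le_trans _ _ (l * (c^-1 * rho nu))); first exact: ler_pM.
  have : 0 <= N0%:R `^ (2 * k) * (1 + l * rho nu) by rewrite mulr_ge0// addr_ge0.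
  by have : 0 <= c^-1 by []; rewrite mulrCA; nra.
have : nu%:R `^ (2 * k) <= N0%:R `^ (2 * k).
  by apply: ge0_ler_powR; rewrite ?nnegrE ?ler0n// ler_nat ltnW.
have : h `^ (2 * k) <= 1 by apply: powR_le1 => //; rewrite h0.
have := powR_ge0 h (2 * k); have := powR_ge0 (nu%:R : R) (2 * k).
move=> x0 y0 h3 h4 /le_trans; apply.
apply: (@le_trans _ _ (1 * N0%:R `^ (2 * k))); first exact: ler_pM.
nra.
Qed.

(** The lower bound on [1 + l * rho nu] with exponent [2 * a + p] leaves the series of nu^(-p). A
    [p] above 1 exists because [a + 1/2 < k], and [p <= 5/2] caps the power of [h] at twice the
    exponent [a + 5/4] of the rates. *)
Lemma sum_weights : exists2 C : R, 0 < C & forall (h l : R) (N : nat),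
  0 < h <= 1 -> h `^ (2 * k) <= l ->
  \sum_(1 <= nu < N.+1) nu%:R `^ (2 * a) / (1 + l * rho nu) <= C * h `^ (- (2 * a + 5 / 2)).
Proof.
have [C C0 hC] := kappa_lower.
have p1a : 1 < 2 * k - 2 * a by have := ak; lra.
pose p : R := Num.min (2 * k - 2 * a) (5 / 2).
have p1b : 1 < 5 / 2 :> R by lra.
have p1 : 1 < p by rewrite /p lt_min p1a.
have p1' : 0 < p - 1 by lra.
have p2 : p <= 2 * k - 2 * a by rewrite /p ge_min lexx.
have p3 : p <= 5 / 2 by rewrite /p ge_min lexx orbT.
exists (C * (1 + (p - 1)^-1)); first by rewrite mulr_gt0// addr_gt0// invr_gt0.
move=> h l N h01 hl; have /andP[h0 h1] := h01.
have l0 : 0 <= l by apply: le_trans hl; exact: powR_ge0.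
apply: (@le_trans _ _ (\sum_(1 <= nu < N.+1) C * h `^ (- (2 * a + p)) * nu%:R `^ (- (1 + (p - 1))))).
  rewrite big_nat_cond [leRHS]big_nat_cond; apply: ler_sum => nu /andP[/andP[nu0 _] _].
  have nuR : 0 < nu%:R :> R by rewrite ltr0n.
  have kap : 0 < 1 + l * rho nu by rewrite ltr_pwDl// mulr_ge0// rho0.
  rewrite ler_pdivrMr//.
  have : (h * nu%:R) `^ (2 * a + p) <= C * (1 + l * rho nu).
    by apply: hC => //; apply/andP; have := a0; split; lra.
  have -> : 1 + (p - 1) = p by ring.
  have e0 : 0 <= h `^ (- (2 * a + p)) * nu%:R `^ (- p) by rewrite mulr_ge0// powR_ge0.
  move=> /(ler_wpM2l e0) h'.
  have -> : C * h `^ (- (2 * a + p)) * nu%:R `^ (- p) * (1 + l * rho nu) =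
    h `^ (- (2 * a + p)) * nu%:R `^ (- p) * (C * (1 + l * rho nu)) by ring.
  apply: le_trans h'; rewrite le_eqVlt; apply/orP; left; apply/eqP.
  rewrite powRM ?(ltW h0) ?(ltW nuR)//.
  have -> : nu%:R `^ (2 * a) = nu%:R `^ (- p) * nu%:R `^ (2 * a + p).
    by rewrite -gt0_powRD//; congr (_ `^ _); ring.
  by rewrite [RHS]mulrACA -(gt0_powRD _ _ h0) addNr powRr0 mul1r.
rewrite -mulr_sumr -!mulrA ler_pM2l//.
rewrite mulrC; apply: ler_pM; rewrite ?powR_ge0//; first by apply: sumr_ge0 => i _; exact: powR_ge0.
  exact: sum_powR_le.
by apply: ger_powR => //; lra.
Qed.

End power_series.

(** * Eigenfunction expansions *)

Section finite_cauchy_schwarz.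
Context (R : realType).

Lemma sum_cauchy_schwarz (I : Type) (s : seq I) (x y : I -> R) :
  (\sum_(i <- s) x i * y i) ^+ 2 <= (\sum_(i <- s) x i ^+ 2) * (\sum_(i <- s) y i ^+ 2).
Proof.
elim: s => [|i s ih]; first by rewrite !big_nil expr0n /= mul0r.
rewrite !big_cons.
set S := \sum_(j <- s) x j * y j in ih *.
set A := \sum_(j <- s) x j ^+ 2 in ih *; set B := \sum_(j <- s) y j ^+ 2 in ih *.
have A0 : 0 <= A by apply: sumr_ge0 => j _; exact: sqr_ge0.
have B0 : 0 <= B by apply: sumr_ge0 => j _; exact: sqr_ge0.
have h : 2 * (x i * y i) * S <= x i ^+ 2 * B + A * y i ^+ 2.
  have : `|2 * (x i * y i) * S| <= x i ^+ 2 * B + A * y i ^+ 2.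
    have r0 : 0 <= x i ^+ 2 * B + A * y i ^+ 2 by rewrite addr_ge0// mulr_ge0// sqr_ge0.
    rewrite -(ger0_norm r0) -ler_sqr ?nnegrE// !real_normK ?num_real//.
    have : (x i * y i) ^+ 2 * S ^+ 2 <= (x i * y i) ^+ 2 * (A * B) by rewrite ler_wpM2l// sqr_ge0.
    have := sqr_ge0 (x i ^+ 2 * B - A * y i ^+ 2).
    nra.
  by apply: le_trans; exact: ler_norm.
by nra.
Qed.

Lemma sum_weighted_cauchy_schwarz (I : Type) (s : seq I) (kap x y : I -> R) :
  (forall i, 0 < kap i) ->
  (\sum_(i <- s) x i * y i) ^+ 2 <= (\sum_(i <- s) kap i * x i ^+ 2) * (\sum_(i <- s) y i ^+ 2 / kap i).
Proof.
move=> k0; have := sum_cauchy_schwarz s (fun i => Num.sqrt (kap i) * x i) (fun i => y i / Num.sqrt (kap i)).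
have sk i : 0 < Num.sqrt (kap i) by rewrite sqrtr_gt0.
rewrite (eq_bigr (fun i => x i * y i)); last first.
  by move=> i _; field; rewrite gt_eqF.
have -> : \sum_(i <- s) (Num.sqrt (kap i) * x i) ^+ 2 = \sum_(i <- s) kap i * x i ^+ 2.
  by apply: eq_bigr => i _; rewrite exprMn sqr_sqrtr// ltW.
have -> // : \sum_(i <- s) (y i / Num.sqrt (kap i)) ^+ 2 = \sum_(i <- s) y i ^+ 2 / kap i.
by apply: eq_bigr => i _; rewrite exprMn exprVn sqr_sqrtr// ltW.
Qed.

End finite_cauchy_schwarz.

Section dominated.
Context d (T : measurableType d) (R : realType) (mu : {measure set T -> \bar R}).

Lemma itg_dominated (f : nat -> T -> R) (g F : T -> R) :
  (forall n, measurable_fun setT (f n)) -> measurable_fun setT g ->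
  {ae mu, forall x, f n x @[n --> \oo] --> g x} -> intg mu F ->
  {ae mu, forall x n, `|f n x| <= F x} ->
  intg mu g /\ itg mu (f n) @[n --> \oo] --> itg mu g.
Proof.
move=> mf mg fg iF fF.
have [] := @dominated_convergence _ _ _ mu setT measurableT (fun n => EFin \o f n) (EFin \o g) (EFin \o F).
- by move=> n; exact/measurable_EFinP.
- exact/measurable_EFinP.
- move: fg; apply: filterS.
  by move=> x h _; apply: cvg_EFin => //; exact: nearW.
- exact: iF.
- move: fF; apply: filterS.
  by move=> x h n _; rewrite /= lee_fin.
move=> ig _ cv; split => //.
by apply: (fine_cvg (f := fun n => _)); rewrite fineK//; exact: integrable_fin_num.
Qed.

End dominated.

(** * Pointwise and L^2 convergence of the eigenfunction series *)

Section expansion.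
Context d (T : measurableType d) (R : realType) (P : probability T R).
Local Notation mu := (@lebesgue_measure R).
Variables (m : nat) (X : T -> R -> R) (B : pathType R -> R) (C2 : R).
Hypothesis m0 : (0 < m)%N.
Hypothesis rX : random_process X.
Hypothesis mB : measurable_fun setT B.
Hypothesis C20 : 0 < C2.
Hypothesis hB : {ae P, forall w, C2^-1 <= B (X w) <= C2}.
Hypothesis hXX : forall s t, unit_itv s -> unit_itv t ->
  intg P (fun w => B (X w) * X w s * X w t).
Hypothesis momX : intg P (fun w => ip (X w) (X w)).
Hypothesis injective_Cov : forall b : R -> R, L2 b ->
  ae_eq mu unit_itv (Cov_op P X B b) (cst 0) -> ae_eq mu unit_itv b (cst 0).
Variables (phi : nat -> R -> R) (rho : nat -> R).
Hypothesis sphi : forall nu, (0 < nu)%N -> Sobolev m (phi nu).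
Hypothesis orth : forall nu nu', (0 < nu)%N -> (0 < nu')%N ->
  V P X B (phi nu) (phi nu') = (nu == nu')%:R /\
  J m (phi nu) (phi nu') = rho nu * (nu == nu')%:R.
Hypothesis rho0 : forall nu, (0 < nu)%N -> 0 <= rho nu.
Variable lam : R.
Hypothesis lam0 : 0 < lam.

Local Notation VV := (V P X B).
Local Notation kap nu := (1 + lam * rho nu).

Let L2S (b : R -> R) : Sobolev m b -> L2 b. Proof. exact: sobolev_L2. Qed.
Let Lphi nu : (0 < nu)%N -> L2 (phi nu). Proof. by move=> /sphi /L2S. Qed.

Definition partial_sum (c : nat -> R) N (t : R) : R := \sum_(1 <= nu < N.+1) c nu * phi nu t.

Lemma sobolev_partial_sum c N : Sobolev m (partial_sum c N).
Proof. exact: sobolev_sum. Qed.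

Lemma V_partial_sum c N f : Sobolev m f ->
  VV f (partial_sum c N) = \sum_(1 <= nu < N.+1) c nu * VV f (phi nu).
Proof. by move=> sf; apply: (V_sumr rX mB C20 hB hXX momX) => //; exact: L2S. Qed.

Lemma J_partial_sum c N f : Sobolev m f ->
  J m f (partial_sum c N) = \sum_(1 <= nu < N.+1) c nu * J m f (phi nu).
Proof. by move=> sf; exact: J_sumr. Qed.

Let sum_delta (c g : nat -> R) N nu : (0 < nu <= N)%N ->
  \sum_(1 <= i < N.+1) c i * (g nu * (nu == i)%:R) = c nu * g nu.
Proof.
move=> /andP[nu0 nuN]; rewrite (bigD1_seq nu) ?iota_uniq ?mem_index_iota ?nu0//=.
rewrite eqxx mulr1 big1_seq ?addr0// => i /andP[inu _].
by rewrite eq_sym (negbTE inu) !mulr0.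
Qed.

Lemma V_phi_partial_sum c N nu : (0 < nu <= N)%N -> VV (phi nu) (partial_sum c N) = c nu.
Proof.
move=> h; have /andP[nu0 _] := h; rewrite V_partial_sum; last exact: sphi.
rewrite big_nat_cond (eq_bigr (fun i => c i * (1 * (nu == i)%:R))); last first.
  by move=> i /andP[/andP[i0 _] _]; have [-> _] := orth nu0 i0; rewrite mul1r.
by rewrite -big_nat_cond (@sum_delta c (fun=> 1))// mulr1.
Qed.

Lemma J_phi_partial_sum c N nu : (0 < nu <= N)%N -> J m (phi nu) (partial_sum c N) = c nu * rho nu.
Proof.
move=> h; have /andP[nu0 _] := h; rewrite J_partial_sum; last exact: sphi.
rewrite big_nat_cond (eq_bigr (fun i => c i * (rho nu * (nu == i)%:R))); last first.
  by move=> i /andP[/andP[i0 _] _]; have [_ ->] := orth nu0 i0.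
by rewrite -big_nat_cond (@sum_delta c rho).
Qed.

Lemma V_partial_sum_sq c N : VV (partial_sum c N) (partial_sum c N) = \sum_(1 <= nu < N.+1) c nu ^+ 2.
Proof.
rewrite V_partial_sum; last exact: sobolev_partial_sum.
rewrite big_nat_cond [RHS]big_nat_cond; apply: eq_bigr => i /andP[iN _].
have i0 : (0 < i)%N by case/andP: iN.
rewrite (VC rX mB C20 hB hXX momX) ?V_phi_partial_sum ?expr2//; try exact: Lphi.
by apply: L2S; exact: sobolev_partial_sum.
Qed.

Lemma J_partial_sum_sq c N : J m (partial_sum c N) (partial_sum c N) = \sum_(1 <= nu < N.+1) c nu ^+ 2 * rho nu.
Proof.
rewrite J_partial_sum; last exact: sobolev_partial_sum.
rewrite big_nat_cond [RHS]big_nat_cond; apply: eq_bigr => i /andP[iN _].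
by rewrite JC J_phi_partial_sum// mulrA -expr2.
Qed.

Let rest (c : nat -> R) (b : R -> R) N (t : R) : R := b t + -1 * partial_sum c N t.

Let sobolev_rest c b N : Sobolev m b -> Sobolev m (rest c b N).
Proof. by move=> sb; apply: sobolev_lin => //; exact: sobolev_partial_sum. Qed.

Variables (b : R -> R) (c : nat -> R).
Hypothesis sb : Sobolev m b.
Hypothesis exp : expansion P m X B lam phi c b.

Let Lr N : L2 (rest c b N). Proof. by apply: L2S; exact: sobolev_rest. Qed.

Lemma ip1_ge0 f : Sobolev m f -> 0 <= ip1 P m X B lam f f.
Proof.
move=> sf; rewrite /ip1 addr_ge0//; first by apply: (V_ge0 rX mB C20 hB hXX momX); exact: L2S.
by rewrite mulr_ge0 ?J_ge0 ?ltW.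
Qed.

Let rest_cvg : ip1 P m X B lam (rest c b N) (rest c b N) @[N --> \oo] --> (0 : R).
Proof.
have := exp; rewrite /expansion /= => h.
have -> : (fun N => ip1 P m X B lam (rest c b N) (rest c b N)) = (fun N =>
   Num.sqrt (ip1 P m X B lam (rest c b N) (rest c b N)) * Num.sqrt (ip1 P m X B lam (rest c b N) (rest c b N))).
  by apply/funext => N; rewrite -expr2 sqr_sqrtr// ip1_ge0//; exact: sobolev_rest.
rewrite -[0](mulr0 0).
have Ec : (fun N => Num.sqrt (ip1 P m X B lam (rest c b N) (rest c b N))) @ \oo --> (0 : R).
  apply: cvg_trans h; apply: near_eq_cvg; apply: nearW => N /=.
  have -> : (fun t => b t - \sum_(1 <= nu < N.+1) c nu * phi nu t) = rest c b N.
    by apply/funext => t; rewrite /rest mulN1r.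
  by [].
exact: (cvgM Ec Ec).
Qed.

Let V_rest N f : L2 f -> VV (rest c b N) f = VV b f - VV (partial_sum c N) f.
Proof.
move=> lf; rewrite /rest (V_linl rX mB C20 hB hXX momX) ?mulN1r//; first exact: L2S.
by apply: L2S; exact: sobolev_partial_sum.
Qed.

Let J_rest N f : Sobolev m f -> J m (rest c b N) f = J m b f - J m (partial_sum c N) f.
Proof. by move=> sf; rewrite /rest J_linl ?mulN1r//; exact: sobolev_partial_sum. Qed.

Let cvg_cst_le0 (x K : R) (u : nat -> R) (N0 : nat) : u @ \oo --> (0 : R) ->
  (forall N, (N0 <= N)%N -> x ^+ 2 <= K * u N) -> x = 0.
Proof.
move=> u0 h; apply/eqP; rewrite -sqrf_eq0 eq_le sqr_ge0 andbT.
have : K * u N @[N --> \oo] --> (0 : R) by rewrite -[X in _ --> X](mulr0 K); apply: cvgM => //; exact: cvg_cst.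
move=> /cvg_lim <- //; apply: limr_ge.
  by apply/cvg_ex; exists (K * 0); apply: cvgM => //; exact: cvg_cst.
by near=> N; apply: h; near: N; exact: nbhs_infty_ge.
Unshelve. all: by end_near. Qed.

Let V_le_ip1 f : Sobolev m f -> VV f f <= ip1 P m X B lam f f.
Proof. by move=> sf; rewrite /ip1 lerDl mulr_ge0 ?J_ge0 ?ltW. Qed.

Lemma expansion_V nu : (0 < nu)%N -> VV b (phi nu) = c nu.
Proof.
move=> nu0; apply/eqP; rewrite -subr_eq0; apply/eqP.
apply: (@cvg_cst_le0 _ 1 (fun N => ip1 P m X B lam (rest c b N) (rest c b N)) nu rest_cvg) => N nuN.
have := V_cauchy_schwarz rX mB C20 hB hXX momX (Lr N) (Lphi nu0).
rewrite V_rest; last exact: Lphi.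
rewrite (VC rX mB C20 hB hXX momX (L2S (sobolev_partial_sum c N)) (Lphi nu0)) V_phi_partial_sum ?nu0//.
have [-> _] := orth nu0 nu0; rewrite eqxx mulr1 mul1r => /le_trans; apply.
by apply: V_le_ip1; exact: sobolev_rest.
Qed.

(** The rest of the series has [J] at most [ip1 / lam], so Cauchy-Schwarz for [J] against [phi nu]
    lets convergence in [ip1] determine these coefficients too. *)
Lemma expansion_J nu : (0 < nu)%N -> J m b (phi nu) = c nu * rho nu.
Proof.
move=> nu0; apply/eqP; rewrite -subr_eq0; apply/eqP.
apply: (@cvg_cst_le0 _ (rho nu / lam) (fun N => ip1 P m X B lam (rest c b N) (rest c b N)) nu rest_cvg) => N nuN.
have := J_cauchy_schwarz (sobolev_rest c N sb) (sphi nu0).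
rewrite J_rest; last exact: sphi.
rewrite (JC m (partial_sum c N)) J_phi_partial_sum ?nu0//.
have [_ ->] := orth nu0 nu0; rewrite eqxx mulr1 => /le_trans; apply.
rewrite mulrC -mulrA ler_wpM2l ?rho0// ler_pdivlMl//.
rewrite /ip1 lerDr; apply: (V_ge0 rX mB C20 hB hXX momX); exact: Lr.
Qed.

(** Positivity of [ip1] on the rest of the series, whose cross terms are computed by orthogonality
    in both [V] and [J]. *)
Lemma bessel N : \sum_(1 <= nu < N.+1) kap nu * c nu ^+ 2 <= ip1 P m X B lam b b.
Proof.
have := ip1_ge0 (sobolev_rest c N sb).
have Lb := L2S sb; have Sp := sobolev_partial_sum c N; have Lp := L2S Sp.
rewrite /ip1 V_rest; last exact: Lr.
rewrite J_rest; last exact: sobolev_rest.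
rewrite (VC rX mB C20 hB hXX momX Lb (Lr N)) (VC rX mB C20 hB hXX momX Lp (Lr N)) !V_rest//.
rewrite (JC m b) (JC m (partial_sum c N) (rest c b N)) !J_rest//.
rewrite (VC rX mB C20 hB hXX momX Lp Lb) (JC m (partial_sum c N) b).
rewrite V_partial_sum_sq J_partial_sum_sq V_partial_sum// J_partial_sum//.
have -> : \sum_(1 <= nu < N.+1) c nu * VV b (phi nu) = \sum_(1 <= nu < N.+1) c nu ^+ 2.
  rewrite big_nat_cond [RHS]big_nat_cond; apply: eq_bigr => i /andP[/andP[i0 _] _].
  by rewrite expansion_V.
have -> : \sum_(1 <= nu < N.+1) c nu * J m b (phi nu) = \sum_(1 <= nu < N.+1) c nu ^+ 2 * rho nu.
  rewrite big_nat_cond [RHS]big_nat_cond; apply: eq_bigr => i /andP[/andP[i0 _] _].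
  by rewrite expansion_J// mulrA.
have -> : \sum_(1 <= nu < N.+1) kap nu * c nu ^+ 2 =
    \sum_(1 <= nu < N.+1) c nu ^+ 2 + lam * \sum_(1 <= nu < N.+1) c nu ^+ 2 * rho nu.
  by rewrite mulr_sumr -big_split /=; apply: eq_bigr => i _; ring.
by nra.
Qed.

Hypothesis weights : exists S : R, forall N,
  \sum_(1 <= nu < N.+1) ip (phi nu) (phi nu) / kap nu <= S.

Let f nu t := res (phi nu) t.
Let kap0 nu : (0 < nu)%N -> 0 < kap nu.
Proof. by move=> nu0; rewrite ltr_pwDl// mulr_ge0 ?rho0// ltW. Qed.
Let K := ip1 P m X B lam b b.
(** [H N t] increases in [N] to [Fe t], which is integrable by [weights]. Bessel's inequality and
    Cauchy-Schwarz bound the square of the partial sum [s N t] by [K * H N t], so a multiple of [Fe]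
    dominates the whole sequence. *)
Let H N t := \sum_(1 <= nu < N.+1) f nu t ^+ 2 / kap nu.
Let s N t := \sum_(1 <= nu < N.+1) c nu * f nu t.
Let Fe t := limn (fun N => (H N t)%:E).

Let sE N t : s N t = res (partial_sum c N) t.
Proof.
rewrite /s /f; case: (boolP (0 <= t <= 1)) => h; last first.
  by rewrite res_out// big1// => i _; rewrite res_out// mulr0.
by rewrite res_in//; apply: eq_bigr => i _; rewrite res_in.
Qed.

Let ms N : measurable_fun setT (s N).
Proof.
have -> : s N = res (partial_sum c N) by apply/funext => t; exact: sE.
by apply: L2_meas; apply: L2S; exact: sobolev_partial_sum.
Qed.

Let K0 : 0 <= K. Proof. exact: ip1_ge0. Qed.

Let HS N t : H N t <= H N.+1 t.
Proof. by rewrite /H [leRHS]big_nat_recr//= lerDl divr_ge0 ?sqr_ge0// ltW// kap0. Qed.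

Let H_nd t : nondecreasing_seq (fun N => (H N t)%:E).
Proof. by apply/nondecreasing_seqP => N; rewrite lee_fin. Qed.

Let H0 N t : 0 <= H N t.
Proof.
rewrite /H big_nat_cond; apply: sumr_ge0 => i /andP[/andP[i0 _] _].
by rewrite divr_ge0 ?sqr_ge0// ltW// kap0.
Qed.

(** With absolute values of the coefficients, this yields absolute convergence wherever [Fe] is
    finite. *)
Let abs_le (x : nat -> R) N t : (forall nu, `|x nu| <= `|c nu|) ->
  (\sum_(1 <= nu < N.+1) x nu * `|f nu t|) ^+ 2 <= K * H N t.
Proof.
move=> xc; pose kap' nu := if (0 < nu)%N then kap nu else 1.
have k' i : 0 < kap' i by rewrite /kap'; case: ifP => // i0; exact: kap0.
apply: (le_trans (sum_weighted_cauchy_schwarz _ _ _ k')); apply: ler_pM.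
- by apply: sumr_ge0 => i _; rewrite mulr_ge0 ?sqr_ge0// ltW.
- by apply: sumr_ge0 => i _; rewrite divr_ge0 ?sqr_ge0// ltW.
- apply: le_trans (bessel N); rewrite big_nat_cond [leRHS]big_nat_cond.
  apply: ler_sum => i /andP[/andP[i0 _] _]; rewrite /kap' i0 ler_wpM2l// ?(ltW (kap0 i0))//.
  rewrite -(real_normK (num_real (x i))) -(real_normK (num_real (c i))).
  by apply: lerXn2r; rewrite ?nnegrE.
- rewrite le_eqVlt; apply/orP; left; apply/eqP; rewrite /H big_nat_cond [RHS]big_nat_cond.
  by apply: eq_bigr => i /andP[/andP[i0 _] _]; rewrite /kap' i0 real_normK ?num_real.
Qed.

Let s_le N t : s N t ^+ 2 <= K * H N t.
Proof.
have := @abs_le (fun nu => `|c nu|) N t; move=> /(_ (fun nu => _)).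
have h nu : `|(`|c nu|)| <= `|c nu| by rewrite normr_id.
move=> /(_ h); apply: le_trans; rewrite -(real_normK (num_real (s N t))).
apply: lerXn2r; rewrite ?nnegrE//; first by apply: sumr_ge0 => i _; rewrite mulr_ge0.
by apply: (le_trans (ler_norm_sum _ _ _)); apply: ler_sum => i _; rewrite normrM.
Qed.

Let mH N : measurable_fun setT (H N).
Proof.
rewrite /H; have hm : forall n, measurable_fun setT (fun t => \sum_(1 <= nu < n.+1) f nu t ^+ 2 / kap nu).
  elim=> [|n ih]; first by under eq_fun do rewrite big_nil; exact: measurable_cst.
  under eq_fun do rewrite big_nat_recr//=; apply: measurable_funD => //.
  by apply: measurable_funM => //; apply: measurable_funX; apply: L2_meas; exact: Lphi.
exact: hm.
Qed.

Let mFe : measurable_fun setT Fe.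
Proof.
apply: (emeasurable_fun_cvg (fun N t => (H N t)%:E)).
  by move=> N; apply/measurable_EFinP; exact: mH.
by move=> t _; apply: ereal_nondecreasing_is_cvgn; exact: H_nd.
Qed.

Let iH N : intg mu (H N) /\ itg mu (H N) = \sum_(1 <= nu < N.+1) ip (phi nu) (phi nu) / kap nu.
Proof.
elim: N => [|N [ih eh]].
  by rewrite /H; under eq_fun do rewrite big_nil; rewrite big_nil; split; [exact: intg0|exact: itg0].
have iff : intg mu (fun t => f N.+1 t ^+ 2) by apply: L2_sq; exact: Lphi.
have E : H N.+1 = (fun t => H N t + f N.+1 t ^+ 2 / kap N.+1).
  by apply/funext => t; rewrite /H big_nat_recr.
have i2 : intg mu (fun t => f N.+1 t ^+ 2 / kap N.+1) by exact: intgZr.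
rewrite E; split; first exact: intgD.
by rewrite itgD// eh [RHS]big_nat_recr//= itgZr// ipE.
Qed.

Let Fe0 t : (0 <= Fe t)%E.
Proof.
apply: lime_ge; first by apply: ereal_nondecreasing_is_cvgn; exact: H_nd.
by apply: nearW => N; rewrite lee_fin.
Qed.

Let HFe N t : ((H N t)%:E <= Fe t)%E.
Proof.
apply: lime_ge; first by apply: ereal_nondecreasing_is_cvgn; exact: H_nd.
by near=> n; apply: H_nd; near: n; exact: nbhs_infty_ge.
Unshelve. all: by end_near. Qed.

Let iFe : mu.-integrable setT Fe.
Proof.
have [S hS] := weights; apply/integrableP; split; first exact: mFe.
under eq_integral do rewrite gee0_abs//.
have := @cvg_monotone_convergence _ _ _ mu setT measurableT (fun N t => (H N t)%:E).
have mH' N : measurable_fun setT (fun t => (H N t)%:E) by apply/measurable_EFinP; exact: mH.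
move=> /(_ mH' (fun N t _ => H0 N t) (fun t _ => H_nd t)) /cvg_lim <- //.
apply: (@le_lt_trans _ _ S%:E); last by rewrite ltry.
apply: lime_le.
  apply: ereal_nondecreasing_is_cvgn; apply/nondecreasing_seqP => N.
  have [i1 e1] := iH N; have [i2 e2] := iH N.+1.
  rewrite -(EFin_itg i1) -(EFin_itg i2) lee_fin e1 e2 [leRHS]big_nat_recr//= lerDl.
  by rewrite divr_ge0 ?ip_ge0// ltW// kap0.
apply: nearW => N; have [ih eh] := iH N.
by rewrite -EFin_itg// lee_fin eh.
Qed.

Let F t := fine (Fe t).
Let iF : intg mu F.
Proof.
have iFe' := iFe; have fae := integrable_ae measurableT iFe.
apply/integrableP; split; first by apply/measurable_EFinP; apply: measurableT_comp.
move/integrableP : iFe' => [_]; apply: le_lt_trans; apply: ge0_le_integral => //.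
- by apply: measurableT_comp => //; apply/measurable_EFinP; apply: measurableT_comp.
- exact: measurableT_comp.
- move=> t _; rewrite gee0_abs// /= /F; case: (Fe t) (Fe0 t) => [r| |] //= r0.
    by rewrite ger0_norm.
Qed.

Let fin t := (Fe t < +oo)%E.

Let ae_fin : {ae mu, forall t, fin t}.
Proof.
have := integrable_ae measurableT iFe; apply: filterS.
by move=> t /(_ I); rewrite /fin fin_numE => /andP[_]; rewrite ltey.
Qed.

Let HF N t : fin t -> H N t <= F t.
Proof.
move=> ft; rewrite -lee_fin /F fineK ?HFe//.
by rewrite ge0_fin_numE.
Qed.

Let s_cvg t : fin t -> cvgn (fun N => s N t).
Proof.
move=> ft; pose u i := c i.+1 * f i.+1 t.
have E v N : \sum_(1 <= nu < N.+1) v nu = series (fun i => v i.+1 : R) N.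
  by rewrite big_add1.
rewrite (_ : (fun N => _) = series u); last by apply/funext => N; exact: (E (fun i => c i * f i t)).
apply: (@normed_cvg R R^o).
apply: nondecreasing_is_cvgn; first by apply/nondecreasing_seqP => n; rewrite /= !seriesEnat /= big_nat_recr//= lerDl.
exists (Num.sqrt (K * F t)) => _ [N _ <-].
have := @abs_le (fun nu => `|c nu|) N t (fun nu => _).
have h nu : `|(`|c nu|)| <= `|c nu| by rewrite normr_id.
move=> /(_ h) h2.
have -> : [normed series u] N = \sum_(1 <= nu < N.+1) `|c nu| * `|f nu t|.
  by rewrite E /series /=; apply: eq_bigr => i _; rewrite /u normrM.
have S0 : 0 <= \sum_(1 <= nu < N.+1) `|c nu| * `|f nu t| by apply: sumr_ge0 => i _; rewrite mulr_ge0.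
rewrite -(ger0_norm S0) -sqrtr_sqr ler_wsqrtr//; apply: (le_trans h2).
by rewrite ler_wpM2l// HF.
Qed.

(** The pointwise sum of the series, to be identified with [b]; it is set to 0 on the null set where
    [Fe] is infinite. *)
Let G t := if fin t then limn (fun N => s N t) else 0.

Let mfin : measurable_fun setT fin.
Proof.
apply: (measurable_fun_bool true); rewrite setTI.
have := emeasurable_fun_infty_o measurableT mFe +oo%E; rewrite setTI.
by congr measurable; apply/seteqP; split => t.
Qed.

Let sG t : fin t -> s N t @[N --> \oo] --> G t.
Proof. by rewrite /G => ft; rewrite ft; exact: s_cvg. Qed.

Let mG : measurable_fun setT G.
Proof.
apply: (@measurable_fun_cvg _ _ _ setT (fun N t => if fin t then s N t else 0)).
  by move=> N; apply: measurable_fun_ifT.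
move=> t _; case: (boolP (fin t)) => ft; first exact: sG.
by rewrite /G (negbTE ft); exact: cvg_cst.
Qed.

Let G_le t : fin t -> G t ^+ 2 <= K * F t.
Proof.
move=> ft; have cG := sG ft.
have : s N t ^+ 2 @[N --> \oo] --> G t ^+ 2 by under eq_fun do rewrite expr2; rewrite expr2; exact: (cvgM cG cG).
move=> /cvg_lim <- //; apply: limr_le; last first.
  by apply: nearW => N; apply: (le_trans (s_le N t)); rewrite ler_wpM2l// HF.
by apply/cvg_ex; exists (G t ^+ 2); under eq_fun do rewrite expr2; rewrite expr2; exact: (cvgM cG cG).
Qed.

Let resG : res G = G.
Proof.
apply/funext => t; case: (boolP (0 <= t <= 1)) => h; first by rewrite res_in.
rewrite res_out// /G; case: ifP => // _; rewrite (_ : (fun N => s N t) = (fun=> 0)) ?lim_cst//.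
by apply/funext => N; rewrite sE res_out.
Qed.

Let L2G : L2 G.
Proof.
apply/L2P; rewrite resG; split => //.
apply: (@ae_intg _ _ _ mu (fun t => if fin t then G t ^+ 2 else 0)).
- by apply: measurable_fun_ifT => //; exact: measurable_funX.
- exact: measurable_funX.
- move: ae_fin; apply: filterS; first exact: (ae_filter_ringOfSetsType mu).
  by move=> t ->.
- apply: (@intg_le _ _ _ mu (fun t => K * F t)).
  + by apply: measurable_fun_ifT => //; exact: measurable_funX.
  + move=> t; case: ifP => ft; first by rewrite ger0_norm ?sqr_ge0//; exact: G_le.
    by rewrite normr0 mulr_ge0// /F fine_ge0.
  + exact: intgZ.
Qed.

Let e N (t : R) := partial_sum c N t + -1 * G t.

Let Le N : L2 (e N).
Proof. exact: (L2_lin (-1) (L2S (sobolev_partial_sum c N)) L2G). Qed.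

Let ip_e_cvg : ip (e N) (e N) @[N --> \oo] --> (0 : R).
Proof.
have E N : ip (e N) (e N) = itg mu (fun t => (s N t - G t) ^+ 2).
  rewrite ipE; congr itg; apply/funext => t.
  by rewrite /e res_lin resG sE mulN1r expr2.
under eq_fun do rewrite E.
rewrite -(itg0 mu).
apply: (@itg_dominated _ _ _ mu (fun N t => (s N t - G t) ^+ 2) (fun=> 0) (fun t => 4 * K * F t) _ _ _ _ _).2.
- by move=> n; have h := measurable_funX 2 (measurable_funB (ms n) mG); exact: h.
- exact: measurable_cst.
- move: ae_fin; apply: filterS; first exact: (ae_filter_ringOfSetsType mu).
  move=> t ft; have h : s n t - G t @[n --> \oo] --> (0 : R).
    by rewrite -(subrr (G t)); apply: (@cvgB _ R^o); [exact: sG|exact: cvg_cst].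
  by under eq_fun do rewrite expr2; rewrite -(mulr0 (0 : R)); exact: (cvgM h h).
- exact: intgZ.
- move: ae_fin; apply: filterS; first exact: (ae_filter_ringOfSetsType mu).
  move=> t ft n; rewrite ger0_norm ?sqr_ge0//.
  have := G_le ft; have : s n t ^+ 2 <= K * F t by apply: (le_trans (s_le n t)); rewrite ler_wpM2l// HF.
  by have := sqr_ge0 (s n t + G t); nra.
Qed.

Let delta (t : R) := b t + -1 * G t.
Let Ld : L2 delta. Proof. exact: (L2_lin (-1) (L2S sb) L2G). Qed.

(** [delta] is the sum of [rest], small in [V] by the expansion hypothesis, and of [e], small in L^2
    and therefore in [V]. *)
Let V_delta N : VV delta delta <= 2 * VV (rest c b N) (rest c b N) + 2 * VV (e N) (e N).
Proof.
have V2 (sg : R) : sg ^+ 2 = 1 -> VV (fun t => rest c b N t + sg * e N t) (fun t => rest c b N t + sg * e N t) =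
    VV (rest c b N) (rest c b N) + 2 * sg * VV (rest c b N) (e N) + VV (e N) (e N).
  move=> s2; have l1 := L2_lin sg (Lr N) (Le N).
  rewrite (V_linl rX mB C20 hB hXX momX sg (Lr N) (Le N) l1).
  rewrite !(V_linr rX mB C20 hB hXX momX sg (Lr N) (Le N)) ?(VC rX mB C20 hB hXX momX (Le N) (Lr N))//.
  move: (VV (rest c b N) (rest c b N)) (VV (rest c b N) (e N)) (VV (e N) (e N)) => x y z.
  by rewrite mulrDr (mulrA sg sg) -expr2 s2; ring.
have d1 : delta = (fun t => rest c b N t + 1 * e N t) by apply/funext => t; rewrite /delta /rest /e; ring.
have := V_ge0 rX mB C20 hB hXX momX (L2_lin (-1) (Lr N) (Le N)).
rewrite V2 ?sqrrN ?expr1n// d1 V2 ?expr1n//.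
move: (VV (rest c b N) (rest c b N)) (VV (rest c b N) (e N)) (VV (e N) (e N)) => x y z.
by lra.
Qed.

Let V_delta0 : VV delta delta = 0.
Proof.
apply/eqP; rewrite eq_le (V_ge0 rX mB C20 hB hXX momX Ld) andbT.
set M := itg P (fun w => ip (X w) (X w)).
have lim0 : 2 * ip1 P m X B lam (rest c b N) (rest c b N) + 2 * (C2 * M * ip (e N) (e N)) @[N --> \oo] --> (0 : R).
  rewrite -[X in _ --> X](_ : 2 * 0 + 2 * (C2 * M * 0) = 0 :> R); last by rewrite !mulr0 addr0.
  apply: (@cvgD _ R^o); first by apply: cvgM; [exact: cvg_cst|exact: rest_cvg].
  by apply: cvgM; [exact: cvg_cst|]; apply: cvgM; [exact: cvg_cst|exact: ip_e_cvg].
rewrite -(cvg_lim _ lim0)//; apply: limr_ge; first by apply/cvg_ex; exists 0.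
apply: nearW => N; apply: (le_trans (V_delta N)).
have h1 := V_le_ip1 (sobolev_rest c N sb); have h2 := V_le rX mB C20 hB hXX momX (Le N).
by apply: lerD; apply: ler_wpM2l; [|exact: h1| |exact: h2].
Qed.

(** The covariance operator kills [delta], because its [V] is zero, and by injectivity [delta]
    vanishes almost everywhere. The series thus converges to [b] in L^2, where the integral against
    [x] is continuous. *)
Lemma ip_expansion x : L2 x ->
  \sum_(1 <= nu < N.+1) c nu * ip x (phi nu) @[N --> \oo] --> ip x b.
Proof.
move=> Lx; have Lb := L2S sb.
have d0 : ae_eq mu unit_itv delta (cst 0).
  apply: injective_Cov => //; apply: aeW => t ht.
  exact: (V_eq0 rX mB C20 hB hXX momX Ld V_delta0 ht).
have -> : ip x b = ip x G.
  apply: ip_ae => //; move: d0; apply: filterS.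
  move=> t h; case: (boolP (0 <= t <= 1)) => ht; last by rewrite !res_out.
  rewrite !res_in//; apply/eqP; rewrite -subr_eq0; apply/eqP; rewrite -mulN1r.
  by apply: h; rewrite unit_itvE.
have E N : \sum_(1 <= nu < N.+1) c nu * ip x (phi nu) = ip x (e N) + ip x G.
  have Lp : L2 (partial_sum c N) by apply: L2S; exact: sobolev_partial_sum.
  rewrite /e ip_linr// mulN1r addrNK; elim: {Lp} N => [|N ih].
    rewrite big_nil /partial_sum; under [in RHS]eq_fun do rewrite big_nil; by rewrite ip0r.
  rewrite big_nat_recr//= ih /partial_sum; under [in RHS]eq_fun do rewrite big_nat_recr//=.
  rewrite ip_linr//; first by apply: L2S; exact: sobolev_partial_sum.
  exact: Lphi.
under eq_fun do rewrite E.
suff h : ip x (e N) @[N --> \oo] --> (0 : R).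
  have hG : (fun _ : nat => ip x G) @ \oo --> ip x G by exact: cvg_cst.
  by have := @cvgD _ R^o _ _ _ _ _ _ _ h hG; rewrite add0r; exact.
apply/norm_cvg0P; apply: (@squeeze_cvgr _ _ _ _ (fun=> 0) (fun N => Num.sqrt (ip x x * ip (e N) (e N)))).
- apply: nearW => N; rewrite normr_ge0/= -sqrtr_sqr ler_wsqrtr//.
  exact: ip_cauchy_schwarz.
- exact: cvg_cst.
- rewrite -sqrtr0 -(mulr0 (ip x x)).
  apply: (@cvg_comp _ _ _ (fun N => ip x x * ip (e N) (e N)) Num.sqrt _ (nbhs (ip x x * 0 : R))).
    by apply: cvgM => //; exact: cvg_cst.
  exact: sqrt_continuous.
Qed.

End expansion.

(** * Moments of the score *)

Section conditional_expectation.
Context d (T : measurableType d) (R : realType) (P : probability T R).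
Variable X : T -> R -> R.
Hypothesis rX : random_process X.

Let preX (A : set (pathType R)) : measurable A -> measurable [set w | A (X w)].
Proof.
move=> mA; have := measurable_path rX measurableT mA; rewrite setTI.
by congr measurable.
Qed.

(** [Z - g (X)] has zero integral over every event determined by [X], so [condexp0_mul] applies to
    it. *)
Lemma condexp_mul (Z : T -> R) (g psi : pathType R -> R) :
  is_condexp P X (fun w => (Z w)%:E) (fun x => (g x)%:E) ->
  intg P Z -> intg P (fun w => g (X w)) ->
  measurable_fun setT psi ->
  intg P (fun w => Z w * psi (X w)) -> intg P (fun w => g (X w) * psi (X w)) ->
  itg P (fun w => Z w * psi (X w)) = itg P (fun w => g (X w) * psi (X w)).
Proof.
move=> [_ cZ] iZ ig mpsi iZp igp.
apply/eqP; rewrite -subr_eq0 -itgB//; apply/eqP.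
under eq_fun do rewrite -mulrBl.
apply: (condexp0_mul (X := X : T -> pathType R) (U := fun w => Z w - g (X w))) => //.
- exact: measurable_path.
- exact: intgB.
- move=> A mA.
  have iI (f : T -> R) : intg P f -> intg P (fun w => f w * \1_A (X w)).
    move=> hf; apply: (@intg_le _ _ _ P (fun w => `|f w|)).
    + apply: measurable_funM; first exact: intg_meas hf.
      exact: (measurableT_comp (measurable_indic mA) (measurable_path rX)).
    + by move=> w; rewrite normrM indicE; case: (_ \in _); rewrite ?normr1 ?mulr1 ?normr0 ?mulr0.
    + exact: intg_norm.
  under eq_fun do rewrite mulrBl.
  rewrite itgB; [|exact: iI..]; apply/eqP; rewrite subr_eq0; apply/eqP.
  have E (f : T -> R) : itg P (fun w => f w * \1_A (X w)) = fine (\int[P]_(w in [set w | A (X w)]) (f w)%:E)%E.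
    rewrite /itg /Rintegral; congr fine; rewrite [RHS]integral_mkcond; apply: eq_integral => w _.
    rewrite patchE indicE; case: (boolP (X w \in A)) => h.
      by rewrite mulr1 mem_set//; rewrite inE in h.
    by rewrite mulr0 memNset// => hA; move/negP: h; apply; rewrite inE.
  by rewrite !E cZ.
- by under eq_fun do rewrite mulrBl; exact: intgB.
Qed.

(** The version [g] is bounded above but has no known sign, so it is compared through its positive
    part. *)
Lemma condexp_le_integral (Z : T -> \bar R) (C : R) : 0 <= C -> condexp_le P X Z C ->
  (\int[P]_w Z w <= C%:E)%E.
Proof.
move=> C0 [g [mg cZ] gC]; have := cZ setT measurableT.
have -> : [set w | [set: pathType R] (X w)] = setT by [].
move=> ->; have mgX : measurable_fun setT (fun w => g (X w)).
  exact: (measurableT_comp mg (measurable_path rX)).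
rewrite integralE; apply: (@le_trans _ _ (\int[P]_w (fun w => g (X w))^\+ w)%E).
  by rewrite geeDl// oppe_le0; apply: integral_ge0 => w _; exact: funeneg_ge0.
rewrite -[C%:E]mule1 -(@probability_setT _ _ _ P) -integral_cst//.
apply: ae_ge0_le_integral => //.
- exact: measurable_funepos.
- move: gC; apply: filterS => w h _.
  by rewrite funeposE /= ge_max h lee_fin C0.
Qed.

End conditional_expectation.

Lemma measurable_expeR (R : realType) : measurable_fun setT (@expeR R).
Proof.
have E : @expeR R = (fun x => if x == -oo%E then 0%E else er_map expR x).
  by apply/funext; case.
rewrite E.
have mb : measurable_fun setT (fun x : \bar R => x == -oo%E).
  apply: (measurable_fun_bool true); rewrite setTI.
  have := @emeasurable_set1 R -oo%E; congr measurable.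
  by apply/seteqP; split => x /= /eqP.
have mer : measurable_fun setT (er_map (@expR R)) by apply: (@measurable_er_map _ (measurableTypeR R)); exact: measurable_expR.
exact: (measurable_fun_ifT mb (measurable_cst _) mer).
Qed.

(** * Moments of the residual, of the derivatives of the criterion and of the path norm *)

Section base_moments.
Context d (T : measurableType d) (R : realType) (P : probability T R).
Variables (Y : T -> R) (X : T -> R -> R) (G : R -> R -> R).
Variable th0 : R * (R -> R).
Hypothesis rX : random_process X.
Hypothesis mY : measurable_fun setT Y.
Hypothesis mG : forall a, measurable_fun setT (fun y => G y a).
Hypothesis dG : forall y j, (j < 3)%N -> forall a : R, derivable (derive1n j (G y)) a 1.
Hypothesis cG3 : forall y, continuous (derive1n 3 (G y)).
Hypothesis Lb0 : L2 th0.2.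

Local Notation O := (measurableTypeR R * pathType R)%type.

(* The law of the sample is only known on cylinder sets, for which the evaluation
   [x |-> x t] is not measurable: everything goes through functionals [ip x b]. *)
Definition ob_eps (o : O) : R := derive1n 1 (G o.1) (predictor th0 o.2).
Definition ob_D (o : O) : R := derive1n 2 (G o.1) (predictor th0 o.2).
Definition ob_W (o : O) : R := fine (sup_deriv_ell G 3 o.1).

Lemma measurable_predictor (th : R * (R -> R)) : L2 th.2 ->
  measurable_fun setT (fun x : pathType R => predictor th x).
Proof. by move=> h; apply: measurable_funD => //; exact: measurable_ip_path. Qed.

Lemma measurable_ob j : (j <= 3)%N ->
  measurable_fun setT (fun o : O => derive1n j (G o.1) (predictor th0 o.2)).
Proof.
move=> j3; pose pr (o : O) : measurableTypeR R * measurableTypeR R := (o.1, predictor th0 o.2).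
have mpr : measurable_fun setT pr.
  apply: measurable_fun_pair => //.
  exact: (measurableT_comp (measurable_predictor Lb0) measurable_snd).
exact: (measurableT_comp (measurable_criterion mG dG cG3 j3) mpr).
Qed.

Lemma measurable_ob_eps : measurable_fun setT ob_eps. Proof. exact: measurable_ob. Qed.
Lemma measurable_ob_D : measurable_fun setT ob_D. Proof. exact: measurable_ob. Qed.
Lemma measurable_ob_W : measurable_fun setT ob_W.
Proof.
apply: (measurableT_comp (f := fun y => fine (sup_deriv_ell G 3 y))) => //.
apply: measurableT_comp => //; exact: (measurable_sup_deriv_ell mG dG cG3).
Qed.

Lemma sup_deriv_ell_ge0 j (y : R) : (0 <= sup_deriv_ell G j y)%E.
Proof.
apply: (@le_trans _ _ (`|derive1n j (G y) 0|%:E)); first by rewrite lee_fin.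
by apply: ereal_sup_ubound; exists 0.
Qed.

Variables (C0 C1 : R).
Hypothesis C00 : 0 < C0.
Hypothesis C10 : 0 < C1.
Hypothesis exp2 : condexp_le P X (fun w => expeR (sup_deriv_ell G 2 (Y w) * (C0^-1)%:E)%E) C1.
Hypothesis exp3 : condexp_le P X (fun w => expeR (sup_deriv_ell G 3 (Y w) * (C0^-1)%:E)%E) C1.

Let ob w : O := obs Y X w.
Let mob : measurable_fun setT ob. Proof. exact: measurable_obs. Qed.

Let msup j : (j <= 3)%N -> measurable_fun setT (fun w => sup_deriv_ell G j (Y w)).
Proof. by move=> j3; exact: (measurableT_comp (measurable_sup_deriv_ell mG dG cG3 j3) mY). Qed.

Let exp_moment j (f : T -> R) : (j <= 3)%N ->
  condexp_le P X (fun w => expeR (sup_deriv_ell G j (Y w) * (C0^-1)%:E)%E) C1 ->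
  measurable_fun setT f -> (forall w, (`|f w|%:E <= sup_deriv_ell G j (Y w))%E) -> all_moments P f.
Proof.
move=> j3 he mf fle; apply: (@exp_all_moments _ _ _ _ _ C0^-1) => //; first by rewrite invr_gt0.
apply: (@le_lt_trans _ _ C1%:E); last by rewrite ltry.
apply: le_trans (condexp_le_integral rX (ltW C10) he).
apply: ge0_le_integral => //.
- apply/measurable_EFinP; apply: measurableT_comp => //; apply: measurable_funM => //.
  exact: measurableT_comp.
- apply: measurableT_comp; last by apply: emeasurable_funM => //; exact: msup.
  exact: measurable_expeR.
- move=> w _; rewrite -[leLHS]/(expeR (C0^-1 * `|f w|)%:E) lee_expeR mulrC EFinM.
  by apply: lee_wpmul2r; rewrite ?lee_fin ?invr_ge0 ?(ltW C00).
Qed.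

Lemma ob_D_moments : all_moments P (fun w => ob_D (ob w)).
Proof.
apply: (exp_moment _ exp2) => //; first exact: (measurableT_comp measurable_ob_D mob).
by move=> w; apply: ereal_sup_ubound; exists (predictor th0 (X w)).
Qed.

Lemma ob_W_moments : all_moments P (fun w => ob_W (ob w)).
Proof.
apply: (exp_moment _ exp3) => //; first exact: (measurableT_comp measurable_ob_W mob).
move=> w; rewrite /ob_W /=; case: (sup_deriv_ell G 3 (Y w)) (sup_deriv_ell_ge0 3 (Y w)) => [r| |] //= r0.
  by rewrite ger0_norm.
by rewrite normr0.
Qed.

Lemma ob_W_finite : {ae P, forall w, (sup_deriv_ell G 3 (Y w) < +oo)%E}.
Proof.
pose Z w := expeR (sup_deriv_ell G 3 (Y w) * (C0^-1)%:E)%E.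
have mZ : measurable_fun setT Z.
  apply: measurableT_comp; first exact: measurable_expeR.
  by apply: emeasurable_funM => //; exact: msup.
have iZ : P.-integrable setT Z.
  apply/integrableP; split => //; under eq_integral do rewrite gee0_abs ?expeR_ge0//.
  by rewrite (le_lt_trans (condexp_le_integral rX (ltW C10) exp3))// ltry.
have := integrable_ae measurableT iZ; apply: filterS => w /(_ I).
rewrite /Z; case: (sup_deriv_ell G 3 (Y w)) => [r| |] //= h; first by rewrite ltry.
by move: h; rewrite gt0_mulye ?lte_fin ?invr_gt0.
Qed.

Variable sx : R.
Hypothesis sx0 : 0 < sx.
Hypothesis expX : ('E_P[fun w => expR (sx * L2norm (X w))] < +oo)%E.
Variable se : R.
Hypothesis se0 : 0 < se.
Hypothesis expe : ('E_P[fun w => expR (se * `|residual G Y X th0 w|)] < +oo)%E.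

Lemma ob_eps_moments : all_moments P (fun w => ob_eps (ob w)).
Proof.
apply: (exp_all_moments se0); first exact: (measurableT_comp measurable_ob_eps mob).
by move: expe; rewrite unlock.
Qed.

Lemma measurable_L2normX : measurable_fun setT (fun w => L2norm (X w)).
Proof.
exact: (measurableT_comp (continuous_measurable_fun (@sqrt_continuous R)) (measurable_ipXX rX)).
Qed.

Lemma normX_moments : all_moments P (fun w => L2norm (X w)).
Proof.
apply: (exp_all_moments sx0); first exact: measurable_L2normX.
move: expX; rewrite unlock.
by under eq_integral do rewrite -[L2norm _]ger0_norm ?sqrtr_ge0//.
Qed.

(** A single variable with all moments that dominates every factor of the score expansion, so that
    products are bounded by its powers. The summand 1 covers the coordinate of the intercept. *)
Definition envelope (w : T) : R :=
  1 + `|ob_eps (ob w)| + `|ob_D (ob w)| + `|ob_W (ob w)| + L2norm (X w).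

Lemma envelope_moments : all_moments P envelope.
Proof.
apply: all_momentsD; last exact: normX_moments.
apply: all_momentsD; last by apply: all_moments_norm; exact: ob_W_moments.
apply: all_momentsD; last by apply: all_moments_norm; exact: ob_D_moments.
apply: all_momentsD; last by apply: all_moments_norm; exact: ob_eps_moments.
exact: all_moments_cst.
Qed.

Lemma envelope_bounds w : [/\ 1 <= envelope w, `|ob_eps (ob w)| <= envelope w,
  `|ob_D (ob w)| <= envelope w, `|ob_W (ob w)| <= envelope w & L2norm (X w) <= envelope w].
Proof.
rewrite /envelope; have := normr_ge0 (ob_eps (ob w)); have := normr_ge0 (ob_D (ob w)).
have := normr_ge0 (ob_W (ob w)); have : 0 <= L2norm (X w) by exact: sqrtr_ge0.
by move=> *; split; lra.
Qed.

Lemma ip_le_norm w b : L2 b -> `|ip (X w) b| <= L2norm (X w) * L2norm b.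
Proof.
move=> lb; rewrite /L2norm -sqrtrM ?ip_ge0// -sqrtr_sqr ler_wsqrtr//.
by apply: ip_cauchy_schwarz => //; exact: process_L2.
Qed.

End base_moments.

(** * Linear and quadratic terms of the score expansion *)

Lemma cvg_sumr (R : realType) (I : Type) (s : seq I) (f : I -> nat -> R) (l : I -> R) :
  (forall i, f i N @[N --> \oo] --> l i) ->
  \sum_(i <- s) f i N @[N --> \oo] --> \sum_(i <- s) l i.
Proof.
move=> h; elim: s => [|i s ih]; first by under eq_fun do rewrite big_nil; rewrite big_nil; exact: cvg_cst.
under eq_fun do rewrite big_cons; rewrite big_cons.
exact: (@cvgD _ R^o _ _ _ _ _ _ _ (h i) ih).
Qed.

Lemma cvg_sq_le (R : realType) (x : nat -> R) (l B : R) : x @ \oo --> l -> (\forall N \near \oo, x N ^+ 2 <= B) -> l ^+ 2 <= B.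
Proof.
move=> cx hx; have c2 : x N ^+ 2 @[N --> \oo] --> l ^+ 2.
  by under eq_fun do rewrite expr2; rewrite expr2; exact: (cvgM cx cx).
by rewrite -(cvg_lim _ c2)//; apply: limr_le => //; apply/cvg_ex; exists (l ^+ 2).
Qed.

Section linearization.
Context d (T : measurableType d) (R : realType) (P : probability T R).
Context dO (O : measurableType dO) (ob : T -> O) (os : nat -> T -> O).
Hypothesis mob : measurable_fun setT ob.
Hypothesis mos : forall i, measurable_fun setT (os i).
Hypothesis ind : mutually_independent P os.
Hypothesis law : forall i, same_law P (os i) ob.
(** Abstract observations: [D] and [W] stand for the second derivative of the criterion and the
    bound on the third, [xi nu] for the coordinates of a path with the intercept at index 0, [Q] for
    the envelope; below, [To] stands for the integral against the test direction and [tt] for the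
    coefficients of that direction. *)
Variables (D W : O -> R) (xi : nat -> O -> R) (u kap : nat -> R) (Q : T -> R).
Hypothesis mD : measurable_fun setT D.
Hypothesis mW : measurable_fun setT W.
Hypothesis mxi : forall nu, measurable_fun setT (xi nu).
Hypothesis momQ : all_moments P Q.
Hypothesis Q1 : forall w, 1 <= Q w.
Hypothesis DQ : forall w, `|D (ob w)| <= Q w.
Hypothesis WQ : forall w, `|W (ob w)| <= Q w.
Hypothesis xiQ : forall nu w, `|xi nu (ob w)| <= u nu * Q w.
Hypothesis u0 : forall nu, 0 <= u nu.
Hypothesis kap1 : forall nu, 1 <= kap nu.
Variables (C4 C5 : R).
Hypothesis C40 : 0 <= C4.
Hypothesis C50 : 0 <= C5.
Hypothesis xi4 : forall N (c : nat -> R),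
  intg P (fun w => (\sum_(nu < N.+1) c nu * xi nu (ob w)) ^+ 4) /\
  itg P (fun w => (\sum_(nu < N.+1) c nu * xi nu (ob w)) ^+ 4) <= C5 * (\sum_(nu < N.+1) c nu ^+ 2) ^+ 2.
Variables (To : O -> R) (sigma : R) (tt : nat -> R).
Hypothesis mTo : measurable_fun setT To.
Hypothesis sigma0 : 0 < sigma.
Hypothesis T4 : intg P (fun w => To (ob w) ^+ 4) /\ itg P (fun w => To (ob w) ^+ 4) <= C4 * sigma ^+ 4.
Hypothesis meanD : forall nu, itg P (fun w => D (ob w) * To (ob w) * xi nu (ob w)) = - tt nu.

Let q k := itg P (fun w => Q w ^+ k).

Let Q0 w : 0 <= Q w. Proof. exact: le_trans ler01 (Q1 w). Qed.
Let iQ k : intg P (fun w => Q w ^+ k).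
Proof. by have [_ /(_ k)] := momQ; congr (intg P _); apply/funext => w; rewrite ger0_norm. Qed.
Let mQ : measurable_fun setT Q. Proof. by case: momQ. Qed.
Let q0 k : 0 <= q k. Proof. by apply: itg_ge0 => w; exact: exprn_ge0. Qed.
Let mT : measurable_fun setT (fun w => To (ob w)). Proof. exact: measurableT_comp. Qed.

Definition growth_cst (k : nat) : R := Num.sqrt (C4 * itg P (fun w => Q w ^+ (4 * k))).

Lemma growth_cst_ge0 k : 0 <= growth_cst k. Proof. exact: sqrtr_ge0. Qed.

(** Cauchy-Schwarz separates the fourth moment of [To] from the moments of [Q]; [growth_cst] is the
    resulting constant. *)
Lemma itg_sq_growth (Z : T -> R) (c : R) k : measurable_fun setT Z -> 0 <= c ->
  (forall w, `|Z w| <= c * `|To (ob w)| * Q w ^+ k) ->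
  intg P (fun w => Z w ^+ 2) /\
  itg P (fun w => Z w ^+ 2) <= c ^+ 2 * growth_cst k * sigma ^+ 2.
Proof.
move=> mZ c0 hZ; have [iT4 eT4] := T4.
have iT4' : intg P (fun w => (To (ob w) ^+ 2) ^+ 2) by under eq_fun do rewrite -exprM.
have iQ4 : intg P (fun w => (Q w ^+ (2 * k)) ^+ 2).
  by under eq_fun do rewrite -exprM mulnAC; exact: iQ.
have mT2 : measurable_fun setT (fun w => To (ob w) ^+ 2) by exact: measurable_funX.
have mQ2 : measurable_fun setT (fun w => Q w ^+ (2 * k)) by exact: measurable_funX.
have iTQ := intg_mul mT2 mQ2 iT4' iQ4.
have Z2 w : Z w ^+ 2 <= c ^+ 2 * (To (ob w) ^+ 2 * Q w ^+ (2 * k)).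
  rewrite -(real_normK (num_real (Z w))).
  apply: (@le_trans _ _ ((c * `|To (ob w)| * Q w ^+ k) ^+ 2)).
    by apply: lerXn2r; rewrite ?nnegrE// ?mulr_ge0// exprn_ge0.
  by rewrite !exprMn real_normK ?num_real// -mulrA -exprM mulnC.
have iZ : intg P (fun w => Z w ^+ 2).
  apply: (@intg_le _ _ _ P (fun w => c ^+ 2 * (To (ob w) ^+ 2 * Q w ^+ (2 * k)))).
  - exact: measurable_funX.
  - by move=> w; rewrite ger0_norm ?sqr_ge0.
  - exact: intgZ.
split => //; apply: (@le_trans _ _ (c ^+ 2 * itg P (fun w => To (ob w) ^+ 2 * Q w ^+ (2 * k)))).
  by rewrite -itgZ//; apply: le_itg => //; exact: intgZ.
rewrite -mulrA ler_wpM2l ?sqr_ge0//.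
have h := cauchy_schwarz mT2 mQ2 iT4' iQ4.
have i0 : 0 <= itg P (fun w => To (ob w) ^+ 2 * Q w ^+ (2 * k)).
  by apply: itg_ge0 => w; rewrite mulr_ge0 ?sqr_ge0 ?exprn_ge0.
rewrite -(ger0_norm i0) -sqrtr_sqr; have s2 : 0 <= sigma ^+ 2 by exact: sqr_ge0.
rewrite -[X in _ * X](ger0_norm s2) -sqrtr_sqr /growth_cst -sqrtrM ?mulr_ge0//; last exact: q0.
apply: ler_wsqrtr; apply: (le_trans h); rewrite mulrAC; apply: ler_pM.
- by apply: itg_ge0 => w; exact: sqr_ge0.
- by apply: itg_ge0 => w; exact: sqr_ge0.
- rewrite -exprM; apply: le_trans eT4; rewrite le_eqVlt; apply/orP; left; apply/eqP.
  by congr itg; apply/funext => w; rewrite -exprM.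
- rewrite le_eqVlt; apply/orP; left; apply/eqP.
  by congr itg; apply/funext => w; rewrite -exprM mulnAC.
Qed.

Lemma intg_of_sq (Z : T -> R) : measurable_fun setT Z -> intg P (fun w => Z w ^+ 2) -> intg P Z.
Proof.
move=> mZ iZ; apply: (@intg_le _ _ _ P (fun w => 1 + Z w ^+ 2)) => //.
- by move=> w; rewrite -(real_normK (num_real (Z w))); have := sqr_ge0 (`|Z w| - 1); nra.
- by apply: intgD => //; exact: intg_cst.
Qed.

Lemma avg_centered_sq (h : O -> R) (c : R) k n : measurable_fun setT h -> 0 <= c ->
  (forall w, `|h (ob w)| <= c * `|To (ob w)| * Q w ^+ k) -> (0 < n)%N ->
  let hc := fun o => h o - itg P (fun w => h (ob w)) in
  intg P (fun w => avg os hc n w ^+ 2) /\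
  itg P (fun w => avg os hc n w ^+ 2) <= n%:R^-1 * (c ^+ 2 * growth_cst k * sigma ^+ 2).
Proof.
move=> mh c0 hh n0 /=; set mean := itg P _; pose hc o := h o - mean.
have mhob : measurable_fun setT (fun w => h (ob w)) by exact: measurableT_comp.
have [i2 e2] := itg_sq_growth mhob c0 hh.
have i1 := intg_of_sq mhob i2.
have mhc : measurable_fun setT hc by exact: measurable_funB.
have ihc : intg P (hc \o ob) by apply: intgB => //; exact: intg_cst.
have hc0 : itg P (hc \o ob) = 0 by rewrite itgB//; [rewrite itg_cst subrr|exact: intg_cst].
have E w : hc (ob w) ^+ 2 = h (ob w) ^+ 2 + - 2 * mean * h (ob w) + mean ^+ 2 by rewrite /hc; ring.
have ihc2 : intg P (fun w => hc (ob w) ^+ 2).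
  under eq_fun do rewrite E; apply: intgD; last exact: intg_cst.
  by apply: intgD => //; exact: intgZ.
have [i e] := avg_sqr mob mos ind law mhc ihc hc0 ihc2 n0.
split => //; rewrite e ler_pM2l ?invr_gt0 ?ltr0n//; apply: le_trans e2.
under eq_fun do rewrite E.
rewrite itgD; [|by apply: intgD => //; exact: intgZ|exact: intg_cst].
rewrite itgD//; last exact: intgZ.
rewrite itgZ// itg_cst -/mean; have := sqr_ge0 mean; nra.
Qed.

Let DT nu o := D o * To o * xi nu o.
Let WT nu nu' o := W o * `|To o| * (xi nu o * xi nu' o).

Let mDT nu : measurable_fun setT (DT nu).
Proof. by apply: measurable_funM => //; exact: measurable_funM. Qed.

Let mWT nu nu' : measurable_fun setT (WT nu nu').
Proof.
apply: measurable_funM; last exact: measurable_funM.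
by apply: measurable_funM => //; exact: measurableT_comp.
Qed.

Let DT_le nu w : `|DT nu (ob w)| <= u nu * `|To (ob w)| * Q w ^+ 2.
Proof.
rewrite /DT !normrM expr2.
have -> : u nu * `|To (ob w)| * (Q w * Q w) = Q w * `|To (ob w)| * (u nu * Q w) by ring.
by apply: ler_pM; rewrite ?mulr_ge0// ler_wpM2r.
Qed.

Let WT_le nu nu' w : `|WT nu nu' (ob w)| <= (u nu * u nu') * `|To (ob w)| * Q w ^+ 3.
Proof.
rewrite /WT !normrM normr_id.
have -> : u nu * u nu' * `|To (ob w)| * Q w ^+ 3 = Q w * `|To (ob w)| * ((u nu * Q w) * (u nu' * Q w)) by ring.
apply: ler_pM; rewrite ?mulr_ge0//; first by rewrite ler_wpM2r.
exact: ler_pM.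
Qed.

(** A centered average, as [meanD] gives [DT nu] the mean [- tt nu]. *)
Definition lin_coef (n nu : nat) (w : T) : R := avg os (DT nu) n w + tt nu.

Definition quad_coef (n nu nu' : nat) (w : T) : R :=
  avg os (WT nu nu') n w - itg P (fun w => WT nu nu' (ob w)).

Let avg_shift (h : O -> R) (c : R) n w : (0 < n)%N -> avg os (fun o => h o - c) n w = avg os h n w - c.
Proof.
move=> n0; rewrite /avg big_split /= mulrDr; congr (_ + _).
by rewrite sumr_const card_ord -[X in _ * X]mulr_natl mulrA mulVf ?mul1r// pnatr_eq0 -lt0n.
Qed.

Lemma lin_coef_sq n nu : (0 < n)%N ->
  intg P (fun w => lin_coef n nu w ^+ 2) /\
  itg P (fun w => lin_coef n nu w ^+ 2) <= n%:R^-1 * (u nu ^+ 2 * growth_cst 2 * sigma ^+ 2).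
Proof.
move=> n0; have := avg_centered_sq (mDT nu) (u0 nu) (DT_le nu) n0 => /=.
have -> : itg P (fun w => DT nu (ob w)) = - tt nu := meanD nu.
rewrite (_ : (fun w => _) = (fun w => lin_coef n nu w ^+ 2))//.
by apply/funext => w; rewrite avg_shift// opprK.
Qed.

Lemma quad_coef_sq n nu nu' : (0 < n)%N ->
  intg P (fun w => quad_coef n nu nu' w ^+ 2) /\
  itg P (fun w => quad_coef n nu nu' w ^+ 2) <= n%:R^-1 * ((u nu * u nu') ^+ 2 * growth_cst 3 * sigma ^+ 2).
Proof.
move=> n0; have uu : 0 <= u nu * u nu' by rewrite mulr_ge0.
have := avg_centered_sq (mWT nu nu') uu (WT_le nu nu') n0 => /=.
rewrite (_ : (fun w => avg os _ n w ^+ 2) = (fun w => quad_coef n nu nu' w ^+ 2))//.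
by apply/funext => w; rewrite avg_shift.
Qed.

(** The mean of the quadratic form does not shrink with [n]. The fourth-moment bound [xi4] controls
    it as a form, by the unweighted sum of squares, so that no power of [S] is lost. *)
Lemma mean_quad_le N (c : nat -> R) :
  itg P (fun w => W (ob w) * `|To (ob w)| * (\sum_(nu < N.+1) c nu * xi nu (ob w)) ^+ 2)
  <= Num.sqrt (growth_cst 1 * C5) * sigma * \sum_(nu < N.+1) c nu ^+ 2.
Proof.
have mWT' : measurable_fun setT (fun w => W (ob w) * `|To (ob w)|).
  by apply: measurable_funM; [exact: measurableT_comp|exact: measurableT_comp].
have mS : measurable_fun setT (fun w => (\sum_(nu < N.+1) c nu * xi nu (ob w)) ^+ 2).
  apply: measurable_funX; apply: measurable_sum => i; apply: measurable_funM => //.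
  exact: measurableT_comp.
have [iW eW] : intg P (fun w => (W (ob w) * `|To (ob w)|) ^+ 2) /\
    itg P (fun w => (W (ob w) * `|To (ob w)|) ^+ 2) <= 1 ^+ 2 * growth_cst 1 * sigma ^+ 2.
  apply: itg_sq_growth => // w; rewrite mul1r expr1 normrM normr_id mulrC.
  by rewrite ler_wpM2l.
have [i4 e4] := xi4 N c.
have i4' : intg P (fun w => ((\sum_(nu < N.+1) c nu * xi nu (ob w)) ^+ 2) ^+ 2) by under eq_fun do rewrite -exprM.
have h := cauchy_schwarz mWT' mS iW i4'.
have c20 : 0 <= \sum_(nu < N.+1) c nu ^+ 2 by apply: sumr_ge0 => i _; exact: sqr_ge0.
apply: (le_trans (ler_norm _)); rewrite -sqrtr_sqr.
have r0 : 0 <= sigma * \sum_(nu < N.+1) c nu ^+ 2 by rewrite mulr_ge0// ltW.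
rewrite -mulrA -[X in _ * X](ger0_norm r0) -sqrtr_sqr -sqrtrM ?mulr_ge0 ?growth_cst_ge0//.
apply: ler_wsqrtr; apply: (le_trans h).
have -> : growth_cst 1 * C5 * (sigma * \sum_(nu < N.+1) c nu ^+ 2) ^+ 2 =
  (1 ^+ 2 * growth_cst 1 * sigma ^+ 2) * (C5 * (\sum_(nu < N.+1) c nu ^+ 2) ^+ 2) by ring.
apply: ler_pM => //; try (by apply: itg_ge0 => w; exact: sqr_ge0).
apply: le_trans e4; rewrite le_eqVlt; apply/orP; left; apply/eqP.
by congr itg; apply/funext => w; rewrite -exprM.
Qed.

Variable S : R.
Hypothesis S0 : 0 < S.
Hypothesis uS : forall N, \sum_(nu < N.+1) u nu ^+ 2 / kap nu <= S.

Let kap0 nu : 0 < kap nu. Proof. exact: lt_le_trans ltr01 (kap1 nu). Qed.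

(** The means of the squared coefficients, weighted by [1 / kap nu], sum to at most a multiple of
    [S / n]. The event does not involve the coefficients of the error. Adding 1 to [growth_cst]
    keeps the constant in Markov's inequality positive. *)
Lemma lin_event n (e : R) : (0 < n)%N -> 0 < e ->
  exists A, [/\ measurable A, (P A <= e%:E)%E &
    forall w, ~ A w -> forall N, \sum_(nu < N.+1) lin_coef n nu w ^+ 2 / kap nu <=
      (n%:R^-1 * (S * (growth_cst 2 + 1) * sigma ^+ 2)) / e].
Proof.
move=> n0 e0; have nn : 0 < n%:R^-1 :> R by rewrite invr_gt0 ltr0n.
have g0 := growth_cst_ge0 2.
apply: markov_nondecreasing => //.
- by move=> N; apply: intg_sum => nu; apply: intgZr; have [] := lin_coef_sq nu n0.
- by move=> N w; apply: sumr_ge0 => i _; rewrite divr_ge0 ?sqr_ge0// ltW.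
- by move=> N w; rewrite [leRHS]big_ord_recr /= lerDl divr_ge0 ?sqr_ge0// ltW.
- by rewrite !mulr_gt0// ?exprn_gt0//; lra.
- move=> N; rewrite itg_sum; last by move=> nu; apply: intgZr; have [] := lin_coef_sq nu n0.
  apply: (@le_trans _ _ (\sum_(nu < N.+1) (u nu ^+ 2 / kap nu) * (n%:R^-1 * (growth_cst 2 * sigma ^+ 2)))).
    apply: ler_sum => nu _; have [i ei] := lin_coef_sq nu n0; rewrite itgZr//.
    rewrite mulrAC ler_pM2r ?invr_gt0//; apply: (le_trans ei).
    by rewrite le_eqVlt; apply/orP; left; apply/eqP; ring.
  rewrite -mulr_suml mulrCA ler_pM2l// -mulrA; apply: ler_pM => //.
  + by apply: sumr_ge0 => i _; rewrite divr_ge0 ?sqr_ge0// ltW.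
  + by rewrite mulr_ge0 ?sqr_ge0.
  + by rewrite ler_wpM2r ?sqr_ge0//; lra.
Qed.

Lemma quad_event n (e : R) : (0 < n)%N -> 0 < e ->
  exists A, [/\ measurable A, (P A <= e%:E)%E &
    forall w, ~ A w -> forall N,
      \sum_(nu < N.+1) \sum_(nu' < N.+1) quad_coef n nu nu' w ^+ 2 / (kap nu * kap nu') <=
      (n%:R^-1 * (S ^+ 2 * (growth_cst 3 + 1) * sigma ^+ 2)) / e].
Proof.
move=> n0 e0; have nn : 0 < n%:R^-1 :> R by rewrite invr_gt0 ltr0n.
have g0 := growth_cst_ge0 3.
have k2 nu nu' : 0 < kap nu * kap nu' by exact: mulr_gt0.
have iq nu nu' : intg P (fun w => quad_coef n nu nu' w ^+ 2 / (kap nu * kap nu')).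
  by apply: intgZr; have [] := quad_coef_sq nu nu' n0.
have t0 nu nu' w : 0 <= quad_coef n nu nu' w ^+ 2 / (kap nu * kap nu') by rewrite divr_ge0 ?sqr_ge0// ltW.
apply: markov_nondecreasing => //.
- by move=> N; apply: intg_sum => nu; apply: intg_sum => nu'.
- by move=> N w; apply: sumr_ge0 => i _; apply: sumr_ge0 => j _.
- move=> N w; rewrite [leRHS]big_ord_recr /=; apply: ler_wpDr; first by apply: sumr_ge0.
  by apply: ler_sum => i _; rewrite [leRHS]big_ord_recr /= lerDl.
- by rewrite !mulr_gt0// ?exprn_gt0//; lra.
- move=> N; rewrite itg_sum; last by move=> nu; apply: intg_sum.
  apply: (@le_trans _ _ (\sum_(nu < N.+1) \sum_(nu' < N.+1)
    (u nu ^+ 2 / kap nu) * (u nu' ^+ 2 / kap nu') * (n%:R^-1 * (growth_cst 3 * sigma ^+ 2)))).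
    apply: ler_sum => nu _; rewrite itg_sum//; apply: ler_sum => nu' _.
    have [i ei] := quad_coef_sq nu nu' n0; rewrite itgZr//.
    rewrite ler_pdivrMr//; apply: (le_trans ei).
    rewrite le_eqVlt; apply/orP; left; apply/eqP; field.
    by rewrite !gt_eqF ?ltr0n//.
  rewrite (eq_bigr (fun nu : 'I_N.+1 => (u nu ^+ 2 / kap nu) * ((\sum_(nu' < N.+1) u nu' ^+ 2 / kap nu') * (n%:R^-1 * (growth_cst 3 * sigma ^+ 2))))); last first.
    by move=> nu _; rewrite mulr_suml mulr_sumr; apply: eq_bigr => nu' _; ring.
  rewrite -mulr_suml.
  have A0 : 0 <= \sum_(nu < N.+1) u nu ^+ 2 / kap nu.
    by apply: sumr_ge0 => i _; rewrite divr_ge0 ?sqr_ge0// ltW.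
  move: A0 (uS N); move: (\sum_(nu < N.+1) u nu ^+ 2 / kap nu) => A A0 AS.
  have -> : A * (A * (n%:R^-1 * (growth_cst 3 * sigma ^+ 2))) = n%:R^-1 * (A ^+ 2 * (growth_cst 3 * sigma ^+ 2)) by ring.
  rewrite ler_pM2l// -mulrA; apply: ler_pM.
  + exact: sqr_ge0.
  + by rewrite mulr_ge0 ?sqr_ge0.
  + by apply: lerXn2r; rewrite ?nnegrE// ltW.
  + by rewrite ler_wpM2r ?sqr_ge0//; lra.
Qed.

(** A deterministic bound at the sample point [w], where [c] may depend on [w] in any way: weighted
    Cauchy-Schwarz for the partial sums, then [N] to infinity. As [tt] vanishes beyond [N0], its sum
    stays fixed in the limit. *)
Lemma lin_term_bound n (w : T) (c : nat -> R) (g : nat -> R) (N0 : nat) (K2 A : R) :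
  (forall nu, (N0 < nu)%N -> tt nu = 0) ->
  (forall i, \sum_(nu < N.+1) c nu * xi nu (os i w) @[N --> \oo] --> g i) ->
  (forall N, \sum_(nu < N.+1) kap nu * c nu ^+ 2 <= K2) ->
  (forall N, \sum_(nu < N.+1) lin_coef n nu w ^+ 2 / kap nu <= A) ->
  (n%:R^-1 * (\sum_(i < n) D (os i w) * To (os i w) * g i) + \sum_(nu < N0.+1) tt nu * c nu) ^+ 2 <= K2 * A.
Proof.
move=> tt0 cg hK hA.
apply: (@cvg_sq_le _ (fun N => n%:R^-1 * (\sum_(i < n) D (os i w) * To (os i w) * (\sum_(nu < N.+1) c nu * xi nu (os i w)))
   + \sum_(nu < N0.+1) tt nu * c nu)).
  apply: (@cvgD _ R^o); last exact: cvg_cst.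
  apply: cvgM; first exact: cvg_cst.
  apply: cvg_sumr => i; apply: cvgM; first exact: cvg_cst.
  exact: cg.
near=> N.
have NN : (N0 <= N)%N by near: N; exact: nbhs_infty_ge.
have -> : \sum_(nu < N0.+1) tt nu * c nu = \sum_(nu < N.+1) tt nu * c nu.
  rewrite -!(big_mkord xpredT (fun nu => tt nu * c nu)) [RHS](@big_cat_nat _ _ _ N0.+1)//=.
  rewrite [X in _ + X]big_nat_cond [X in _ + X]big1 ?addr0// => nu /andP[/andP[h _] _].
  by rewrite tt0 ?mul0r.
have -> : n%:R^-1 * (\sum_(i < n) D (os i w) * To (os i w) * (\sum_(nu < N.+1) c nu * xi nu (os i w)))
    + \sum_(nu < N.+1) tt nu * c nu = \sum_(nu < N.+1) c nu * lin_coef n nu w.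
  rewrite /lin_coef; under [RHS]eq_bigr do rewrite mulrDr.
  rewrite big_split /=; congr (_ + _); last by apply: eq_bigr => i _; rewrite mulrC.
  under eq_bigr do rewrite mulr_sumr.
  rewrite exchange_big /= mulr_sumr; apply: eq_bigr => nu _.
  rewrite /avg mulrCA; congr (_ * _); rewrite mulr_sumr; apply: eq_bigr => i _.
  by rewrite /DT; ring.
apply: (le_trans (sum_weighted_cauchy_schwarz _ _ _ (fun i : 'I_N.+1 => kap0 i))).
apply: ler_pM; [| |exact: hK|exact: hA].
  by apply: sumr_ge0 => i _; rewrite mulr_ge0 ?sqr_ge0// ltW.
by apply: sumr_ge0 => i _; rewrite divr_ge0 ?sqr_ge0// ltW.
Unshelve. all: by end_near. Qed.

(** The averaged form splits into its mean, bounded by [mean_quad_le], and its centered part,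
    bounded by Cauchy-Schwarz over pairs of indices with the weights [kap nu * kap nu']. *)
Lemma quad_term_bound n (w : T) (c : nat -> R) (g : nat -> R) (K2 A : R) :
  (forall i, \sum_(nu < N.+1) c nu * xi nu (os i w) @[N --> \oo] --> g i) ->
  (forall N, \sum_(nu < N.+1) kap nu * c nu ^+ 2 <= K2) ->
  (forall N, \sum_(nu < N.+1) \sum_(nu' < N.+1) quad_coef n nu nu' w ^+ 2 / (kap nu * kap nu') <= A) ->
  n%:R^-1 * (\sum_(i < n) W (os i w) * `|To (os i w)| * g i ^+ 2) <=
  Num.sqrt (growth_cst 1 * C5) * sigma * K2 + K2 * Num.sqrt A.
Proof.
move=> cg hK hA.
have K20 : 0 <= K2.
  by apply: le_trans (hK 0); apply: sumr_ge0 => i _; rewrite mulr_ge0 ?sqr_ge0// ltW.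
have cv : n%:R^-1 * (\sum_(i < n) W (os i w) * `|To (os i w)| * (\sum_(nu < N.+1) c nu * xi nu (os i w)) ^+ 2) @[N --> \oo]
   --> n%:R^-1 * (\sum_(i < n) W (os i w) * `|To (os i w)| * g i ^+ 2).
  apply: cvgM; first exact: cvg_cst.
  apply: cvg_sumr => i; apply: cvgM; first exact: cvg_cst.
  by under eq_fun do rewrite expr2; rewrite expr2; exact: (cvgM (cg i) (cg i)).
rewrite -(cvg_lim _ cv)//; apply: limr_le; first by apply/cvg_ex; eexists; exact: cv.
apply: nearW => N.
pose mean nu nu' := itg P (fun w => WT nu nu' (ob w)).
have iWT nu nu' : intg P (fun w => WT nu nu' (ob w)).
  have mh : measurable_fun setT (fun w => WT nu nu' (ob w)) by exact: (measurableT_comp (mWT nu nu') mob).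
  have uu : 0 <= u nu * u nu' by rewrite mulr_ge0.
  by have [i2 _] := itg_sq_growth mh uu (WT_le nu nu'); exact: intg_of_sq.
have sqE (o : O) : W o * `|To o| * (\sum_(nu < N.+1) c nu * xi nu o) ^+ 2 =
    \sum_(nu < N.+1) \sum_(nu' < N.+1) c nu * c nu' * WT nu nu' o.
  rewrite expr2 mulr_suml mulr_sumr; apply: eq_bigr => nu _.
  by rewrite !mulr_sumr; apply: eq_bigr => nu' _; rewrite /WT; ring.
have -> : n%:R^-1 * (\sum_(i < n) W (os i w) * `|To (os i w)| * (\sum_(nu < N.+1) c nu * xi nu (os i w)) ^+ 2) =
    \sum_(nu < N.+1) \sum_(nu' < N.+1) c nu * c nu' * mean nu nu' +
    \sum_(nu < N.+1) \sum_(nu' < N.+1) c nu * c nu' * quad_coef n nu nu' w.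
  rewrite -big_split /=; under eq_bigr do rewrite sqE.
  rewrite exchange_big /= mulr_sumr; apply: eq_bigr => nu _.
  rewrite exchange_big /= mulr_sumr -big_split /=; apply: eq_bigr => nu' _.
  by rewrite /quad_coef /avg -mulr_sumr -/(mean nu nu') mulrCA; ring.
apply: lerD.
  have <- : itg P (fun w => W (ob w) * `|To (ob w)| * (\sum_(nu < N.+1) c nu * xi nu (ob w)) ^+ 2) =
    \sum_(nu < N.+1) \sum_(nu' < N.+1) c nu * c nu' * mean nu nu'.
    under eq_fun do rewrite sqE.
    rewrite itg_sum; last by move=> nu; apply: intg_sum => nu'; exact: intgZ.
    apply: eq_bigr => nu _; rewrite itg_sum; last by move=> nu'; exact: intgZ.
    by apply: eq_bigr => nu' _; rewrite itgZ.
  apply: (le_trans (mean_quad_le N c)); apply: ler_wpM2l.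
    by rewrite mulr_ge0 ?sqrtr_ge0// ltW.
  apply: le_trans (hK N); apply: ler_sum => nu _.
  by rewrite ler_peMl ?sqr_ge0.
apply: (le_trans (ler_norm _)); rewrite -sqrtr_sqr -[X in X * _](ger0_norm K20) -sqrtr_sqr -sqrtrM ?sqr_ge0//.
apply: ler_wsqrtr; rewrite pair_big /=.
have k2 (p : 'I_N.+1 * 'I_N.+1) : 0 < kap p.1 * kap p.2 by exact: mulr_gt0.
apply: (le_trans (sum_weighted_cauchy_schwarz _ (fun p : 'I_N.+1 * 'I_N.+1 => c p.1 * c p.2) _ k2)).
apply: ler_pM.
- by apply: sumr_ge0 => p _; rewrite mulr_ge0 ?sqr_ge0// ltW.
- by apply: sumr_ge0 => p _; rewrite divr_ge0 ?sqr_ge0// ltW.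
- rewrite -(pair_big xpredT xpredT (fun i j : 'I_N.+1 => kap i * kap j * (c i * c j) ^+ 2)) /=.
  rewrite (eq_bigr (fun i : 'I_N.+1 => (kap i * c i ^+ 2) * \sum_(j < N.+1) kap j * c j ^+ 2)); last first.
    by move=> i _; rewrite mulr_sumr; apply: eq_bigr => j _; ring.
  rewrite -mulr_suml -expr2; apply: lerXn2r; rewrite ?nnegrE//.
    by apply: sumr_ge0 => i _; rewrite mulr_ge0 ?sqr_ge0// ltW.
  exact: hK.
- by have := hA N; rewrite pair_big.
Qed.

End linearization.

(** * The score equation *)

Section score.
Context (R : realType).

Lemma is_derive_sumf n (f : 'I_n -> R -> R) (l : 'I_n -> R) (x : R) :
  (forall i, is_derive x (1 : R) (f i) (l i)) ->
  is_derive x (1 : R) (fun s => \sum_(i < n) f i s) (\sum_(i < n) l i).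
Proof.
move=> h; have -> : (fun s => \sum_(i < n) f i s) = \sum_(i < n) f i.
  by apply/funext => s; rewrite fct_sumE.
exact: is_derive_sum.
Qed.

Lemma is_derive_affine (f df : R -> R) (p t x : R) : (forall z, is_derive z (1 : R) f (df z)) ->
  is_derive x (1 : R) (fun s => f (p + s * t)) (df (p + x * t) * t).
Proof.
move=> hf.
have h1 : is_derive x (1 : R) (fun s : R => p + s * t) t.
  have h1 := @is_deriveZ _ _ _ id t x 1 1 (is_derive_id x 1).
  have := @is_deriveD _ _ _ (cst p) _ x 1 _ _ (is_derive_cst p x 1) h1.
  rewrite add0r [_ *: 1]mulr1; congr is_derive; apply/funext => s.
  by rewrite [LHS]/(p + t * s) mulrC.
exact: (@is_derive1_comp _ f (fun s : R => p + s * t) x _ _ (hf _) h1).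
Qed.

Lemma is_derive_quadratic (c0 c1 c2 x : R) :
  is_derive x (1 : R) (fun s => c0 + s * c1 + s ^+ 2 * c2) (c1 + 2 * x * c2).
Proof.
have h1 := @is_deriveZ _ _ _ id c1 x 1 1 (is_derive_id x 1).
have h2 := @is_deriveZ _ _ _ _ c2 x 1 _ (@is_deriveX _ _ id 2 x 1 1 (is_derive_id x 1)).
have := @is_deriveD _ _ _ _ _ x 1 _ _ (@is_deriveD _ _ _ (cst c0) _ x 1 _ _ (is_derive_cst _ x 1) h1) h2.
rewrite add0r [c1 *: 1]mulr1 [_ *: 1]mulr1 /= expr1.
have -> : c2 *: (2 * x) = 2 * x * c2 by rewrite [LHS]mulrC.
congr is_derive; apply/funext => s.
by rewrite [LHS]/(c0 + c1 * s + c2 * s ^+ 2) mulrC [X in _ + X]mulrC.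
Qed.

Variables (m : nat) (m0 : (0 < m)%N) (G : R -> R -> R).
Hypothesis dG : forall y j, (j < 3)%N -> forall a : R, derivable (derive1n j (G y)) a 1.

(** Along the line through [th] in the direction [tau], with the intercept fixed, the criterion is
    maximal at [s = 0], an interior point, where its derivative vanishes. *)
Lemma score_equation (n : nat) (ys : nat -> R) (xs : nat -> R -> R) (lam : R)
    (th : R * (R -> R)) (tau : R -> R) :
  (forall i, L2 (xs i)) -> Sobolev m th.2 -> Sobolev m tau ->
  (forall th', Sobolev m th'.2 ->
     n%:R^-1 * \sum_(i < n) G (ys i) (predictor th' (xs i)) - lam / 2 * J m th'.2 th'.2 <=
     n%:R^-1 * \sum_(i < n) G (ys i) (predictor th (xs i)) - lam / 2 * J m th.2 th.2) ->
  n%:R^-1 * \sum_(i < n) derive1n 1 (G (ys i)) (predictor th (xs i)) * ip (xs i) tau = lam * J m th.2 tau.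
Proof.
move=> lx sth st hmax.
pose f s := n%:R^-1 * \sum_(i < n) G (ys i) (predictor th (xs i) + s * ip (xs i) tau)
  - lam / 2 * (J m th.2 th.2 + s * (2 * J m th.2 tau) + s ^+ 2 * J m tau tau).
have fE s : f s = n%:R^-1 * \sum_(i < n) G (ys i) (predictor (th.1, fun t => th.2 t + s * tau t) (xs i))
   - lam / 2 * J m (fun t => th.2 t + s * tau t) (fun t => th.2 t + s * tau t).
  have sl := sobolev_lin m0 s sth st.
  rewrite /f; congr (_ * _ - _ * _).
    apply: eq_bigr => i _; by rewrite /predictor /= (ip_linr s (sobolev_L2 m0 sth) (sobolev_L2 m0 st) (lx i)) addrA.
  by rewrite J_linl// !J_linr// (JC m tau th.2); ring.
have f0 s : f s <= f 0.
  rewrite !fE; have := hmax (th.1, fun t => th.2 t + s * tau t) (sobolev_lin m0 s sth st).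
  move/le_trans; apply; rewrite le_eqVlt; apply/orP; left; apply/eqP.
  have -> : (fun t => th.2 t + 0 * tau t) = th.2 by apply/funext => t; rewrite mul0r addr0.
  by rewrite -surjective_pairing.
have hs (x : R) : is_derive x (1 : R) (fun s => \sum_(i < n) G (ys i) (predictor th (xs i) + s * ip (xs i) tau))
   (\sum_(i < n) derive1n 1 (G (ys i)) (predictor th (xs i) + x * ip (xs i) tau) * ip (xs i) tau).
  apply: (is_derive_sumf (f := fun (i : 'I_n) s => G (ys i) (predictor th (xs i) + s * ip (xs i) tau))) => i.
  apply: (@is_derive_affine (G (ys i)) (derive1n 1 (G (ys i)))) => z.
  exact: (criterion_derive dG (ys i) z (isT : (0 < 3)%N)).
have hf (x : R) : is_derive x (1 : R) f (n%:R^-1 * (\sum_(i < n) derive1n 1 (G (ys i)) (predictor th (xs i) + x * ip (xs i) tau) * ip (xs i) tau)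
    - lam / 2 * (2 * J m th.2 tau + 2 * x * J m tau tau)).
  have hp := is_derive_quadratic (J m th.2 th.2) (2 * J m th.2 tau) (J m tau tau) x.
  exact: (@is_deriveB _ _ _ _ _ x 1 _ _ (@is_deriveZ _ _ _ _ n%:R^-1 x 1 _ (hs x)) (@is_deriveZ _ _ _ _ (lam / 2) x 1 _ hp)).
have h0 : (0 : R) \in `]-1, 1[ by rewrite in_itv /= ltrN10 ltr01.
have n11 : -1 <= 1 :> R by exact: (le_trans (lerN10 R) ler01).
have d0 := @derive1_at_max R f (-1) 1 0 n11 (fun t _ => @ex_derive _ _ _ _ _ _ _ (hf t)) h0 (fun t _ => f0 t).
have := @derive_val _ _ _ _ _ _ _ d0; have := @derive_val _ _ _ _ _ _ _ (hf 0) => -> /eqP.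
rewrite mulr0 mul0r addr0 mulrA divfK ?pnatr_eq0// subr_eq0 => /eqP <-.
by congr (_ * _); apply: eq_bigr => i _; rewrite mul0r addr0.
Qed.

Lemma score_taylor (n : nat) (ys : nat -> R) (xs : nat -> R -> R) (lam : R)
    (th0 th : R * (R -> R)) (tau : R -> R) (W g : nat -> R) :
  (forall i, L2 (xs i)) -> Sobolev m th0.2 -> Sobolev m th.2 -> Sobolev m tau ->
  (forall th', Sobolev m th'.2 ->
     n%:R^-1 * \sum_(i < n) G (ys i) (predictor th' (xs i)) - lam / 2 * J m th'.2 th'.2 <=
     n%:R^-1 * \sum_(i < n) G (ys i) (predictor th (xs i)) - lam / 2 * J m th.2 th.2) ->
  (forall i a, `|derive1n 3 (G (ys i)) a| <= W i) ->
  (forall i, g i = predictor (th.1 - th0.1, th.2 \- th0.2) (xs i)) ->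
  `|n%:R^-1 * (\sum_(i < n) derive1n 1 (G (ys i)) (predictor th0 (xs i)) * ip (xs i) tau)
    + n%:R^-1 * (\sum_(i < n) derive1n 2 (G (ys i)) (predictor th0 (xs i)) * ip (xs i) tau * g i)
    - lam * J m th.2 tau| <= n%:R^-1 * (\sum_(i < n) W i * `|ip (xs i) tau| * g i ^+ 2).
Proof.
move=> lx sth0 sth st hmax hW hg.
rewrite -(score_equation lx sth st hmax) -mulrDr -mulrBr -big_split /= -sumrB normrM ger0_norm ?invr_ge0//.
rewrite ler_wpM2l ?invr_ge0//; apply: (le_trans (ler_norm_sum _ _ _)); apply: ler_sum => i _.
have gE : predictor th (xs i) = predictor th0 (xs i) + g i.
  have E : th.2 \- th0.2 = (fun t => th.2 t + -1 * th0.2 t) by apply/funext => t; rewrite mulN1r.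
  rewrite hg /predictor /= E (ip_linr (-1) (sobolev_L2 m0 sth) (sobolev_L2 m0 sth0) (lx i)); ring.
have := criterion_taylor dG (predictor th0 (xs i)) (g i) (hW i).
rewrite -gE => h.
have -> : derive1n 1 (G (ys i)) (predictor th0 (xs i)) * ip (xs i) tau +
   derive1n 2 (G (ys i)) (predictor th0 (xs i)) * ip (xs i) tau * g i -
   derive1n 1 (G (ys i)) (predictor th (xs i)) * ip (xs i) tau =
   - ((derive1n 1 (G (ys i)) (predictor th (xs i)) - derive1n 1 (G (ys i)) (predictor th0 (xs i)) -
      derive1n 2 (G (ys i)) (predictor th0 (xs i)) * g i) * ip (xs i) tau) by ring.
by rewrite normrN normrM mulrAC ler_wpM2r.
Qed.

End score.

(** * Moments of the projected model *)

Section moments_product.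
Context d (T : measurableType d) (R : realType) (P : probability T R).

Lemma all_momentsM (f g : T -> R) : all_moments P f -> all_moments P g ->
  all_moments P (fun w => f w * g w).
Proof.
move=> [mf hf] [mg hg]; have mfg : measurable_fun setT (fun w => f w * g w) by exact: measurable_funM.
split => // k; apply: (@intg_le _ _ _ P (fun w => `|f w| ^+ (2 * k) + `|g w| ^+ (2 * k))).
- by apply: measurable_funX; exact: measurableT_comp.
- move=> w; rewrite ger0_norm ?exprn_ge0// normrM exprMn mulnC !exprM.
  by have := sqr_ge0 (`|f w| ^+ k - `|g w| ^+ k); nra.
- exact: intgD.
Qed.

Lemma all_moments_intg (f : T -> R) : all_moments P f -> intg P f.
Proof.
move=> [mf /(_ 1) hf]; apply: (intg_le mf _ hf) => w; by rewrite expr1.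
Qed.

Lemma all_moments_intgX (f : T -> R) k : all_moments P f -> intg P (fun w => f w ^+ k).
Proof.
move=> [mf /(_ k) hf]; apply: (intg_le _ _ hf); first exact: measurable_funX.
by move=> w; rewrite normrX.
Qed.

Lemma all_momentsX (f : T -> R) k : all_moments P f -> all_moments P (fun w => f w ^+ k).
Proof.
move=> hf; elim: k => [|k ih]; first by under eq_fun do rewrite expr0; exact: all_moments_cst.
by under eq_fun do rewrite exprS; exact: all_momentsM.
Qed.

End moments_product.

Section model.
Context d (T : measurableType d) (R : realType) (P : probability T R).
Variables (m : nat) (Y : T -> R) (X : T -> R -> R) (G : R -> R -> R).
Variables (th0 : R * (R -> R)) (B : pathType R -> R) (C2 : R).
Hypothesis m0 : (0 < m)%N.
Hypothesis rX : random_process X.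
Hypothesis mY : measurable_fun setT Y.
Hypothesis mB : measurable_fun setT B.
Hypothesis C20 : 0 < C2.
Hypothesis hB : {ae P, forall w, C2^-1 <= B (X w) <= C2}.
Hypothesis hBX : forall t, unit_itv t -> ('E_P[fun w => (B (X w) * X w t)%R] = 0)%E.
Hypothesis hXX : forall s t, unit_itv s -> unit_itv t ->
  intg P (fun w => B (X w) * X w s * X w t).
Hypothesis mG : forall a, measurable_fun setT (fun y => G y a).
Hypothesis dG : forall y j, (j < 3)%N -> forall a : R, derivable (derive1n j (G y)) a 1.
Hypothesis cG3 : forall y, continuous (derive1n 3 (G y)).
Hypothesis sth0 : Sobolev m th0.2.
Let eps w := ob_eps G th0 (obs Y X w).
Let D w := ob_D G th0 (obs Y X w).
Variable Q : T -> R.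
Hypothesis momQ : all_moments P Q.
Hypothesis epsQ : forall w, `|eps w| <= Q w.
Hypothesis DQ : forall w, `|D w| <= Q w.
Hypothesis normQ : forall w, L2norm (X w) <= Q w.
Hypothesis cD : is_condexp P X (fun w => (D w)%:E) (fun x => (- B x)%:E).
Hypothesis ce : is_condexp P X (fun w => (eps w)%:E) (fun=> 0%E).
Hypothesis ce2 : is_condexp P X (fun w => (eps w ^+ 2)%:E) (fun x => (B x)%:E).

Let Lb0 : L2 th0.2. Proof. exact: (sobolev_L2 m0 sth0). Qed.
Let meps : measurable_fun setT eps.
Proof. exact: (measurableT_comp (measurable_ob_eps mG dG cG3 Lb0) (measurable_obs rX mY)). Qed.
Let mDw : measurable_fun setT D.
Proof. exact: (measurableT_comp (measurable_ob_D mG dG cG3 Lb0) (measurable_obs rX mY)). Qed.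

Let Qle w : Q w <= `|Q w|. Proof. exact: ler_norm. Qed.

Lemma eps_moments : all_moments P eps.
Proof. by apply: (all_moments_le _ _ momQ) => // w; exact: le_trans (epsQ w) (Qle w). Qed.

Lemma D_moments : all_moments P D.
Proof. by apply: (all_moments_le _ _ momQ) => // w; exact: le_trans (DQ w) (Qle w). Qed.

Lemma ip_moments b : L2 b -> all_moments P (fun w => ip (X w) b).
Proof.
move=> lb; apply: (all_moments_le _ _ (all_momentsM momQ (all_moments_cst P (L2norm b)))).
  exact: measurable_ip_process.
move=> w; apply: (le_trans (ip_le_norm rX w lb)); rewrite normrM.
by rewrite ler_pM ?sqrtr_ge0 ?ler_norm// (le_trans (normQ w)).
Qed.

Let normX2 : intg P (fun w => ip (X w) (X w)).
Proof.
apply: (@intg_le _ _ _ P (fun w => Q w ^+ 2)); [exact: measurable_ipXX| |exact: all_moments_intgX].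
move=> w; rewrite ger0_norm ?ip_ge0// -[leLHS](sqr_sqrtr (ip_ge0 _)).
by apply: lerXn2r; rewrite ?nnegrE ?sqrtr_ge0// ?normQ// (le_trans _ (normQ w)) ?sqrtr_ge0.
Qed.

Let Bc w := Bclip B C2 (X w).

Let intg_BX H : intg P H -> intg P (fun w => B (X w) * H w).
Proof.
move=> iH; have := intg_Bc rX mB C20 hB iH; apply: ae_intg.
- by apply: measurable_funM; [exact: measurable_BclipX|exact: intg_meas iH].
- by apply: measurable_funM; [exact: measurable_BX|exact: intg_meas iH].
- by have := ae_BclipX hB; apply: filterS => w ->.
Qed.

Let intg_BX1 : intg P (fun w => B (X w)).
Proof. by have := intg_BX (intg_cst P 1); congr (intg P _); apply/funext => w; rewrite mulr1. Qed.

Lemma condexp_D (psi : pathType R -> R) : measurable_fun setT psi ->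
  all_moments P (fun w => psi (X w)) ->
  itg P (fun w => D w * psi (X w)) = - itg P (fun w => Bc w * psi (X w)).
Proof.
move=> mpsi hp; have hip := all_moments_intg hp.
have iB := intg_BX hip.
rewrite (condexp_mul rX cD (all_moments_intg D_moments) _ mpsi).
- under eq_fun do rewrite mulNr; rewrite itgN//; congr (- _).
  by apply: (itg_Bc rX mB hB); exact: intg_meas hip.
- exact: intgN.
- exact: all_moments_intg (all_momentsM D_moments hp).
- by under eq_fun do rewrite mulNr; exact: intgN.
Qed.

Lemma condexp_eps (psi : pathType R -> R) : measurable_fun setT psi ->
  all_moments P (fun w => psi (X w)) -> itg P (fun w => eps w * psi (X w)) = 0.
Proof.
move=> mpsi hp.
rewrite (condexp_mul (g := fun=> 0) rX ce (all_moments_intg eps_moments) _ mpsi).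
- by under eq_fun do rewrite mul0r; exact: itg0.
- exact: intg0.
- exact: all_moments_intg (all_momentsM eps_moments hp).
- by under eq_fun do rewrite mul0r; exact: intg0.
Qed.

Lemma condexp_eps2 (psi : pathType R -> R) : measurable_fun setT psi ->
  all_moments P (fun w => psi (X w)) ->
  itg P (fun w => eps w ^+ 2 * psi (X w)) = itg P (fun w => Bc w * psi (X w)).
Proof.
move=> mpsi hp; have hip := all_moments_intg hp.
rewrite (condexp_mul rX ce2 (all_moments_intg (all_momentsX 2 eps_moments)) _ mpsi).
- by apply: (itg_Bc rX mB hB); exact: intg_meas hip.
- exact: intg_BX1.
- exact: all_moments_intg (all_momentsM (all_momentsX 2 eps_moments) hp).
- exact: intg_BX.
Qed.

Variables (phi : nat -> R -> R) (rho : nat -> R).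
Hypothesis sphi : forall nu, (0 < nu)%N -> Sobolev m (phi nu).
Hypothesis orth : forall nu nu', (0 < nu)%N -> (0 < nu')%N ->
  V P X B (phi nu) (phi nu') = (nu == nu')%:R /\
  J m (phi nu) (phi nu') = rho nu * (nu == nu')%:R.
Variable M0 : R.
Hypothesis M00 : 0 < M0.
Hypothesis fourth : forall b : R -> R, Sobolev m b ->
     ('E_P[fun w => (`|ip (X w) b| ^+ 4)%R]
      <= M0%:E * 'E_P[fun w => (`|ip (X w) b| ^+ 2)%R] ^+ 2)%E.

Lemma ip_fourth b : Sobolev m b ->
  intg P (fun w => ip (X w) b ^+ 4) /\
  itg P (fun w => ip (X w) b ^+ 4) <= M0 * (C2 * V P X B b b) ^+ 2.
Proof.
move=> sb; have lb := sobolev_L2 m0 sb; have hm := ip_moments lb.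
have i4 := all_moments_intgX 4 hm; have i2 := all_moments_intgX 2 hm.
split => //; have := fourth sb; rewrite unlock.
under eq_integral do rewrite -normrX ger0_norm ?exprn_even_ge0//.
under [X in (_ <= _ * X ^+ 2)%E -> _]eq_integral do rewrite -normrX ger0_norm ?sqr_ge0//.
rewrite -(EFin_itg i4) -(EFin_itg i2) -EFin_expe -EFinM lee_fin => /le_trans; apply.
rewrite ler_pM2l//; apply: lerXn2r; rewrite ?nnegrE.
- by apply: itg_ge0 => w; exact: sqr_ge0.
- exact: mulr_ge0 (ltW C20) (V_ge0 rX mB C20 hB hXX normX2 lb).
- exact: (V_ge rX mB C20 hB hXX normX2 lb).
Qed.

Local Notation O := (measurableTypeR R * pathType R)%type.

(* Index 0 carries the intercept. *)
Definition ob_xi (nu : nat) (o : O) : R := if nu is 0%N then 1 else ip o.2 (phi nu).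

Lemma measurable_ob_xi nu : measurable_fun setT (ob_xi nu).
Proof.
case: nu => [|nu]; first exact: measurable_cst.
exact: (measurableT_comp (measurable_ip_path (sobolev_L2 m0 (sphi (ltn0Sn nu)))) measurable_snd).
Qed.

Lemma ob_xi_sum (c : nat -> R) N (o : O) : L2 (o.2 : R -> R) ->
  \sum_(nu < N.+1) c nu * ob_xi nu o = c 0%N + ip o.2 (partial_sum phi c N).
Proof.
move=> lo; rewrite big_ord_recl /= mulr1; congr (_ + _).
have -> : \sum_(i < N) c (bump 0 i) * ip o.2 (phi (bump 0 i)) = \sum_(1 <= i < N.+1) c i * ip o.2 (phi i).
  by rewrite big_add1 /= big_mkord.
elim: N => [|N ih].
  by rewrite big_nil /partial_sum; under [in RHS]eq_fun do rewrite big_nil; rewrite ip0r.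
rewrite big_nat_recr//= ih /partial_sum; under [in RHS]eq_fun do rewrite big_nat_recr//=.
rewrite ip_linr//; first by apply: (sobolev_L2 m0); exact: sobolev_partial_sum.
exact: (sobolev_L2 m0 (sphi (ltn0Sn N))).
Qed.

(** The 8 comes from [(x + y) ^+ 4 <= 8 * (x ^+ 4 + y ^+ 4)], which separates the intercept;
    orthonormality in [V] turns the slope part into a sum of squares. *)
Lemma ob_xi_fourth N (c : nat -> R) :
  intg P (fun w => (\sum_(nu < N.+1) c nu * ob_xi nu (obs Y X w)) ^+ 4) /\
  itg P (fun w => (\sum_(nu < N.+1) c nu * ob_xi nu (obs Y X w)) ^+ 4) <=
    (8 * (1 + M0 * C2 ^+ 2)) * (\sum_(nu < N.+1) c nu ^+ 2) ^+ 2.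
Proof.
have sp := sobolev_partial_sum m0 sphi c N; have lp := sobolev_L2 m0 sp.
have [i4 e4] := ip_fourth sp; have hm := ip_moments lp.
have hm2 := all_momentsD (all_moments_cst P (c 0%N)) hm.
have -> : (fun w => (\sum_(nu < N.+1) c nu * ob_xi nu (obs Y X w)) ^+ 4) =
    (fun w => (c 0%N + ip (X w) (partial_sum phi c N)) ^+ 4).
  by apply/funext => w; rewrite (@ob_xi_sum _ _ (obs Y X w))//; exact: (process_L2 rX w).
have i := all_moments_intgX 4 hm2; split; first exact: i.
apply: (@le_trans _ _ (8 * (c 0%N ^+ 4 + itg P (fun w => ip (X w) (partial_sum phi c N) ^+ 4)))).
  rewrite -[c 0%N ^+ 4](itg_cst P) -(itgD (intg_cst P _) i4).
  rewrite -itgZ; last by apply: intgD => //; exact: intg_cst.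
  apply: le_itg => //; first by apply: intgZ; apply: intgD => //; exact: intg_cst.
  move=> w /=; move: (c 0%N) (ip (X w) _) => x y.
  have h1 : (x + y) ^+ 2 <= 2 * (x ^+ 2 + y ^+ 2) by have := sqr_ge0 (x - y); nra.
  have -> : (x + y) ^+ 4 = ((x + y) ^+ 2) ^+ 2 by rewrite -exprM.
  have h2 : ((x + y) ^+ 2) ^+ 2 <= (2 * (x ^+ 2 + y ^+ 2)) ^+ 2.
    by apply: lerXn2r; rewrite ?nnegrE ?sqr_ge0// mulr_ge0// addr_ge0 ?sqr_ge0.
  apply: (le_trans h2); have -> : x ^+ 4 = (x ^+ 2) ^+ 2 by rewrite -exprM.
  have -> : y ^+ 4 = (y ^+ 2) ^+ 2 by rewrite -exprM.
  by have := sqr_ge0 (x ^+ 2 - y ^+ 2); nra.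
rewrite -mulrA ler_pM2l//.
rewrite (V_partial_sum_sq m0 rX mB C20 hB hXX normX2 sphi orth) in e4.
have -> : \sum_(nu < N.+1) c nu ^+ 2 = c 0%N ^+ 2 + \sum_(1 <= nu < N.+1) c nu ^+ 2.
  by rewrite big_ord_recl /= big_add1 /= big_mkord.
have S0 : 0 <= \sum_(1 <= nu < N.+1) c nu ^+ 2 by apply: sumr_ge0 => j _; exact: sqr_ge0.
apply: (@le_trans _ _ (c 0%N ^+ 4 + M0 * (C2 * \sum_(1 <= nu < N.+1) c nu ^+ 2) ^+ 2)); first by rewrite lerD2l.
have -> : c 0%N ^+ 4 = (c 0%N ^+ 2) ^+ 2 by rewrite -exprM.
move: (c 0%N ^+ 2) (sqr_ge0 (c 0%N)) S0; move: (\sum_(1 <= nu < N.+1) _) => y x x0 y0.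
have z0 : 0 <= M0 * C2 ^+ 2 by rewrite mulr_ge0 ?sqr_ge0// ltW.
rewrite exprMn mulrA; move: (M0 * C2 ^+ 2) z0 => z z0.
have : 0 <= x * y by rewrite mulr_ge0.
have : 0 <= z * (x * y) by rewrite !mulr_ge0.
have : 0 <= z * x ^+ 2 by rewrite mulr_ge0 ?sqr_ge0.
by have := sqr_ge0 y; nra.
Qed.

Variables (tw : nat -> R) (N : nat).
Let tau := partial_sum phi tw N.
Let sigma2 := \sum_(1 <= nu < N.+1) tw nu ^+ 2.

Definition ob_T (o : O) : R := ip o.2 tau.

Let stau : Sobolev m tau. Proof. exact: sobolev_partial_sum. Qed.
Let ltau : L2 tau. Proof. exact: (sobolev_L2 m0 stau). Qed.

Lemma measurable_ob_T : measurable_fun setT ob_T.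
Proof. exact: (measurableT_comp (measurable_ip_path ltau) measurable_snd). Qed.

Lemma ob_T_fourth :
  intg P (fun w => ob_T (obs Y X w) ^+ 4) /\
  itg P (fun w => ob_T (obs Y X w) ^+ 4) <= M0 * C2 ^+ 2 * Num.sqrt sigma2 ^+ 4.
Proof.
have [i e] := ip_fourth stau; split => //; apply: (le_trans e).
rewrite (V_partial_sum_sq m0 rX mB C20 hB hXX normX2 sphi orth) -/sigma2.
have s0 : 0 <= sigma2 by apply: sumr_ge0 => j _; exact: sqr_ge0.
have -> : Num.sqrt sigma2 ^+ 4 = (Num.sqrt sigma2 ^+ 2) ^+ 2 by rewrite -exprM.
by rewrite sqr_sqrtr// exprMn mulrA.
Qed.

Lemma V_phi_tau nu : (0 < nu)%N -> V P X B (phi nu) tau = if (nu <= N)%N then tw nu else 0.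
Proof.
move=> nu0; case: leqP => nuN.
  by apply: (V_phi_partial_sum m0 rX mB C20 hB hXX normX2 sphi orth); rewrite nu0.
rewrite (V_partial_sum m0 rX mB C20 hB hXX normX2 sphi)//; last exact: sphi.
rewrite big_nat_cond big1// => i /andP[/andP[i0 iN] _].
have [-> _] := orth nu0 i0; rewrite gtn_eqF ?mulr0//.
by rewrite ltnS in iN; exact: leq_ltn_trans iN nuN.
Qed.

(** Conditioning on [X] replaces the second derivative by [- B]. Against the intercept the mean
    vanishes by centering; against [phi nu] it is [- V (phi nu) tau], a coefficient of [tau] up to
    sign. *)
Lemma mean_D_T_xi nu :
  itg P (fun w => ob_D G th0 (obs Y X w) * ob_T (obs Y X w) * ob_xi nu (obs Y X w)) =
  - (if (0 < nu <= N)%N then tw nu else 0).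
Proof.
case: nu => [|nu].
  have -> : (fun w => ob_D G th0 (obs Y X w) * ob_T (obs Y X w) * ob_xi 0 (obs Y X w)) =
     (fun w => D w * ip (X w) tau) by apply/funext => w; rewrite /= mulr1.
  rewrite (condexp_D (psi := fun x => ip x tau)); [|exact: measurable_ip_path|exact: ip_moments].
  by rewrite (itg_Bip0 rX mB C20 hB hBX hXX normX2).
have lph := sobolev_L2 m0 (sphi (ltn0Sn nu)).
have -> : (fun w => ob_D G th0 (obs Y X w) * ob_T (obs Y X w) * ob_xi nu.+1 (obs Y X w)) =
   (fun w => D w * (ip (X w) tau * ip (X w) (phi nu.+1))) by apply/funext => w; rewrite /= mulrA.
rewrite (condexp_D (psi := fun x => ip x tau * ip x (phi nu.+1))).
- rewrite /= -V_phi_tau//; congr (- _); rewrite (V_E rX mB C20 hB hXX normX2)//.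
  by congr itg; apply/funext => w; rewrite mulrA.
- by apply: measurable_funM; exact: measurable_ip_path.
- by apply: all_momentsM; exact: ip_moments.
Qed.

Lemma mean_eps_T : itg P (fun w => ob_eps G th0 (obs Y X w) * ob_T (obs Y X w)) = 0.
Proof. by apply: (condexp_eps (psi := fun x => ip x tau)); [exact: measurable_ip_path|exact: ip_moments]. Qed.

Lemma mean_eps2_T2 : itg P (fun w => (ob_eps G th0 (obs Y X w) * ob_T (obs Y X w)) ^+ 2) = sigma2.
Proof.
have -> : (fun w => (ob_eps G th0 (obs Y X w) * ob_T (obs Y X w)) ^+ 2) =
  (fun w => eps w ^+ 2 * ip (X w) tau ^+ 2) by apply/funext => w; rewrite exprMn.
rewrite (condexp_eps2 (psi := fun x => ip x tau ^+ 2)).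
- rewrite /sigma2 -(V_partial_sum_sq m0 rX mB C20 hB hXX normX2 sphi orth) (V_E rX mB C20 hB hXX normX2)//.
  by congr itg; apply/funext => w; rewrite expr2 mulrA.
- by apply: measurable_funX; exact: measurable_ip_path.
- by apply: all_momentsX; exact: ip_moments.
Qed.

(** Relative to [s ^+ 3] the bound depends neither on the truncation nor on the sample size, which
    is Lyapunov's condition for the array. *)
Lemma third_eps_T (s : R) : 0 < s -> s ^+ 2 = sigma2 ->
  intg P (fun w => `|ob_eps G th0 (obs Y X w) * ob_T (obs Y X w)| ^+ 3) /\
  itg P (fun w => `|ob_eps G th0 (obs Y X w) * ob_T (obs Y X w)| ^+ 3) <=
    s ^+ 3 * (M0 * C2 ^+ 2 + itg P (fun w => Q w ^+ 12)).
Proof.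
move=> s0 ss; have hm := all_momentsM eps_moments (ip_moments ltau).
have i3 : intg P (fun w => `|eps w * ip (X w) tau| ^+ 3) by have [_ /(_ 3)] := hm.
have iQ := all_moments_intgX 12 momQ; have [i4 e4] := ob_T_fourth.
split; first exact: i3.
apply: (@le_trans _ _ (itg P (fun w => s ^+ 3 * (s ^- 4 * ip (X w) tau ^+ 4 + Q w ^+ 12)))).
  apply: le_itg => //.
    by apply: intgZ; apply: intgD => //; exact: intgZ.
  move=> w; rewrite -/(eps w) /ob_T /=; set t := ip (X w) tau.
  have -> : `|eps w * t| ^+ 3 = s ^+ 3 * ((`|t| / s) ^+ 3 * `|eps w| ^+ 3).
    by rewrite normrM expr_div_n exprMn; field; rewrite gt_eqF.
  apply: ler_wpM2l; first by rewrite exprn_ge0// ltW.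
  have -> : s ^- 4 * t ^+ 4 = (`|t| / s) ^+ 4.
    by rewrite expr_div_n -normrX ger0_norm ?exprn_even_ge0// mulrC.
  have x0 : 0 <= `|t| / s by rewrite divr_ge0// ltW.
  have q0 : 0 <= `|eps w| by [].
  have : `|eps w| ^+ 12 <= Q w ^+ 12.
    by apply: lerXn2r; rewrite ?nnegrE// (le_trans _ (epsQ w)).
  move: (`|t| / s) (`|eps w|) x0 q0 => x y x0 y0 h; apply: (@le_trans _ _ (x ^+ 4 + y ^+ 12)); last by rewrite lerD2l.
  (* [x ^+ 3 * y ^+ 3] is at most the fourth power of the larger of [x] and [y ^+ 3]; hence the
     twelfth moment of [Q]. *)
  case: (leP (y ^+ 3) x) => xy.
    apply: (@le_trans _ _ (x ^+ 4)); last by rewrite lerDl exprn_ge0.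
    by rewrite [leRHS]exprSr ler_wpM2l ?exprn_ge0.
  apply: (@le_trans _ _ (y ^+ 12)); last by rewrite lerDr exprn_ge0.
  have -> : y ^+ 12 = (y ^+ 3) ^+ 3 * y ^+ 3 by rewrite -!exprM -exprD.
  by rewrite ler_wpM2r ?exprn_ge0//; apply: lerXn2r; rewrite ?nnegrE ?exprn_ge0// ltW.
rewrite itgZ; last by apply: intgD => //; exact: intgZ.
rewrite ler_pM2l ?exprn_gt0// itgD//; last exact: intgZ.
rewrite lerD2r itgZ// ler_pdivrMl ?exprn_gt0// mulrC.
by apply: (le_trans e4); rewrite -ss sqrtr_sqr ger0_norm// ltW.
Qed.

End model.

(** * The estimation error at a fixed sample size *)

Lemma measurable_preimage d1 d2 (T1 : measurableType d1) (T2 : measurableType d2)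
  (f : T1 -> T2) (A : set T2) : measurable_fun setT f -> measurable A -> measurable (f @^-1` A).
Proof. by move=> mf mA; rewrite -[X in measurable X]setTI; exact: mf. Qed.

Lemma same_law_ae d1 d2 (T : measurableType d1) (O : measurableType d2) (R : realType)
  (P : probability T R) (Z Z' : T -> O) (A : set O) :
  measurable_fun setT Z -> measurable_fun setT Z' -> same_law P Z Z' -> measurable A ->
  {ae P, forall w, A (Z' w)} -> {ae P, forall w, A (Z w)}.
Proof.
move=> mZ mZ' law mA [N [mN N0 hN]].
have mC := measurableC mA.
have h0 : P (Z' @^-1` (~` A)) = 0%E.
  exact: (subset_measure0 (measurable_preimage mZ' mC) mN hN N0).
exists (Z @^-1` (~` A)); split=> //; first exact: measurable_preimage.
by rewrite law.
Qed.

Section fixed_sample_size.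
Context d (T : measurableType d) (R : realType) (P : probability T R).
Variables (m : nat) (Y : T -> R) (X : T -> R -> R) (G : R -> R -> R).
Variables (th0 : R * (R -> R)) (B : pathType R -> R) (C2 : R).
Hypothesis m0 : (0 < m)%N.
Hypothesis rX : random_process X.
Hypothesis mY : measurable_fun setT Y.
Hypothesis mB : measurable_fun setT B.
Hypothesis C20 : 0 < C2.
Hypothesis hB : {ae P, forall w, C2^-1 <= B (X w) <= C2}.
Hypothesis hBX : forall t, unit_itv t -> ('E_P[fun w => (B (X w) * X w t)%R] = 0)%E.
Hypothesis hXX : forall s t, unit_itv s -> unit_itv t ->
  intg P (fun w => B (X w) * X w s * X w t).
Hypothesis mG : forall a, measurable_fun setT (fun y => G y a).
Hypothesis dG : forall y j, (j < 3)%N -> forall a : R, derivable (derive1n j (G y)) a 1.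
Hypothesis cG3 : forall y, continuous (derive1n 3 (G y)).
Hypothesis sth0 : Sobolev m th0.2.
Variable Q : T -> R.
Hypothesis momQ : all_moments P Q.
Hypothesis Q1 : forall w, 1 <= Q w.
Hypothesis DQ : forall w, `|ob_D G th0 (obs Y X w)| <= Q w.
Hypothesis WQ : forall w, `|ob_W G (obs Y X w)| <= Q w.
Hypothesis normQ : forall w, L2norm (X w) <= Q w.
Hypothesis Wfin : {ae P, forall w, (sup_deriv_ell G 3 (Y w) < +oo)%E}.
Hypothesis cD : is_condexp P X (fun w => (ob_D G th0 (obs Y X w))%:E) (fun x => (- B x)%:E).
Hypothesis injective_Cov : forall b : R -> R, L2 b ->
  ae_eq lebesgue_measure unit_itv (Cov_op P X B b) (cst 0) -> ae_eq lebesgue_measure unit_itv b (cst 0).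
Variables (phi : nat -> R -> R) (rho : nat -> R).
Hypothesis sphi : forall nu, (0 < nu)%N -> Sobolev m (phi nu).
Hypothesis orth : forall nu nu', (0 < nu)%N -> (0 < nu')%N ->
  V P X B (phi nu) (phi nu') = (nu == nu')%:R /\
  J m (phi nu) (phi nu') = rho nu * (nu == nu')%:R.
Hypothesis rho0 : forall nu, (0 < nu)%N -> 0 <= rho nu.
Variable M0 : R.
Hypothesis M00 : 0 < M0.
Hypothesis fourth : forall b : R -> R, Sobolev m b ->
     ('E_P[fun w => (`|ip (X w) b| ^+ 4)%R]
      <= M0%:E * 'E_P[fun w => (`|ip (X w) b| ^+ 2)%R] ^+ 2)%E.
Variables (a Cphi : R).
Hypothesis Cphi0 : 0 < Cphi.
Hypothesis normphi : forall nu, (0 < nu)%N -> L2norm (phi nu) <= Cphi * nu%:R `^ a.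
Variables (Ys : nat -> T -> R) (Xs : nat -> T -> R -> R).
Hypothesis rXs : forall i, random_process (Xs i).
Hypothesis mYs : forall i, measurable_fun setT (Ys i).
Hypothesis iid : iid_copies P Y X Ys Xs.
Variable wt : R -> R.
Hypothesis Lwt : L2 wt.

Local Notation O := (measurableTypeR R * pathType R)%type.
Let ob : T -> O := obs Y X.
Let os i : T -> O := obs (Ys i) (Xs i).
Let mob : measurable_fun setT ob. Proof. exact: measurable_obs. Qed.
Let mos i : measurable_fun setT (os i). Proof. exact: measurable_obs. Qed.
Let ind : mutually_independent P os := iid.1.
Let law i : same_law P (os i) ob := iid.2 i.
Let Lb0 : L2 th0.2. Proof. exact: (sobolev_L2 m0 sth0). Qed.
Let L2S b : Sobolev m b -> L2 (b : R -> R). Proof. exact: sobolev_L2. Qed.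

Let normX2 : intg P (fun w => ip (X w) (X w)).
Proof.
apply: (@intg_le _ _ _ P (fun w => Q w ^+ 2)); [exact: measurable_ipXX| |exact: all_moments_intgX].
move=> w; rewrite ger0_norm ?ip_ge0// -[leLHS](sqr_sqrtr (ip_ge0 _)).
by apply: lerXn2r; rewrite ?nnegrE ?sqrtr_ge0// ?normQ// (le_trans _ (normQ w)) ?sqrtr_ge0.
Qed.

Definition weight (nu : nat) : R := if nu is 0%N then 1 else Cphi * nu%:R `^ a.

Lemma weight_ge0 nu : 0 <= weight nu.
Proof. by case: nu => [|nu] //=; rewrite mulr_ge0 ?powR_ge0// ltW. Qed.

Let xiQ nu w : `|ob_xi phi nu (ob w)| <= weight nu * Q w.
Proof.
case: nu => [|nu] /=; first by rewrite normr1 mul1r.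
apply: (le_trans (ip_le_norm rX w (L2S (sphi (ltn0Sn nu))))); rewrite mulrC.
by apply: ler_pM; rewrite ?sqrtr_ge0// normphi.
Qed.

(** Finiteness passes from [Y] to each observation by equality in law, and to all of them at once by
    countability. *)
Lemma ob_W_sample : {ae P, forall w, forall i, (sup_deriv_ell G 3 (Ys i w) < +oo)%E}.
Proof.
apply: ae_foralln => i.
pose A : set O := [set o | (sup_deriv_ell G 3 o.1 < +oo)%E].
have mA : measurable A.
  have h : measurable_fun setT (fun o : O => sup_deriv_ell G 3 o.1).
    apply: (measurableT_comp (f := fun y => sup_deriv_ell G 3 y)) => //.
    exact: (measurable_sup_deriv_ell mG dG cG3).
  have := emeasurable_fun_infty_o measurableT h +oo%E; rewrite setTI.
  by congr measurable.
exact: (same_law_ae (mos i) mob (law i) mA Wfin).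
Qed.

(** Collects the constants of the remainder terms; it depends neither on the sample size nor on the
    smoothing parameter, the truncation or the test direction. *)
Definition fixed_n_cst : R :=
  Num.sqrt (C2 + 1) + Num.sqrt ((C2 + 1) * (growth_cst P Q (M0 * C2 ^+ 2) 2 + 1)) +
  (C2 + 1) * Num.sqrt (growth_cst P Q (M0 * C2 ^+ 2) 1 * (8 * (1 + M0 * C2 ^+ 2))) +
  (C2 + 1) * Num.sqrt (growth_cst P Q (M0 * C2 ^+ 2) 3 + 1).

Variables (n : nat) (lam : R) (N : nat) (S del sigma Cb e : R) (b : nat -> R) (thhat : T -> R * (R -> R)).
Hypothesis n0 : (0 < n)%N.
Hypothesis lam0 : 0 < lam.
Local Notation kap nu := (1 + lam * rho nu).
Hypothesis S0 : 0 < S.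
Hypothesis uS : forall N', 1 + \sum_(1 <= nu < N'.+1) (Cphi * nu%:R `^ a) ^+ 2 / kap nu <= S.
Hypothesis tail : forall N', \sum_(N.+1 <= nu < N') ip wt (phi nu) ^+ 2 / kap nu <= del.
Let tw nu := ip wt (phi nu) / kap nu.
Let tau := partial_sum phi tw N.
Hypothesis sigma0 : 0 < sigma.
Hypothesis sigmaE : sigma ^+ 2 = \sum_(1 <= nu < N.+1) tw nu ^+ 2.
Hypothesis expb : expansion P m X B lam phi b th0.2.
Hypothesis hCb : forall N', \sum_(1 <= nu < N'.+1) b nu ^+ 2 * rho nu ^+ 2 <= Cb.
Hypothesis expS : forall f : R -> R, Sobolev m f ->
  expansion P m X B lam phi (fun nu => V P X B f (phi nu)) f.
Hypothesis sthat : forall w, Sobolev m (thhat w).2.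
Hypothesis maximal : {ae P, forall w, forall th, Sobolev m th.2 ->
  penalized_criterion m G Ys Xs (fun=> lam) n w th <= penalized_criterion m G Ys Xs (fun=> lam) n w (thhat w)}.
Hypothesis e0 : 0 < e.

(** The intercept is not penalized, so its weight at index 0 is 1. *)
Let kapx (nu : nat) : R := if nu is 0%N then 1 else kap nu.
Let kapx1 nu : 1 <= kapx nu.
Proof. by case: nu => [|nu] //=; rewrite lerDl mulr_ge0 ?rho0// ltW. Qed.
Let kapx0 nu : 0 < kapx nu. Proof. exact: lt_le_trans ltr01 (kapx1 nu). Qed.

Let split0 (f : nat -> R) N' : \sum_(nu < N'.+1) f nu = f 0%N + \sum_(1 <= nu < N'.+1) f nu.
Proof. by rewrite big_ord_recl /= big_add1 /= big_mkord. Qed.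

Let uSx N' : \sum_(nu < N'.+1) weight nu ^+ 2 / kapx nu <= S.
Proof.
rewrite (split0 (fun nu => weight nu ^+ 2 / kapx nu)) /= expr1n divr1; apply: le_trans (uS N').
rewrite lerD2l big_nat_cond [leRHS]big_nat_cond; apply: ler_sum => i /andP[/andP[i0 _] _].
by case: i i0.
Qed.

Let C4 := M0 * C2 ^+ 2.
Let C40 : 0 <= C4. Proof. by rewrite mulr_ge0 ?sqr_ge0// ltW. Qed.
Let C5 := 8 * (1 + M0 * C2 ^+ 2).
Let C50 : 0 <= C5. Proof. by rewrite mulr_ge0// addr_ge0. Qed.
Let To := ob_T phi tw N.
Let tt nu : R := if (0 < nu <= N)%N then tw nu else 0.
Let mD := measurable_ob_D mG dG cG3 Lb0.
Let mW := measurable_ob_W mG dG cG3.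
Let mxi nu := measurable_ob_xi m0 sphi nu.
Let mTo := measurable_ob_T m0 sphi tw N.
Let stau : Sobolev m tau. Proof. exact: sobolev_partial_sum. Qed.

Let T4 : intg P (fun w => To (ob w) ^+ 4) /\ itg P (fun w => To (ob w) ^+ 4) <= C4 * sigma ^+ 4.
Proof.
have [i h] := ob_T_fourth Y m0 rX mB C20 hB hXX momQ normQ sphi orth M00 fourth tw N.
split; first exact: i.
by apply: (le_trans h); rewrite -sigmaE sqrtr_sqr ger0_norm// ltW.
Qed.

Let xi4 N' (c : nat -> R) := ob_xi_fourth Y m0 rX mB C20 hB hXX momQ normQ sphi orth M00 fourth N' c.

Let meanD nu : itg P (fun w => ob_D G th0 (ob w) * To (ob w) * ob_xi phi nu (ob w)) = - tt nu.
Proof. exact: (mean_D_T_xi m0 rX mY mB C20 hB hBX hXX mG dG cG3 sth0 momQ DQ normQ cD sphi orth). Qed.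

Let NH w := normH P m X B lam ((thhat w).1 - th0.1, (thhat w).2 \- th0.2).
(** Bounds the weighted sum of squared coordinates of the error: Bessel's inequality covers the
    slope, and the summand [C2] pays for the intercept, which enters the norm through the mean of
    [B], at least [1 / C2]. *)
Let K2 w := (C2 + 1) * NH w ^+ 2.

Section at_sample_point.
Variable w : T.
Hypothesis hW : forall i, (sup_deriv_ell G 3 (Ys i w) < +oo)%E.
Hypothesis hmax : forall th, Sobolev m th.2 ->
  penalized_criterion m G Ys Xs (fun=> lam) n w th <= penalized_criterion m G Ys Xs (fun=> lam) n w (thhat w).
Variables (A1 A2 : R).
Hypothesis hA1 : forall N', \sum_(nu < N'.+1) lin_coef os (ob_D G th0) (ob_xi phi) To tt n nu w ^+ 2 / kapx nu <= A1.
Hypothesis hA2 : forall N', \sum_(nu < N'.+1) \sum_(nu' < N'.+1)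
  quad_coef P ob os (ob_W G) (ob_xi phi) To n nu nu' w ^+ 2 / (kapx nu * kapx nu') <= A2.

Let db := (thhat w).2 \- th0.2.
Let sdb : Sobolev m db. Proof. exact: sobolevB. Qed.
Let c (nu : nat) : R := if nu is 0%N then (thhat w).1 - th0.1 else V P X B db (phi nu).
Let expc : expansion P m X B lam phi c db.
Proof.
have := expS sdb; rewrite /expansion /=; apply: cvg_trans; apply: near_eq_cvg; apply: nearW => N' /=.
have E : (fun t => db t - \sum_(1 <= nu < N'.+1) V P X B db (phi nu) * phi nu t) =
  (fun t => db t - \sum_(1 <= nu < N'.+1) c nu * phi nu t).
  apply/funext => t; congr (_ - _); rewrite big_nat_cond [RHS]big_nat_cond.
  by apply: eq_bigr => i /andP[/andP[i0 _] _]; case: i i0.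
by rewrite E.
Qed.

Let NH2 : NH w ^+ 2 = ipH P m X B lam ((thhat w).1 - th0.1, db) ((thhat w).1 - th0.1, db).
Proof.
rewrite /NH /normH sqr_sqrtr// (ipH_E rX mB C20 hB hBX hXX normX2 _ _ sdb (L2S sdb)).
rewrite addr_ge0//; last by rewrite mulr_ge0 ?J_ge0// ltW.
rewrite addr_ge0//; last by apply: (V_ge0 rX mB C20 hB hXX normX2); exact: L2S.
rewrite mulr_ge0 ?sqr_ge0//; apply: le_trans (itg_Bc_ge rX mB C20 hB).
by rewrite invr_ge0 ltW.
Qed.

Let hK N' : \sum_(nu < N'.+1) kapx nu * c nu ^+ 2 <= K2 w.
Proof.
rewrite (split0 (fun nu => kapx nu * c nu ^+ 2)) /= mul1r.
have h1 : \sum_(1 <= nu < N'.+1) kapx nu * c nu ^+ 2 <= ip1 P m X B lam db db.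
  have := bessel m0 rX mB C20 hB hXX normX2 sphi orth rho0 lam0 sdb expc N'.
  apply: le_trans; rewrite le_eqVlt; apply/orP; left; apply/eqP.
  rewrite big_nat_cond [RHS]big_nat_cond; apply: eq_bigr => i /andP[/andP[i0 _] _].
  by case: i i0.
apply: (le_trans (lerD (lexx _) h1)).
rewrite /K2 NH2 (ipH_E rX mB C20 hB hBX hXX normX2 _ _ sdb (L2S sdb)) /ip1.
have Vg := V_ge0 rX mB C20 hB hXX normX2 (L2S sdb).
have Jg : 0 <= lam * J m db db by rewrite mulr_ge0 ?J_ge0// ltW.
have Bg := itg_Bc_ge rX mB C20 hB.
have C2B : 1 <= C2 * itg P (fun w => Bclip B C2 (X w)).
  by rewrite -(@mulfV _ C2) ?gt_eqF// ler_pM2l.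
move: (V P X B db db) (lam * J m db db) (itg P _) Vg Jg Bg C2B => v j z v0 j0 z0 z1.
have Z0 : 0 <= z by apply: le_trans z0; rewrite invr_ge0 ltW.
have := sqr_ge0 ((thhat w).1 - th0.1); move: (((thhat w).1 - th0.1) ^+ 2) => x x0.
have : 0 <= x * (C2 * z - 1) by rewrite mulr_ge0// subr_ge0.
have : 0 <= x * z by rewrite mulr_ge0.
have : 0 <= C2 * v by rewrite mulr_ge0// ltW.
have : 0 <= C2 * j by rewrite mulr_ge0// ltW.
by nra.
Qed.

Let cvg_ip x : L2 x -> \sum_(1 <= nu < N'.+1) c nu * ip x (phi nu) @[N' --> \oo] --> ip x db.
Proof.
move=> lx; apply: (ip_expansion m0 rX mB C20 hB hXX normX2 injective_Cov sphi orth rho0 lam0 sdb expc _ lx).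
exists S => N'; apply: le_trans (uS N'); apply: ler_wpDl => //.
rewrite big_nat_cond [leRHS]big_nat_cond; apply: ler_sum => i /andP[/andP[i0 _] _].
have k0 : 0 <= (kap i)^-1 by rewrite invr_ge0 addr_ge0// mulr_ge0 ?rho0// ltW.
apply: ler_wpM2r => //; rewrite -[leLHS](sqr_sqrtr (ip_ge0 _)); apply: lerXn2r; rewrite ?nnegrE ?sqrtr_ge0//.
  by rewrite mulr_ge0 ?powR_ge0// ltW.
exact: normphi.
Qed.

Let g i := predictor ((thhat w).1 - th0.1, db) (Xs i w).

Let cvg_g i : \sum_(nu < N'.+1) c nu * ob_xi phi nu (os i w) @[N' --> \oo] --> g i.
Proof.
have E N' : \sum_(nu < N'.+1) c nu * ob_xi phi nu (os i w) = c 0%N + \sum_(1 <= nu < N'.+1) c nu * ip (Xs i w) (phi nu).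
  rewrite (split0 (fun nu => c nu * ob_xi phi nu (os i w))) /= mulr1; congr (_ + _).
  rewrite big_nat_cond [RHS]big_nat_cond; apply: eq_bigr => j /andP[/andP[j0 _] _].
  by case: j j0.
under eq_fun do rewrite E.
apply: (@cvgD _ R^o); first exact: cvg_cst.
exact: (cvg_ip (process_L2 (rXs i) w)).
Qed.

(** The [J] of [beta_0] against [phi nu] is [b nu * rho nu], square summable, so Cauchy-Schwarz
    leaves only [sigma] of the test direction. *)
Let bias_le : `|J m th0.2 tau| <= sigma * Num.sqrt Cb.
Proof.
rewrite (J_partial_sum m0 sphi tw N sth0).
have -> : \sum_(1 <= nu < N.+1) tw nu * J m th0.2 (phi nu) = \sum_(1 <= nu < N.+1) tw nu * (b nu * rho nu).
  rewrite big_nat_cond [RHS]big_nat_cond; apply: eq_bigr => j /andP[/andP[j0 _] _].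
  by rewrite (expansion_J m0 rX mB C20 hB hXX normX2 sphi orth rho0 lam0 sth0 expb).
have {1}<- : Num.sqrt (sigma ^+ 2) = sigma by rewrite sqrtr_sqr ger0_norm// ltW.
rewrite -sqrtrM ?sqr_ge0// -sqrtr_sqr ler_wsqrtr//.
apply: (le_trans (sum_cauchy_schwarz _ _ _)); rewrite sigmaE; apply: ler_wpM2l.
  by apply: sumr_ge0 => j _; exact: sqr_ge0.
by apply: le_trans (hCb N); apply: ler_sum => j _; rewrite exprMn.
Qed.

Let tail_le : (ip wt db - \sum_(1 <= nu < N.+1) ip wt (phi nu) * c nu) ^+ 2 <= K2 w * del.
Proof.
have cv : \sum_(1 <= nu < N'.+1) c nu * ip wt (phi nu) - \sum_(1 <= nu < N.+1) ip wt (phi nu) * c nu @[N' --> \oo]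
   --> ip wt db - \sum_(1 <= nu < N.+1) ip wt (phi nu) * c nu.
  by apply: (@cvgB _ R^o); [exact: cvg_ip|exact: cvg_cst].
apply: (cvg_sq_le cv); near=> N'.
have NN : (N <= N')%N by near: N'; exact: nbhs_infty_ge.
have -> : \sum_(1 <= nu < N'.+1) c nu * ip wt (phi nu) - \sum_(1 <= nu < N.+1) ip wt (phi nu) * c nu
   = \sum_(N.+1 <= nu < N'.+1) c nu * ip wt (phi nu).
  rewrite (@big_cat_nat _ _ _ N.+1)//= addrAC.
  rewrite (eq_bigr (fun nu => ip wt (phi nu) * c nu)) ?subrr ?add0r//.
  by move=> i _; rewrite mulrC.
apply: (le_trans (sum_weighted_cauchy_schwarz _ _ _ kapx0)); apply: ler_pM.
- by apply: sumr_ge0 => i _; rewrite mulr_ge0 ?sqr_ge0// ltW.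
- by apply: sumr_ge0 => i _; rewrite divr_ge0 ?sqr_ge0// ltW.
- apply: le_trans (hK N').
  rewrite -(big_mkord xpredT (fun nu => kapx nu * c nu ^+ 2)) [leRHS](@big_cat_nat _ _ _ N.+1)//=.
  by apply: ler_wpDl => //; apply: sumr_ge0 => i _; rewrite mulr_ge0 ?sqr_ge0// ltW.
- apply: le_trans (tail N'.+1); rewrite le_eqVlt; apply/orP; left; apply/eqP.
  rewrite big_nat_cond [RHS]big_nat_cond; apply: eq_bigr => j /andP[/andP[j0 _] _].
  by case: j j0.
Unshelve. all: by end_near. Qed.

(** The terms come, in this order, from the tail of the series beyond [N], the linear remainder, the
    quadratic remainder and the bias. *)
Lemma sample_point_bound :
  `|ip wt db - n%:R^-1 * (\sum_(i < n) ob_eps G th0 (os i w) * To (os i w))| <=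
  Num.sqrt (K2 w * del) + Num.sqrt (K2 w * A1) +
  (Num.sqrt (growth_cst P Q C4 1 * C5) * sigma * K2 w + K2 w * Num.sqrt A2) + lam * (sigma * Num.sqrt Cb).
Proof.
have lin : (n%:R^-1 * (\sum_(i < n) ob_D G th0 (os i w) * To (os i w) * g i) + \sum_(nu < N.+1) tt nu * c nu) ^+ 2 <= K2 w * A1.
  apply: (lin_term_bound kapx1 _ cvg_g hK hA1) => nu nuN.
  by rewrite /tt (leqNgt nu N) nuN andbF.
have quad : n%:R^-1 * (\sum_(i < n) ob_W G (os i w) * `|To (os i w)| * g i ^+ 2) <=
    Num.sqrt (growth_cst P Q C4 1 * C5) * sigma * K2 w + K2 w * Num.sqrt A2.
  by apply: (quad_term_bound mob mW mxi momQ Q1 WQ xiQ weight_ge0 kapx1 C40 C50 xi4 mTo sigma0 T4 cvg_g hK hA2).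
have hW' i a' : `|derive1n 3 (G (Ys i w)) a'| <= ob_W G (os i w).
  rewrite -lee_fin /ob_W fineK; first by apply: ereal_sup_ubound; exists a'.
  by rewrite ge0_fin_numE ?sup_deriv_ell_ge0//; exact: hW.
have tay := score_taylor m0 dG (fun i => process_L2 (rXs i) w) sth0 (sthat w) stau hmax hW' (fun i => erefl (g i)).
have JE : J m (thhat w).2 tau = J m db tau + J m th0.2 tau.
  have -> : (thhat w).2 = (fun t => db t + 1 * th0.2 t) by apply/funext => t; rewrite /db /= mul1r subrK.
  by rewrite (J_linl m0 1 sdb sth0 stau) mul1r.
have s1E : \sum_(nu < N.+1) tt nu * c nu = \sum_(1 <= nu < N.+1) tw nu * c nu.
  rewrite (split0 (fun nu => tt nu * c nu)) /tt /= mul0r add0r.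
  rewrite big_nat_cond [RHS]big_nat_cond; apply: eq_bigr => j /andP[/andP[j0 jN] _].
  by rewrite j0 -ltnS jN.
have s2E : J m db tau = \sum_(1 <= nu < N.+1) tw nu * (c nu * rho nu).
  rewrite (J_partial_sum m0 sphi tw N sdb).
  rewrite big_nat_cond [RHS]big_nat_cond; apply: eq_bigr => j /andP[/andP[j0 _] _].
  by rewrite (expansion_J m0 rX mB C20 hB hXX normX2 sphi orth rho0 lam0 sdb expc).
(* The choice of [tw] makes [w_nu = tw nu + lam * rho nu * tw nu]: the penalty in the score equation
   recombines with the curvature term into the contrast itself. *)
have wE : \sum_(1 <= nu < N.+1) ip wt (phi nu) * c nu =
    \sum_(1 <= nu < N.+1) tw nu * c nu + lam * \sum_(1 <= nu < N.+1) tw nu * (c nu * rho nu).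
  rewrite mulr_sumr -big_split /= big_nat_cond [RHS]big_nat_cond; apply: eq_bigr => j /andP[/andP[j0 _] _].
  have k0 : kap j != 0 by rewrite gt_eqF// ltr_pwDl// mulr_ge0 ?rho0// ltW.
  by rewrite /tw; field.
rewrite s1E in lin; rewrite JE s2E in tay.
have tl := tail_le; rewrite wE in tl.
move: lin tay tl bias_le.
rewrite -/(ob_T phi tw N) -/To.
set E1 := n%:R^-1 * (\sum_(i < n) ob_eps G th0 (os i w) * To (os i w)).
set E2 := n%:R^-1 * (\sum_(i < n) ob_D G th0 (os i w) * To (os i w) * g i).
set s1 := \sum_(1 <= nu < N.+1) tw nu * c nu.
set s2 := \sum_(1 <= nu < N.+1) tw nu * (c nu * rho nu).
move=> lin tay tl bias.
have sq (x y : R) : x ^+ 2 <= y -> `|x| <= Num.sqrt y by move=> h; rewrite -sqrtr_sqr ler_wsqrtr.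
have h1 := sq _ _ tl; have h2 := sq _ _ lin.
have h3 : `|lam * J m th0.2 tau| <= lam * (sigma * Num.sqrt Cb).
  by rewrite normrM gtr0_norm// ler_pM2l.
have h4 : `|E1 + E2 - lam * (s2 + J m th0.2 tau)| <=
    Num.sqrt (growth_cst P Q C4 1 * C5) * sigma * K2 w + K2 w * Num.sqrt A2 := le_trans tay quad.
have -> : ip wt db - E1 = (ip wt db - (s1 + lam * s2)) + (E2 + s1) - (E1 + E2 - lam * (s2 + J m th0.2 tau)) - lam * J m th0.2 tau by ring.
apply: (le_trans (ler_normB _ _)); apply: lerD => //.
apply: (le_trans (ler_normB _ _)); apply: lerD => //.
by apply: (le_trans (ler_normD _ _)); exact: lerD.
Qed.

End at_sample_point.

Lemma fixed_n_bound : exists A, [/\ measurable A, (P A <= (e + e)%:E)%E & forall w, ~ A w ->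
  `|ip wt ((thhat w).2 \- th0.2) - n%:R^-1 * (\sum_(i < n) ob_eps G th0 (os i w) * To (os i w))| <=
  fixed_n_cst * (NH w * Num.sqrt del + sigma * (NH w * Num.sqrt (S / (n%:R * e)))
    + sigma * NH w ^+ 2 * (1 + S / Num.sqrt (n%:R * e))) + lam * (sigma * Num.sqrt Cb)].
Proof.
have [B1 [mB1 PB1 hB1]] := lin_event mob mos ind law mD mxi momQ Q1 DQ xiQ weight_ge0 kapx1 C40 mTo sigma0 T4 meanD S0 uSx n0 e0.
have [B2 [mB2 PB2 hB2]] := quad_event mob mos ind law mW mxi momQ Q1 WQ xiQ weight_ge0 kapx1 C40 mTo sigma0 T4 S0 uSx n0 e0.
have [N3 [mN3 PN3 hN3]] : {ae P, forall w, (forall i, (sup_deriv_ell G 3 (Ys i w) < +oo)%E) /\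
  (forall th, Sobolev m th.2 -> penalized_criterion m G Ys Xs (fun=> lam) n w th <=
     penalized_criterion m G Ys Xs (fun=> lam) n w (thhat w))}.
  by move: ob_W_sample maximal; apply: filterS2 => w h1 h2.
exists (B1 `|` B2 `|` N3); split.
- by apply: measurableU => //; exact: measurableU.
- apply: (le_trans (measureU2 _ _ _)) => //; first exact: measurableU.
  rewrite [X in (_ + X <= _)%E](_ : _ = 0%E) ?adde0; last exact: PN3.
  apply: (le_trans (measureU2 _ _ _)) => //; rewrite EFinD; exact: leeD.
move=> w hw.
have w1 : ~ B1 w by move=> h; apply: hw; left; left.
have w2 : ~ B2 w by move=> h; apply: hw; left; right.
have [w3 w4] : (forall i, (sup_deriv_ell G 3 (Ys i w) < +oo)%E) /\
  (forall th, Sobolev m th.2 -> penalized_criterion m G Ys Xs (fun=> lam) n w th <=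
     penalized_criterion m G Ys Xs (fun=> lam) n w (thhat w)).
  by apply: contrapT => h; apply: hw; right; exact: hN3.
apply: (le_trans (sample_point_bound w3 w4 (hB1 w w1) (hB2 w w2))); rewrite lerD2r.
have n1 : 0 < n%:R :> R by rewrite ltr0n.
have NH0 : 0 <= NH w by rewrite /NH /normH sqrtr_ge0.
have g1 := growth_cst_ge0 P Q C4 1; have g2 := growth_cst_ge0 P Q C4 2; have g3 := growth_cst_ge0 P Q C4 3.
have sg : Num.sqrt (sigma ^+ 2) = sigma by rewrite sqrtr_sqr ger0_norm// ltW.
have sN : Num.sqrt (NH w ^+ 2) = NH w by rewrite sqrtr_sqr ger0_norm.
have sS : Num.sqrt (S ^+ 2) = S by rewrite sqrtr_sqr ger0_norm// ltW.
have C21 : 0 <= C2 + 1 by rewrite addr_ge0// ltW.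
have ne : 0 < n%:R * e by exact: mulr_gt0.
have E1 : Num.sqrt (K2 w * del) = Num.sqrt (C2 + 1) * (NH w * Num.sqrt del).
  by rewrite /K2 -mulrA sqrtrM// sqrtrM ?sqr_ge0// sN.
have E2 : Num.sqrt (K2 w * (n%:R^-1 * (S * (growth_cst P Q C4 2 + 1) * sigma ^+ 2) / e)) =
   Num.sqrt ((C2 + 1) * (growth_cst P Q C4 2 + 1)) * (sigma * (NH w * Num.sqrt (S / (n%:R * e)))).
  have -> : sigma * (NH w * Num.sqrt (S / (n%:R * e))) =
      Num.sqrt (sigma ^+ 2) * (Num.sqrt (NH w ^+ 2) * Num.sqrt (S / (n%:R * e))) by rewrite sg sN.
  rewrite -!sqrtrM ?sqr_ge0//; last by rewrite mulr_ge0// addr_ge0.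
  by congr Num.sqrt; rewrite /K2; field; rewrite !gt_eqF.
have E3 : Num.sqrt (n%:R^-1 * (S ^+ 2 * (growth_cst P Q C4 3 + 1) * sigma ^+ 2) / e) =
   Num.sqrt (growth_cst P Q C4 3 + 1) * sigma * S / Num.sqrt (n%:R * e).
  have -> : Num.sqrt (growth_cst P Q C4 3 + 1) * sigma * S / Num.sqrt (n%:R * e) =
      Num.sqrt (growth_cst P Q C4 3 + 1) * Num.sqrt (sigma ^+ 2) * Num.sqrt (S ^+ 2) / Num.sqrt (n%:R * e).
    by rewrite sg sS.
  rewrite -sqrtrV ?(ltW ne)// -!sqrtrM ?sqr_ge0 ?mulr_ge0 ?sqr_ge0 ?addr_ge0 ?(ltW sigma0) ?(ltW S0)//.
  by congr Num.sqrt; field; rewrite !gt_eqF.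
rewrite E1 E2 E3 /fixed_n_cst -/C4 -/C5 /K2.
set k1 := Num.sqrt (C2 + 1); set k2 := Num.sqrt ((C2 + 1) * _).
set k3 := Num.sqrt (growth_cst P Q C4 1 * C5); set k4 := Num.sqrt (growth_cst P Q C4 3 + 1).
have x0 : 0 <= NH w * Num.sqrt del by rewrite mulr_ge0// sqrtr_ge0.
have y0 : 0 <= sigma * (NH w * Num.sqrt (S / (n%:R * e))) by rewrite !mulr_ge0 ?sqrtr_ge0// ltW.
have z0 : 0 <= sigma * NH w ^+ 2 by rewrite mulr_ge0 ?sqr_ge0// ltW.
have v0 : 0 <= S / Num.sqrt (n%:R * e) by rewrite divr_ge0 ?sqrtr_ge0// ltW.
have -> : k3 * sigma * ((C2 + 1) * NH w ^+ 2) + (C2 + 1) * NH w ^+ 2 * (k4 * sigma * S / Num.sqrt (n%:R * e)) =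
   ((C2 + 1) * k3) * (sigma * NH w ^+ 2) + ((C2 + 1) * k4) * (sigma * NH w ^+ 2 * (S / Num.sqrt (n%:R * e))) by ring.
have -> : sigma * NH w ^+ 2 * (1 + S / Num.sqrt (n%:R * e)) =
  sigma * NH w ^+ 2 + sigma * NH w ^+ 2 * (S / Num.sqrt (n%:R * e)) by ring.
have u0 : 0 <= sigma * NH w ^+ 2 * (S / Num.sqrt (n%:R * e)) by exact: mulr_ge0.
have k10 : 0 <= k1 := sqrtr_ge0 _; have k20 : 0 <= k2 := sqrtr_ge0 _.
have k30 : 0 <= (C2 + 1) * k3 by rewrite mulr_ge0// sqrtr_ge0.
have k40 : 0 <= (C2 + 1) * k4 by rewrite mulr_ge0// sqrtr_ge0.
move: (NH w * _) (sigma * (NH w * _)) (sigma * NH w ^+ 2) (sigma * NH w ^+ 2 * _) x0 y0 z0 u0 => x y z u x0 y0 z0 u0.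
move: k1 k2 ((C2 + 1) * k3) ((C2 + 1) * k4) k10 k20 k30 k40 => k1 k2 k3' k4' k10 k20 k30 k40.
have -> : (k1 + k2 + k3' + k4') * (x + y + (z + u)) = (k1 * x + k2 * y + (k3' * z + k4' * u)) +
  ((k2 + k3' + k4') * x + (k1 + k3' + k4') * y + (k1 + k2 + k4') * z + (k1 + k2 + k3') * u) by ring.
by rewrite lerDl !addr_ge0// mulr_ge0// !addr_ge0.
Qed.

End fixed_sample_size.

(** * Rates *)

Section rates.
Context (R : realType).
Variables (m : nat) (a k : R) (lam : nat -> R) (Cell : \bar R).
Local Notation h := (bandwidth k lam).
Local Notation r := (rate_r k lam).
Hypothesis m0 : (0 < m)%N.
Hypothesis a0 : 0 <= a.
Hypothesis ak : a + 2^-1 < k.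
Hypothesis lam0 : forall n, (0 < n)%N -> 0 < lam n.
Hypothesis h0 : h n @[n --> \oo] --> (0 : R).
Hypothesis Cell0 : (0 <= Cell)%E.
Hypothesis ha : (n%:R%:E * rate_a m a k lam Cell n ^+ 2)%E @[n --> \oo] --> (0 : \bar R)%E.
Hypothesis hbias : n%:R * h n `^ (4 * k) @[n --> \oo] --> (0 : R).

Let k0 : 0 < k. Proof. by have := ak; have := a0; lra. Qed.

Lemma bandwidth_gt0 n : (0 < n)%N -> 0 < h n.
Proof. by move=> n0; apply: powR_gt0; exact: lam0. Qed.

Lemma bandwidth_le1 : \forall n \near \oo, h n <= 1.
Proof.
have /cvgrPdist_le /(_ 1 ltr01) := h0; apply: filterS => n; rewrite sub0r normrN.
exact: le_trans (ler_norm _).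
Qed.

Lemma bandwidth_pow n : (0 < n)%N -> h n `^ (2 * k) = lam n.
Proof.
move=> n0; rewrite /bandwidth -powRrM mulVf ?powRr1 ?(ltW (lam0 n0))//.
by rewrite mulf_neq0// gt_eqF.
Qed.

Lemma rate_r_ge0 n : 0 <= r n.
Proof. by rewrite addr_ge0 ?powR_ge0. Qed.

(** The rate of the error, inflated by the order of the square root of the weight sums. *)
Let q n := h n `^ (- (a + 5 / 4)) * r n.

Let q0 n : 0 <= q n. Proof. by rewrite mulr_ge0 ?powR_ge0 ?rate_r_ge0. Qed.

(** The right-hand side is [a + 3/2 - 1 / (4 * m)], and [m >= 1]. *)
Let exponent_ge : a + 5 / 4 <= (4 * m%:R * a + 6 * m%:R - 1) / (4 * m%:R).
Proof.
have m1 : 1 <= m%:R :> R by rewrite ler1n.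
by rewrite ler_pdivlMr; nra.
Qed.

Let powN_le (x y z : R) : 0 < x <= 1 -> y <= z -> x `^ (- y) <= x `^ (- z).
Proof.
move=> /andP[x0 x1] yz; have -> : - z = - y + - (z - y) by ring.
rewrite gt0_powRD// ler_peMr ?powR_ge0// powRN invf_ge1 ?powR_gt0//.
by apply: powR_le1; rewrite ?x0// subr_ge0.
Qed.

(* As [0 <= Cell], [rate_a] is at least its first term, whose exponent of [h] is at
   most [- (a + 5 / 4)]. *)
Lemma rate_a_dominates : \forall n \near \oo,
  ((q n ^+ 2)%:E <= n%:R%:E * rate_a m a k lam Cell n ^+ 2)%E.
Proof.
near=> n.
have n0 : (0 < n)%N by near: n; exact: nbhs_infty_gt.
have nR : 0 < n%:R :> R by rewrite ltr0n.
have hn0 := bandwidth_gt0 n0.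
have h1 : h n <= 1 by near: n; exact: bandwidth_le1.
have nE : expR (expR 1) <= n%:R :> R by near: n; exact: nbhs_infty_ger.
have l1 : expR 1 <= ln n%:R :> R by rewrite -ler_expR lnK// posrE.
have l0 : 0 < ln n%:R :> R := lt_le_trans (expR_gt0 _) l1.
have l2 : 1 <= ln (ln n%:R) :> R by rewrite -ler_expR lnK// posrE.
have l3 : 1 <= ln n%:R ^+ 2 * Num.sqrt (ln (ln n%:R)) :> R.
  rewrite -[leLHS]mulr1; apply: ler_pM => //.
    rewrite exprn_ege1// (le_trans _ l1)// -expR0 ler_expR//.
  by rewrite -[leLHS]sqrtr1 ler_wsqrtr.
rewrite /rate_a; set s := n%:R `^ (- 2^-1) * _ * _ * _ * _.
have s1 : n%:R `^ (- 2^-1) * q n <= s.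
  have -> : s = n%:R `^ (- 2^-1) * (h n `^ (- ((4 * m%:R * a + 6 * m%:R - 1) / (4 * m%:R))) * r n) *
      (ln n%:R ^+ 2 * Num.sqrt (ln (ln n%:R))) by rewrite /s !mulrA.
  rewrite -[leLHS]mulr1; apply: ler_pM => //; first by rewrite mulr_ge0 ?powR_ge0.
  rewrite ler_wpM2l ?powR_ge0// ler_wpM2r ?rate_r_ge0//.
  by apply: powN_le; rewrite ?hn0.
have s0 : 0 <= n%:R `^ (- 2^-1) * q n by rewrite mulr_ge0 ?powR_ge0.
have E : q n ^+ 2 = n%:R * (n%:R `^ (- 2^-1) * q n) ^+ 2.
  rewrite [in RHS]exprMn (powRN n%:R) powR12_sqrt ?(ltW nR)// exprVn sqr_sqrtr ?(ltW nR)//.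
  by rewrite mulrA mulfV ?gt_eqF// mul1r.
have le1 : ((n%:R `^ (- 2^-1) * q n)%:E <= s%:E + Cell * (h n `^ (- 2^-1) * r n ^+ 2)%:E)%E.
  apply: (@le_trans _ _ (s%:E)); first by rewrite lee_fin.
  by rewrite leeDl// mule_ge0// lee_fin mulr_ge0 ?powR_ge0 ?sqr_ge0.
rewrite E EFinM EFin_expe lee_pmul ?lee_fin ?sqr_ge0 ?(ltW nR)// !expe2 ?lee_pmul ?lee_fin//.
Unshelve. all: by end_near. Qed.

Let cvg_q2 : q n ^+ 2 @[n --> \oo] --> (0 : R).
Proof.
have : (q n ^+ 2)%:E @[n --> \oo] --> (0 : \bar R)%E.
  apply: (@squeeze_cvge _ _ _ _ (fun=> 0%E) _ (fun n => n%:R%:E * rate_a m a k lam Cell n ^+ 2)%E); [|exact: cvg_cst|exact: ha].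
  near=> n; apply/andP; split; first by rewrite lee_fin sqr_ge0.
  by near: n; exact: rate_a_dominates.
by move/fine_cvgP => [].
Unshelve. all: by end_near. Qed.

Let sqrt_cvg0 (x : nat -> R) : x n @[n --> \oo] --> (0 : R) -> Num.sqrt (x n) @[n --> \oo] --> (0 : R).
Proof.
move=> hx; rewrite -sqrtr0; apply: (@cvg_comp _ _ _ x Num.sqrt _ (nbhs (0 : R))) => //.
exact: sqrt_continuous.
Qed.

Let cvg_q : q n @[n --> \oo] --> (0 : R).
Proof.
have := sqrt_cvg0 cvg_q2; apply: cvg_trans; apply: near_eq_cvg; apply: nearW => n.
by rewrite sqrtr_sqr ger0_norm.
Qed.

Lemma cvg_rate_weights : r n ^+ 2 * h n `^ (- (2 * a + 5 / 2)) @[n --> \oo] --> (0 : R).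
Proof.
have := cvg_q2; apply: cvg_trans; apply: near_eq_cvg; near=> n.
have n0 : (0 < n)%N by near: n; exact: nbhs_infty_gt.
rewrite /q exprMn mulrC [in LHS](expr2 (h n `^ _)) -gt0_powRD ?bandwidth_gt0//; congr (_ * _ `^ _).
by field.
Unshelve. all: by end_near. Qed.

Lemma cvg_rate_r : r n @[n --> \oo] --> (0 : R).
Proof.
apply: (squeeze_cvgr (f := fun=> 0) (h := q)); [|exact: cvg_cst|exact: cvg_q].
near=> n; rewrite rate_r_ge0/= /q ler_peMl ?rate_r_ge0//.
have n0 : (0 < n)%N by near: n; exact: nbhs_infty_gt.
have := @powN_le (h n) 0 (a + 5 / 4); rewrite oppr0 powRr0; apply; last by rewrite addr_ge0.
by rewrite bandwidth_gt0//=; near: n; exact: bandwidth_le1.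
Unshelve. all: by end_near. Qed.

Lemma cvg_lam_sqrt : lam n * Num.sqrt n%:R @[n --> \oo] --> (0 : R).
Proof.
have := sqrt_cvg0 hbias; apply: cvg_trans; apply: near_eq_cvg; near=> n.
have n0 : (0 < n)%N by near: n; exact: nbhs_infty_gt.
rewrite (_ : 4 * k = 2 * k + 2 * k); last by ring.
rewrite gt0_powRD ?bandwidth_gt0// bandwidth_pow// -expr2 sqrtrM ?ler0n//.
by rewrite sqrtr_sqr ger0_norm ?(ltW (lam0 n0))// mulrC.
Unshelve. all: by end_near. Qed.

(** With [r = u + v], one has [v ^+ 2 = lam] and [sqrt n * u = h^(-1/2)]; so the quantity is bounded
    through [q] and [lam * sqrt n], which both vanish. *)
Lemma cvg_sqrt_rate_sq : Num.sqrt n%:R * r n ^+ 2 @[n --> \oo] --> (0 : R).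
Proof.
apply: (squeeze_cvgr (f := fun=> 0) (h := fun n => 2 * (q n + lam n * Num.sqrt n%:R))); [|exact: cvg_cst|]; last first.
  rewrite -[X in _ --> X](mulr0 2) -[X in _ * X](addr0 (0 : R)).
  by apply: cvgM; [exact: cvg_cst|apply: (@cvgD _ R^o); [exact: cvg_q|exact: cvg_lam_sqrt]].
near=> n.
have n0 : (0 < n)%N by near: n; exact: nbhs_infty_gt.
have nR : 0 < n%:R :> R by rewrite ltr0n.
have hn0 := bandwidth_gt0 n0.
have h1 : h n <= 1 by near: n; exact: bandwidth_le1.
rewrite mulr_ge0 ?sqrtr_ge0 ?sqr_ge0//=.
have hk : h n `^ k ^+ 2 = lam n.
  by rewrite expr2 -gt0_powRD// -(bandwidth_pow n0); congr (_ `^ _); ring.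
rewrite /q /rate_r; set u := (n%:R * h n) `^ _; set v := h n `^ k in hk *.
have u0 : 0 <= u := powR_ge0 _ _; have v0 : 0 <= v := powR_ge0 _ _.
have su : Num.sqrt n%:R * u = h n `^ (- 2^-1).
  rewrite /u powRM ?(ltW nR) ?(ltW hn0)// -powR12_sqrt ?(ltW nR)// mulrA -gt0_powRD//.
  by rewrite subrr powRr0 mul1r.
have hE : h n `^ (- 2^-1) <= h n `^ (- (a + 5 / 4)).
  by apply: powN_le; rewrite ?hn0//; have := a0; lra.
have H0 : 0 <= h n `^ (- (a + 5 / 4)) := powR_ge0 _ _.
have s0 : 0 <= Num.sqrt n%:R :> R := sqrtr_ge0 _.
have key (x y z : R) : 0 <= x -> x * (y + z) ^+ 2 <= 2 * (x * y ^+ 2 + z ^+ 2 * x).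
  by move=> x0; have := mulr_ge0 x0 (sqr_ge0 (y - z)); nra.
apply: (le_trans (key _ u v s0)); rewrite hk ler_pM2l// lerD2r.
rewrite expr2 mulrA su; apply: ler_pM => //; last by rewrite lerDl.
by rewrite -su mulr_ge0.
Unshelve. all: by end_near. Qed.

End rates.

(** * Series of nonnegative terms *)

Section nonnegative_series.
Context (R : realType).
Variable u : nat -> R.
Hypothesis u0 : forall nu, (0 < nu)%N -> 0 <= u nu.

Lemma sum1_nondecreasing N N' : (N <= N')%N -> \sum_(1 <= nu < N.+1) u nu <= \sum_(1 <= nu < N'.+1) u nu.
Proof.
move=> NN; rewrite [leRHS](@big_cat_nat _ _ _ N.+1)//= lerDl big_nat_cond.
by apply: sumr_ge0 => i /andP[/andP[Ni _] _]; apply: u0; exact: leq_trans Ni.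
Qed.

Lemma summable_bounded C : (forall N, \sum_(1 <= nu < N.+1) u nu <= C) -> summable_from1 u.
Proof.
move=> hC; apply: nondecreasing_is_cvgn; first by move=> N N' NN; exact: sum1_nondecreasing.
by exists C => _ [N _ <-].
Qed.

Lemma sum1_le_sum_from1 N : summable_from1 u -> \sum_(1 <= nu < N.+1) u nu <= sum_from1 u.
Proof.
move=> su; apply: (nondecreasing_cvgn_le (u_ := fun N => \sum_(1 <= nu < N.+1) u nu)) => //.
by move=> ? ? ?; exact: sum1_nondecreasing.
Qed.

Lemma summable_tail (del : R) : summable_from1 u -> 0 < del ->
  exists N, sum_from1 u - del <= \sum_(1 <= nu < N.+1) u nu /\
    forall N', \sum_(N.+1 <= nu < N') u nu <= del.
Proof.
move=> su d0; have cu : \sum_(1 <= nu < N.+1) u nu @[N --> \oo] --> sum_from1 u by exact: su.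
have /cvgrPdist_le /(_ _ d0) [N _ /(_ N (leqnn _))] := cu => /= hN.
have hN' : sum_from1 u - del <= \sum_(1 <= nu < N.+1) u nu.
  by move: hN; rewrite ler_norml => /andP[_]; lra.
exists N; split => // N'.
have [NN|NN] := leqP N' N.+1; first by rewrite big_geq// ltW.
have e : \sum_(1 <= nu < N') u nu = \sum_(1 <= nu < N.+1) u nu + \sum_(N.+1 <= nu < N') u nu.
  by rewrite (@big_cat_nat _ _ _ N.+1)//= ltnW.
case: N' NN e => // N' NN e.
by have := sum1_le_sum_from1 N' su; rewrite e; lra.
Qed.

End nonnegative_series.

(** * Asymptotic normality *)

(** Measurability is known at each [t] only; continuity in [t] makes the curve jointly measurable by
    [caratheodory_measurable]. *)
Lemma measurable_ip_curve d (T : measurableType d) (R : realType) (x : R -> R) (f : T -> R -> R) :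
  L2 x -> (forall t, unit_itv t -> measurable_fun setT (fun w => f w t)) ->
  (forall w, continuous (f w \o @clamp01 R)) -> measurable_fun setT (fun w => ip x (f w)).
Proof.
move=> lx mf cf.
have -> : (fun w => ip x (f w)) = (fun w => ip x (f w \o @clamp01 R)).
  by apply/funext => w; apply: ip_ext => // t ht /=; rewrite clamp01_id.
under eq_fun do rewrite ipE.
apply: (@measurable_itg_l _ _ T (measurableTypeR R) R (@lebesgue_measure R)
  (fun w t => res x t * res (f w \o @clamp01 R) t)).
apply: measurable_funM; first by apply: measurableT_comp => //; exact: L2_meas.
have -> : (fun p : T * measurableTypeR R => res (f p.1 \o @clamp01 R) p.2) =
    (fun p => \1_(unit_itv : set R) p.2 * f p.1 (clamp01 p.2)).
  apply/funext => -[w t] /=; rewrite indicE; case: (boolP (0 <= t <= 1)) => h.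
    by rewrite res_in// mem_set ?unit_itvE// mul1r.
  by rewrite res_out// memNset ?unit_itvE ?mul0r//; exact/negP.
apply: measurable_funM.
  by apply: measurableT_comp => //; apply: measurable_indic; exact: measurable_unit.
apply: (@caratheodory_measurable _ T R (fun w t => f w (clamp01 t))) => // t.
by apply: mf; rewrite unit_itvE clamp01_itv.
Qed.

(** The bound at a fixed sample size, multiplied by [sqrt n / sqrt m2]: as [sg <= sqrt m2], the size
    of the direction cancels, and the tail [m2 / n] contributes [Y] alone. *)
Lemma scaled_bound (R : realType) (K Y S n e sg m2 l cb NH : R) :
  0 < n -> 0 < e -> 0 < m2 -> 0 <= sg -> sg ^+ 2 <= m2 -> 0 <= NH <= Y -> 0 <= S -> 0 <= K -> 0 <= l -> 0 <= cb ->
  Num.sqrt n / Num.sqrt m2 * (K * (NH * Num.sqrt (m2 / n) + sg * (NH * Num.sqrt (S / (n * e)))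
    + sg * NH ^+ 2 * (1 + S / Num.sqrt (n * e))) + l * (sg * cb)) <=
  K * (Y + Y * Num.sqrt (S / e) + Y ^+ 2 * Num.sqrt n + Y ^+ 2 * (S / Num.sqrt e)) + l * Num.sqrt n * cb.
Proof.
move=> n0 e0 m0 sg0 sgm /andP[NH0 NHY] S0 K0 l0 cb0.
have q0 : 0 < Num.sqrt n by rewrite sqrtr_gt0.
have p0 : 0 < Num.sqrt m2 by rewrite sqrtr_gt0.
have e'0 : 0 < Num.sqrt e by rewrite sqrtr_gt0.
have -> : Num.sqrt (m2 / n) = Num.sqrt m2 / Num.sqrt n by rewrite sqrtrM ?(ltW m0)// sqrtrV ?(ltW n0).
have -> : S / (n * e) = (S / e) / n by field; rewrite !gt_eqF.
have -> : Num.sqrt (S / e / n) = Num.sqrt (S / e) / Num.sqrt n.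
  by rewrite sqrtrM ?divr_ge0 ?(ltW e0)// sqrtrV ?(ltW n0).
rewrite (sqrtrM _ (ltW n0)).
have z1 : sg / Num.sqrt m2 <= 1.
  rewrite ler_pdivrMr// mul1r -[leLHS](ger0_norm sg0) -sqrtr_sqr ler_wsqrtr//.
have z0 : 0 <= sg / Num.sqrt m2 by rewrite divr_ge0 ?(ltW p0).
set s := Num.sqrt (S / e); have s0 : 0 <= s := sqrtr_ge0 _.
move: (Num.sqrt n) (Num.sqrt m2) (Num.sqrt e) q0 p0 e'0 z1 z0 => q p e' q0 p0 e'0 z1 z0.
have -> : q / p * (K * (NH * (p / q) + sg * (NH * (s / q)) + sg * NH ^+ 2 * (1 + S / (q * e'))) + l * (sg * cb)) =
  K * (NH + sg / p * (NH * s) + sg / p * (NH ^+ 2 * q) + sg / p * (NH ^+ 2 * (S / e'))) + sg / p * (l * q * cb).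
  by field; rewrite !gt_eqF.
have Y0 : 0 <= Y := le_trans NH0 NHY.
have N2 : NH ^+ 2 <= Y ^+ 2 by apply: lerXn2r; rewrite ?nnegrE.
have key (x y : R) : 0 <= x -> x <= y -> sg / p * x <= y.
  by move=> x0; apply: le_trans; rewrite ler_piMl.
have Se : 0 <= S / e' by rewrite divr_ge0 ?(ltW e'0).
apply: lerD; last by apply: key => //; rewrite !mulr_ge0 ?(ltW q0).
apply: ler_wpM2l => //; apply: lerD; [apply: lerD; [apply: lerD => //|]|]; apply: key.
- exact: mulr_ge0.
- exact: ler_wpM2r.
- by rewrite mulr_ge0 ?sqr_ge0 ?(ltW q0).
- by rewrite ler_wpM2r ?(ltW q0).
- by rewrite mulr_ge0 ?sqr_ge0.
- exact: ler_wpM2r.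
Qed.

Lemma iid_moments d (T : measurableType d) (R : realType) (P : probability T R)
  dO (O : measurableType dO) (o : T -> O) (os : nat -> T -> O) (f : O -> R) (i : nat) :
  measurable_fun setT o -> (forall i, measurable_fun setT (os i)) -> (forall i, same_law P (os i) o) ->
  measurable_fun setT f -> intg P (fun w => f (o w)) ->
  intg P (fun w => f (os i w)) /\ itg P (fun w => f (os i w)) = itg P (fun w => f (o w)).
Proof. by move=> mo mos law mf; exact: (iid_itg mo mos law i mf). Qed.

Lemma iid_row_moments d (T : measurableType d) (R : realType) (P : probability T R)
  dO (O : measurableType dO) (o : T -> O) (os : nat -> T -> O) (f : O -> R) (v c : R) (i : nat) :
  measurable_fun setT o -> (forall i, measurable_fun setT (os i)) -> (forall i, same_law P (os i) o) ->
  measurable_fun setT f ->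
  [/\ intg P (fun w => `|f (o w)| ^+ 3), intg P (fun w => f (o w) ^+ 2), intg P (fun w => f (o w)) &
    [/\ itg P (fun w => f (o w)) = 0, itg P (fun w => f (o w) ^+ 2) = v &
      itg P (fun w => `|f (o w)| ^+ 3) <= c]] ->
  [/\ intg P (fun w => `|f (os i w)| ^+ 3), intg P (fun w => f (os i w) ^+ 2), intg P (fun w => f (os i w)) &
    [/\ itg P (fun w => f (os i w)) = 0, itg P (fun w => f (os i w) ^+ 2) = v &
      itg P (fun w => `|f (os i w)| ^+ 3) <= c]].
Proof.
move=> mo mos law mf [i3 i2 i1 [e1 e2 e3]].
have [j1 f1] := iid_moments i mo mos law mf i1.
have m2 : measurable_fun setT (fun y => f y ^+ 2) by exact: measurable_funX.
have m3 : measurable_fun setT (fun y => `|f y| ^+ 3).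
  by apply: measurable_funX; exact: measurableT_comp.
have [j2 f2] := iid_moments i mo mos law m2 i2.
have [j3 f3] := iid_moments i mo mos law m3 i3.
by split => //; split; rewrite ?f1 ?f2 ?f3.
Qed.

Section asymptotic_normality.
Context d (T : measurableType d) (R : realType) (P : probability T R).
Variables (m : nat) (Y : T -> R) (X : T -> R -> R) (G : R -> R -> R).
Variables (th0 : R * (R -> R)) (B : pathType R -> R) (C2 : R).
Hypothesis m0 : (0 < m)%N.
Hypothesis rX : random_process X.
Hypothesis mY : measurable_fun setT Y.
Hypothesis mB : measurable_fun setT B.
Hypothesis C20 : 0 < C2.
Hypothesis hB : {ae P, forall w, C2^-1 <= B (X w) <= C2}.
Hypothesis hBX : forall t, unit_itv t -> ('E_P[fun w => (B (X w) * X w t)%R] = 0)%E.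
Hypothesis hXX : forall s t, unit_itv s -> unit_itv t ->
  intg P (fun w => B (X w) * X w s * X w t).
Hypothesis mG : forall a, measurable_fun setT (fun y => G y a).
Hypothesis dG : forall y j, (j < 3)%N -> forall a : R, derivable (derive1n j (G y)) a 1.
Hypothesis cG3 : forall y, continuous (derive1n 3 (G y)).
Hypothesis sth0 : Sobolev m th0.2.
Variable Q : T -> R.
Hypothesis momQ : all_moments P Q.
Hypothesis Q1 : forall w, 1 <= Q w.
Hypothesis epsQ : forall w, `|ob_eps G th0 (obs Y X w)| <= Q w.
Hypothesis DQ : forall w, `|ob_D G th0 (obs Y X w)| <= Q w.
Hypothesis WQ : forall w, `|ob_W G (obs Y X w)| <= Q w.
Hypothesis normQ : forall w, L2norm (X w) <= Q w.
Hypothesis Wfin : {ae P, forall w, (sup_deriv_ell G 3 (Y w) < +oo)%E}.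
Hypothesis cD : is_condexp P X (fun w => (ob_D G th0 (obs Y X w))%:E) (fun x => (- B x)%:E).
Hypothesis injective_Cov : forall b : R -> R, L2 b ->
  ae_eq lebesgue_measure unit_itv (Cov_op P X B b) (cst 0) -> ae_eq lebesgue_measure unit_itv b (cst 0).
Variables (phi : nat -> R -> R) (rho : nat -> R).
Hypothesis sphi : forall nu, (0 < nu)%N -> Sobolev m (phi nu).
Hypothesis orth : forall nu nu', (0 < nu)%N -> (0 < nu')%N ->
  V P X B (phi nu) (phi nu') = (nu == nu')%:R /\
  J m (phi nu) (phi nu') = rho nu * (nu == nu')%:R.
Hypothesis rho0 : forall nu, (0 < nu)%N -> 0 <= rho nu.
Variable M0 : R.
Hypothesis M00 : 0 < M0.
Hypothesis fourth : forall b : R -> R, Sobolev m b ->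
     ('E_P[fun w => (`|ip (X w) b| ^+ 4)%R]
      <= M0%:E * 'E_P[fun w => (`|ip (X w) b| ^+ 2)%R] ^+ 2)%E.
Variables (a Cphi : R).
Hypothesis Cphi0 : 0 < Cphi.
Hypothesis normphi : forall nu, (0 < nu)%N -> L2norm (phi nu) <= Cphi * nu%:R `^ a.
Variables (Ys : nat -> T -> R) (Xs : nat -> T -> R -> R).
Hypothesis rXs : forall i, random_process (Xs i).
Hypothesis mYs : forall i, measurable_fun setT (Ys i).
Hypothesis iid : iid_copies P Y X Ys Xs.
Variable wt : R -> R.
Hypothesis Lwt : L2 wt.

Local Notation O := (measurableTypeR R * pathType R)%type.

Let mob : measurable_fun setT (obs Y X). Proof. exact: measurable_obs. Qed.
Let os i := obs (Ys i) (Xs i).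
Let mos i : measurable_fun setT (os i). Proof. exact: measurable_obs. Qed.
Let ind : mutually_independent P os := iid.1.
Let law i : same_law P (os i) (obs Y X) := iid.2 i.

Hypothesis ce : is_condexp P X (fun w => (ob_eps G th0 (obs Y X w))%:E) (fun=> 0%E).
Hypothesis ce2 : is_condexp P X (fun w => (ob_eps G th0 (obs Y X w) ^+ 2)%:E) (fun x => (B x)%:E).
Variables (k : R) (lam : nat -> R) (thhat : nat -> T -> R * (R -> R)) (b : nat -> R) (Cell : \bar R).
Hypothesis a0 : 0 <= a.
Hypothesis ak : a + 2^-1 < k.
Hypothesis lam0 : forall n, (0 < n)%N -> 0 < lam n.
Hypothesis expS : forall n (f : R -> R), (0 < n)%N -> Sobolev m f ->
  expansion P m X B (lam n) phi (fun nu => V P X B f (phi nu)) f.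
Hypothesis est : is_estimator P m G Ys Xs lam thhat.
Hypothesis rate : bounded_in_prob P (fun n w => normH P m X B (lam n)
  ((thhat n w).1 - th0.1, (thhat n w).2 \- th0.2)) (rate_r k lam).
Hypothesis Cell0 : (0 <= Cell)%E.
Hypothesis expb : forall n, (0 < n)%N -> expansion P m X B (lam n) phi b th0.2.
Hypothesis sumb : summable_from1 (fun nu => b nu ^+ 2 * rho nu ^+ 2).
Local Notation h := (bandwidth k lam).
Hypothesis h0 : h n @[n --> \oo] --> (0 : R).
Hypothesis ha : (n%:R%:E * rate_a m a k lam Cell n ^+ 2)%E @[n --> \oo] --> (0 : \bar R)%E.
Hypothesis hbias : n%:R * h n `^ (4 * k) @[n --> \oo] --> (0 : R).
Local Notation M2 := (M_sum wt phi rho lam 2).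
Hypothesis M2_gt0 : \forall n \near \oo, 0 < M2 n.
Variable Cw : R.
Hypothesis Cw0 : 0 < Cw.
Hypothesis hCw : forall (h l : R) (N : nat), 0 < h <= 1 -> h `^ (2 * k) <= l ->
  \sum_(1 <= nu < N.+1) nu%:R `^ (2 * a) / (1 + l * rho nu) <= Cw * h `^ (- (2 * a + 5 / 2)).

Local Notation kap n nu := (1 + lam n * rho nu).
Local Notation good n := [/\ (1 < n)%N, h n <= 1 & 0 < M2 n].
Let S n := 1 + Cphi ^+ 2 * (Cw * h n `^ (- (2 * a + 5 / 2))).
Let Cb := sum_from1 (fun nu => b nu ^+ 2 * rho nu ^+ 2).
Let tw n nu := ip wt (phi nu) / kap n nu.

Let kap1 n nu : (0 < n)%N -> (0 < nu)%N -> 1 <= kap n nu.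
Proof. by move=> n0 nu0; rewrite lerDl mulr_ge0 ?rho0// (ltW (lam0 n0)). Qed.
Let kap0 n nu : (0 < n)%N -> (0 < nu)%N -> 0 < kap n nu.
Proof. by move=> n0 nu0; exact: lt_le_trans ltr01 (kap1 n0 nu0). Qed.
Let good_gt0 n : good n -> (0 < n)%N. Proof. by case=> /ltnW. Qed.

Let hCb N' : \sum_(1 <= nu < N'.+1) b nu ^+ 2 * rho nu ^+ 2 <= Cb.
Proof. by apply: sum1_le_sum_from1 => // nu _; rewrite mulr_ge0 ?sqr_ge0. Qed.

Let S0 n : 0 < S n.
Proof. by rewrite ltr_pwDl// mulr_ge0 ?sqr_ge0// mulr_ge0 ?powR_ge0 ?(ltW Cw0). Qed.

Let weight_sq nu : (Cphi * nu%:R `^ a) ^+ 2 = Cphi ^+ 2 * nu%:R `^ (2 * a).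
Proof. by rewrite exprMn -(powR_mulrn 2 (powR_ge0 nu%:R a)) -powRrM (mulrC a). Qed.

Let uS n : good n -> forall N', 1 + \sum_(1 <= nu < N'.+1) (Cphi * nu%:R `^ a) ^+ 2 / kap n nu <= S n.
Proof.
move=> gn N'; have n0 := good_gt0 gn; rewrite lerD2l.
under eq_bigr do rewrite weight_sq -mulrA.
rewrite -mulr_sumr ler_wpM2l ?sqr_ge0//; apply: hCw.
  by case: gn => _ -> _; rewrite (bandwidth_gt0 k lam0 n0).
by rewrite (bandwidth_pow a0 ak lam0 n0).
Qed.

Let ip_phi_sq nu : (0 < nu)%N -> ip wt (phi nu) ^+ 2 <= ip wt wt * (Cphi * nu%:R `^ a) ^+ 2.
Proof.
move=> nu0; have l := sobolev_L2 m0 (sphi nu0).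
apply: (le_trans (ip_cauchy_schwarz Lwt l)); rewrite ler_wpM2l ?ip_ge0//.
rewrite -[leLHS](sqr_sqrtr (ip_ge0 _)); apply: lerXn2r; rewrite ?nnegrE ?sqrtr_ge0 ?normphi//.
by rewrite mulr_ge0 ?powR_ge0 ?(ltW Cphi0).
Qed.

(** The summands of [M_sum] of order 1. Their tail bounds the truncation error of the contrast and,
    as [kap >= 1], also the loss of variance. *)
Let u1 n nu := ip wt (phi nu) ^+ 2 / kap n nu.

Let u1_ge0 n nu : (0 < n)%N -> (0 < nu)%N -> 0 <= u1 n nu.
Proof. by move=> n0 nu0; rewrite divr_ge0 ?sqr_ge0 ?(ltW (kap0 n0 nu0)). Qed.

Let tw_le n nu : (0 < n)%N -> (0 < nu)%N -> tw n nu ^+ 2 <= u1 n nu.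
Proof.
move=> n0 nu0; have k0 := kap0 n0 nu0; rewrite /tw /u1 exprMn ler_wpM2l ?sqr_ge0//.
by rewrite expr2 ler_piMl ?invr_ge0 ?(ltW k0)// invf_le1// kap1.
Qed.

Let sum_u1_le n : good n -> forall N, \sum_(1 <= nu < N.+1) u1 n nu <= ip wt wt * S n.
Proof.
move=> gn N; have n0 := good_gt0 gn.
apply: (@le_trans _ _ (ip wt wt * \sum_(1 <= nu < N.+1) (Cphi * nu%:R `^ a) ^+ 2 / kap n nu)).
  rewrite mulr_sumr big_nat_cond [leRHS]big_nat_cond; apply: ler_sum => nu /andP[/andP[nu0 _] _].
  by rewrite mulrA ler_wpM2r ?invr_ge0 ?(ltW (kap0 n0 nu0))// ip_phi_sq.
by rewrite ler_wpM2l ?ip_ge0//; apply: le_trans (uS gn N); rewrite lerDr.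
Qed.

Let M2E n : M2 n = sum_from1 (fun nu => tw n nu ^+ 2).
Proof. by congr sum_from1; apply/funext => nu; rewrite /tw exprMn exprVn. Qed.

Let sum_tw n : good n -> summable_from1 (fun nu => tw n nu ^+ 2).
Proof.
move=> gn; have n0 := good_gt0 gn.
apply: (@summable_bounded _ _ _ (ip wt wt * S n)) => [nu _|N]; first exact: sqr_ge0.
apply: le_trans (sum_u1_le gn N); rewrite big_nat_cond [leRHS]big_nat_cond.
by apply: ler_sum => nu /andP[/andP[nu0 _] _]; exact: tw_le.
Qed.

(** A tail of at most [M2 n / n] stays negligible after scaling and keeps the variance within a
    factor [1 - 1 / n] of [M2 n]. *)
Let truncation n : good n -> exists N : nat,
  (forall N', \sum_(N.+1 <= nu < N') u1 n nu <= M2 n / n%:R) /\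
  M2 n * (1 - n%:R^-1) <= \sum_(1 <= nu < N.+1) tw n nu ^+ 2 <= M2 n.
Proof.
move=> gn; have n0 := good_gt0 gn; have [_ _ M0'] := gn.
have d0 : 0 < M2 n / n%:R by rewrite divr_gt0 ?ltr0n.
have su : summable_from1 (u1 n) := summable_bounded (fun nu => u1_ge0 n0) (sum_u1_le gn).
have [N [_ hN]] := summable_tail (fun nu => u1_ge0 n0) su d0.
exists N; split => //; apply/andP; split; last first.
  by rewrite M2E; apply: sum1_le_sum_from1; [move=> nu _; exact: sqr_ge0|exact: sum_tw].
rewrite mulrBr mulr1 lerBlDr {1}M2E; apply: limr_le; first exact: sum_tw.
near=> N'.
have NN : (N <= N')%N by near: N'; exact: nbhs_infty_ge.
rewrite (@big_cat_nat _ _ _ N.+1)//= lerD2l; apply: le_trans (hN N'.+1).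
rewrite big_nat_cond [leRHS]big_nat_cond; apply: ler_sum => nu /andP[/andP[nu0 _] _].
by apply: tw_le => //; exact: leq_trans nu0.
Unshelve. all: by end_near. Qed.

Lemma contrast_measurable n c : measurable_fun setT (CT wt phi rho lam thhat c n).
Proof.
case: n => [|n].
  have -> : CT wt phi rho lam thhat c 0 = fun=> 0 by apply/funext => w; rewrite /CT sqrtr0 !mul0r.
  exact: measurable_cst.
have n0 : (0 < n.+1)%N by []. have [sth _ mth _] := est n0.
apply: measurable_funM => //; apply: measurable_funM => //; apply: measurable_funB => //.
by apply: measurable_ip_curve => // w; exact: (sobolev_continuous m0 (sth w)).
Qed.

Section truncated_score.
Variable Nn : nat -> nat.
Hypothesis hNn : forall n, good n ->
  (forall N', \sum_((Nn n).+1 <= nu < N') u1 n nu <= M2 n / n%:R) /\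
  M2 n * (1 - n%:R^-1) <= \sum_(1 <= nu < (Nn n).+1) tw n nu ^+ 2 <= M2 n.
Let sigma n := Num.sqrt (\sum_(1 <= nu < (Nn n).+1) tw n nu ^+ 2).
Let To n := ob_T phi (tw n) (Nn n).
(** Normalized so that each summand has variance exactly [1 / n], whatever the truncation. *)
Let psi n (o : measurableTypeR R * pathType R) : R :=
  (sigma n * Num.sqrt n%:R)^-1 * (ob_eps G th0 o * To n o).

Let good_near : \forall n \near \oo, good n.
Proof.
near=> n; split.
- by near: n; exact: nbhs_infty_gt.
- by near: n; exact: bandwidth_le1.
- by near: n; exact: M2_gt0.
Unshelve. all: by end_near. Qed.

Let sigma2 n : sigma n ^+ 2 = \sum_(1 <= nu < (Nn n).+1) tw n nu ^+ 2.
Proof. by rewrite sqr_sqrtr//; apply: sumr_ge0 => nu _; exact: sqr_ge0. Qed.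

Let sigma0 n : good n -> 0 < sigma n.
Proof.
move=> gn; have [n1 _ M0'] := gn; have [_ /andP[lo _]] := hNn gn.
rewrite sqrtr_gt0; apply: lt_le_trans lo; rewrite mulr_gt0// subr_gt0 invf_lt1 ?ltr0n ?(ltnW n1)//.
by rewrite ltr1n.
Qed.

Let mpsi n : measurable_fun setT (psi n).
Proof.
apply: measurable_funM => //; apply: measurable_funM.
  exact: (measurable_ob_eps mG dG cG3 (sobolev_L2 m0 sth0)).
exact: (measurable_ob_T m0 sphi).
Qed.

Let C3 := M0 * C2 ^+ 2 + itg P (fun w => Q w ^+ 12).

Let psi_moments n : good n ->
  [/\ intg P (fun w => `|psi n (obs Y X w)| ^+ 3), intg P (fun w => psi n (obs Y X w) ^+ 2),
      intg P (fun w => psi n (obs Y X w)) & [/\ itg P (fun w => psi n (obs Y X w)) = 0,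
      itg P (fun w => psi n (obs Y X w) ^+ 2) = n%:R^-1 &
      itg P (fun w => `|psi n (obs Y X w)| ^+ 3) <= C3 * Num.sqrt n%:R^-1 ^+ 3]].
Proof.
move=> gn; have n0 := good_gt0 gn; have nR : 0 < n%:R :> R by rewrite ltr0n.
have s0 := sigma0 gn; have q0 : 0 < Num.sqrt n%:R :> R by rewrite sqrtr_gt0.
set x : R := (sigma n * Num.sqrt n%:R)^-1; have x0 : 0 < x by rewrite invr_gt0 mulr_gt0.
have em := eps_moments m0 rX mY mG dG cG3 sth0 momQ epsQ.
have tm : all_moments P (fun w => To n (obs Y X w)).
  exact: (ip_moments rX momQ normQ (sobolev_L2 m0 (sobolev_partial_sum m0 sphi (tw n) (Nn n)))).
have etm := all_momentsM em tm.
have [i3 h3] := third_eps_T m0 rX mY mB C20 hB hXX mG dG cG3 sth0 momQ epsQ normQ sphi orth M00 fourth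
  (tw := tw n) (N := Nn n) s0 (sigma2 n).
have E3 w : `|psi n (obs Y X w)| ^+ 3 = x ^+ 3 * `|ob_eps G th0 (obs Y X w) * To n (obs Y X w)| ^+ 3.
  by rewrite /psi -/x normrM (gtr0_norm x0) exprMn.
have E2 w : psi n (obs Y X w) ^+ 2 = x ^+ 2 * (ob_eps G th0 (obs Y X w) * To n (obs Y X w)) ^+ 2.
  by rewrite /psi -/x exprMn.
have i2 := all_moments_intgX 2 etm; have i1 := all_moments_intg etm.
split.
- by under eq_fun do rewrite E3; exact: intgZ.
- by under eq_fun do rewrite E2; exact: intgZ.
- exact: intgZ.
split.
- rewrite itgZ// (mean_eps_T m0 rX mY mG dG cG3 sth0 momQ epsQ normQ ce sphi) mulr0//.
- under eq_fun do rewrite E2.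
  rewrite itgZ// (mean_eps2_T2 m0 rX mY mB C20 hB hXX mG dG cG3 sth0 momQ epsQ normQ ce2 sphi orth).
  rewrite -sigma2 /x exprVn exprMn (@sqr_sqrtr _ n%:R (ltW nR)).
  by move: (n%:R) nR => y y0; field; rewrite !gt_eqF.
- under eq_fun do rewrite E3.
  rewrite itgZ//; apply: (@le_trans _ _ (x ^+ 3 * (sigma n ^+ 3 * C3))).
    by rewrite ler_wpM2l// exprn_ge0// ltW.
  rewrite sqrtrV ?(ltW nR)// le_eqVlt; apply/orP; left; apply/eqP.
  by rewrite /x; field; rewrite !gt_eqF.
Qed.

Let Z n i w := psi n (os i w).
Let mZ n i : measurable_fun setT (Z n i). Proof. exact: (measurableT_comp (mpsi n) (mos i)). Qed.

Let rowZ : \forall n \near \oo, row_independent P n (Z n).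
Proof. by apply: nearW => n; exact: (row_independent_iid ind n (mpsi n)). Qed.

Let momZ : \forall n \near \oo, forall i, (i < n)%N ->
  [/\ intg P (fun w => `|Z n i w| ^+ 3), intg P (fun w => Z n i w ^+ 2),
      intg P (Z n i) & [/\ itg P (Z n i) = 0, itg P (fun w => Z n i w ^+ 2) = n%:R^-1 &
      itg P (fun w => `|Z n i w| ^+ 3) <= C3 * Num.sqrt n%:R^-1 ^+ 3]].
Proof.
move: good_near; apply: filterS => n gn i _.
exact: (iid_row_moments i mob mos law (mpsi n) (psi_moments gn)).
Qed.

Let avg_score n w := n%:R^-1 * \sum_(i < n) ob_eps G th0 (os i w) * To n (os i w).

Let psum_avg n w : good n -> psum (Z n) n w = Num.sqrt n%:R / sigma n * avg_score n w.
Proof.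
move=> gn; have n0 := good_gt0 gn; have nR : 0 < n%:R :> R by rewrite ltr0n.
have s0 := sigma0 gn; have q0 : 0 < Num.sqrt n%:R :> R by rewrite sqrtr_gt0.
rewrite /psum /Z /psi -mulr_sumr /avg_score mulrA; congr (_ * _).
have E : n%:R^-1 = (Num.sqrt n%:R ^+ 2)^-1 :> R by rewrite sqr_sqrtr// ltW.
by rewrite E; field; rewrite !gt_eqF.
Qed.

Let psum_sq n : good n -> intg P (fun w => psum (Z n) n w ^+ 2) /\ itg P (fun w => psum (Z n) n w ^+ 2) = 1.
Proof.
move=> gn; have n0 := good_gt0 gn; have nR : 0 < n%:R :> R by rewrite ltr0n.
have [_ i2 i1 [e1 e2 _]] := psi_moments gn.
have [j e] := avg_sqr mob mos ind law (mpsi n) i1 e1 i2 n0.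
have E w : psum (Z n) n w ^+ 2 = n%:R ^+ 2 * avg os (psi n) n w ^+ 2.
  by rewrite -exprMn /avg mulrA divff ?gt_eqF// mul1r.
under eq_fun do rewrite E.
split; first exact: intgZ.
by rewrite itgZ// e e2; field; rewrite gt_eqF.
Qed.

Let Kc := fixed_n_cst P C2 Q M0.
Let r_ := rate_r k lam.
(** The right-hand side of [scaled_bound] for an error of norm at most [M * r_ n]. *)
Let err (M e : R) n := Kc * (M * r_ n + M * r_ n * Num.sqrt (S n / e) + (M * r_ n) ^+ 2 * Num.sqrt n%:R
   + (M * r_ n) ^+ 2 * (S n / Num.sqrt e)) + lam n * Num.sqrt n%:R * Num.sqrt Cb.

Let err_cvg (M e : R) : 0 < e -> err M e n @[n --> \oo] --> (0 : R).
Proof.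
move=> e0.
have cr : r_ n @[n --> \oo] --> (0 : R) := cvg_rate_r m0 a0 lam0 h0 Cell0 ha.
have cl := cvg_lam_sqrt a0 ak lam0 hbias.
have cq : Num.sqrt n%:R * r_ n ^+ 2 @[n --> \oo] --> (0 : R) := cvg_sqrt_rate_sq m0 a0 ak lam0 h0 Cell0 ha hbias.
have cw : r_ n ^+ 2 * h n `^ (- (2 * a + 5 / 2)) @[n --> \oo] --> (0 : R) := cvg_rate_weights m0 lam0 h0 Cell0 ha.
have cst_cvg (c : R) (x : nat -> R) : x n @[n --> \oo] --> (0 : R) -> c * x n @[n --> \oo] --> (0 : R).
  by move=> cx; rewrite -(mulr0 c); exact: (cvgM (cvg_cst c) cx).
have cadd (x y : nat -> R) : x n @[n --> \oo] --> (0 : R) -> y n @[n --> \oo] --> (0 : R) ->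
    x n + y n @[n --> \oo] --> (0 : R).
  by move=> cx cy; rewrite -(addr0 (0 : R)); exact: (@cvgD _ R^o _ _ _ _ _ _ _ cx cy).
have cS : r_ n ^+ 2 * S n @[n --> \oo] --> (0 : R).
  have E n : r_ n ^+ 2 * S n = r_ n * r_ n + (Cphi ^+ 2 * Cw) * (r_ n ^+ 2 * h n `^ (- (2 * a + 5 / 2))).
    by rewrite /S; ring.
  under eq_fun do rewrite E.
  apply: cadd; last exact: cst_cvg.
  by rewrite -(mulr0 (0 : R)); exact: (cvgM cr cr).
have csq : r_ n * Num.sqrt (S n / e) @[n --> \oo] --> (0 : R).
  have E n : r_ n * Num.sqrt (S n / e) = Num.sqrt (e^-1 * (r_ n ^+ 2 * S n)).
    rewrite mulrCA (sqrtrM _ (sqr_ge0 (r_ n))) sqrtr_sqr ger0_norm ?rate_r_ge0//.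
    by rewrite (mulrC e^-1).
  under eq_fun do rewrite E.
  rewrite -sqrtr0; apply: (@cvg_comp _ _ _ (fun n => e^-1 * (r_ n ^+ 2 * S n)) Num.sqrt _ (nbhs (0 : R))).
    exact: cst_cvg.
  exact: sqrt_continuous.
have E n : err M e n = Kc * (M * r_ n + M * (r_ n * Num.sqrt (S n / e)) + M ^+ 2 * (Num.sqrt n%:R * r_ n ^+ 2)
    + (M ^+ 2 / Num.sqrt e) * (r_ n ^+ 2 * S n)) + Num.sqrt Cb * (lam n * Num.sqrt n%:R).
  by rewrite /err; ring.
under eq_fun do rewrite E.
exact: (cadd _ _ (cst_cvg Kc _ (cadd _ _ (cadd _ _ (cadd _ _ (cst_cvg M _ cr) (cst_cvg M _ csq))
  (cst_cvg (M ^+ 2) _ cq)) (cst_cvg (M ^+ 2 / Num.sqrt e) _ cS))) (cst_cvg (Num.sqrt Cb) _ cl)).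
Qed.

Variable c : R.
Hypothesis null : ip wt th0.2 = c.

Let U n := CT wt phi rho lam thhat c n.

(** The difference splits into the scaled remainder and a correction for normalizing by [sigma n]
    instead of the square root of [M2 n], of relative size [1 / n]. *)
Let contrast_error n (M e : R) : good n -> 0 < e -> exists A, [/\ measurable A, (P A <= (e + e)%:E)%E &
  forall w, ~ A w -> normH P m X B (lam n) ((thhat n w).1 - th0.1, (thhat n w).2 \- th0.2) <= M * r_ n ->
  `|U n w - psum (Z n) n w| <= err M e n + `|psum (Z n) n w| / n%:R].
Proof.
move=> gn e0; have n0 := good_gt0 gn; have [sth _ _ mx] := est n0.
have [_ _ M0'] := gn; have nR : 0 < n%:R :> R by rewrite ltr0n.
have [tl /andP[lo hi]] := hNn gn; rewrite -sigma2 in lo hi.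
have s0 := sigma0 gn.
have [A [mA PA hA]] := fixed_n_bound m0 rX mY mB C20 hB hBX hXX mG dG cG3 sth0 momQ Q1 DQ WQ normQ Wfin cD
  injective_Cov sphi orth rho0 M00 fourth Cphi0 normphi rXs mYs iid Lwt n0 (lam0 n0) (S0 n) (uS gn) tl s0 (sigma2 n)
  (expb n0) hCb (fun f => expS n0) sth mx e0.
exists A; split => // w Aw hM.
set db := (thhat n w).2 \- th0.2.
have Ldb : L2 db by apply: (sobolev_L2 m0); apply: sobolevB => //; exact: sth.
have UE : U n w = Num.sqrt n%:R / Num.sqrt (M2 n) * ip wt db.
  rewrite /U /CT -null mulrAC; congr (_ * _).
  have -> : (thhat n w).2 = (fun t => db t + 1 * th0.2 t) by apply/funext => t; rewrite /db /= mul1r subrK.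
  by rewrite ip_linr//; [ring|exact: (sobolev_L2 m0 sth0)].
have q0 : 0 < Num.sqrt n%:R :> R by rewrite sqrtr_gt0.
have p0 : 0 < Num.sqrt (M2 n) by rewrite sqrtr_gt0.
have dE : U n w - psum (Z n) n w = Num.sqrt n%:R / Num.sqrt (M2 n) * (ip wt db - avg_score n w)
    + psum (Z n) n w * (sigma n / Num.sqrt (M2 n) - 1).
  by rewrite UE psum_avg//; field; rewrite !gt_eqF.
rewrite dE; apply: (le_trans (ler_normD _ _)); apply: lerD.
  rewrite normrM ger0_norm ?divr_ge0 ?(ltW q0) ?(ltW p0)//.
  apply: (le_trans (ler_wpM2l _ (hA w Aw))); first by rewrite divr_ge0 ?(ltW q0) ?(ltW p0).
  rewrite /err; apply: scaled_bound => //; rewrite ?(ltW s0) ?(ltW (S0 n)) ?(ltW (lam0 n0)) ?sqrtr_ge0//.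
  by rewrite !addr_ge0 ?mulr_ge0 ?sqrtr_ge0 ?addr_ge0 ?(ltW C20).
rewrite normrM ler_wpM2l//.
(* From [1 - 1 / n <= x ^+ 2 <= x <= 1], the correction factor [1 - x] is at most [1 / n]. *)
set x : R := sigma n / Num.sqrt (M2 n).
have x0 : 0 <= x by rewrite divr_ge0 ?(ltW s0) ?(ltW p0).
have x2 : 1 - n%:R^-1 <= x ^+ 2.
  by rewrite exprMn exprVn (@sqr_sqrtr _ (M2 n) (ltW M0')) ler_pdivlMr// mulrC.
have x21 : x ^+ 2 <= 1 by rewrite exprMn exprVn (@sqr_sqrtr _ (M2 n) (ltW M0')) ler_pdivrMr// mul1r.
have x1 : x <= 1 by rewrite -(@expr_le1 _ 2).
by rewrite distrC ger0_norm ?subr_ge0//; nra.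
Qed.

(** Three exceptional events, each of probability at most [eta / 4]: for the norm of the error, for
    the remainders of the score expansion, and for the size of the partial sum, whose second moment
    is 1. *)
Let small : small_in_prob P (fun n w => U n w - psum (Z n) n w).
Proof.
move=> e eta e0 eta0.
have e8 : 0 < eta / 8 by rewrite divr_gt0.
have e4 : 0 < eta / 4 by rewrite divr_gt0.
have [M hM] := rate e4.
have c1 : \forall n \near \oo, err M (eta / 8) n <= e / 2.
  have /cvgrPdist_le /(_ (e / 2)) := err_cvg M e8; rewrite divr_gt0// => /(_ isT).
  by apply: filterS => n; rewrite sub0r normrN; exact: le_trans (ler_norm _).
near=> n.
have gn : good n by near: n; exact: good_near.
have n0 := good_gt0 gn; have nR : 0 < n%:R :> R by rewrite ltr0n.
have [A1 [mA1 PA1 hA1]] : exists A : set T, [/\ measurable A, (P A <= (eta / 4)%:E)%E &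
      [set w | M * r_ n < `|normH P m X B (lam n) ((thhat n w).1 - th0.1, (thhat n w).2 \- th0.2)|] `<=` A].
  by near: n; exact: hM.
have [A2 [mA2 PA2 hA2]] := contrast_error M gn e8.
have [i2 e2] := psum_sq gn.
have eq_le1 (x : R) : x = 1 -> x <= 1 by move->.
have [mA3 PA3] := markov_itg i2 (fun w => sqr_ge0 _) ltr01 e4 (eq_le1 _ e2).
set A3 := [set w | _] in mA3 PA3.
exists (A1 `|` A2 `|` A3); split.
- by apply: measurableU => //; exact: measurableU.
- apply: (le_trans (measureU2 _ _ _)) => //; first exact: measurableU.
  have le_eta (x : R) : 0 < x -> x / 4 + (x / 8 + x / 8) + x / 4 <= x by lra.
  apply: (@le_trans _ _ (eta / 4 + (eta / 8 + eta / 8) + eta / 4)%:E); last by rewrite lee_fin; exact: le_eta.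
  rewrite EFinD; apply: leeD => //.
  by apply: (le_trans (measureU2 _ _ _)) => //; rewrite EFinD; exact: leeD.
move=> w /= hw; apply: contrapT => hA.
have w1 : normH P m X B (lam n) ((thhat n w).1 - th0.1, (thhat n w).2 \- th0.2) <= M * r_ n.
  rewrite leNgt; apply/negP => h1; apply: hA; left; left; apply: hA1 => /=.
  by apply: (lt_le_trans h1); exact: ler_norm.
have w2 : ~ A2 w by move=> h2; apply: hA; left; right.
have w3 : psum (Z n) n w ^+ 2 <= 1 / (eta / 4).
  by rewrite leNgt; apply/negP => h3; apply: hA; right.
have := hA2 w w2 w1; rewrite leNgt => /negP; apply; apply: le_lt_trans hw.
have er : err M (eta / 8) n <= e / 2 by near: n; exact: c1.
have ps : `|psum (Z n) n w| <= Num.sqrt (1 / (eta / 4)) by rewrite -sqrtr_sqr ler_wsqrtr.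
have nb : Num.sqrt (1 / (eta / 4)) / (e / 2) <= n%:R by near: n; exact: nbhs_infty_ger.
rewrite [leRHS](_ : e = e / 2 + e / 2); last by field.
apply: lerD => //; rewrite ler_pdivrMr//; apply: (le_trans ps).
have e20 : 0 < e / 2 by rewrite divr_gt0.
by move: nb; rewrite (ler_pdivrMr _ _ e20) (mulrC n%:R).
Unshelve. all: by end_near. Qed.

Lemma truncated_contrast_clt : cvg_std_normal P (CT wt phi rho lam thhat c).
Proof.
exact: (clt_slutsky mZ rowZ momZ (fun n => contrast_measurable n c) small).
Qed.

End truncated_score.

Lemma contrast_clt c : ip wt th0.2 = c -> cvg_std_normal P (CT wt phi rho lam thhat c).
Proof.
move=> null.
have [Nn hNn] : {Nn : nat -> nat & forall n, good n ->
    (forall N', \sum_((Nn n).+1 <= nu < N') u1 n nu <= M2 n / n%:R) /\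
    M2 n * (1 - n%:R^-1) <= \sum_(1 <= nu < (Nn n).+1) tw n nu ^+ 2 <= M2 n}.
  apply: (@choice _ _ (fun n N => good n ->
    (forall N', \sum_(N.+1 <= nu < N') u1 n nu <= M2 n / n%:R) /\
    M2 n * (1 - n%:R^-1) <= \sum_(1 <= nu < N.+1) tw n nu ^+ 2 <= M2 n)) => n.
  have [gn|gn] := pselect (good n); last by exists 0%N.
  by have [N hN] := truncation gn; exists N.
exact: (truncated_contrast_clt hNn null).
Qed.

End asymptotic_normality.

(** * The contrast test *)

(** If [g (X w)] were negative everywhere, its integral, equal to that of [Z], would be both
    nonnegative and minus the integral of its absolute value; it would then vanish almost
    everywhere. One path is enough, as [C_ell] is a supremum over L^2. *)
Lemma condexp_ge0 d (T : measurableType d) (R : realType) (P : probability T R) (X : T -> R -> R)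
  (Z : T -> \bar R) (g : pathType R -> \bar R) : random_process X ->
  (forall w, (0 <= Z w)%E) -> is_condexp P X Z g -> exists w, (0 <= g (X w))%E.
Proof.
move=> rX Z0 [mg cZ]; apply: contrapT => hg.
have gneg w : (g (X w) < 0)%E by rewrite ltNge; apply/negP => h; apply: hg; exists w.
have mgX : measurable_fun setT (fun w => g (X w)) := measurableT_comp mg (measurable_path rX).
have := cZ setT measurableT; rewrite (_ : [set w | _] = setT)// => E.
have I0 : (0 <= \int[P]_w g (X w))%E by rewrite -E; exact: integral_ge0.
have absE : (\int[P]_w `|g (X w)| = - \int[P]_w g (X w))%E.
  rewrite [in RHS]integralE integral0_eq ?sub0e ?oppeK; last first.
    by move=> w _; rewrite funeposE; apply/max_idPr; exact: ltW.
  apply: eq_integral => w _; rewrite funenegE (max_idPl _) ?oppe_ge0 ?(ltW (gneg w))//.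
  by rewrite lee0_abs ?(ltW (gneg w)).
have abs0 : (\int[P]_w `|g (X w)| = 0)%E.
  apply/eqP; rewrite eq_le integral_ge0// andbT absE.
  by rewrite oppe_le0.
have [N [mN N0 hN]] := (ae_eq_integral_abs P measurableT mgX).1 abs0.
have : P setT = 0%E.
  apply: (subset_measure0 measurableT mN _ N0) => w _; apply: hN => /= /(_ I) h.
  by have := gneg w; rewrite h ltxx.
by rewrite probability_setT => /eqP; rewrite onee_eq0.
Qed.

Theorem theorem5p1 (R : realType) (d : measure_display) (T : measurableType d)
    (P : probability T R) (m : nat)
    (Yset : set R) (ell : R -> R -> R) (F : R -> R)
    (Y : {RV P >-> R}) (X : T -> R -> R)
    (Ys : nat -> {RV P >-> R}) (Xs : nat -> T -> R -> R)
    (alpha0 : R) (beta0 : R -> R) (B : pathType R -> R)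
    (lam : nat -> R) (thhat : nat -> T -> R * (R -> R))
    (phi : nat -> R -> R) (rho : nat -> R) (a k : R)
    (supell3 : pathType R -> \bar R) (Cell : \bar R)
    (wt : R -> R) (c : R) (b : nat -> R)
    (th0 := (alpha0, beta0)) (h := bandwidth k lam) :
  (* setting *)
  (0 < m)%N ->
  measurable Yset ->
  (forall w, Yset (Y w)) -> (forall i w, Yset (Ys i w)) ->
  (forall a', measurable_fun Yset (fun y => ell y a')) ->
  random_process X -> (forall i, random_process (Xs i)) ->
  iid_copies P Y X (fun i => Ys i) Xs ->
  Hspace m th0 ->
  is_condexp P X (fun w => (Y w)%:E) (fun x => (F (predictor th0 x))%:E) ->
  is_information P ell Y X th0 B ->
  (forall n, (0 < n)%N -> 0 < lam n) ->
  is_estimator P m ell (fun i => Ys i) Xs lam thhat ->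
  (* A1 - A5 *)
  assumption_A1 P ell Y X th0 B Yset ->
  assumption_A2 P X B ->
  assumption_A3 P m X B lam phi rho a k ->
  assumption_A4 P m X ->
  bounded_in_prob P
    (fun n w => normH P m X B (lam n)
       ((thhat n w).1 - alpha0, (thhat n w).2 \- beta0))
    (rate_r k lam) ->
  (* C_ell, the supremum over L2 of E{ sup_u |ell'''(Y; u)| | X = x } *)
  is_condexp P X (fun w => sup_deriv_ell ell 3 (Y w)) supell3 ->
  Cell = ereal_sup [set supell3 x | x in L2] ->
  (* regularity of beta0, tails of the residual *)
  (forall n, (0 < n)%N -> expansion P m X B (lam n) phi b beta0) ->
  summable_from1 (fun nu => b nu ^+ 2 * rho nu ^+ 2) ->
  (exists2 s : R, 0 < s &
     ('E_P[fun w => expR (s * `|residual ell Y X th0 w|)] < +oo)%E) ->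
  (* rates *)
  h n @[n --> \oo] --> (0 : R) ->
  (fun n => ln (h n)^-1 : R^o) =O_\oo (fun n => ln n%:R : R^o) ->
  n%:R * h n `^ (2 * a + 1) * (ln (h n)^-1) ^- 4 @[n --> \oo] --> +oo ->
  same_order (M_sum wt phi rho lam 1) (M_sum wt phi rho lam 2) ->
  (n%:R%:E * rate_a m a k lam Cell n ^+ 2)%E @[n --> \oo] --> (0 : \bar R)%E ->
  n%:R * h n `^ (4 * k) @[n --> \oo] --> (0 : R) ->
  (* contrast and null hypothesis *)
  L2 wt ->
  ip wt beta0 = c ->
  cvg_std_normal P (CT wt phi rho lam thhat c).
Proof.
move=> m0 mYset YY YYs mell rX rXs iid Hth0 _ info lam0 est A1 A2 A3 A4 rate cell3 CellE expb sumb
  [se se0 expe] h0 _ _ sameM ha hbias Lwt null.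
have [[smooth [C0 [C1 [C00 C10 exp2 exp3]]]] [[C2 C20 hB] hBX] [ce ce2]] := A1.
have [hXX _ injC] := A2.
have [a0 ak [sphi [Cphi Cphi0 normphi]] orth [rho0 _ rhoE expS]] := A3.
have [[sx [/andP[sx0 _] expX]] [M0 M00 fourth]] := A4.
(* [ell y] is regular for [y] in [Yset] only. *)
pose G (y a' : R) := ((fun y => ell y a') \_ Yset) y.
have GE y : Yset y -> G y = ell y by move=> hy; apply/funext => a'; rewrite /G patchE mem_set.
have G0 y : ~ Yset y -> G y = cst 0 by move=> hy; apply/funext => a'; rewrite /G patchE memNset.
have mG a' : measurable_fun setT (fun y => G y a') by exact/(measurable_restrictT _ mYset).
have d0 j : derive1n j (cst 0 : R -> R) = cst 0 by elim: j => //= j ->; apply/funext => x; rewrite derive1_cst.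
have dG y j : (j < 3)%N -> forall a' : R, derivable (derive1n j (G y)) a' 1.
  have [hy|hy] := pselect (Yset y); first by rewrite GE//; have [hd _ _] := smooth y hy; exact: hd.
  by move=> _ a'; rewrite G0// d0; exact: derivable_cst.
have cG3 y : continuous (derive1n 3 (G y)).
  have [hy|hy] := pselect (Yset y); first by rewrite GE//; have [_ hc _] := smooth y hy; exact: hc.
  by rewrite G0// d0; exact: cst_continuous.
have supE j w : sup_deriv_ell G j (Y w) = sup_deriv_ell ell j (Y w) by rewrite /sup_deriv_ell GE.
have epsE w : ob_eps G th0 (obs Y X w) = residual ell Y X th0 w by rewrite /ob_eps /= GE.
have DE w : ob_D G th0 (obs Y X w) = derive1n 2 (ell (Y w)) (predictor th0 (X w)) by rewrite /ob_D /= GE.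
have penE n w th : penalized_criterion m G (fun i => Ys i) Xs lam n w th =
    penalized_criterion m ell (fun i => Ys i) Xs lam n w th.
  by rewrite /penalized_criterion; congr (_ * _ - _); apply: eq_bigr => i _; rewrite GE.
have mY : measurable_fun setT (Y : T -> R) by exact: measurable_funPT.
have mYs i : measurable_fun setT (Ys i : T -> R) by exact: measurable_funPT.
have mB : measurable_fun setT B.
  have [/measurable_EFinP mNB _] := info.
  have -> : B = (fun x => - (- B x)) by apply/funext => x; rewrite opprK.
  exact: measurableT_comp.
have Lb0 : L2 th0.2 := sobolev_L2 m0 Hth0.
have exp2' : condexp_le P X (fun w => expeR (sup_deriv_ell G 2 (Y w) * (C0^-1)%:E)%E) C1.
  by under eq_fun do rewrite supE.
have exp3' : condexp_le P X (fun w => expeR (sup_deriv_ell G 3 (Y w) * (C0^-1)%:E)%E) C1.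
  by under eq_fun do rewrite supE.
have expe' : ('E_P[fun w => expR (se * `|residual G Y X th0 w|)] < +oo)%E.
  by under eq_fun do rewrite -[residual G Y X th0 _]/(ob_eps G th0 (obs Y X _)) epsE.
pose Q := envelope Y X G th0.
have momQ : all_moments P Q := envelope_moments rX mY mG dG cG3 Lb0 C00 C10 exp2' exp3' sx0 expX se0 expe'.
have Qb w := envelope_bounds Y X G th0 w.
have Wfin := ob_W_finite rX mY mG dG cG3 C00 C10 exp3'.
have cD : is_condexp P X (fun w => (ob_D G th0 (obs Y X w))%:E) (fun x => (- B x)%:E).
  by under eq_fun do rewrite DE.
have ceG : is_condexp P X (fun w => (ob_eps G th0 (obs Y X w))%:E) (fun=> 0%E).
  by under eq_fun do rewrite epsE.
have ce2G : is_condexp P X (fun w => (ob_eps G th0 (obs Y X w) ^+ 2)%:E) (fun x => (B x)%:E).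
  by under eq_fun do rewrite epsE.
have estG : is_estimator P m G (fun i => Ys i) Xs lam thhat.
  move=> n n0; have [e1 e2 e3 e4] := est n n0; split => //.
  by move: e4; apply: filterS => w hw th hth; rewrite !penE; exact: hw.
have Cell0 : (0 <= Cell)%E.
  have [w hw] : exists w, (0 <= supell3 (X w))%E.
    by apply: (condexp_ge0 rX _ cell3) => w; exact: sup_deriv_ell_ge0.
  by rewrite CellE; apply: (le_trans hw); apply: ereal_sup_ubound; exists (X w) => //; exact: process_L2.
(* [same_order] includes the eventual positivity of its second argument. *)
have M2_gt0 : \forall n \near \oo, 0 < M_sum wt phi rho lam 2 n.
  by have [c1 [C [_ _ hM]]] := sameM; move: hM; apply: filterS => n [].
have [Cw Cw0 hCw] := sum_weights a0 ak rho0 rhoE.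
have Q1 w : 1 <= Q w by have [] := Qb w.
have epsQ w : `|ob_eps G th0 (obs Y X w)| <= Q w by have [] := Qb w.
have DQ w : `|ob_D G th0 (obs Y X w)| <= Q w by have [] := Qb w.
have WQ w : `|ob_W G (obs Y X w)| <= Q w by have [] := Qb w.
have normQ w : L2norm (X w) <= Q w by have [] := Qb w.
exact: (contrast_clt m0 rX mY mB C20 hB hBX hXX mG dG cG3 Hth0 momQ Q1 epsQ DQ WQ normQ Wfin cD injC
  sphi orth rho0 M00 fourth Cphi0 normphi rXs mYs iid Lwt ceG ce2G a0 ak lam0 expS estG rate Cell0 expb sumb
  h0 ha hbias M2_gt0 Cw0 hCw null).
Qed.
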